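(* Let $m$ be an order function on $\mathbb{C}^n$ and let $f\in S(m)$ be real-valued and such that $|f(z)|\to+\infty$ as $|z|\to+\infty$. Let $V_N\in H_{\Phi}$ be $L^2$-normalised and such that $$T_N(f)V_N=E_NV_N+O(N^{-\infty}),$$ where the sequence $(E_N)$ converges to a regular value of the principal symbol of $f$. Then, for $p\in[2,+\infty]$, $$\|V_N\|_{L^p(\mathbb{C}^n)}=O\left(N^{\left(n-\frac12\right)\left(\frac12-\frac1p\right)}\right).$$
   Context: Let $\Phi(z)=\frac{\mathrm{Im}(z)^2}{2}=\frac12\sum_j(\mathrm{Im}\,z_j)^2$ for $z\in\mathbb{C}^n$. The Bargmann-type space is $H_{\Phi}=L^2(\mathbb{C}^n)\cap\{e^{-N\Phi(z)}v : v\text{ holomorphic on }\mathbb{C}^n\}$, with the $L^2(\mathbb{C}^n)$ scalar product (Lebesgue measure), and $\Pi_\Phi:L^2(\mathbb{C}^n)\to H_\Phi$ is the orthogonal projection. An order function is $m:\mathbb{C}^n\to\,]0,+\infty[$ such that there exist $C>0$, $L\in\mathbb{R}$ with $m(z)\le C\langle z-w\rangle^Lm(w)$ for all $z,w$, where $\langle z\rangle=\sqrt{1+|z|^2}$. $S(m)$ is the set of $f\in C^\infty(\mathbb{C}^n)$ such that for all $\alpha=(\alpha_1,\alpha_2)\in\mathbb{N}^{2n}$ there is $C_\alpha$ with $|\partial^{\alpha_1}\overline\partial^{\alpha_2}f|\le C_\alpha m$. Symbols may depend on $N$ (with $C_\alpha$ independent of $N$), in which case $f\sim\sum_jN^{-j}f_j$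 with $f_j\in S(m)$ independent of $N$, meaning that for every $L$, the derivatives of $f-\sum_{j<L}N^{-j}f_j$ are bounded by $C_{\alpha,L}\,m\,N^{-L}$; the principal symbol of $f$ is $f_0$ (so $f_0=f$ if $f$ does not depend on $N$), and the convergence $|f(z)|\to+\infty$ is uniform in $N$. For $f\in S(m)$, $T_N(f)v=\Pi_\Phi(fv)$, with domain $\{v\in H_\Phi: mv\in L^2\}$ (to which $V_N$ belongs). $E$ is a regular value of $f_0$ if $f_0(z)=E$ implies $df_0(z)\ne0$. $O(N^{-\infty})$ means $L^2$ norm $O(N^{-L})$ for every $L\in\mathbb{N}$. *)

(* Defs.v *)
From HB Require Import structures.
From mathcomp Require Import all_boot all_order all_algebra.
From mathcomp Require Import all_classical all_reals all_analysis.
From mathcomp Require Import complex.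

Set Implicit Arguments.
Unset Strict Implicit.
Unset Printing Implicit Defensive.

Import Order.TTheory GRing.Theory Num.Theory numFieldNormedType.Exports.

Local Open Scope classical_set_scope.
Local Open Scope ring_scope.
Local Open Scope complex_scope.

(* [R[i]^o] is [R[i]] as a normed module over itself, so that [differentiable]
   on [Cn R n] is complex differentiability. *)
Notation Cplx R := (R[i]^o).
Notation Cn R n := ('rV[Cplx R]_n).
Notation normc := Normc.normc.

Section LebesgueMeasure.
Context {R : realType}.
Let T := measurableTypeR R.

Definition tcons k (x : k.-tuple T * T) : k.+1.-tuple T :=
  [tuple of x.2 :: x.1].

Lemma measurable_tcons k : measurable_fun setT (@tcons k).
Proof. exact: measurable_cons. Qed.

Section lebesgue_cons.
Variables (k : nat) (mu : {measure set (k.-tuple T) -> \bar R}).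

Definition lebesgue_cons : set (k.+1.-tuple T) -> \bar R :=
  pushforward (mu \x @lebesgue_measure R)%E (@tcons k).

Let lebesgue_cons0 : lebesgue_cons set0 = 0%E.
Proof. by rewrite /lebesgue_cons /pushforward preimage_set0 measure0. Qed.

Let lebesgue_cons_ge0 A : (0 <= lebesgue_cons A)%E.
Proof. by rewrite /lebesgue_cons /pushforward; apply: measure_ge0. Qed.

Let lebesgue_cons_sigma_additive : semi_sigma_additive lebesgue_cons.
Proof.
apply: measure_semi_sigma_additive; exact: measurable_tcons.
Qed.

HB.instance Definition _ := isMeasure.Build _ _ _ lebesgue_cons
  lebesgue_cons0 lebesgue_cons_ge0 lebesgue_cons_sigma_additive.
End lebesgue_cons.

(* Lebesgue measure on R^k, as an iterated product. *)
Fixpoint lebesgue_tuple k : {measure set (k.-tuple T) -> \bar R} :=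
  if k is k'.+1 then lebesgue_cons (lebesgue_tuple k')
  else \d_ ([tuple] : 0.-tuple T).

End LebesgueMeasure.

Section Space.
Context {R : realType} {n : nat}.
Implicit Types (z w : Cn R n) (u v : Cn R n -> Cplx R).

(* The identification of R^2n with C^n : z_j = t_j + i t_(n+j). *)
Definition cpoint (t : (n + n).-tuple (measurableTypeR R)) : Cn R n :=
  \row_j ((tnth t (lshift n j) : R) +i* (tnth t (rshift n j) : R)).

(* Euclidean: the library norm on ['rV_n] is the sup norm. *)
Definition enorm z : R := Num.sqrt (\sum_(j < n) normc (z 0 j) ^+ 2).

Definition japanese_bracket z : R := Num.sqrt (1 + enorm z ^+ 2).

Definition Phi z : R := 2^-1 * \sum_(j < n) complex.Im (z 0 j) ^+ 2.

Definition Lpnorm (p : \bar R) u : \bar R :=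
  Lnorm (lebesgue_tuple (n + n)) p (fun t => (normc (u (cpoint t)))%:E).

(* The measurable sets of [lebesgue_tuple] are the Borel sets: a function is
   Lebesgue measurable when it is a.e. equal to a Borel one. *)
Definition lebesgue_measurable u : Prop :=
  exists2 g : Cn R n -> Cplx R,
    measurable_fun setT (fun t => complex.Re (g (cpoint t)) : R) /\
    measurable_fun setT (fun t => complex.Im (g (cpoint t)) : R) &
    {ae lebesgue_tuple (n + n), forall t, u (cpoint t) = g (cpoint t)}.

Definition L2 : set (Cn R n -> Cplx R) :=
  [set u | lebesgue_measurable u /\ (Lpnorm 2%:E u < +oo)%E].

Definition inner u v : Cplx R :=
  let w t := u (cpoint t) * conjc (v (cpoint t)) in
  Rintegral (lebesgue_tuple (n + n)) setT (fun t => complex.Re (w t)) +i*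
  Rintegral (lebesgue_tuple (n + n)) setT (fun t => complex.Im (w t)).

Definition holomorphic v : Prop := forall z, differentiable v z.

Definition Hspace (N : nat) : set (Cn R n -> Cplx R) :=
  [set u | L2 u /\ exists2 v, holomorphic v &
    u = fun z => (expR (- (N%:R * Phi z)))%:C * v z].

(* For [H := Hspace N], a closed subspace of L^2 made of continuous functions,
   such a [w] exists and is unique as a function when [u] is in L^2. *)
Definition orth_proj (H : set (Cn R n -> Cplx R)) u : Cn R n -> Cplx R :=
  xget (fun=> 0) [set w | H w /\
    forall h, H h -> inner (fun z => u z - w z) h = 0].

Definition Toeplitz (N : nat) (f : Cn R n -> Cplx R) v : Cn R n -> Cplx R :=
  orth_proj (Hspace N) (fun z => f z * v z).

Definition Toeplitz_dom (N : nat) (m : Cn R n -> R) : set (Cn R n -> Cplx R) :=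
  [set v | Hspace N v /\ L2 (fun z => (m z)%:C * v z)].

(* Derivative of [u] at [z] along the real line [z + t w], i.e. the value at
   [w] of the real differential of [u] at [z]. *)
Definition rderivable u w z : Prop :=
  derivable (fun t : R => complex.Re (u (z + t%:C *: w))) 0 1 /\
  derivable (fun t : R => complex.Im (u (z + t%:C *: w))) 0 1.

Definition rderive u w z : Cplx R :=
  derive1 (fun t : R => complex.Re (u (z + t%:C *: w))) 0 +i*
  derive1 (fun t : R => complex.Im (u (z + t%:C *: w))) 0.

Definition dirx (j : 'I_n) : Cn R n := delta_mx 0 j.
Definition diry (j : 'I_n) : Cn R n := 'i *: delta_mx 0 j.

Definition coord_dir (k : 'I_n + 'I_n) : Cn R n :=
  match k with inl j => dirx j | inr j => diry j end.

Definition iter_rderive (s : seq ('I_n + 'I_n)) u : Cn R n -> Cplx R :=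
  foldr (fun k g => rderive g (coord_dir k)) u s.

Definition smooth u : Prop := forall s,
  continuous (iter_rderive s u) /\
  forall k z, rderivable (iter_rderive s u) (coord_dir k) z.

Definition del (j : 'I_n) u : Cn R n -> Cplx R :=
  fun z => 2^-1 * (rderive u (dirx j) z - 'i * rderive u (diry j) z).

Definition delbar (j : 'I_n) u : Cn R n -> Cplx R :=
  fun z => 2^-1 * (rderive u (dirx j) z + 'i * rderive u (diry j) z).

Definition multi (D : 'I_n -> (Cn R n -> Cplx R) -> Cn R n -> Cplx R)
    (a : 'I_n -> nat) u : Cn R n -> Cplx R :=
  foldr (fun j g => iter (a j) (D j) g) u (enum 'I_n).

Definition order_function (m : Cn R n -> R) : Prop :=
  (forall z, 0 < m z) /\
  exists C L : R, 0 < C /\ forall z w, m z <= C * japanese_bracket (z - w) `^ L * m w.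

Definition deriv_bound (m : Cn R n -> R) (a1 a2 : 'I_n -> nat) (c : R) u :
    Prop :=
  forall z, normc (multi del a1 (multi delbar a2 u) z) <= c * m z.

Definition symbol (m : Cn R n -> R) u : Prop :=
  smooth u /\ forall a1 a2, exists c, deriv_bound m a1 a2 c u.

(* Symbols depending on N >= 1; the value at N = 0 is irrelevant. *)
Definition symbol_family (m : Cn R n -> R) (f : nat -> Cn R n -> Cplx R) :
    Prop :=
  (forall N, (0 < N)%N -> smooth (f N)) /\
  forall a1 a2, exists c, forall N, (0 < N)%N -> deriv_bound m a1 a2 c (f N).

Definition expansion (m : Cn R n -> R) (f fj : nat -> Cn R n -> Cplx R) :
    Prop :=
  (forall j, symbol m (fj j)) /\
  forall (L : nat) a1 a2, exists c, forall N, (0 < N)%N ->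
    deriv_bound m a1 a2 (c * N%:R ^- L)
      (fun z => f N z - \sum_(j < L) N%:R ^- j * fj j z).

Definition diverges (f : nat -> Cn R n -> Cplx R) : Prop :=
  forall A : R, exists r : R, forall N, (0 < N)%N ->
    forall z, r <= enorm z -> A <= normc (f N z).

Definition regular_value u (E : Cplx R) : Prop :=
  forall z, u z = E -> exists w, rderive u w z != 0.

(* u_N = O(N^-oo) in L^2. *)
Definition rapidly_small_L2 (u : nat -> Cn R n -> Cplx R) : Prop :=
  forall L : nat, exists c : R,
    \forall N \near \oo, (Lpnorm 2%:E (u N) <= (c * N%:R ^- L)%:E)%E.

End Space.

(* Main.v *)
(* The orthogonal projection onto H_Phi is the Bergman integral operator, whose
   kernel is Gaussian at scale N^(-1/2). Taylor expansion of f_0 at z under this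
   integral gives
     (f_0(z) - E_N) V(z) + sum_j (dbar_j f_0)(z) M_j(z) = r(z) + O(1/N),
   where r = T_N(f) V - E_N V, the error is relative to a Gaussian average of |V|
   and M_j is the moment of V against conj (w - z)_j; the moments against
   (w - z)_j vanish because V is reproduced by the kernel.

   Since f - E_N has constant sign at infinity and the integral of
   (f - E_N) |V|^2 is negligible, |f_0 - E_N| |V|^2 has mass O(N^(-1/2)); this
   controls |V|^2 near points where f_0 stays away from E. Multiplying the
   expansion by conj V and taking imaginary parts, the derivative of |V|^2 along
   the Hamiltonian field X of f_0 is O(1) in L^1. Near a point z0 with X(z0) <> 0
   integrate it against atan (sqrt N l) psi, where l is a linear form with X l > 0
   and psi a cut-off: the mass of |V|^2 within N^(-1/2) of z0 is O(N^(-1/2)). The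
   reproducing formula bounds |V(z)|^2 by N^n times the mass of |V|^2 around z
   with Gaussian weight, whence sup |V|^2 = O(N^(n - 1/2)); interpolation with
   the L^2 norm concludes. *)
From HB Require Import structures.
Require Import Defs.
From mathcomp Require Import all_boot all_order all_algebra.
From mathcomp Require Import all_classical all_reals all_analysis.
From mathcomp Require Import complex ring lra measurable_realfun ess_sup_inf.

Set Implicit Arguments.
Unset Strict Implicit.
Unset Printing Implicit Defensive.

Import Order.TTheory GRing.Theory Num.Theory numFieldNormedType.Exports.
Import Defs.

Local Open Scope classical_set_scope.
Local Open Scope ring_scope.

(** * Lebesgue measure on tuples *)

(** The centre of the local estimate may depend on [N], so every constant has to be uniform in it:
    all of them are taken on one fixed ball by compactness, while at infinity the symbol is not
    expanded and enters only through its size and its sign. Regularity of [E] becomes a dichotomy on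
    that ball: at each point either [|f_0 - E|] or the gradient is bounded below. The derivative of
    [|V|^2] in a direction is exactly [N] times the real part of [conj V] times moments. Pairing
    with the Hamiltonian field turns it into the imaginary part of [conj V] times the gradient term
    of the expansion; there the real quantity [f_0 |V|^2] disappears and only [Im E_N], of order
    [1/N], survives, so that the factor [N] meets nothing but errors of order [1/N]. Since [atan] is
    bounded, the scale [sqrt N] costs nothing on one side of the integration by parts and gains
    [sqrt N] on the other. The reproducing formula rests on the invariance of the Gaussian under
    multiplication by unit complex numbers and on the mean value property on circles, which a
    Goursat bisection in logarithmic polar coordinates provides. *)

Lemma measurable_int2 d1 d2 (T1 : measurableType d1) (T2 : measurableType d2)
    (R : realType) (m2 : {sigma_finite_measure set T2 -> \bar R})
    (f : T1 -> T2 -> \bar R) :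
  measurable_fun setT (fun p : T1 * T2 => f p.1 p.2) ->
  (forall x y, 0 <= f x y)%E ->
  measurable_fun setT (fun x => \int[m2]_y f x y)%E.
Proof.
move=> mf f0.
apply: (@measurable_fun_fubini_tonelli_F _ _ _ _ _ m2 (fun p => f p.1 p.2)) => //.
Qed.

Section TupleMeasure.
Context {R : realType}.
Local Notation T := (measurableTypeR R).
Implicit Types k : nat.

(** An alias of [lebesgue_tuple] to which the sigma-finite structure required by Tonelli and Fubini
    is attached. *)
Definition leb k : set (k.-tuple T) -> \bar R := lebesgue_tuple k.

Arguments leb : clear implicits.
HB.instance Definition _ k := Measure.copy (leb k) (lebesgue_tuple k : {measure set _ -> \bar R}).

Definition box k (r : R) : set (k.-tuple T) :=
  [set t | forall j, `[- r, r]%classic (tnth t j)].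
Arguments box : clear implicits.

Lemma measurable_box k r : measurable (box k r).
Proof.
rewrite (_ : box k r = \bigcap_(j in [set: 'I_k]) ((@tnth _ T)^~ j @^-1` `[- r, r])); last first.
  by apply/seteqP; split => t /= H j; [move=> _; exact: H | exact: (H j I)].
apply: fin_bigcap_measurable => // j _.
rewrite -[X in measurable X]setTI; apply: measurable_tnth => //.
Qed.

Lemma leb_box k r : (leb k (box k r) < +oo)%E.
Proof.
elim: k => [|k IH].
  rewrite /leb /= /dirac indicE ; exact: ltry.
rewrite /leb /= /lebesgue_cons /pushforward.
rewrite (_ : _ @^-1` _ = box k r `*` `[- r, r]%classic).
  rewrite product_measure1E//; last exact: measurable_box.
  apply: lte_mul_pinfty => //.
    by rewrite ge0_fin_numE//; exact: IH.
  change (lebesgue_measure (`[(- r)%R, r]%classic : set R) < +oo)%E.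
  by rewrite lebesgue_measure_itv; case: ifP => // _; rewrite -EFinB ltry.
apply/seteqP; split => [[t x]|[t x] []] /=.
  move=> H; split=> [j|]; last exact: (H ord0).
  by have := H (lift ord0 j); rewrite tnthS.
move=> Ht Hx j; have [->//|] := eqVneq j ord0.
by case: (unliftP ord0 j) => [i ->|->]; rewrite ?eqxx// tnthS => _; exact: Ht.
Qed.

Lemma leb_sigma_finite k : sigma_finite [set: k.-tuple T] (leb k).
Proof.
exists (fun i => box k i%:R); last first.
  by move=> i; split; [exact: measurable_box | exact: leb_box].
apply/esym; rewrite -subTset => t _.
have [M HM] : exists M : nat, forall j, `|tnth t j : R| <= M%:R.
  exists (\sum_j (Num.truncn (`|tnth t j| : R)%R).+1)%N => j.
  rewrite (bigD1 j)//= natrD.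
  apply: le_trans (_ : _ <= (Num.truncn (`|tnth t j| : R)).+1%:R) _.
    exact/ltW/Num.Theory.truncnS_gt.
  by rewrite lerDl.
exists M => // j /=; rewrite in_itv/= -ler_norml; exact: HM.
Qed.

HB.instance Definition _ k := @Measure_isSigmaFinite.Build _ _ _ (leb k) (@leb_sigma_finite k).

(** The measure on [k.+1] coordinates is the pushforward of a product measure: a change of
    variables, then Tonelli. The head coordinate becomes the innermost variable. *)
Lemma leb_ge0_cons k (F : k.+1.-tuple T -> \bar R) :
  measurable_fun setT F -> (forall t, 0 <= F t)%E ->
  (\int[leb k.+1]_t F t = \int[leb k]_t \int[@lebesgue_measure R]_x F (tcons (t, x)))%E.
Proof.
move=> mF F0.
transitivity (\int[pushforward (leb k \x @lebesgue_measure R) (@tcons R k)]_t F t)%E => //.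
rewrite ge0_integral_pushforward//=; last exact: measurable_tcons.
rewrite preimage_setT fubini_tonelli1//.
by apply: measurableT_comp => //; exact: measurable_tcons.
Qed.


(** The image of Lebesgue measure under a translation has the right value on half-open intervals,
    which determine the measure. *)
Lemma lebesgue_translate (a : R) (F : R -> \bar R) :
  measurable_fun setT F -> (forall x, 0 <= F x)%E ->
  (\int[@lebesgue_measure R]_x F (x + a)%R = \int[@lebesgue_measure R]_x F x)%E.
Proof.
move=> mF F0.
have ma : measurable_fun setT (fun x : T => (x + a)%R : T).
  exact: measurable_funD.
transitivity (\int[pushforward (@lebesgue_measure R) (fun x : T => (x + a)%R : T)]_x F x)%E.
  by rewrite ge0_integral_pushforward.
apply: eq_measure_integral => A mA _; apply/esym.
apply: lebesgue_measure_unique => // _ [[b c] _ <-] /=.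
rewrite /pushforward.
rewrite (_ : _ @^-1` _ = `](b - a), (c - a)]%classic); last first.
  by apply/seteqP; split => x /=; rewrite !in_itv/= ltrBlDr lerBrDr.
by rewrite !lebesgue_measure_itv /= !lte_fin ltrD2r -!EFinB; congr (if _ then _ else _); congr EFin; ring.
Qed.

Definition tadd k (a t : k.-tuple T) : k.-tuple T :=
  [tuple (tnth t i : R) + (tnth a i : R) | i < k].

Lemma measurable_tadd k (a : k.-tuple T) : measurable_fun setT (tadd a).
Proof.
apply/measurable_fun_tnthP => i.
rewrite (_ : _ \o _ = fun t => (tnth t i : R) + (tnth a i : R)); last first.
  by apply/funext => t /=; rewrite tnth_mktuple.
apply: (@measurable_funD _ _ R _ (fun t : k.-tuple T => tnth t i : R)) => //.
exact: measurable_tnth.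
Qed.

Lemma leb_translate k (a : k.-tuple T) (F : k.-tuple T -> \bar R) :
  measurable_fun setT F -> (forall t, 0 <= F t)%E ->
  (\int[leb k]_t F (tadd a t) = \int[leb k]_t F t)%E.
Proof.
elim: k a F => [|k IH] a F mF F0.
  by apply: eq_integral => t _; congr F; rewrite tuple0 [RHS]tuple0.
have mt (x : R) : measurable_fun setT (fun t : k.-tuple T => (t, x : T)).
  exact: measurable_pair2.
rewrite (leb_ge0_cons mF F0).
rewrite (leb_ge0_cons (measurableT_comp mF (measurable_tadd a)) (fun t => F0 _)).
pose G (t : k.-tuple T) := (\int[@lebesgue_measure R]_x F (tcons (t, x)))%E.
rewrite -[RHS](IH [tuple tnth a (lift ord0 i) | i < k] G); last 2 first.
- apply: (@measurable_fun_fubini_tonelli_F _ _ _ _ _ (@lebesgue_measure R) (F \o @tcons R k)).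
    by apply: measurableT_comp => //; exact: measurable_tcons.
  by move=> x; exact: F0.
- by move=> t; exact: integral_ge0.
apply: eq_integral => t _; rewrite /G /=.
rewrite -[RHS](lebesgue_translate (thead a)); last 2 first.
- apply: measurableT_comp => //.
  apply: (measurableT_comp (@measurable_tcons R k)).
  exact: measurable_pair1.
- by [].
apply: eq_integral => x _; congr F.
apply: eq_from_tnth => i; rewrite tnth_mktuple.
case: (unliftP ord0 i) => [j ->|->].
  by rewrite !tnthS !tnth_mktuple.
by rewrite /thead !(tnth_nth (0 : R)).
Qed.


Lemma measurable_cat a b : measurable_fun setT
  (fun p : a.-tuple T * b.-tuple T => [tuple of p.1 ++ p.2]).
Proof.
apply/measurable_fun_tnthP => i.
case: (split_ordP i) => j ->.
  rewrite (_ : _ \o _ = (fun t => tnth t j) \o fst); last first.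
    by apply/funext => t /=; rewrite tnth_lshift.
  by apply: measurableT_comp => //; exact: measurable_tnth.
rewrite (_ : _ \o _ = (fun t => tnth t j) \o snd); last first.
  by apply/funext => t /=; rewrite tnth_rshift.
by apply: measurableT_comp => //; exact: measurable_tnth.
Qed.

Lemma measurable_catl a b (s : a.-tuple T) :
  measurable_fun setT (fun t : b.-tuple T => [tuple of s ++ t]).
Proof. exact: (measurableT_comp (@measurable_cat a b) (measurable_pair1 s)). Qed.

Lemma measurable_catr a b (t : b.-tuple T) :
  measurable_fun setT (fun s : a.-tuple T => [tuple of s ++ t]).
Proof. exact: (measurableT_comp (@measurable_cat a b) (measurable_pair2 t)). Qed.

Lemma leb_split a b (F : (a + b).-tuple T -> \bar R) :
  measurable_fun setT F -> (forall t, 0 <= F t)%E ->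
  (\int[leb (a + b)]_t F t = \int[leb a]_s \int[leb b]_t F [tuple of s ++ t])%E.
Proof.
elim: a F => [|a IH] F mF F0.
  rewrite [RHS](_ : _ = \int[\d_ ([tuple] : 0.-tuple T)]_s \int[leb b]_t F [tuple of s ++ t])%E//.
  rewrite integral_dirac//.
    rewrite diracT mul1e; apply: eq_integral => t _; congr F.
    exact/val_inj.
  have := @measurable_int2 _ _ _ _ _ (leb b) (fun (s : 0.-tuple T) (t : b.-tuple T) => F [tuple of s ++ t]).
  apply; last by move=> x y; exact: F0.
  by apply: measurableT_comp => //; exact: (@measurable_cat 0 b).
rewrite (leb_ge0_cons mF F0) [RHS]leb_ge0_cons; last 2 first.
- have := @measurable_int2 _ _ _ _ _ (leb b) (fun (s : a.+1.-tuple T) (t : b.-tuple T) => F [tuple of s ++ t]).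
  apply; last by move=> x y; exact: F0.
  by apply: measurableT_comp => //; exact: (@measurable_cat a.+1 b).
- by move=> t; exact: integral_ge0.
rewrite (IH (fun t => \int[@lebesgue_measure R]_x F (tcons (t, x)))%E); last 2 first.
- apply: (@measurable_fun_fubini_tonelli_F _ _ _ _ _ (@lebesgue_measure R) (F \o @tcons R (a + b))).
    by apply: measurableT_comp => //; exact: measurable_tcons.
  by move=> x; exact: F0.
- by move=> t; exact: integral_ge0.
apply: eq_integral => s _.
have mcs : measurable_fun setT (fun t : b.-tuple T => [tuple of s ++ t]).
  exact: measurable_catl.
have mq : measurable_fun setT (fun p : b.-tuple T * T => F (tcons ([tuple of s ++ p.1], p.2))).
  apply: (measurableT_comp mF); apply: (measurableT_comp (@measurable_tcons R _)).
  apply: measurable_fun_pair; last exact: measurable_snd.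
  by apply: (measurableT_comp mcs); exact: measurable_fst.
(* The left side integrates the head coordinate before the last [b] ones, the right side after
   them. *)
rewrite (@fubini_tonelli _ _ _ _ _ (leb b) (@lebesgue_measure R) _ mq (fun p => F0 _)).
apply: eq_integral => x _; apply: eq_integral => t _; congr F.
exact/val_inj.
Qed.

Lemma leb_prod k (g : R -> R) : measurable_fun setT g -> (forall x, 0 <= g x) ->
  (\int[leb k]_t (\prod_(i < k) g (tnth t i))%:E =
   (\int[@lebesgue_measure R]_x (g x)%:E) ^+ k)%E.
Proof.
move=> mg g0; elim: k => [|k IH].
  rewrite expe0 (_ : leb 0 = \d_ ([tuple] : 0.-tuple T))// integral_dirac//.
    by rewrite big_ord0 diracT mul1e.
  apply/measurable_EFinP; rewrite (_ : (fun _ => _) = cst 1); first exact: measurable_cst.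
  by apply/funext => t; rewrite big_ord0.
have mp j : measurable_fun setT (fun t : j.-tuple T => \prod_(i < j) g (tnth t i)).
  apply: measurable_prod => i _; apply: measurableT_comp => //; exact: measurable_tnth.
have p0 j (t : j.-tuple T) : 0 <= \prod_(i < j) g (tnth t i).
  by apply: prodr_ge0.
rewrite leb_ge0_cons; [|by apply/measurable_EFinP; exact: mp|by move=> t; rewrite lee_fin].
rewrite expeS -IH muleC -ge0_integralZr//; last 3 first.
- by apply/measurable_EFinP; exact: mp.
- by move=> t _; rewrite lee_fin.
- by apply: integral_ge0 => t _; rewrite lee_fin.
apply: eq_integral => t _.
rewrite muleC -ge0_integralZr//; last 3 first.
- exact/measurable_EFinP.
- by move=> x _; rewrite lee_fin.
- by rewrite lee_fin.
apply: eq_integral => x _; rewrite -EFinM big_ord_recl; congr (_%:E).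
rewrite tnth0; congr (_ * _); apply: eq_bigr => i _; congr g.
by rewrite tnthS.
Qed.

(** Read off from the total mass of the normal density of variance [1 / (2 a)]. *)
Lemma gauss1 (a : R) : 0 < a ->
  (\int[@lebesgue_measure R]_x (expR (- a * x ^+ 2))%:E = (Num.sqrt (pi / a))%:E)%E.
Proof.
move=> a0; pose s := Num.sqrt (a *+ 2)^-1.
have s0 : s != 0 by rewrite gt_eqF// sqrtr_gt0 invr_gt0 mulrn_wgt0.
have s2 : s ^+ 2 = (a *+ 2)^-1 by rewrite sqr_sqrtr// invr_ge0 mulrn_wge0// ltW.
have := integral_normal_pdf 0 s.
under eq_integral do rewrite (normal_pdfE _ s0).
rewrite /normal_peak /normal_fun s2.
have -> : (a *+ 2)^-1 * pi *+ 2 = pi / a by rewrite -[a *+ 2]mulr_natl -mulr_natl; field; rewrite gt_eqF.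
under eq_integral => x _.
  rewrite subr0 EFinM (_ : - x ^+ 2 / ((a *+ 2)^-1 *+ 2) = - a * x ^+ 2); last by field; rewrite gt_eqF.
  over.
have q0 : 0 < Num.sqrt (pi / a) by rewrite sqrtr_gt0 divr_gt0// pi_gt0.
have mg : measurable_fun setT (fun x : T => expR (- a * x ^+ 2)).
  apply: measurableT_comp => //.
  by apply: measurable_funM => //; exact: exprn_measurable.
rewrite (ge0_integralZl_EFin _ measurableT); last 3 first.
- by move=> x _; rewrite lee_fin expR_ge0.
- by apply/measurable_EFinP.
- by rewrite invr_ge0 ltW.
move=> H; rewrite -[LHS]mul1e -(divff (lt0r_neq0 q0)) EFinM -muleA H mule1//.
Qed.

Lemma gauss_tuple k (a : R) : 0 < a ->
  (\int[leb k]_t (expR (- a * \sum_(i < k) (tnth t i : R) ^+ 2))%:E =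
   (Num.sqrt (pi / a) ^+ k)%:E)%E.
Proof.
move=> a0; rewrite EFin_expe -gauss1// -leb_prod; last 2 first.
- apply: measurableT_comp => //.
  by apply: measurable_funM => //; exact: exprn_measurable.
- by move=> x; exact: expR_ge0.
by apply: eq_integral => t _; rewrite mulr_sumr expR_sum.
Qed.


(** Tested on nonnegative functions, to which Tonelli applies directly; other integrals follow
    through positive and negative parts. *)
Definition measure_preserving k (phi : k.-tuple T -> k.-tuple T) :=
  measurable_fun setT phi /\ forall F : k.-tuple T -> \bar R,
    measurable_fun setT F -> (forall t, 0 <= F t)%E ->
    (\int[leb k]_t F (phi t) = \int[leb k]_t F t)%E.

Lemma measure_preserving_comp k (phi psi : k.-tuple T -> k.-tuple T) :
  measure_preserving phi -> measure_preserving psi -> measure_preserving (phi \o psi).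
Proof.
move=> [m1 p1] [m2 p2]; split; first exact: measurableT_comp.
move=> F mF F0; rewrite -(p1 F mF F0) -(p2 (F \o phi))//.
  exact: measurableT_comp.
by move=> t; exact: F0.
Qed.

Lemma measure_preserving_integral k (phi : k.-tuple T -> k.-tuple T) (g : k.-tuple T -> \bar R) :
  measure_preserving phi -> measurable_fun setT g ->
  (\int[leb k]_t g (phi t) = \int[leb k]_t g t)%E.
Proof.
move=> [_ mp] mg; rewrite [LHS]integralE [RHS]integralE; congr (_ - _)%E.
  under eq_integral => t _ do rewrite funeposE.
  under [RHS]eq_integral => t _ do rewrite funeposE.
  apply: (mp (fun t => maxe (g t) 0)%E) => [|t]; last by rewrite le_max lexx orbT.
  by apply: measurable_maxe => //; exact: measurable_cst.
under eq_integral => t _ do rewrite funenegE.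
under [RHS]eq_integral => t _ do rewrite funenegE.
apply: (mp (fun t => maxe (- g t) 0)%E) => [|t]; last by rewrite le_max lexx orbT.
by apply: measurable_maxe; [exact: measurableT_comp|exact: measurable_cst].
Qed.

Lemma measure_preserving_tadd k (a : k.-tuple T) : measure_preserving (tadd a).
Proof. by split; [exact: measurable_tadd|move=> F mF F0; exact: leb_translate]. Qed.

(** One real 2x2 matrix acts on every pair of coordinates [(t_j, t_(k+j))]. Through [cpoint],
    multiplication by a complex number is of this form. *)
Definition lmap k (c1 c2 c3 c4 : R) (t : (k + k).-tuple T) : (k + k).-tuple T :=
  [tuple of [tuple c1 * tnth t (lshift k j) + c2 * tnth t (rshift k j) | j < k] ++
   [tuple c3 * tnth t (lshift k j) + c4 * tnth t (rshift k j) | j < k]].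

Lemma lmap_comp k c1 c2 c3 c4 d1 d2 d3 d4 :
  @lmap k c1 c2 c3 c4 \o @lmap k d1 d2 d3 d4 =
  @lmap k (c1 * d1 + c2 * d3) (c1 * d2 + c2 * d4) (c3 * d1 + c4 * d3) (c3 * d2 + c4 * d4).
Proof.
apply/funext => t /=; apply: eq_from_tnth => i; rewrite /lmap.
by case: (split_ordP i) => j ->; rewrite ?(tnth_lshift, tnth_rshift) !tnth_mktuple
  ?(tnth_lshift, tnth_rshift) !tnth_mktuple; ring.
Qed.

Lemma measurable_lmap k c1 c2 c3 c4 : measurable_fun setT (@lmap k c1 c2 c3 c4).
Proof.
apply/measurable_fun_tnthP => i.
have H j c d : measurable_fun setT (fun t : (k + k).-tuple T =>
    (c * (tnth t (lshift k j) : R) + d * (tnth t (rshift k j) : R))%R).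
  by apply: measurable_funD; apply: measurable_funM => //; exact: measurable_tnth.
case: (split_ordP i) => j ->.
  rewrite (_ : _ \o _ = fun t => (c1 * (tnth t (lshift k j) : R) + c2 * (tnth t (rshift k j) : R))%R).
    exact: H.
  by apply/funext => t /=; rewrite tnth_lshift tnth_mktuple.
rewrite (_ : _ \o _ = fun t => (c3 * (tnth t (lshift k j) : R) + c4 * (tnth t (rshift k j) : R))%R).
  exact: H.
by apply/funext => t /=; rewrite tnth_rshift tnth_mktuple.
Qed.

(** For a fixed second half of the coordinates the shear is a translation of the first half; Tonelli
    puts the translated variables innermost. *)
Lemma shear1 k (c : R) : measure_preserving (@lmap k 1 c 0 1).
Proof.
split; first exact: measurable_lmap.
move=> F mF F0.
have mG := measurableT_comp mF (@measurable_lmap k 1 c 0 1).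
have mc (G : (k + k).-tuple T -> \bar R) : measurable_fun setT G ->
    measurable_fun setT (fun p : k.-tuple T * k.-tuple T => G [tuple of p.1 ++ p.2]).
  by move=> mG'; apply: (measurableT_comp mG'); exact: measurable_cat.
rewrite (leb_split mG (fun t => F0 _)) (leb_split mF F0).
rewrite (@fubini_tonelli _ _ _ _ _ (leb k) (leb k) _ (mc _ mG) (fun t => F0 _)).
rewrite (@fubini_tonelli _ _ _ _ _ (leb k) (leb k) _ (mc _ mF) (fun t => F0 _)).
apply: eq_integral => t _ /=.
rewrite -[RHS](leb_translate [tuple c * tnth t j | j < k]); last 2 first.
- by apply: (measurableT_comp mF); exact: measurable_catr.
- by move=> s; exact: F0.
apply: eq_integral => s _; congr F.
apply: eq_from_tnth => i; rewrite /lmap /tadd.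
by case: (split_ordP i) => j ->; rewrite ?(tnth_lshift, tnth_rshift) !tnth_mktuple
  ?(tnth_lshift, tnth_rshift)//; ring.
Qed.

Lemma shear2 k (c : R) : measure_preserving (@lmap k 1 0 c 1).
Proof.
split; first exact: measurable_lmap.
move=> F mF F0.
have mG := measurableT_comp mF (@measurable_lmap k 1 0 c 1).
have mc (G : (k + k).-tuple T -> \bar R) : measurable_fun setT G ->
    measurable_fun setT (fun p : k.-tuple T * k.-tuple T => G [tuple of p.1 ++ p.2]).
  by move=> mG'; apply: (measurableT_comp mG'); exact: measurable_cat.
rewrite (leb_split mG (fun t => F0 _)) (leb_split mF F0).
apply: eq_integral => t _ /=.
rewrite -[RHS](leb_translate [tuple c * tnth t j | j < k]); last 2 first.
- by apply: (measurableT_comp mF); exact: measurable_catl.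
- by move=> s; exact: F0.
apply: eq_integral => s _; congr F.
apply: eq_from_tnth => i; rewrite /lmap /tadd.
by case: (split_ordP i) => j ->; rewrite ?(tnth_lshift, tnth_rshift) !tnth_mktuple
  ?(tnth_lshift, tnth_rshift)//; ring.
Qed.

(* A rotation of angle other than pi is a product of three shears. *)
Lemma rotation_measure_preserving k (c s : R) :
  c ^+ 2 + s ^+ 2 = 1 -> measure_preserving (@lmap k c (- s) s c).
Proof.
have main a b : a ^+ 2 + b ^+ 2 = 1 -> a != -1 ->
    measure_preserving (@lmap k a (- b) b a).
  (* [t] is the tangent of half the angle. *)
  move=> ab1 a1; pose t := b / (1 + a).
  have a10 : 1 + a != 0 by rewrite addrC -(opprK 1) subr_eq0.
  have -> : @lmap k a (- b) b a = @lmap k 1 (- t) 0 1 \o @lmap k 1 0 b 1 \o @lmap k 1 (- t) 0 1.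
    have ta : t * (1 + a) = b by rewrite /t divfK.
    have tb : t * b = 1 - a.
      apply: (mulIf a10); rewrite mulrAC ta; move: ab1; rewrite !expr2; lra.
    have ttb : t * (t * b) = t - t * a by rewrite tb; ring.
    by rewrite !lmap_comp; congr lmap; lra.
  apply: measure_preserving_comp; last exact: shear1.
  by apply: measure_preserving_comp; [exact: shear1|exact: shear2].
move=> cs; have [c1|] := eqVneq c (-1); last exact: main.
have s0 : s = 0 by apply/eqP; rewrite -sqrf_eq0; apply/eqP; rewrite c1 in cs; lra.
(* The half turn is the square of a quarter turn. *)
have -> : @lmap k c (- s) s c = @lmap k 0 (- 1) 1 0 \o @lmap k 0 (- 1) 1 0.
  by rewrite lmap_comp c1 s0; congr lmap; ring.
have m01 : measure_preserving (@lmap k 0 (-1) 1 0).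
  by apply: main; [ring|rewrite eq_sym oppr_eq0 oner_eq0].
exact: measure_preserving_comp.
Qed.

End TupleMeasure.
Arguments leb {R} k _.
Arguments box {R} k _ _.
Arguments lmap {R} k c1 c2 c3 c4 t.

(** * Second-order Taylor bound and the complex exponential *)

Section Calculus.
Context {R : realType}.
Implicit Types (x y t : R).

(** The mean value theorem is applied twice, which costs the factor 1/2 of the sharp remainder. *)
Lemma taylor2 (f f1 f2 : R -> R) (M : R) :
  (forall t, is_derive t 1 f (f1 t)) -> (forall t, is_derive t 1 f1 (f2 t)) ->
  (forall t, 0 <= t <= 1 -> `|f2 t| <= M) -> `|f 1 - f 0 - f1 0| <= M.
Proof.
move=> df df1 HM.
have cf g g1 : (forall t : R, is_derive t (1 : R) g (g1 t : R)) -> forall a b : R, {within `[a, b], continuous g}.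
  move=> dg a b; apply: continuous_subspaceT => t.
  by apply: differentiable_continuous; apply/derivable1_diffP; case: (dg t).
have [c c01 ->] := @MVT R f f1 0 1 ltr01 (fun t _ => df t) (cf _ _ df 0 1).
rewrite subr0 mulr1; move: c01; rewrite in_itv/= => /andP[c0 c1].
have [d d0c ->] := @MVT R f1 f2 0 c c0 (fun t _ => df1 t) (cf _ _ df1 0 c).
move: d0c; rewrite in_itv/= => /andP[d0 dc].
rewrite subr0 normrM (gtr0_norm c0).
apply: le_trans (_ : M * 1 <= _); last by rewrite mulr1.
apply: ler_pM => //; [exact: ltW| |exact: ltW].
by apply: HM; rewrite (ltW d0) (ltW (lt_trans dc c1)).
Qed.

End Calculus.

Section ComplexBasics.
Context {R : realType}.
Local Notation C := R[i].
Local Notation Re := complex.Re.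
Local Notation Im := complex.Im.
Implicit Types z w : C.
Local Open Scope complex_scope.

Lemma normc_ge0 z : 0 <= normc z.
Proof. by case: z => a b; rewrite sqrtr_ge0. Qed.

Lemma normc_sqr z : normc z ^+ 2 = Re z ^+ 2 + Im z ^+ 2.
Proof. by case: z => a b; rewrite sqr_sqrtr// addr_ge0// sqr_ge0. Qed.

Lemma normr_normc z : `|z| = (normc z)%:C.
Proof. by case: z. Qed.

Lemma normr_Re z : `|Re z| <= normc z.
Proof.
rewrite -(ler_pXn2r (ltn0Sn 1)) ?nnegrE ?normc_ge0//.
by rewrite normc_sqr real_normK ?num_real// lerDl sqr_ge0.
Qed.

Lemma normr_Im z : `|Im z| <= normc z.
Proof.
rewrite -(ler_pXn2r (ltn0Sn 1)) ?nnegrE ?normc_ge0//.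
by rewrite normc_sqr real_normK ?num_real// lerDr sqr_ge0.
Qed.

Lemma normc_le z : normc z <= `|Re z| + `|Im z|.
Proof.
rewrite -(ler_pXn2r (ltn0Sn 1)) ?nnegrE ?normc_ge0// ?addr_ge0//.
rewrite normc_sqr sqrrD !real_normK ?num_real// -addrA lerD2l lerDr.
by rewrite mulrn_wge0// mulr_ge0.
Qed.

Lemma normc_conj z : normc (conjc z) = normc z.
Proof. by case: z => a b /=; rewrite sqrrN. Qed.

Lemma normc_real (x : R) : normc x%:C = `|x|.
Proof. by rewrite /= expr0n addr0 sqrtr_sqr. Qed.

Lemma normcB z w : normc (z - w) = normc (w - z).
Proof. by rewrite -normcN opprB. Qed.

Lemma normc_eq0 z : (normc z == 0) = (z == 0).
Proof.
apply/eqP/eqP => [|->]; first exact: Normc.eq0_normc.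
by rewrite Normc.normc0.
Qed.

Lemma cReD z w : Re (z + w) = Re z + Re w. Proof. by case: z; case: w. Qed.
Lemma cImD z w : Im (z + w) = Im z + Im w. Proof. by case: z; case: w. Qed.
Lemma cReN z : Re (- z) = - Re z. Proof. by case: z. Qed.
Lemma cImN z : Im (- z) = - Im z. Proof. by case: z. Qed.
Lemma cReM z w : Re (z * w) = Re z * Re w - Im z * Im w.
Proof. by case: z; case: w. Qed.
Lemma cImM z w : Im (z * w) = Re z * Im w + Im z * Re w.
Proof. by case: z => a b; case: w. Qed.
Lemma cRe_conj z : Re (conjc z) = Re z. Proof. by case: z. Qed.
Lemma cIm_conj z : Im (conjc z) = - Im z. Proof. by case: z. Qed.
Lemma cRe_sum (I : Type) (r : seq I) (P : pred I) (F : I -> C) :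
  Re (\sum_(i <- r | P i) F i) = \sum_(i <- r | P i) Re (F i).
Proof. exact: (big_morph _ cReD (erefl : Re 0 = 0)). Qed.
Lemma cIm_sum (I : Type) (r : seq I) (P : pred I) (F : I -> C) :
  Im (\sum_(i <- r | P i) F i) = \sum_(i <- r | P i) Im (F i).
Proof. exact: (big_morph _ cImD (erefl : Im 0 = 0)). Qed.

Definition complexE_simp := (cReD, cImD, cReN, cImN, cReM, cImM, cRe_conj, cIm_conj).

Lemma complex_eq z w : Re z = Re w -> Im z = Im w -> z = w.
Proof. by case: z => a b; case: w => c d /= -> ->. Qed.

Definition cexp z : C := (expR (Re z) * cos (Im z)) +i* (expR (Re z) * sin (Im z)).

Lemma cexp0 : cexp 0 = 1.
Proof. by rewrite /cexp /= expR0 cos0 sin0 mulr1 mulr0. Qed.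

Lemma cexpD z w : cexp (z + w) = cexp z * cexp w.
Proof.
by apply: complex_eq; rewrite /cexp ?complexE_simp /= expRD ?cosD ?sinD; ring.
Qed.

Lemma normc_cexp z : normc (cexp z) = expR (Re z).
Proof.
apply/eqP; rewrite -(@eqrXn2 _ 2) ?normc_ge0 ?expR_ge0//; apply/eqP.
by rewrite normc_sqr /cexp /= !exprMn -mulrDr cos2Dsin2 mulr1.
Qed.

Lemma conj_cexp z : conjc (cexp z) = cexp (conjc z).
Proof. by apply: complex_eq; rewrite /cexp ?complexE_simp /= ?complexE_simp ?cosN ?sinN ?mulrN. Qed.

Lemma cexp_taylor z : normc (cexp z - 1 - z) <= 4 * normc z ^+ 2 * expR (normc z).
Proof.
pose a := Re z; pose b := Im z.
pose M := 2 * normc z ^+ 2 * expR (normc z).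
(* This family contains the real and imaginary parts of [cexp (t z)] and is closed under
   differentiation in [t], so one bound serves both second derivatives. *)
pose u (p q t : R) : R := expR (t * a) * (p * cos (t * b) + q * sin (t * b)).
have du (p q t : R) : is_derive t (1 : R) (u p q) (u (a * p + b * q) (a * q - b * p) t).
  apply: is_derive_eq; rewrite /u /GRing.scale /=; ring.
have bu p q t : `|p| <= normc z ^+ 2 -> `|q| <= normc z ^+ 2 -> 0 <= t <= 1 -> `|u p q t| <= M.
  move=> hp hq /andP[t0 t1]; rewrite /u /M normrM (gtr0_norm (expR_gt0 _)) mulrC.
  apply: ler_pM => //; rewrite ?expR_ge0//.
    rewrite mulr_natl mulr2n (le_trans (ler_normD _ _))//; apply: lerD; rewrite normrM.
      apply: le_trans (_ : `|p| * 1 <= _); last by rewrite mulr1.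
      by rewrite ler_wpM2l// ler_norml cos_geN1 cos_le1.
    apply: le_trans (_ : `|q| * 1 <= _); last by rewrite mulr1.
    by rewrite ler_wpM2l// ler_norml sin_geN1 sin_le1.
  rewrite ler_expR (le_trans (ler_norm _))// normrM (ger0_norm t0).
  apply: le_trans (_ : 1 * normc z <= _); last by rewrite mul1r.
  by apply: ler_pM => //; exact: normr_Re.
have n2 : normc z ^+ 2 = a ^+ 2 + b ^+ 2 by exact: normc_sqr.
have hp1 : `|a ^+ 2 - b ^+ 2| <= normc z ^+ 2.
  by rewrite n2 ler_norml; have := sqr_ge0 a; have := sqr_ge0 b; lra.
have hp2 : `|2 * a * b| <= normc z ^+ 2.
  rewrite n2 ler_norml; have := sqr_ge0 (a + b); have := sqr_ge0 (a - b).
  by rewrite sqrrB sqrrD; lra.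
have H1 := @taylor2 R _ _ _ M (du 1 0) (du _ _).
have H2 := @taylor2 R _ _ _ M (du 0 1) (du _ _).
apply: le_trans (normc_le _) _.
have -> : 4 * normc z ^+ 2 * expR (normc z) = M + M by rewrite /M; ring.
apply: lerD.
- have -> : Re (cexp z - 1 - z) = u 1 0 1 - u 1 0 0 - u (a * 1 + b * 0) (a * 0 - b * 1) 0.
    by rewrite /u !complexE_simp /= !mul1r !mul0r !expR0 cos0 sin0 -/a -/b; ring.
  apply: H1 => t ht; apply: bu => //.
    by rewrite (_ : _ + _ = a ^+ 2 - b ^+ 2)//; ring.
  by rewrite (_ : _ - _ = - (2 * a * b)) ?normrN//; ring.
- have -> : Im (cexp z - 1 - z) = u 0 1 1 - u 0 1 0 - u (a * 0 + b * 1) (a * 1 - b * 0) 0.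
    by rewrite /u !complexE_simp /= !mul1r !mul0r !expR0 cos0 sin0 -/a -/b; ring.
  apply: H2 => t ht; apply: bu => //.
    by rewrite (_ : _ + _ = 2 * a * b)//; ring.
  by rewrite (_ : _ - _ = a ^+ 2 - b ^+ 2)//; ring.
Qed.

End ComplexBasics.

(** * Complex-valued integrals *)

Section NonnegIntegral.
Context d (T : measurableType d) (R : realType) (mu : {measure set T -> \bar R}).
Implicit Types f g : T -> R.

Lemma nint_ge0 f : (forall x, 0 <= f x) -> (0 <= \int[mu]_x (f x)%:E)%E.
Proof. by move=> f0; apply: integral_ge0 => x _; rewrite lee_fin. Qed.

Lemma nint_le f g : measurable_fun setT f -> measurable_fun setT g ->
  (forall x, 0 <= f x) -> (forall x, f x <= g x) ->
  (\int[mu]_x (f x)%:E <= \int[mu]_x (g x)%:E)%E.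
Proof.
move=> mf mg f0 fg; apply: ge0_le_integral => //.
- by move=> x _; rewrite lee_fin.
- exact/measurable_EFinP.
- exact/measurable_EFinP.
- by move=> x _; rewrite lee_fin.
Qed.

Lemma nintZ (k : R) f : measurable_fun setT f -> (forall x, 0 <= f x) -> 0 <= k ->
  (\int[mu]_x (k * f x)%:E = k%:E * \int[mu]_x (f x)%:E)%E.
Proof.
move=> mf f0 k0; rewrite -ge0_integralZl_EFin//.
- by move=> x _; rewrite lee_fin.
- exact/measurable_EFinP.
Qed.

Lemma nintD f g : measurable_fun setT f -> measurable_fun setT g ->
  (forall x, 0 <= f x) -> (forall x, 0 <= g x) ->
  (\int[mu]_x (f x + g x)%:E = \int[mu]_x (f x)%:E + \int[mu]_x (g x)%:E)%E.
Proof.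
move=> mf mg f0 g0; rewrite -ge0_integralD//.
- by move=> x _; rewrite lee_fin.
- exact/measurable_EFinP.
- by move=> x _; rewrite lee_fin.
- exact/measurable_EFinP.
Qed.

Lemma nint_integrable f : measurable_fun setT f -> (forall x, 0 <= f x) ->
  (\int[mu]_x (f x)%:E < +oo)%E -> mu.-integrable setT (EFin \o f).
Proof.
move=> mf f0 foo; apply/integrableP; split; first exact/measurable_EFinP.
under eq_integral => x _ do rewrite /= ger0_norm//.
exact: foo.
Qed.

Lemma integrable_le f g : measurable_fun setT f -> measurable_fun setT g ->
  (forall x, `|f x| <= g x) ->
  (\int[mu]_x (g x)%:E < +oo)%E -> mu.-integrable setT (EFin \o f).
Proof.
move=> mf mg fg goo; apply/integrableP; split; first exact/measurable_EFinP.
apply: le_lt_trans goo; apply: (@nint_le (fun x => `|f x|)) => //.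
by apply: measurableT_comp.
Qed.

End NonnegIntegral.

Section ComplexIntegral.
Context d (T : measurableType d) (R : realType).
Local Notation C := R[i].
Local Notation Re := complex.Re.
Local Notation Im := complex.Im.
Implicit Types (F G : T -> C) (f g : T -> R).
Local Open Scope complex_scope.

Definition cmeas F := measurable_fun setT (fun x => Re (F x)) /\
  measurable_fun setT (fun x => Im (F x)).

Lemma cmeasD F G : cmeas F -> cmeas G -> cmeas (fun x => F x + G x).
Proof.
move=> [F1 F2] [G1 G2]; split.
  by rewrite (_ : (fun _ => _) = fun x => Re (F x) + Re (G x)); [exact: measurable_funD|apply/funext => x; rewrite cReD].
by rewrite (_ : (fun _ => _) = fun x => Im (F x) + Im (G x)); [exact: measurable_funD|apply/funext => x; rewrite cImD].
Qed.

Lemma cmeasM F G : cmeas F -> cmeas G -> cmeas (fun x => F x * G x).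
Proof.
move=> [F1 F2] [G1 G2]; split.
  rewrite (_ : (fun _ => _) = fun x => Re (F x) * Re (G x) - Im (F x) * Im (G x)).
    by apply: measurable_funB; apply: measurable_funM.
  by apply/funext => x; rewrite cReM.
rewrite (_ : (fun _ => _) = fun x => Re (F x) * Im (G x) + Im (F x) * Re (G x)).
  by apply: measurable_funD; apply: measurable_funM.
by apply/funext => x; rewrite cImM.
Qed.

Lemma cmeas_cst (c : C) : cmeas (fun=> c).
Proof. by split; exact: measurable_cst. Qed.

Lemma cmeasN F : cmeas F -> cmeas (fun x => - F x).
Proof.
move=> mF; rewrite (_ : (fun _ => _) = fun x => (-1) * F x).
  exact: cmeasM (cmeas_cst _) mF.
by apply/funext => x; rewrite mulN1r.
Qed.

Lemma cmeasB F G : cmeas F -> cmeas G -> cmeas (fun x => F x - G x).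
Proof. by move=> mF mG; exact: cmeasD mF (cmeasN mG). Qed.

Lemma cmeas_conj F : cmeas F -> cmeas (fun x => conjc (F x)).
Proof.
move=> [F1 F2]; split.
  by rewrite (_ : (fun _ => _) = fun x => Re (F x)) //; apply/funext => x; rewrite cRe_conj.
rewrite (_ : (fun _ => _) = fun x => - Im (F x)); first exact: measurableT_comp.
by apply/funext => x; rewrite cIm_conj.
Qed.

Lemma cmeas_sum (I : Type) (r : seq I) (F : I -> T -> C) :
  (forall i, cmeas (F i)) -> cmeas (fun x => \sum_(i <- r) F i x).
Proof.
move=> mF; elim: r => [|i r IH].
  by rewrite (_ : (fun _ => _) = fun=> 0); [exact: cmeas_cst|apply/funext => x; rewrite big_nil].
rewrite (_ : (fun _ => _) = fun x => F i x + \sum_(i <- r) F i x); first exact: cmeasD.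
by apply/funext => x; rewrite big_cons.
Qed.

Lemma cmeas_real f : measurable_fun setT f -> cmeas (fun x => (f x)%:C).
Proof. by move=> mf; split => //=; exact: measurable_cst. Qed.

Lemma cmeas_normc F : cmeas F -> measurable_fun setT (fun x => normc (F x)).
Proof.
move=> [F1 F2].
rewrite (_ : (fun _ => _) = (@Num.sqrt R) \o (fun x => Re (F x) ^+ 2 + Im (F x) ^+ 2)); last first.
  by apply/funext => x /=; case: (F x).
apply: measurableT_comp; first by apply: continuous_measurable_fun; exact: sqrt_continuous.
by apply: measurable_funD; apply: measurable_funX.
Qed.

Lemma cmeas_cexp F : cmeas F -> cmeas (fun x => cexp (F x)).
Proof.
move=> [F1 F2]; split => /=.
  apply: measurable_funM; first exact: measurableT_comp.
  by apply: measurableT_comp => //; apply: continuous_measurable_fun; exact: continuous_cos.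
apply: measurable_funM; first exact: measurableT_comp.
by apply: measurableT_comp => //; apply: continuous_measurable_fun; exact: continuous_sin.
Qed.

Variable mu : {measure set T -> \bar R}.

Definition Cint F : C := Rintegral mu setT (fun x => Re (F x)) +i*
  Rintegral mu setT (fun x => Im (F x)).

Definition cintegrable F := cmeas F /\ (\int[mu]_x (normc (F x))%:E < +oo)%E.

Lemma cintegrableRe F : cintegrable F -> mu.-integrable setT (EFin \o (fun x => Re (F x))).
Proof.
move=> [mF Foo]; apply: integrable_le Foo; [by case: mF|exact: cmeas_normc|].
by move=> x; exact: normr_Re.
Qed.

Lemma cintegrableIm F : cintegrable F -> mu.-integrable setT (EFin \o (fun x => Im (F x))).
Proof.
move=> [mF Foo]; apply: integrable_le Foo; [by case: mF|exact: cmeas_normc|].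
by move=> x; exact: normr_Im.
Qed.

Lemma cintegrable_le F g : cmeas F -> measurable_fun setT g ->
  (forall x, normc (F x) <= g x) -> (\int[mu]_x (g x)%:E < +oo)%E -> cintegrable F.
Proof.
move=> mF mg Fg goo; split => //; apply: le_lt_trans goo.
apply: nint_le => //; [exact: cmeas_normc|move=> x; exact: normc_ge0].
Qed.

Lemma cintegrableD F G : cintegrable F -> cintegrable G -> cintegrable (fun x => F x + G x).
Proof.
move=> [mF Foo] [mG Goo]; apply: (@cintegrable_le _ (fun x => normc (F x) + normc (G x))).
- exact: cmeasD.
- by apply: measurable_funD; exact: cmeas_normc.
- by move=> x; exact: le_normcD.
- rewrite nintD; [exact: lte_add_pinfty|exact: cmeas_normc|exact: cmeas_normc|move=> x; exact: normc_ge0|move=> x; exact: normc_ge0].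
Qed.

Lemma cintegrableZ (c : C) F : cintegrable F -> cintegrable (fun x => c * F x).
Proof.
move=> [mF Foo]; split; first exact: cmeasM (cmeas_cst _) mF.
under eq_integral => x _ do rewrite Normc.normcM.
rewrite nintZ; last 3 first.
- exact: cmeas_normc.
- by move=> x; exact: normc_ge0.
- exact: normc_ge0.
by rewrite lte_mul_pinfty// lee_fin normc_ge0.
Qed.

Lemma cintegrableN F : cintegrable F -> cintegrable (fun x => - F x).
Proof.
move=> /(cintegrableZ (-1)); rewrite (_ : (fun _ => _) = fun x => - F x)//.
by apply/funext => x; rewrite mulN1r.
Qed.

Lemma cintegrableB F G : cintegrable F -> cintegrable G -> cintegrable (fun x => F x - G x).
Proof. by move=> iF iG; exact: cintegrableD iF (cintegrableN iG). Qed.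

Lemma cintegrable_conj F : cintegrable F -> cintegrable (fun x => conjc (F x)).
Proof.
move=> [mF Foo]; split; first exact: cmeas_conj.
by under eq_integral => x _ do rewrite normc_conj.
Qed.

Lemma eq_Cint F G : F =1 G -> Cint F = Cint G.
Proof. by move=> /funext ->. Qed.

Lemma Cint0 : Cint (fun=> 0) = 0.
Proof. by rewrite /Cint /=; congr (_ +i* _); rewrite Rintegral_cst//= ?mul0r//. Qed.

Lemma CintD F G : cintegrable F -> cintegrable G ->
  Cint (fun x => F x + G x) = Cint F + Cint G.
Proof.
move=> iF iG; apply: complex_eq; rewrite ?cReD ?cImD /=.
  rewrite -RintegralD//; try exact: cintegrableRe.
  by apply: eq_Rintegral => x _; rewrite cReD.
rewrite -RintegralD//; try exact: cintegrableIm.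
by apply: eq_Rintegral => x _; rewrite cImD.
Qed.

Lemma CintZ (c : C) F : cintegrable F -> Cint (fun x => c * F x) = c * Cint F.
Proof.
move=> iF; have iR := cintegrableRe iF; have iI := cintegrableIm iF.
have iZ (k : R) (f : T -> R) : mu.-integrable setT (EFin \o f) ->
    mu.-integrable setT (EFin \o (fun x => k * f x)).
  by move=> /(integrableZl measurableT k).
apply: complex_eq; rewrite ?cReM ?cImM.
  transitivity (Rintegral mu setT (fun x => complex.Re c * Re (F x) - complex.Im c * Im (F x))).
    by apply: eq_Rintegral => x _; rewrite cReM.
  by rewrite RintegralB ?RintegralZl//; exact: iZ.
transitivity (Rintegral mu setT (fun x => complex.Re c * Im (F x) + complex.Im c * Re (F x))).
  by apply: eq_Rintegral => x _; rewrite cImM.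
by rewrite RintegralD ?RintegralZl//; exact: iZ.
Qed.

Lemma CintZr (c : C) F : cintegrable F -> Cint (fun x => F x * c) = Cint F * c.
Proof. by move=> iF; rewrite mulrC -CintZ//; apply: eq_Cint => x; rewrite mulrC. Qed.

Lemma CintN F : cintegrable F -> Cint (fun x => - F x) = - Cint F.
Proof. by move=> iF; rewrite -mulN1r -CintZ//; apply: eq_Cint => x; rewrite mulN1r. Qed.

Lemma CintB F G : cintegrable F -> cintegrable G ->
  Cint (fun x => F x - G x) = Cint F - Cint G.
Proof. by move=> iF iG; rewrite CintD ?CintN//; exact: cintegrableN. Qed.

Lemma Cint_conj F : cintegrable F -> Cint (fun x => conjc (F x)) = conjc (Cint F).
Proof.
move=> iF; apply: complex_eq => /=.
  by apply: eq_Rintegral => x _; rewrite cRe_conj.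
rewrite -mulN1r -RintegralZl//; last exact: cintegrableIm.
by apply: eq_Rintegral => x _; rewrite cIm_conj mulN1r.
Qed.

Lemma cintegrable_sum (I : Type) (r : seq I) (F : I -> T -> C) :
  (forall i, cintegrable (F i)) -> cintegrable (fun x => \sum_(i <- r) F i x).
Proof.
move=> iF; elim: r => [|i r IH].
  rewrite (_ : (fun _ => _) = fun=> 0); last by apply/funext => x; rewrite big_nil.
  split; first exact: cmeas_cst.
  by under eq_integral do rewrite Normc.normc0; rewrite integral0.
rewrite (_ : (fun _ => _) = fun x => F i x + \sum_(i <- r) F i x); first exact: cintegrableD.
by apply/funext => x; rewrite big_cons.
Qed.

Lemma Cint_sum (I : Type) (r : seq I) (F : I -> T -> C) :
  (forall i, cintegrable (F i)) ->
  Cint (fun x => \sum_(i <- r) F i x) = \sum_(i <- r) Cint (F i).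
Proof.
move=> iF; elim: r => [|i r IH].
  by rewrite big_nil -[RHS]Cint0; apply: eq_Cint => x; rewrite big_nil.
rewrite big_cons -IH -CintD//; last exact: cintegrable_sum.
by apply: eq_Cint => x; rewrite big_cons.
Qed.

(** The factor 2 comes from treating the real and imaginary parts separately. *)
Lemma Cint_bound F (B : R) : cintegrable F ->
  (\int[mu]_x (normc (F x))%:E <= B%:E)%E -> normc (Cint F) <= 2 * B.
Proof.
move=> iF FB; apply: le_trans (normc_le _) _; rewrite mulr_natl mulr2n /=.
have H f : mu.-integrable setT (EFin \o f) -> (forall x, `|f x| <= normc (F x)) ->
    `|Rintegral mu setT f| <= B.
  move=> i_f fF; rewrite -lee_fin; apply: le_trans FB.
  apply: le_trans (_ : (\int[mu]_x `|f x|%:E <= _)%E); last first.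
    apply: nint_le => //; last by case: iF => [/cmeas_normc].
    by apply: measurableT_comp => //; apply/measurable_EFinP; case/integrableP: i_f.
  have := le_normr_Rintegral measurableT i_f.
  rewrite -lee_fin => /le_trans; apply.
  rewrite /Rintegral fineK//.
  have /integrableP[_] := i_f.
  rewrite ge0_fin_numE//.
  by apply: integral_ge0 => x _; rewrite lee_fin.
apply: lerD; apply: H.
- exact: cintegrableRe.
- by move=> x; exact: normr_Re.
- exact: cintegrableIm.
- by move=> x; exact: normr_Im.
Qed.

End ComplexIntegral.

Section ComplexFubini.
Context d1 d2 (T1 : measurableType d1) (T2 : measurableType d2) (R : realType).
Variables (m1 : {sigma_finite_measure set T1 -> \bar R})
  (m2 : {sigma_finite_measure set T2 -> \bar R}).
Local Open Scope complex_scope.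

(** Integrability is asked of every section, not only almost every one, so that the inner real
    integrals can be turned into extended ones pointwise. *)
Lemma Rfubini (f : T1 -> T2 -> R) :
  (m1 \x m2)%E.-integrable setT (fun p => (f p.1 p.2)%:E) ->
  (forall x, m2.-integrable setT (EFin \o f x)) ->
  (forall y, m1.-integrable setT (EFin \o f^~ y)) ->
  Rintegral m1 setT (fun x => Rintegral m2 setT (f x)) =
  Rintegral m2 setT (fun y => Rintegral m1 setT (f^~ y)).
Proof.
move=> fi f1 f2; rewrite /Rintegral; congr fine.
transitivity (\int[m1]_x \int[m2]_y (f x y)%:E)%E.
  by apply: eq_integral => x _; rewrite fineK//; exact: (integrable_fin_num measurableT (f1 x)).
rewrite (@Fubini _ _ _ _ _ m1 m2 (fun p => (f p.1 p.2)%:E))//.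
by apply: eq_integral => y _; rewrite fineK//; exact: (integrable_fin_num measurableT (f2 y)).
Qed.

Lemma Cfubini (F : T1 -> T2 -> R[i]) :
  cmeas (fun p : T1 * T2 => F p.1 p.2) ->
  (forall x, cintegrable m2 (F x)) -> (forall y, cintegrable m1 (F^~ y)) ->
  (\int[m1]_x \int[m2]_y (normc (F x y))%:E < +oo)%E ->
  Cint m1 (fun x => Cint m2 (F x)) = Cint m2 (fun y => Cint m1 (F^~ y)).
Proof.
move=> mF F1 F2 Foo.
have iF : (\int[m1 \x m2]_p (normc (F p.1 p.2))%:E < +oo)%E.
  rewrite (@fubini_tonelli1 _ _ _ _ _ m1 m2 (fun p => (normc (F p.1 p.2))%:E))//.
    by apply/measurable_EFinP; exact: cmeas_normc.
  by move=> p; rewrite lee_fin normc_ge0.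
apply: complex_eq => /=.
- apply: Rfubini.
  + apply: integrable_le iF; [by case: mF|exact: cmeas_normc|move=> p; exact: normr_Re].
  + by move=> x; exact: cintegrableRe.
  + by move=> y; exact: cintegrableRe (F2 y).
- apply: Rfubini.
  + apply: integrable_le iF; [by case: mF|exact: cmeas_normc|move=> p; exact: normr_Im].
  + by move=> x; exact: cintegrableIm.
  + by move=> y; exact: cintegrableIm (F2 y).
Qed.

End ComplexFubini.

(** * Topology and measurability on C^n *)

Section CnTopology.
Context {R : realType} {n : nat}.
Local Notation C := (Cplx R).
Implicit Types z w : Cn R n.
Local Open Scope complex_scope.

(** Balls of [R[i]] have their radii in [R[i]]; a positive element there is real, which allows real
    radii. *)
Lemma nbhs_CP (x : C) (A : set C) :
  nbhs x A <-> exists2 e : R, 0 < e & forall y, normc (y - x) < e -> A y.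
Proof.
split.
  move=> /nbhs_ballP[e /= e0 H].
  have er : e = (complex.Re e)%:C by move: e0; case: (e) => a b; rewrite ltcE /= => /andP[/eqP -> _].
  exists (complex.Re e); first by move: e0; rewrite er ltcR.
  move=> y yx; apply: H; rewrite /ball /= distrC normr_normc er ltcR //.
move=> [e e0 H]; apply/nbhs_ballP; exists e%:C => /=; first by rewrite ltcR.
move=> y; rewrite /ball /= distrC normr_normc ltcR; exact: H.
Qed.

Lemma nbhs_CnP z (A : set (Cn R n)) :
  nbhs z A <-> exists2 e : R, 0 < e &
    forall w, (forall j, normc (w 0 j - z 0 j) < e) -> A w.
Proof.
split.
  move=> /nbhs_ballP[e /= e0 H].
  have er : e = (complex.Re e)%:C by move: e0; case: (e) => a b; rewrite ltcE /= => /andP[/eqP -> _].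
  exists (complex.Re e); first by move: e0; rewrite er ltcR.
  move=> y yx; apply: H; split => // i j; rewrite (ord1 i).
  by rewrite /ball /= distrC normr_normc er ltcR.
move=> [e e0 H]; apply/nbhs_ballP; exists e%:C => /=; first by rewrite ltcR.
move=> y [_ yx]; apply: H => j; move: (yx 0 j).
by rewrite /ball /= distrC normr_normc ltcR.
Qed.

Lemma continuous_CnP (F : Cn R n -> R) z :
  {for z, continuous F} <-> forall e, 0 < e -> exists2 d : R, 0 < d &
    forall w, (forall j, normc (w 0 j - z 0 j) < d) -> `|F w - F z| < e.
Proof.
split=> [H e e0|H].
  move/cvgrPdist_lt: H => /(_ e e0) /nbhs_CnP[d d0 H].
  by exists d => // w wz; rewrite distrC; exact: H.
move=> A /nbhs_ballP[e /= e0 HA]; have [d d0 Hd] := H e e0.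
by apply/nbhs_CnP; exists d => // w /Hd; rewrite distrC; exact: HA.
Qed.

Lemma continuous_CnCP (F : Cn R n -> C) z :
  {for z, continuous F} <-> forall e, 0 < e -> exists2 d : R, 0 < d &
    forall w, (forall j, normc (w 0 j - z 0 j) < d) -> normc (F w - F z) < e.
Proof.
split=> [H e e0|H].
  have /H /nbhs_CnP[d d0 Hd] : nbhs (F z) [set y | normc (y - F z) < e].
    by apply/nbhs_CP; exists e.
  by exists d.
move=> A /nbhs_CP[e e0 HA]; have [d d0 Hd] := H e e0.
by apply/nbhs_CnP; exists d => // w /Hd; exact: HA.
Qed.

Lemma continuous_Cn_Re (F : Cn R n -> C) : continuous F ->
  continuous (fun z => complex.Re (F z) : R).
Proof.
move=> cF z; apply/continuous_CnP => e e0.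
have /continuous_CnCP /(_ e e0) [d d0 H] := cF z.
exists d => // w /H; apply: le_lt_trans.
by have := normr_Re (F w - F z); rewrite cReD cReN.
Qed.

Lemma continuous_Cn_Im (F : Cn R n -> C) : continuous F ->
  continuous (fun z => complex.Im (F z) : R).
Proof.
move=> cF z; apply/continuous_CnP => e e0.
have /continuous_CnCP /(_ e e0) [d d0 H] := cF z.
exists d => // w /H; apply: le_lt_trans.
by have := normr_Im (F w - F z); rewrite cImD cImN.
Qed.

Lemma continuous_Cn_complex (F : Cn R n -> C) :
  continuous (fun z => complex.Re (F z) : R) ->
  continuous (fun z => complex.Im (F z) : R) -> continuous F.
Proof.
move=> cR cI z; apply/continuous_CnCP => e e0.
have e2 : 0 < e / 2 by rewrite divr_gt0.
have /continuous_CnP /(_ _ e2) [d d0 H] := cR z.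
have /continuous_CnP /(_ _ e2) [d' d'0 H'] := cI z.
exists (Num.min d d'); first by rewrite lt_min d0.
move=> w wz; apply: le_lt_trans (normc_le _) _.
rewrite cReD cImD cReN cImN (splitr e); apply: ltrD.
  by apply: H => j; apply: lt_le_trans (wz j) _; rewrite ge_min lexx.
by apply: H' => j; apply: lt_le_trans (wz j) _; rewrite ge_min lexx orbT.
Qed.

End CnTopology.

Section CnMeasurable.
Context {R : realType} {n : nat}.
Local Notation C := (Cplx R).
Local Open Scope complex_scope.

Let code (m : nat) (z : Cn R n) : {ffun 'I_n -> int * int} :=
  [ffun j => (Num.floor (m.+1%:R * complex.Re (z 0 j)),
              Num.floor (m.+1%:R * complex.Im (z 0 j)))].

Let decode (m : nat) (c : {ffun 'I_n -> int * int}) : Cn R n :=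
  \row_j (((c j).1%:~R / m.+1%:R) +i* ((c j).2%:~R / m.+1%:R) : C).

Let code_approx m z j : normc (decode m (code m z) 0 j - z 0 j) <= 2 / m.+1%:R.
Proof.
have m0 : (0 : R) < m.+1%:R by [].
have H (x : R) : `|(Num.floor (m.+1%:R * x))%:~R / m.+1%:R - x| <= m.+1%:R^-1.
  rewrite -(@ler_pM2l _ m.+1%:R)// divff ?gt_eqF// -{1}(gtr0_norm m0) -normrM mulrBr.
  rewrite mulrCA divff ?gt_eqF// mulr1 distrC ler_norml.
  have /andP[h1 h2] := floor_itv (m.+1%:R * x).
  move: h2; rewrite intrD => h2; lra.
apply: le_trans (normc_le _) _; rewrite mxE ffunE cReD cReN cImD cImN /=.
have -> : 2 / m.+1%:R = m.+1%:R^-1 + m.+1%:R^-1 :> R by field.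
by apply: lerD.
Qed.

(* Rounding to a grid makes the argument countably valued. *)
Lemma measurable_continuous_Cn d (T : measurableType d) (phi : T -> Cn R n)
    (F : Cn R n -> R) : continuous F ->
  (forall j, cmeas (fun t => phi t 0 j)) -> measurable_fun setT (fun t => F (phi t)).
Proof.
move=> cF mphi.
apply: (@measurable_fun_cvg _ _ _ _ (fun m t => F (decode m (code m (phi t))))); last first.
  move=> t _; apply/cvgrPdist_lt => e e0.
  have /continuous_CnP /(_ e e0) [dl dl0 H] := cF (phi t).
  near=> m; rewrite distrC; apply: H => j.
  apply: le_lt_trans (code_approx m (phi t) j) _.
  rewrite ltr_pdivrMr// -ltr_pdivrMl// mulrC.
  apply: lt_le_trans (_ : m%:R <= _); last by rewrite ler_nat.
  near: m; exact: nbhs_infty_gtr.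
move=> m _ B mB; rewrite setTI.
have -> : (fun t => F (decode m (code m (phi t)))) @^-1` B =
    \bigcup_c ([set t | code m (phi t) = c] `&` [set t | B (F (decode m c))]).
  by apply/seteqP; split => [t Bt|t [c _ [<-]]//]; exists (code m (phi t)).
apply: countable_bigcupT_measurable => [|c]; first exact: countableP.
apply: measurableI; last first.
  have [Bc|Bc] := pselect (B (F (decode m c))).
    by rewrite (_ : [set _ | _] = setT)//; apply/seteqP; split.
  by rewrite (_ : [set _ | _] = set0)//; apply/seteqP; split.
have -> : [set t | code m (phi t) = c] = \bigcap_(j in [set: 'I_n])
   ([set t | Num.floor (m.+1%:R * complex.Re (phi t 0 j)) = (c j).1] `&`
    [set t | Num.floor (m.+1%:R * complex.Im (phi t 0 j)) = (c j).2]).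
  apply/seteqP; split => [t <- j _ /=|t H /=]; first by rewrite ffunE.
  by apply/ffunP => j; rewrite ffunE; case: (H j I) => /= -> ->; case: (c j).
apply: fin_bigcap_measurable => // j _; have [m1 m2] := mphi j.
have mfl (g : T -> R) (a : int) : measurable_fun setT g ->
    measurable [set t | Num.floor (m.+1%:R * g t) = a].
  move=> mg; have -> : [set t | Num.floor (m.+1%:R * g t) = a] =
      (fun t => m.+1%:R * g t) @^-1` `[a%:~R, (a + 1)%:~R[.
    apply/seteqP; split => t /=; rewrite in_itv/=.
      by move=> <-; exact: floor_itv.
    by move=> H; apply: floor_def.
  rewrite -[X in measurable X]setTI.
  have : measurable_fun setT (fun t => m.+1%:R * g t) by exact: measurable_funM.
  by apply.
by apply: measurableI; exact: mfl.
Unshelve. all: by end_near.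
Qed.

Lemma cmeas_continuous_Cn d (T : measurableType d) (phi : T -> Cn R n)
    (F : Cn R n -> C) : continuous F ->
  (forall j, cmeas (fun t => phi t 0 j)) -> cmeas (fun t => F (phi t)).
Proof.
move=> cF mphi; split.
  by apply: measurable_continuous_Cn (continuous_Cn_Re cF) mphi.
by apply: measurable_continuous_Cn (continuous_Cn_Im cF) mphi.
Qed.

End CnMeasurable.

(** * Translations, rotations and Gaussian integrals on C^n *)

Section CnGeometry.
Context {R : realType} {n : nat}.
Local Notation C := (Cplx R).
Local Notation X := ((n + n).-tuple (measurableTypeR R)).
Implicit Types z w a : Cn R n.
Local Open Scope complex_scope.

Local Notation cleb := (@leb R (n + n)).

Definition nsq z : R := \sum_(j < n) normc (z 0 j) ^+ 2.

Lemma nsq_ge0 z : 0 <= nsq z.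
Proof. by apply: sumr_ge0 => j _; exact: sqr_ge0. Qed.

Lemma nsqZ (c : C) z : nsq (c *: z) = normc c ^+ 2 * nsq z.
Proof.
rewrite /nsq mulr_sumr; apply: eq_bigr => j _.
by rewrite mxE Normc.normcM exprMn.
Qed.

Lemma nsqN z : nsq (- z) = nsq z.
Proof. by apply: eq_bigr => j _; rewrite mxE normcN. Qed.

Lemma nsqB z w : nsq (z - w) = nsq (w - z).
Proof. by rewrite -nsqN opprB. Qed.

Lemma normc_le_nsq z j : normc (z 0 j) ^+ 2 <= nsq z.
Proof. by rewrite /nsq (bigD1 j)//= lerDl; apply: sumr_ge0 => i _; exact: sqr_ge0. Qed.

Lemma nsqD z w : nsq (z + w) <= 2 * nsq z + 2 * nsq w.
Proof.
rewrite /nsq !mulr_sumr -big_split /=; apply: ler_sum => j _; rewrite mxE.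
apply: le_trans (_ : (normc (z 0 j) + normc (w 0 j)) ^+ 2 <= _).
  by rewrite ler_pXn2r ?nnegrE ?addr_ge0 ?normc_ge0//; exact: le_normcD.
by rewrite sqrrD; have := sqr_ge0 (normc (z 0 j) - normc (w 0 j)); rewrite sqrrB; lra.
Qed.

Definition tpoint z : X := [tuple of [tuple complex.Re (z 0 j) | j < n] ++
   [tuple complex.Im (z 0 j) | j < n]].

Lemma cpoint_tadd a t : cpoint (tadd (tpoint a) t) = cpoint t + a.
Proof.
apply/rowP => j; rewrite !mxE /tadd !tnth_mktuple /tpoint tnth_lshift tnth_rshift !tnth_mktuple.
by case: (a 0 j).
Qed.

Lemma cpoint_lmap (c s : R) t :
  cpoint (lmap n c (- s) s c t) = ((c +i* s) : C) *: cpoint t.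
Proof.
apply/rowP => j; rewrite !mxE /lmap tnth_lshift tnth_rshift !tnth_mktuple.
by apply: complex_eq; rewrite ?cReM ?cImM /=; ring.
Qed.

Lemma cmeas_coord j : cmeas (fun t : X => cpoint t 0 j).
Proof.
split.
  rewrite (_ : (fun _ => _) = fun t : X => (tnth t (lshift n j) : R)).
    exact: measurable_tnth.
  by apply/funext => t; rewrite mxE.
rewrite (_ : (fun _ => _) = fun t : X => (tnth t (rshift n j) : R)).
  exact: measurable_tnth.
by apply/funext => t; rewrite mxE.
Qed.

Lemma cmeas_continuous (F : Cn R n -> C) : continuous F ->
  cmeas (fun t : X => F (cpoint t)).
Proof. by move=> cF; apply: cmeas_continuous_Cn => //; exact: cmeas_coord. Qed.

Lemma measurable_nsq d (T : measurableType d) (phi : T -> Cn R n) :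
  (forall j, cmeas (fun t => phi t 0 j)) -> measurable_fun setT (fun t => nsq (phi t)).
Proof.
move=> mphi; apply: measurable_sum => j _.
exact: (measurable_funX 2 (cmeas_normc (mphi j))).
Qed.

Lemma cleb_translate a (F : Cn R n -> \bar R) :
  measurable_fun setT (fun t : X => F (cpoint t)) -> (forall z, 0 <= F z)%E ->
  (\int[cleb]_t F (cpoint t + a)%R = \int[cleb]_t F (cpoint t))%E.
Proof.
move=> mF F0; rewrite -(leb_translate (tpoint a) mF (fun t => F0 _)).
by apply: eq_integral => t _; rewrite cpoint_tadd.
Qed.

Lemma cleb_rotate (u : C) (F : Cn R n -> \bar R) : normc u = 1 ->
  measurable_fun setT (fun t : X => F (cpoint t)) -> (forall z, 0 <= F z)%E ->
  (\int[cleb]_t F (u *: cpoint t) = \int[cleb]_t F (cpoint t))%E.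
Proof.
move=> u1 mF F0; have cs : complex.Re u ^+ 2 + complex.Im u ^+ 2 = 1.
  by rewrite -normc_sqr u1 expr1n.
have [_ H] := rotation_measure_preserving n cs.
rewrite -(H _ mF (fun t => F0 _)).
apply: eq_integral => t _; congr F; rewrite cpoint_lmap.
by case: (u).
Qed.

Lemma cint_preserving (psi : Cn R n -> Cn R n) (phi : X -> X) (F : Cn R n -> C) :
  measure_preserving phi -> (forall t, cpoint (phi t) = psi (cpoint t)) ->
  cmeas (fun t : X => F (cpoint t)) ->
  Cint cleb (fun t => F (psi (cpoint t))) = Cint cleb (fun t => F (cpoint t)).
Proof.
move=> mp Hp [m1 m2].
have H (g : Cn R n -> R) : measurable_fun setT (fun t : X => g (cpoint t)) ->
    Rintegral cleb setT (fun t => g (psi (cpoint t))) = Rintegral cleb setT (fun t => g (cpoint t)).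
  move=> mg; rewrite /Rintegral; congr fine.
  under eq_integral => t _ do rewrite -Hp.
  by apply: (measure_preserving_integral (g := fun t => (g (cpoint t))%:E) mp); exact/measurable_EFinP.
apply: complex_eq => /=.
  exact: (H (fun z => complex.Re (F z))).
exact: (H (fun z => complex.Im (F z))).
Qed.

Lemma cint_translate a (F : Cn R n -> C) :
  cmeas (fun t : X => F (cpoint t)) ->
  Cint cleb (fun t => F (cpoint t + a)) = Cint cleb (fun t => F (cpoint t)).
Proof.
apply: (@cint_preserving (fun z => z + a) (tadd (tpoint a))).
  exact: measure_preserving_tadd.
exact: cpoint_tadd.
Qed.

Lemma cint_rotate (u : C) (F : Cn R n -> C) : normc u = 1 ->
  cmeas (fun t : X => F (cpoint t)) ->
  Cint cleb (fun t => F (u *: cpoint t)) = Cint cleb (fun t => F (cpoint t)).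
Proof.
move=> u1.
have cs : complex.Re u ^+ 2 + complex.Im u ^+ 2 = 1.
  by rewrite -normc_sqr u1 expr1n.
apply: (@cint_preserving (fun z => u *: z) _ _ (rotation_measure_preserving n cs)) => t.
by rewrite cpoint_lmap; case: (u).
Qed.

Lemma nsq_cpoint t : nsq (cpoint t) = \sum_(i < n + n) (tnth t i : R) ^+ 2.
Proof.
transitivity (\sum_(j < n) ((tnth t (lshift n j) : R) ^+ 2 + (tnth t (rshift n j) : R) ^+ 2)).
  by apply: eq_bigr => j _; rewrite mxE normc_sqr.
by rewrite big_split big_split_ord.
Qed.

Lemma cleb_gauss (a : R) : 0 < a ->
  (\int[cleb]_t (expR (- a * nsq (cpoint t)))%:E = ((pi / a) ^+ n)%:E)%E.
Proof.
move=> a0; under eq_integral => t _ do rewrite nsq_cpoint.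
rewrite gauss_tuple// exprD -exprMn -expr2 sqr_sqrtr// divr_ge0 ?pi_ge0//.
exact: ltW.
Qed.

End CnGeometry.

(** * The mean value property on circles *)

Section Goursat.
Context {R : realType}.
Implicit Types (x y a b c h k : R).

Lemma mvt_itv (f f1 : R -> R) (M a b : R) : a <= b ->
  (forall t, a <= t <= b -> is_derive t 1 f (f1 t)) ->
  (forall t, a <= t <= b -> `|f1 t| <= M) -> `|f b - f a| <= M * (b - a).
Proof.
rewrite le_eqVlt => /predU1P[->|ab] df HM.
  by rewrite !subrr normr0 mulr0.
have cf : {within `[a, b], continuous f}.
  apply: derivable_within_continuous => t; rewrite in_itv/= => tab.
  by case: (df t tab).
have df' t : t \in `]a, b[ -> is_derive t 1 f (f1 t).
  by rewrite in_itv/= => /andP[ta tb]; apply: df; rewrite !ltW.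
have [c] := @MVT R f f1 a b ab df' cf.
rewrite in_itv/= => /andP[ac cb] ->.
rewrite normrM (@gtr0_norm _ (b - a)) ?subr_gt0//.
by apply: ler_wpM2r; [rewrite subr_ge0 ltW|apply: HM; rewrite !ltW].
Qed.

(** The integral of [P dx + Q dy] along the boundary of a rectangle, written with a primitive [H] of
    [P] in [x] and a primitive [W] of [Q] in [y], so that line integrals never appear. *)
Definition rect_int (H W : R -> R -> R) a c h k : R :=
  (H (a + h) c - H a c) + (W (a + h) (c + k) - W (a + h) c)
  - (H (a + h) (c + k) - H a (c + k)) - (W a (c + k) - W a c).

(** [P] and [Q] are differentiable at the point and share the cross derivative [b]: the form
    [P dx + Q dy] is closed there, with no continuity of derivatives. *)
Definition closed_form_at (P Q : R -> R -> R) x0 y0 := exists a b e : R,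
  forall eps, 0 < eps -> exists2 d, 0 < d & forall x y,
    `|x - x0| <= d -> `|y - y0| <= d ->
    `|P x y - P x0 y0 - a * (x - x0) - b * (y - y0)| <= eps * (`|x - x0| + `|y - y0|) /\
    `|Q x y - Q x0 y0 - b * (x - x0) - e * (y - y0)| <= eps * (`|x - x0| + `|y - y0|).

Variables (P Q H W : R -> R -> R) (A B : R).
Hypothesis dH : forall y x, A < x -> is_derive x 1 (H^~ y) (P x y).
Hypothesis dW : forall x y, B < y -> is_derive y 1 (W x) (Q x y).
Hypothesis closedPQ : forall x y, A < x -> B < y -> closed_form_at P Q x y.

Let D := rect_int H W.

Let D_split a c h k : D a c h k = D a c (h / 2) (k / 2) + D (a + h / 2) c (h / 2) (k / 2)
  + D a (c + k / 2) (h / 2) (k / 2) + D (a + h / 2) (c + k / 2) (h / 2) (k / 2).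
Proof.
have e x y : x + y / 2 + y / 2 = x + y by field.
by rewrite /D /rect_int !e; ring.
Qed.

(** The affine part of the form at the point is exact and contributes nothing; [H'] and [W'] are
    what is left after removing its primitives. The remaining form is at most [eps * (h + k)] on a
    boundary of length [2 * (h + k)]. *)
Let D_small x0 y0 : A < x0 -> B < y0 -> forall eps, 0 < eps -> exists2 d, 0 < d &
  forall a c h k, 0 <= h <= d -> 0 <= k <= d -> A < a -> B < c ->
  a <= x0 <= a + h -> c <= y0 <= c + k ->
  `|D a c h k| <= 2 * eps * (h + k) ^+ 2.
Proof.
move=> Ax By eps e0; have [p [b [e Hpbe]]] := closedPQ Ax By.
have [d d0 {}Hpbe] := Hpbe _ e0; exists d => // a c h k /andP[h0 hd] /andP[k0 kd] Aa Bc /andP[ax xa] /andP[cy yc].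
pose H' y x := H x y - (P x0 y0 * x + p * (x - x0) ^+ 2 / 2 + b * (y - y0) * x).
pose W' x y := W x y - (Q x0 y0 * y + b * (x - x0) * y + e * (y - y0) ^+ 2 / 2).
have xle x : a <= x <= a + h -> `|x - x0| <= h.
  by move=> /andP[? ?]; rewrite ler_norml; lra.
have yle y : c <= y <= c + k -> `|y - y0| <= k.
  by move=> /andP[? ?]; rewrite ler_norml; lra.
have hH y : c <= y <= c + k -> `|H' y (a + h) - H' y a| <= eps * (h + k) * h.
  move=> cy'; rewrite [X in _ <= _ * X](_ : h = (a + h) - a); last by ring.
  apply: (@mvt_itv (H' y) (fun x => P x y - P x0 y0 - p * (x - x0) - b * (y - y0))).
  - by rewrite lerDl.
  - move=> x /andP[ax' xa'].
    have dHx := dH y (lt_le_trans Aa ax').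
    by rewrite /H'; apply: is_derive_eq; rewrite /GRing.scale /=; field.
  - move=> x xa'; have [|| +_] := Hpbe x y.
    + exact: le_trans (xle _ xa') _.
    + exact: le_trans (yle _ cy') _.
    move=> /le_trans; apply; rewrite ler_pM2l//.
    by apply: lerD; [exact: xle|exact: yle].
have hW x : a <= x <= a + h -> `|W' x (c + k) - W' x c| <= eps * (h + k) * k.
  move=> cx; rewrite [X in _ <= _ * X](_ : k = (c + k) - c); last by ring.
  apply: (@mvt_itv (W' x) (fun y => Q x y - Q x0 y0 - b * (x - x0) - e * (y - y0))).
  - by rewrite lerDl.
  - move=> y /andP[cy' yc'].
    have dWx := dW x (lt_le_trans Bc cy').
    by rewrite /W'; apply: is_derive_eq; rewrite /GRing.scale /=; field.
  - move=> y yc'; have [|| _] := Hpbe x y.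
    + exact: le_trans (xle _ cx) _.
    + exact: le_trans (yle _ yc') _.
    move=> /le_trans; apply; rewrite ler_pM2l//.
    by apply: lerD; [exact: xle|exact: yle].
have -> : D a c h k = (H' c (a + h) - H' c a) + (W' (a + h) (c + k) - W' (a + h) c)
    - (H' (c + k) (a + h) - H' (c + k) a) - (W' a (c + k) - W' a c).
  by rewrite /D /rect_int /H' /W'; field.
have ca : a <= a <= a + h by rewrite lexx lerDl.
have cah : a <= a + h <= a + h by rewrite lexx lerDl h0.
have cc : c <= c <= c + k by rewrite lexx lerDl.
have cck : c <= c + k <= c + k by rewrite lexx lerDl k0.
have := hH _ cc; have := hH _ cck; have := hW _ ca; have := hW _ cah.
set u1 := W' _ _ - _; set u2 := W' _ _ - _; set u3 := H' _ _ - _; set u4 := H' _ _ - _.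
move=> i1 i2 i3 i4.
have -> : 2 * eps * (h + k) ^+ 2 = eps * (h + k) * h + eps * (h + k) * k +
  eps * (h + k) * h + eps * (h + k) * k by ring.
apply: le_trans (ler_normB _ _) _; apply: lerD => //.
apply: le_trans (ler_normB _ _) _; apply: lerD => //.
by apply: le_trans (ler_normD _ _) _; apply: lerD.
Qed.

(** Among the four quarters one carries at least a quarter of the integral. The sign conditions
    stand under the existential so that [choice] yields a function defined on all rectangles. *)
Let next a c h k : exists q : R * R, 0 <= h -> 0 <= k ->
  [/\ a <= q.1, q.1 + h / 2 <= a + h, c <= q.2, q.2 + k / 2 <= c + k &
  `|D a c h k| <= 4 * `|D q.1 q.2 (h / 2) (k / 2)| ].
Proof.
have H1 : exists q : R * R, (q.1 = a \/ q.1 = a + h / 2) /\ (q.2 = c \/ q.2 = c + k / 2) /\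
    `|D a c h k| <= 4 * `|D q.1 q.2 (h / 2) (k / 2)|.
  apply/not_existsP => F.
  have F' x y : (x = a \/ x = a + h / 2) -> (y = c \/ y = c + k / 2) ->
      `|D x y (h / 2) (k / 2)| < `|D a c h k| / 4.
    move=> hx hy; rewrite ltNge; apply/negP => G; apply: (F (x, y)) => /=.
    by split=> //; split=> //; rewrite mulrC -ler_pdivrMr.
  have := ltrD (ltrD (ltrD (F' a c (or_introl erefl) (or_introl erefl)) (F' _ c (or_intror erefl) (or_introl erefl)))
     (F' a _ (or_introl erefl) (or_intror erefl))) (F' _ _ (or_intror erefl) (or_intror erefl)).
  rewrite [X in _ < X](_ : _ = `|D a c h k|); last by field.
  rewrite [in X in _ < X]D_split ltNge => /negP; apply.
  apply: le_trans (ler_normD _ _) _; apply: lerD => //.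
  apply: le_trans (ler_normD _ _) _; apply: lerD => //.
  exact: ler_normD.
have [q [q1 [q2 q3]]] := H1; exists q => h0 k0; split=> //.
- by case: q1 => ->; lra.
- by case: q1 => ->; lra.
- by case: q2 => ->; lra.
- by case: q2 => ->; lra.
Qed.

(** Bisection: after [i] steps the integral is still at least [4^-i] times the original one, whereas
    closedness at the common point of the nested rectangles makes it negligible against [4^-i]. *)
Lemma goursat a c h k : A < a -> B < c -> 0 < h -> 0 < k -> rect_int H W a c h k = 0.
Proof.
move=> Aa Bc h0 k0; rewrite -/(D a c h k).
have [F HF] := choice (fun s : (R * R) * (R * R) => next s.1.1 s.1.2 s.2.1 s.2.2).
pose hn i := h / 2 ^+ i; pose kn i := k / 2 ^+ i.
pose r := fix r i : R * R := if i is j.+1 then F (r j, (hn j, kn j)) else (a, c).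
have hn0 i : 0 < hn i by rewrite divr_gt0// exprn_gt0.
have kn0 i : 0 < kn i by rewrite divr_gt0// exprn_gt0.
have hS i : hn i / 2 = hn i.+1 by rewrite /hn exprS invfM; field; rewrite expf_neq0.
have kS i : kn i / 2 = kn i.+1 by rewrite /kn exprS invfM; field; rewrite expf_neq0.
have step i : [/\ (r i).1 <= (r i.+1).1, (r i.+1).1 + hn i.+1 <= (r i).1 + hn i,
   (r i).2 <= (r i.+1).2, (r i.+1).2 + kn i.+1 <= (r i).2 + kn i &
   `|D (r i).1 (r i).2 (hn i) (kn i)| <= 4 * `|D (r i.+1).1 (r i.+1).2 (hn i.+1) (kn i.+1)|].
  by have := HF (r i, (hn i, kn i)) (ltW (hn0 i)) (ltW (kn0 i)); rewrite /= hS kS.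
have mono i j : (i <= j)%N -> [/\ (r i).1 <= (r j).1, (r j).1 + hn j <= (r i).1 + hn i,
    (r i).2 <= (r j).2 & (r j).2 + kn j <= (r i).2 + kn i].
  elim: j => [|j IH]; first by rewrite leqn0 => /eqP ->.
  rewrite leq_eqVlt => /predU1P[->//|]; rewrite ltnS => /IH[a1 a2 a3 a4].
  have [b1 b2 b3 b4 _] := step j; split.
  - exact: le_trans b1.
  - exact: le_trans b2 _.
  - exact: le_trans b3.
  - exact: le_trans b4 _.
pose x0 := sup [set (r i).1 | i in [set: nat]].
pose y0 := sup [set (r i).2 | i in [set: nat]].
have ub i : ubound [set (r i).1 | i in [set: nat]] ((r i).1 + hn i).
  move=> _ [j _ <-]; have [ij|/ltnW ji] := leqP i j.
    by have [_ + _ _] := mono _ _ ij; apply: le_trans; rewrite lerDl ltW.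
  by have [+ _ _ _] := mono _ _ ji; move/le_trans; apply; rewrite lerDl ltW.
have ub2 i : ubound [set (r i).2 | i in [set: nat]] ((r i).2 + kn i).
  move=> _ [j _ <-]; have [ij|/ltnW ji] := leqP i j.
    by have [_ _ _ +] := mono _ _ ij; apply: le_trans; rewrite lerDl ltW.
  by have [_ _ + _] := mono _ _ ji; move/le_trans; apply; rewrite lerDl ltW.
have x0i i : (r i).1 <= x0 <= (r i).1 + hn i.
  apply/andP; split; last by apply: ge_sup => //; exists (r 0%N).1; exists 0%N.
  by apply: ub_le_sup; [exists ((r i).1 + hn i); exact: ub|exists i].
have y0i i : (r i).2 <= y0 <= (r i).2 + kn i.
  apply/andP; split; last by apply: ge_sup => //; exists (r 0%N).2; exists 0%N.
  by apply: ub_le_sup; [exists ((r i).2 + kn i); exact: ub2|exists i].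
have big i : `|D a c h k| <= 4 ^+ i * `|D (r i).1 (r i).2 (hn i) (kn i)|.
  elim: i => [|i IH]; first by rewrite expr0 mul1r /hn /kn expr0 !divr1.
  apply: le_trans IH _; rewrite exprSr -mulrA ler_pM2l ?exprn_gt0//.
  by have [] := step i.
apply/eqP; rewrite -normr_eq0; apply/eqP/le_anti; rewrite normr_ge0 andbT.
rewrite leNgt; apply/negP => D0.
have Ax : A < x0 by apply: lt_le_trans Aa _; have /andP[] := x0i 0%N.
have By : B < y0 by apply: lt_le_trans Bc _; have /andP[] := y0i 0%N.
(* With this value [D_small], multiplied by [4 ^+ i], gives exactly half of the original
   integral. *)
pose eps := `|D a c h k| / (4 * (h + k) ^+ 2).
have hk0 : 0 < h + k by rewrite addr_gt0.
have eps0 : 0 < eps by rewrite divr_gt0// mulr_gt0// exprn_gt0.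
have [d d0 Hd] := D_small Ax By eps0.
have [i Hi] : exists i : nat, (h + k) / d < 2 ^+ i.
  exists (Num.truncn ((h + k) / d)).+1.
  apply: lt_le_trans (Num.Theory.truncnS_gt _) _.
  by rewrite -natrX ler_nat ltnW// ltn_expl.
have p2 : (0 : R) < 2 ^+ i by rewrite exprn_gt0.
have hkd : (h + k) / 2 ^+ i < d by rewrite ltr_pdivrMr// mulrC -ltr_pdivrMr.
have := big i; apply/negP; rewrite -ltNge.
have [r1 _ r2 _] := mono 0%N i (leq0n _).
have := Hd (r i).1 (r i).2 (hn i) (kn i).
have hi : hn i <= d.
  by apply: le_trans (ltW hkd); rewrite /hn ler_pM2r ?invr_gt0// lerDl ltW.
have ki : kn i <= d.
  by apply: le_trans (ltW hkd); rewrite /kn ler_pM2r ?invr_gt0// lerDr ltW.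
rewrite (ltW (hn0 i)) (ltW (kn0 i)) hi ki => /(_ isT isT (lt_le_trans Aa r1) (lt_le_trans Bc r2) (x0i i) (y0i i)) DD.
apply: le_lt_trans (_ : 4 ^+ i * (2 * eps * (hn i + kn i) ^+ 2) < _).
  by rewrite ler_pM2l ?exprn_gt0.
have -> : 4 ^+ i * (2 * eps * (hn i + kn i) ^+ 2) = `|D a c h k| / 2.
  rewrite /hn /kn -mulrDl /eps expr_div_n -exprM mulnC exprM.
  have -> : (2 : R) ^+ 2 = 4 by ring.
  by field; rewrite ?expf_neq0 ?gt_eqF.
by rewrite ltr_pdivrMr// ltr_pMr// ltr1n.
Qed.

End Goursat.

Section Primitive.
Context {R : realType}.
Implicit Types f F : R -> R.

(** The base point [A] is kept strictly left of the arguments, so that the derivative there is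
    two-sided. *)
Definition primitive (A : R) f (x : R) : R :=
  Rintegral (@lebesgue_measure R) `[A, x]%classic f.

Lemma is_derive_primitive (A : R) f x : continuous f -> A < x ->
  is_derive x 1 (primitive A f) (f x).
Proof.
move=> cf Ax.
have xu : x < x + 1 by rewrite ltrDl.
have fi : (@lebesgue_measure R).-integrable `[A, x + 1] (EFin \o f).
  apply: continuous_compact_integrable; first exact: segment_compact.
  exact: continuous_subspaceT.
have [d1 d2] := continuous_FTC1_closed xu fi Ax (cf x).
by apply: DeriveDef; [exact: d1|rewrite -derive1E; exact: d2].
Qed.

Lemma Rintegral_primitive (A a b : R) f : continuous f -> A < a -> a < b ->
  Rintegral (@lebesgue_measure R) `[a, b]%classic f = primitive A f b - primitive A f a.
Proof.
move=> cf Aa ab; rewrite /Rintegral.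
have dF x : A < x -> is_derive x 1 (primitive A f) (f x) by exact: is_derive_primitive.
have cF x : A < x -> {for x, continuous (primitive A f)}.
  by move=> /dF [? _]; apply/differentiable_continuous/derivable1_diffP.
rewrite (@continuous_FTC2 _ f (primitive A f)) //.
- exact: continuous_subspaceT.
- split.
  + by move=> x; rewrite in_itv/= => /andP[ax _]; case: (dF x (lt_trans Aa ax)).
  + by apply: cvg_at_right_filter; exact: cF.
  + by apply: cvg_at_left_filter; apply: cF; exact: lt_trans ab.
- move=> x; rewrite in_itv/= => /andP[ax _]; rewrite derive1E.
  by case: (dF x (lt_trans Aa ax)).
Qed.

End Primitive.

Section ComplexDerivative.
Context {R : realType}.
Local Notation C := R[i].
Local Notation Re := complex.Re.
Local Notation Im := complex.Im.
Implicit Types (g : C -> C) (z c : C).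
Local Open Scope complex_scope.

Definition cderiv g z c := forall eps : R, 0 < eps -> exists2 d : R, 0 < d &
  forall h : C, normc h <= d -> normc (g (z + h) - g z - h * c) <= eps * normc h.

Lemma cderiv_quadratic g z c (K : R) :
  (forall h, normc h <= 1 -> normc (g (z + h) - g z - h * c) <= K * normc h ^+ 2) ->
  cderiv g z c.
Proof.
move=> H eps e0; exists (Num.min 1 (eps / (`|K| + 1))).
  by rewrite lt_min ltr01 divr_gt0// ltr_wpDl.
move=> h; rewrite le_min => /andP[h1 h2].
apply: le_trans (H h h1) _; rewrite expr2 mulrA ler_wpM2r ?normc_ge0//.
apply: le_trans (_ : (`|K| + 1) * normc h <= _).
  by rewrite ler_wpM2r ?normc_ge0// (le_trans (ler_norm _))// lerDl.
by rewrite mulrC -ler_pdivlMr// ltr_wpDl.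
Qed.

Lemma cderiv_lipschitz g z c : cderiv g z c -> exists2 d : R, 0 < d &
  forall h, normc h <= d -> normc (g (z + h) - g z) <= (normc c + 1) * normc h.
Proof.
move=> /(_ 1 ltr01) [d d0 H]; exists d => // h /H; rewrite mul1r => Hh.
rewrite (_ : g (z + h) - g z = (g (z + h) - g z - h * c) + h * c); last by ring.
apply: le_trans (le_normcD _ _) _; rewrite Normc.normcM mulrDl mul1r addrC mulrC.
by rewrite lerD2l.
Qed.

Lemma cderiv_cexp z : cderiv cexp z (cexp z).
Proof.
apply: (@cderiv_quadratic _ _ _ (expR (Re z) * (4 * expR 1))) => h h1.
rewrite cexpD (_ : _ - _ - _ = cexp z * (cexp h - 1 - h)); last by ring.
rewrite Normc.normcM normc_cexp -mulrA ler_pM2l ?expR_gt0//.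
apply: le_trans (cexp_taylor h) _; rewrite -mulrA -[X in _ <= X]mulrA ler_pM2l//.
by rewrite mulrC ler_wpM2r ?sqr_ge0// ler_expR.
Qed.

Lemma cderiv_comp g f z c e : cderiv f z c -> cderiv g (f z) e ->
  cderiv (g \o f) z (c * e).
Proof.
move=> Hf Hg eps e0.
have [d1 d10 H1] := cderiv_lipschitz Hf.
pose M := normc c + 1; have M0 : 0 < M by rewrite ltr_wpDl ?normc_ge0.
have e10 : 0 < eps / (2 * M) by rewrite divr_gt0// mulr_gt0.
have [d2 d20 H2] := Hg _ e10.
have e20 : 0 < eps / (2 * (normc e + 1)) by rewrite divr_gt0// mulr_gt0// ltr_wpDl ?normc_ge0.
have [d3 d30 H3] := Hf _ e20.
exists (Num.min d1 (Num.min (d2 / M) d3)).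
  by rewrite !lt_min d10 d30 divr_gt0.
move=> h; rewrite !le_min => /and3P[h1 h2 h3] /=.
pose k := f (z + h) - f z.
have kM : normc k <= M * normc h by exact: H1.
have kd : normc k <= d2 by apply: le_trans kM _; rewrite mulrC -ler_pdivlMr.
have -> : f (z + h) = f z + k by rewrite /k; ring.
rewrite (_ : _ - _ - _ = (g (f z + k) - g (f z) - k * e) + (f (z + h) - f z - h * c) * e); last by rewrite /k; ring.
have -> : eps * normc h = eps / 2 * normc h + eps / 2 * normc h by field.
apply: le_trans (le_normcD _ _) _; apply: lerD.
  apply: le_trans (H2 _ kd) _.
  apply: le_trans (_ : eps / (2 * M) * (M * normc h) <= _).
    by rewrite ler_wpM2l// ltW.
  by rewrite le_eqVlt; apply/orP; left; apply/eqP; field; rewrite gt_eqF.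
rewrite Normc.normcM; apply: le_trans (_ : eps / (2 * (normc e + 1)) * normc h * (normc e + 1) <= _).
  apply: ler_pM; rewrite ?normc_ge0//; first exact: H3.
  by rewrite lerDl.
have ne : 0 < normc e + 1 by rewrite ltr_wpDl ?normc_ge0.
by rewrite le_eqVlt; apply/orP; left; apply/eqP; field; rewrite gt_eqF.
Qed.

Lemma cderivM g f z c e : cderiv f z c -> cderiv g z e ->
  cderiv (fun x => f x * g x) z (c * g z + f z * e).
Proof.
move=> Hf Hg eps e0.
have [d1 d10 H1] := cderiv_lipschitz Hf.
have [d2 d20 H2] := cderiv_lipschitz Hg.
pose M := (normc c + 1) * (normc e + 1).
have M0 : 0 < M by rewrite mulr_gt0// ltr_wpDl ?normc_ge0.
have e10 : 0 < eps / (3 * (normc (g z) + 1)) by rewrite divr_gt0// mulr_gt0// ltr_wpDl ?normc_ge0.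
have e20 : 0 < eps / (3 * (normc (f z) + 1)) by rewrite divr_gt0// mulr_gt0// ltr_wpDl ?normc_ge0.
have [d3 d30 H3] := Hf _ e10.
have [d4 d40 H4] := Hg _ e20.
exists (Num.min (Num.min d1 d2) (Num.min (Num.min d3 d4) (eps / (3 * M)))).
  by rewrite !lt_min d10 d30 d20 d40 divr_gt0// mulr_gt0.
move=> h; rewrite !le_min => /andP[/andP[h1 h2] /andP[/andP[h3 h4] h5]].
rewrite (_ : _ - _ - _ = (f (z + h) - f z - h * c) * g z + f z * (g (z + h) - g z - h * e)
  + (f (z + h) - f z) * (g (z + h) - g z)); last by ring.
have -> : eps * normc h = eps / 3 * normc h + eps / 3 * normc h + eps / 3 * normc h by field.
have key (a b n1 : R) : 0 <= n1 -> a <= eps / (3 * (n1 + 1)) * normc h -> 0 <= a -> a * n1 <= eps / 3 * normc h.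
  move=> n10 ha a0; apply: le_trans (_ : eps / (3 * (n1 + 1)) * normc h * (n1 + 1) <= _).
    by apply: ler_pM => //; rewrite lerDl.
  have n1p : 0 < n1 + 1 by rewrite ltr_wpDl.
  by rewrite le_eqVlt; apply/orP; left; apply/eqP; field; rewrite gt_eqF.
apply: le_trans (le_normcD _ _) _; apply: lerD.
  apply: le_trans (le_normcD _ _) _; apply: lerD; rewrite Normc.normcM.
    by apply: key; rewrite ?normc_ge0//; exact: H3.
  by rewrite mulrC; apply: key; rewrite ?normc_ge0//; exact: H4.
rewrite Normc.normcM.
apply: le_trans (_ : ((normc c + 1) * normc h) * ((normc e + 1) * normc h) <= _).
  by apply: ler_pM; rewrite ?normc_ge0//; [exact: H1|exact: H2].
have -> : (normc c + 1) * normc h * ((normc e + 1) * normc h) = (M * normc h) * normc h.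
  by rewrite /M; ring.
rewrite ler_wpM2r ?normc_ge0//.
rewrite mulrC -ler_pdivlMr//; apply: le_trans h5 _.
by rewrite le_eqVlt; apply/orP; left; apply/eqP; field; rewrite gt_eqF.
Qed.

Lemma continuous_cderiv g z c : cderiv g z c -> forall eps, 0 < eps ->
  exists2 d : R, 0 < d & forall h, normc h <= d -> normc (g (z + h) - g z) < eps.
Proof.
move=> /cderiv_lipschitz[d d0 H] eps e0.
have c0 : 0 < normc c + 1 by rewrite ltr_wpDl ?normc_ge0.
exists (Num.min d (eps / 2 / (normc c + 1))).
  by rewrite lt_min d0 !divr_gt0.
move=> h; rewrite le_min => /andP[h1 h2].
apply: le_lt_trans (H _ h1) _; rewrite mulrC.
apply: le_lt_trans (_ : eps / 2 < _); first by rewrite -ler_pdivlMr.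
by rewrite ltr_pdivrMr// ltr_pMr// ltr1n.
Qed.

End ComplexDerivative.

Section CircleMean.
Context {R : realType}.
Local Notation C := R[i].
Local Notation Re := complex.Re.
Local Notation Im := complex.Im.
Local Notation leb1 := (@lebesgue_measure R).
Implicit Types (g : C -> C) (z c : C).
Local Open Scope complex_scope.

Let ptC (x y : R) : C := x +i* y.

Lemma cexp_periodic (x : R) : cexp (ptC x (pi *+ 2)) = cexp (ptC x 0).
Proof. by rewrite /cexp /= cos2pi sin2pi cos0 sin0. Qed.

Section Fixed.
Variable g : C -> C.
Hypothesis dg : forall z, exists c, cderiv g z c.

(** Logarithmic polar coordinates: [x] is the logarithm of the radius and [y] the angle, so that
    circles around 0 become vertical segments. *)
Let G (x y : R) : C := g (cexp (ptC x y)).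

Let dG x y : exists c : C, forall eps : R, 0 < eps -> exists2 d : R, 0 < d &
  forall a b : R, `|a| <= d -> `|b| <= d ->
    normc (G (x + a) (y + b) - G x y - ptC a b * c) <= eps * (`|a| + `|b|).
Proof.
have [e He] := dg (cexp (ptC x y)).
exists (cexp (ptC x y) * e) => eps e0.
have [d d0 H] := cderiv_comp (cderiv_cexp (ptC x y)) He e0.
exists (d / 2); first by rewrite divr_gt0.
move=> a b ad bd.
have n_ab : normc (ptC a b) <= `|a| + `|b| by exact: normc_le.
have -> : G (x + a) (y + b) = (g \o cexp) (ptC x y + ptC a b) by [].
apply: le_trans (H _ _) _; first by apply: le_trans n_ab _; rewrite (splitr d) lerD.
by rewrite ler_wpM2l// ltW.
Qed.

Let contG x y : forall eps, 0 < eps -> exists2 d : R, 0 < d &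
  forall a b : R, `|a| <= d -> `|b| <= d -> normc (G (x + a) (y + b) - G x y) < eps.
Proof.
move=> eps e0; have [e He] := dg (cexp (ptC x y)).
have [d d0 H] := continuous_cderiv (cderiv_comp (cderiv_cexp (ptC x y)) He) e0.
exists (d / 2); first by rewrite divr_gt0.
move=> a b ad bd; have n_ab : normc (ptC a b) <= `|a| + `|b| by exact: normc_le.
by apply: (H (ptC a b)); apply: le_trans n_ab _; rewrite (splitr d) lerD.
Qed.

Let contx (F : C -> R) y : (forall u v, `|F u - F v| <= normc (u - v)) ->
  continuous (fun x => F (G x y)).
Proof.
move=> HF x; apply/cvgrPdist_lt => eps e0; have [d d0 H] := contG x y e0.
near=> t; rewrite distrC; apply: le_lt_trans (HF _ _) _.
have := H (t - x) 0; rewrite (addrC x) subrK addr0 normr0; apply; last exact: ltW.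
by rewrite distrC; near: t; apply: cvgr_dist_le => //; exact: cvg_id.
Unshelve. all: by end_near. Qed.

Let conty (F : C -> R) x : (forall u v, `|F u - F v| <= normc (u - v)) ->
  continuous (fun y => F (G x y)).
Proof.
move=> HF y; apply/cvgrPdist_lt => eps e0; have [d d0 H] := contG x y e0.
near=> t; rewrite distrC; apply: le_lt_trans (HF _ _) _.
have := H 0 (t - y); rewrite (addrC y) subrK addr0 normr0; apply; first exact: ltW.
by rewrite distrC; near: t; apply: cvgr_dist_le => //; exact: cvg_id.
Unshelve. all: by end_near. Qed.

Let lipRe (u v : C) : `|Re u - Re v| <= normc (u - v).
Proof. by have := normr_Re (u - v); rewrite cReD cReN. Qed.
Let lipIm (u v : C) : `|Im u - Im v| <= normc (u - v).
Proof. by have := normr_Im (u - v); rewrite cImD cImN. Qed.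

Let twopi_gt0 : (0 : R) < pi *+ 2. Proof. by rewrite mulrn_wgt0// pi_gt0. Qed.

(** By the Cauchy-Riemann equations [Im G dx + Re G dy] is closed. On the rectangle of height [2 pi]
    between the abscissas [x] and 0 the horizontal sides cancel by periodicity, and the vertical
    sides are the two means. *)
Let mean_const x : x < 0 ->
  Rintegral leb1 `[0, pi *+ 2]%classic (fun y => Re (G 0 y)) =
  Rintegral leb1 `[0, pi *+ 2]%classic (fun y => Re (G x y)).
Proof.
move=> x0; pose A := x - 1; pose B : R := -1.
pose H (s t : R) := primitive A (fun s => Im (G s t)) s.
pose W (s t : R) := primitive B (fun t => Re (G s t)) t.
have := @goursat R (fun s t => Im (G s t)) (fun s t => Re (G s t)) H W A B.
have cF (s t : R) : closed_form_at (fun s t => Im (G s t)) (fun s t => Re (G s t)) s t.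
  have [c Hc] := dG s t; exists (Im c), (Re c), (- Im c) => eps e0.
  have [d d0 Hd] := Hc _ e0; exists d => // u v us vt.
  have := Hd (u - s) (v - t) us vt; rewrite !(addrC s) !(addrC t) !subrK => N.
  split; apply: le_trans N.
  - apply: le_trans (normr_Im _); rewrite !complexE_simp /=.
    by rewrite le_eqVlt; apply/orP; left; apply/eqP; congr `|_|; ring.
  - apply: le_trans (normr_Re _); rewrite !complexE_simp /=.
    by rewrite le_eqVlt; apply/orP; left; apply/eqP; congr `|_|; ring.
move=> /(_ _ _ (fun s t _ _ => cF s t) x 0 (- x) (pi *+ 2)) => D.
have D' : rect_int H W x 0 (- x) (pi *+ 2) = 0.
  apply: D; rewrite ?oppr_gt0//.
  - by move=> y t At; apply: is_derive_primitive => //; exact: contx.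
  - by move=> y t At; apply: is_derive_primitive => //; exact: conty.
  - by rewrite /A ltrBlDr ltrDl.
  - by rewrite /B ltrN10.
have HH s : H s (pi *+ 2) = H s 0.
  by congr primitive; apply/funext => y; rewrite /G cexp_periodic.
have B0 : B < 0 by rewrite /B ltrN10.
have r0 := Rintegral_primitive (@conty (@complex.Re R) 0 lipRe) B0 twopi_gt0.
have r1 := Rintegral_primitive (@conty (@complex.Re R) x lipRe) B0 twopi_gt0.
rewrite [LHS]r0 [RHS]r1 -/(W 0 _) -/(W 0 _) -/(W x _) -/(W x _) {r0 r1}.
move: D'; rewrite /rect_int !add0r subrr (HH 0) (HH x).
move: (W 0 _) (W 0 _) (W x _) (W x _) (H 0 0) (H x 0) => u1 u2 u3 u4 u5 u6 D'.
by apply/eqP; rewrite -subr_eq0; apply/eqP; rewrite -[RHS]D'; ring.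
Qed.

(** The mean does not depend on the radius, and it tends to the value at the centre as the radius
    shrinks. *)
Lemma circle_mean_Re :
  Rintegral leb1 `[0, pi *+ 2]%classic (fun y => Re (g (cexp (ptC 0 y)))) = pi *+ 2 * Re (g 0).
Proof.
apply/eqP; rewrite -subr_eq0 -normr_eq0; apply/eqP/le_anti; rewrite normr_ge0 andbT.
apply/ler_addgt0Pr => eps e0; rewrite add0r.
have e1 : 0 < eps / (pi *+ 2) by rewrite divr_gt0.
have [c /continuous_cderiv /(_ _ e1) [d d0 Hd]] := dg 0.
pose x := Num.min (-1) (ln d).
have x0 : x < 0 by rewrite gt_min ltrN10.
have xd : expR x <= d.
  apply: le_trans (_ : expR (ln d) <= _); last by rewrite lnK.
  by rewrite ler_expR ge_min lexx orbT.
rewrite (mean_const x0).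
have ci : {within `[0, pi *+ 2], continuous (fun y => Re (G x y))}.
  by apply: continuous_subspaceT; exact: conty.
have fi : leb1.-integrable `[0, pi *+ 2] (EFin \o (fun y => Re (G x y))).
  by apply: continuous_compact_integrable => //; exact: segment_compact.
have fc (r : R) : leb1.-integrable `[0, pi *+ 2] (EFin \o cst r).
  apply: continuous_compact_integrable; first exact: segment_compact.
  by apply: continuous_subspaceT => ?; exact: cvg_cst.
have Ic (r : R) : Rintegral leb1 `[0, pi *+ 2]%classic (cst r) = pi *+ 2 * r.
  rewrite Rintegral_cst//= lebesgue_measure_itv /= lte_fin twopi_gt0 /= subr0.
  by rewrite mulrC.
have cB : continuous (fun y : R => Re (G x y) - Re (g 0)).
  by move=> y; apply: cvgB; [exact: conty|exact: cvg_cst].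
have fB : leb1.-integrable `[0, pi *+ 2] (EFin \o (fun y => Re (G x y) - Re (g 0))).
  by apply: continuous_compact_integrable; [exact: segment_compact|exact: continuous_subspaceT].
have fN : leb1.-integrable `[0, pi *+ 2] (EFin \o (fun y => `|Re (G x y) - Re (g 0)|)).
  apply: continuous_compact_integrable; first exact: segment_compact.
  by apply: continuous_subspaceT => y; apply: cvg_norm; exact: cB.
rewrite -Ic -RintegralB//; last exact: fc.
apply: le_trans (le_normr_Rintegral _ fB) _ => //.
have -> : eps = Rintegral leb1 `[0, pi *+ 2]%classic (cst (eps / (pi *+ 2))).
  by rewrite Ic mulrC divfK// gt_eqF.
apply: le_Rintegral => //; first exact: fc.
move=> y _; apply: le_trans (lipRe _ _) _; apply: ltW.
have := Hd (cexp (ptC x y)); rewrite add0r; apply.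
by rewrite normc_cexp.
Qed.

End Fixed.

Lemma circle_mean g : (forall z, exists c, cderiv g z c) ->
  Rintegral leb1 `[0, pi *+ 2]%classic (fun y => Re (g (cexp (ptC 0 y)))) +i*
  Rintegral leb1 `[0, pi *+ 2]%classic (fun y => Im (g (cexp (ptC 0 y)))) =
  (pi *+ 2)%:C * g 0.
Proof.
move=> dg; apply: complex_eq; rewrite !complexE_simp /= ?mul0r ?subr0 ?addr0.
  exact: circle_mean_Re.
(* Multiplication by [-i] turns the imaginary part into the real part already treated. *)
pose w : C := 0 +i* (- 1).
have w1 : normc w = 1 by rewrite /= expr0n add0r sqrrN expr1n sqrtr1.
pose f z := w * g z.
have ReE z : Re (f z) = Im (g z) by rewrite /f !complexE_simp /=; ring.
rewrite -ReE -circle_mean_Re; first by apply: eq_Rintegral => y _; rewrite ReE.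
move=> z; have [c Hc] := dg z; exists (w * c) => eps e0.
have [d d0 H] := Hc _ e0; exists d => // h /H Hh.
clearbody w; rewrite /f (_ : _ - _ - _ = w * (g (z + h) - g z - h * c)); last by ring.
by rewrite Normc.normcM w1 mul1r.
Qed.

End CircleMean.

Section HolomorphicLines.
Context {R : realType} {n : nat}.
Local Notation C := (Cplx R).
Implicit Types (z w : Cn R n) (v : Cn R n -> C).
Local Open Scope complex_scope.

Lemma norm_Cn_real w : `|w| = (complex.Re `|w|)%:C.
Proof.
have : 0 <= `|w| by exact: normr_ge0.
by case: `|w| => a b; rewrite lecE /= => /andP[/eqP -> _].
Qed.

Lemma Re_norm_Cn_ge0 w : 0 <= complex.Re `|w|.
Proof.
have : 0 <= `|w| by exact: normr_ge0.
by case: `|w| => a b; rewrite lecE /= => /andP[].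
Qed.

Lemma differentiable_line v z w (l : R[i]) : differentiable v (z + (l : C) *: w) ->
  exists c, cderiv (fun x : R[i] => v (z + (x : C) *: w) : R[i]) l c.
Proof.
move=> /diff_locallyP[_ /eqaddoP H]; set p := z + _ in H *.
exists ('d v p w) => eps e0.
pose M := complex.Re `|w| + 1.
have M0 : 0 < M by rewrite ltr_wpDl ?Re_norm_Cn_ge0.
have e1 : 0 < (eps / M)%:C :> R[i] by rewrite ltcR divr_gt0.
have /nbhs_CnP[d d0 Hd] := H _ e1.
exists (d / 2 / (\sum_j normc (w 0 j) + 1)).
  by rewrite !divr_gt0// ltr_wpDl ?sumr_ge0// => j _; exact: normc_ge0.
move=> h hd.
have S0 : 0 < \sum_j normc (w 0 j) + 1.
  by rewrite ltr_wpDl ?sumr_ge0// => j _; exact: normc_ge0.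
have : forall j, normc (((h : C) *: w) 0 j - (0 : Cn R n) 0 j) < d.
  move=> j; rewrite !mxE subr0 Normc.normcM.
  apply: le_lt_trans (_ : normc h * (\sum_j normc (w 0 j) + 1) < _).
    rewrite ler_wpM2l ?normc_ge0// (bigD1 j)//= -addrA lerDl addr_ge0//.
    by apply: sumr_ge0 => i _; exact: normc_ge0.
  rewrite -ltr_pdivlMr//; apply: le_lt_trans hd _.
  by rewrite ltr_pM2r ?invr_gt0// ltr_pdivrMr// ltr_pMr// ltr1n.
move=> /Hd /=; rewrite normrZ /=.
have -> : (v \o shift p - (cst (v p) + 'd v p)) ((h : C) *: w) =
   v (z + ((l + h : R[i]) : C) *: w) - v p - h * 'd v p w.
  transitivity (v ((h : C) *: w + p) - (v p + 'd v p ((h : C) *: w))); first by [].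
  rewrite linearZ opprD addrA; congr (v _ - _ - _).
  by rewrite /p [in RHS]scalerDl addrC -addrA.
rewrite normr_normc (normr_normc h) norm_Cn_real -!rmorphM /= lecR => /le_trans; apply.
rewrite mulrA mulrAC ler_wpM2r ?normc_ge0//.
rewrite mulrAC ler_pdivrMr// ler_wpM2l// ?lerDl// ltW//.
Qed.

Lemma holomorphic_continuous v : holomorphic v -> continuous v.
Proof. by move=> hv z; exact: differentiable_continuous. Qed.

End HolomorphicLines.

(** * The Gaussian mean value property *)

Section GaussianMean.
Context {R : realType} {n : nat}.
Local Notation C := (Cplx R).
Local Notation X := ((n + n).-tuple (measurableTypeR R)).
Local Notation mu := (@leb R (n + n)).
Local Notation leb1 := (@lebesgue_measure R).
Local Open Scope complex_scope.

Variables (v : Cn R n -> C) (a : R).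
Hypothesis a0 : 0 < a.
Hypothesis cv : continuous v.
Hypothesis dv : forall w (l : R[i]), exists c, cderiv (fun x : R[i] => v ((x : C) *: w) : R[i]) l c.
Hypothesis iv : cintegrable mu (fun t => (expR (- a * nsq (cpoint t)))%:C * v (cpoint t)).

Let u (y : R) : C := cexp (0 +i* y).
Let u1 y : normc (u y) = 1. Proof. by rewrite normc_cexp /= expR0. Qed.
(** The angle is integrated over the whole line against this indicator, so that Fubini is applied on
    full spaces. *)
Let ind : R -> R := \1_(`[0, pi *+ 2]%classic : set R).
Let G (y : R) (t : X) : R[i] :=
  (ind y)%:C * ((expR (- a * nsq (cpoint t)))%:C * v (u y *: cpoint t)).

Let mind : measurable_fun (setT : set (measurableTypeR R)) ind.
Proof. by apply: measurable_indic; exact: measurable_itv. Qed.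

Let mG : cmeas (fun p : measurableTypeR R * X => G p.1 p.2).
Proof.
apply: cmeasM.
  by apply: cmeas_real; apply: (measurableT_comp mind); exact: measurable_fst.
apply: cmeasM.
  apply: cmeas_real; apply: measurableT_comp => //; apply: measurable_funM => //.
  apply: (@measurableT_comp _ _ _ _ _ _ (fun t : X => nsq (cpoint t)) setT snd) => //.
  by apply: measurable_nsq; exact: cmeas_coord.
apply: (cmeas_continuous_Cn cv) => j.
rewrite (_ : (fun _ => _) = fun p : measurableTypeR R * X => u p.1 * cpoint p.2 0 j); last first.
  by apply/funext => p; rewrite mxE.
apply: cmeasM.
  by apply: cmeas_cexp; split => /=; [exact: measurable_cst|exact: measurable_fst].
have [m1 m2] := @cmeas_coord R n j.
by split; [exact: (measurableT_comp m1 measurable_snd)|exact: (measurableT_comp m2 measurable_snd)].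
Qed.

Let gE y (z : Cn R n) : expR (- a * nsq (u y *: z)) = expR (- a * nsq z).
Proof. by rewrite nsqZ u1 expr1n mul1r. Qed.

Let mF : cmeas (fun t : X => (expR (- a * nsq (cpoint t)))%:C * v (cpoint t)).
Proof. by case: iv. Qed.

Let irot y : cintegrable mu (fun t => (expR (- a * nsq (cpoint t)))%:C * v (u y *: cpoint t)).
Proof.
have Gy := measurable_pair1 y.
split.
  apply: cmeasM; first by apply: cmeas_real; apply: measurableT_comp => //;
    apply: measurable_funM => //; apply: measurable_nsq; exact: cmeas_coord.
  apply: (cmeas_continuous_Cn cv) => j.
  rewrite (_ : (fun _ => _) = fun t : X => u y * cpoint t 0 j); last by apply/funext => p; rewrite mxE.
  by apply: cmeasM; [exact: cmeas_cst|exact: cmeas_coord].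
case: iv => _.
rewrite -(@cleb_rotate R n (u y) (fun z => (normc ((expR (- a * nsq z))%:C * v z))%:E) (u1 y)).
- apply: le_lt_trans; rewrite le_eqVlt; apply/orP; left; apply/eqP.
  by apply: eq_integral => t _; rewrite gE.
- by apply/measurable_EFinP; exact: cmeas_normc.
- by move=> z; rewrite lee_fin normc_ge0.
Qed.

Let iG1 y : cintegrable mu (G y).
Proof. by apply: cintegrableZ; exact: irot. Qed.

Let cont_line (z : Cn R n) (F : C -> R) : (forall x y, `|F x - F y| <= normc (x - y)) ->
  continuous (fun y : R => F (v (u y *: z))).
Proof.
move=> HF y; apply/cvgrPdist_lt => eps e0.
have [c Hc] := dv z (u y).
have [d d0 Hd] := continuous_cderiv (cderiv_comp (cderiv_cexp (0 +i* y)) Hc) e0.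
near=> t; rewrite distrC; apply: le_lt_trans (HF _ _) _.
have := Hd (0 +i* (t - y)); rewrite /= (_ : (0 +i* y) + (0 +i* (t - y)) = 0 +i* t); last first.
  by apply: complex_eq; rewrite !complexE_simp /=; ring.
apply; rewrite expr0n add0r sqrtr_sqr distrC.
by near: t; apply: cvgr_dist_le => //; exact: cvg_id.
Unshelve. all: by end_near. Qed.

Let lipRe (x y : C) : `|complex.Re x - complex.Re y| <= normc (x - y).
Proof. by have := normr_Re (x - y); rewrite cReD cReN. Qed.
Let lipIm (x y : C) : `|complex.Im x - complex.Im y| <= normc (x - y).
Proof. by have := normr_Im (x - y); rewrite cImD cImN. Qed.
Let lipN (x y : C) : `|normc x - normc y| <= normc (x - y).
Proof.
have H (p q : C) : normc p <= normc (p - q) + normc q.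
  by rewrite -{1}(subrK q p); exact: le_normcD.
have := H x y; have := H y x; rewrite (normcB y x) => h1 h2.
by rewrite ler_norml; apply/andP; split; lra.
Qed.

Let Rint_ind (f : R -> R) : Rintegral leb1 setT (fun y => ind y * f y) =
  Rintegral leb1 `[0, pi *+ 2]%classic f.
Proof.
rewrite [RHS]Rintegral_mkcond; congr Rintegral; apply/funext => y.
by rewrite patch_indic mulrC.
Qed.

Let iG2 (t : X) : cintegrable leb1 (fun y => G y t).
Proof.
have mGt : cmeas (fun y : measurableTypeR R => G y t).
  have [m1 m2] := mG.
  by split; [exact: (measurableT_comp m1 (measurable_pair2 t))|exact: (measurableT_comp m2 (measurable_pair2 t))].
split => //.
have cN : continuous (fun y : R => expR (- a * nsq (cpoint t)) * normc (v (u y *: cpoint t))).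
  move=> y; apply: cvgM; first exact: cvg_cst.
  exact: (cont_line (F := @Normc.normc R) lipN).
have : leb1.-integrable `[0, pi *+ 2] (EFin \o (fun y : R => expR (- a * nsq (cpoint t)) * normc (v (u y *: cpoint t)))).
  by apply: continuous_compact_integrable; [exact: segment_compact|exact: continuous_subspaceT].
move=> /integrableP[_]; apply: le_lt_trans.
rewrite [leRHS]integral_mkcond; apply: ge0_le_integral => //.
- by move=> y _; rewrite lee_fin normc_ge0.
- by apply/measurable_EFinP; exact: cmeas_normc.
- have [m1 _] : measurable_fun (setT : set (measurableTypeR R)) (fun y => normc (G y t)) /\ True by split => //; exact: cmeas_normc.
  rewrite (_ : _ \_ _ = (EFin \o (fun y => normc (G y t)))); first exact/measurable_EFinP.
  apply/funext => y /=; rewrite /patch /G /ind indicE.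
  case: ifP => _ /=; rewrite ?mul0r ?Normc.normc0// mul1r Normc.normcM normc_real.
  by rewrite normrM (ger0_norm (normc_ge0 _)).
- move=> y _; rewrite /patch /G /ind indicE.
  case: ifP => _ /=; rewrite ?mul0r ?Normc.normc0// mul1r Normc.normcM normc_real lee_fin.
  by rewrite normrM (ger0_norm (normc_ge0 _)).
Qed.

(** The maps [z -> exp (i y) z] preserve the measure and the Gaussian. Averaging over [y] and
    exchanging the integrals replaces [v] by its means on circles, all equal to [v 0]. *)
Lemma gaussian_mean :
  Cint mu (fun t => (expR (- a * nsq (cpoint t)))%:C * v (cpoint t)) =
  ((pi / a) ^+ n)%:C * v 0.
Proof.
have p0 : (pi *+ 2 : R) != 0 by rewrite gt_eqF// mulrn_wgt0// pi_gt0.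
have p0c : (pi *+ 2)%:C != 0 :> R[i] by rewrite eq_complex /= eqxx andbT.
apply: (mulfI p0c).
set I := Cint _ _.
have E1 : Cint leb1 (fun y => Cint mu (G y)) = (pi *+ 2)%:C * I.
  have GI y : Cint mu (G y) = (ind y)%:C * I.
    rewrite CintZ; last exact: irot.
    have Hr := @cint_rotate R n (u y) (fun z => (expR (- a * nsq z))%:C * v z) (u1 y) mF.
    congr (_ * _); apply: etrans Hr.
    by apply: eq_Cint => t; rewrite gE.
  have Ic : Rintegral leb1 setT ind = pi *+ 2.
    rewrite (_ : ind = fun y => ind y * 1); last by apply/funext => y; rewrite mulr1.
    rewrite Rint_ind Rintegral_cst//= lebesgue_measure_itv /= lte_fin.
    by rewrite mulrn_wgt0 ?pi_gt0//= subr0 mul1r.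
  have iind : leb1.-integrable setT (EFin \o ind).
    apply: nint_integrable => //.
    rewrite /ind integral_indic//.
    rewrite setIT; change (lebesgue_measure (`[0%R, (pi *+ 2)%R]%classic : set R) < +oo)%E.
    by rewrite lebesgue_measure_itv /=; case: ifP => //; rewrite ltry.
  have E c : Rintegral leb1 setT (fun y => ind y * c) = pi *+ 2 * c.
    by rewrite RintegralZr// Ic.
  transitivity (Cint leb1 (fun y => (ind y)%:C * I)).
    by apply: eq_Cint => y; exact: GI.
  clear GI; move: I => I.
  apply: complex_eq; rewrite ?complexE_simp /= !mul0r ?subr0 ?addr0 -E.
    by apply: eq_Rintegral => y _; rewrite complexE_simp /= mul0r subr0.
  by apply: eq_Rintegral => y _; rewrite complexE_simp /= mul0r addr0.
have E2 t : Cint leb1 (fun y => G y t) = (pi *+ 2)%:C * v 0 * (expR (- a * nsq (cpoint t)))%:C.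
  have := circle_mean (dv (cpoint t)); rewrite scale0r => <-.
  rewrite [in RHS]mulrC; set g := expR _.
  have iF (F : C -> R) : (forall x y, `|F x - F y| <= normc (x - y)) ->
      leb1.-integrable `[0, pi *+ 2] (EFin \o (fun y : R => F (v (u y *: cpoint t)))).
    move=> HF; apply: continuous_compact_integrable; first exact: segment_compact.
    by apply: continuous_subspaceT; exact: cont_line.
  apply: complex_eq; rewrite ?complexE_simp /= !mul0r ?subr0 ?addr0.
    rewrite -RintegralZl//; last exact: (iF (@complex.Re R)).
    rewrite -Rint_ind; apply: eq_Rintegral => y _; rewrite /G -/g.
    by set x := v (u y *: cpoint t); rewrite !cReM !cImM /=; move: x => x; ring.
  rewrite -RintegralZl//; last exact: (iF (@complex.Im R)).
  rewrite -Rint_ind; apply: eq_Rintegral => y _; rewrite /G -/g.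
  by set x := v (u y *: cpoint t); rewrite !cImM !cReM /=; move: x => x; ring.
have mN : measurable_fun setT (fun t : X => normc ((expR (- a * nsq (cpoint t)))%:C * v (cpoint t))).
  exact: cmeas_normc.
rewrite -E1 (@Cfubini _ _ _ _ _ leb1 mu G mG iG1 iG2); last first.
  pose I0 := fine (\int[mu]_t (normc ((expR (- a * nsq (cpoint t)))%:C * v (cpoint t)))%:E)%E.
  have I0E : (\int[mu]_t (normc ((expR (- a * nsq (cpoint t)))%:C * v (cpoint t)))%:E)%E = I0%:E.
    rewrite /I0 fineK// ge0_fin_numE; first by case: iv.
    by apply: nint_ge0 => t; exact: normc_ge0.
  under eq_integral => y _.
    rewrite (_ : (\int[mu]_t _)%E = (I0 * ind y)%:E); first over.
    transitivity (\int[mu]_t (ind y * normc ((expR (- a * nsq (u y *: cpoint t)))%:C * v (u y *: cpoint t)))%:E)%E.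
      apply: eq_integral => t _; rewrite gE /G Normc.normcM normc_real ger0_norm//.
    rewrite nintZ; last 3 first.
    - have [mi _] := irot y; have := cmeas_normc mi.
      by under eq_fun do rewrite -(gE y).
    - by move=> t; exact: normc_ge0.
    - by rewrite /ind indicE.
    rewrite (@cleb_rotate R n (u y) (fun z => (normc ((expR (- a * nsq z))%:C * v z))%:E) (u1 y)); last 2 first.
    - exact/measurable_EFinP.
    - by move=> z; rewrite lee_fin normc_ge0.
    by rewrite I0E -EFinM mulrC.
  rewrite nintZ; last 3 first.
  - exact: mind.
  - by move=> y; rewrite /ind indicE.
  - by rewrite -lee_fin -I0E; apply: nint_ge0 => t; exact: normc_ge0.
  rewrite /ind integral_indic//.
  rewrite setIT; change (I0%:E * lebesgue_measure (`[0%R, (pi *+ 2)%R]%classic : set R) < +oo)%E.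
  by rewrite lebesgue_measure_itv /=; case: ifP => _; rewrite ?mule0 ?ltry//.
have mg : measurable_fun setT (fun t : X => expR (- a * nsq (cpoint t))).
  apply: measurableT_comp => //; apply: measurable_funM => //.
  by apply: measurable_nsq; exact: cmeas_coord.
have ig : cintegrable mu (fun t => (expR (- a * nsq (cpoint t)))%:C : R[i]).
  split; first exact: cmeas_real.
  under eq_integral => t _ do rewrite normc_real ger0_norm ?expR_ge0//.
  by rewrite cleb_gauss// ltry.
rewrite (eq_Cint _ E2) CintZ// -mulrA; congr (_ * _); rewrite mulrC; congr (_ * _).
apply: complex_eq => /=; last by rewrite Rintegral_cst//= mul0r.
by rewrite /Rintegral cleb_gauss.
Qed.

End GaussianMean.

Section CnContinuity.
Context {R : realType} {n : nat}.
Local Notation C := (Cplx R).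
Local Notation Re := complex.Re.
Local Notation Im := complex.Im.
Implicit Types (z w : Cn R n) (f g : Cn R n -> R) (F G : Cn R n -> C).
Local Open Scope complex_scope.

Lemma continuous_coord j : continuous (fun z : Cn R n => z 0 j : C).
Proof. by move=> z; apply/continuous_CnCP => e e0; exists e. Qed.

Lemma continuous_coordRe j : continuous (fun z : Cn R n => Re (z 0 j) : R).
Proof. exact: continuous_Cn_Re (@continuous_coord j). Qed.

Lemma continuous_coordIm j : continuous (fun z : Cn R n => Im (z 0 j) : R).
Proof. exact: continuous_Cn_Im (@continuous_coord j). Qed.

Lemma continuous_CnM f g : continuous f -> continuous g -> continuous (fun z => f z * g z).
Proof. by move=> cf cg z; exact: (cvgM (cf z) (cg z)). Qed.

Lemma continuous_CnD f g : continuous f -> continuous g -> continuous (fun z => f z + g z).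
Proof. by move=> cf cg z; exact: (cvgD (cf z) (cg z)). Qed.

Lemma continuous_CnB f g : continuous f -> continuous g -> continuous (fun z => f z - g z).
Proof. by move=> cf cg z; exact: (cvgB (cf z) (cg z)). Qed.

Lemma continuous_Cn_cst (c : R) : continuous (fun z : Cn R n => c).
Proof. by move=> z; exact: (@cvg_cst _ c _ (nbhs z)). Qed.

Lemma continuous_Cn_sum (I : Type) (r : seq I) (f : I -> Cn R n -> R) :
  (forall i, continuous (f i)) -> continuous (fun z => \sum_(i <- r) f i z).
Proof.
move=> cf; elim: r => [|i r IH].
  by rewrite (_ : (fun _ => _) = fun=> 0); [exact: continuous_Cn_cst|apply/funext => x; rewrite big_nil].
rewrite (_ : (fun _ => _) = fun x => f i x + \sum_(i <- r) f i x); first exact: continuous_CnD.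
by apply/funext => x; rewrite big_cons.
Qed.

Lemma continuous_Cn_comp (h : R -> R) f : continuous h -> continuous f ->
  continuous (fun z => h (f z)).
Proof. by move=> ch cf z; apply: (@continuous_comp _ _ _ f h); [exact: cf|exact: ch]. Qed.

Lemma continuous_CnCM F G : continuous F -> continuous G -> continuous (fun z => F z * G z).
Proof.
move=> cF cG; apply: continuous_Cn_complex.
  rewrite (_ : (fun _ => _) = fun z => Re (F z) * Re (G z) - Im (F z) * Im (G z)); last first.
    by apply/funext => z; rewrite cReM.
  apply: continuous_CnB; apply: continuous_CnM;
    solve [exact: continuous_Cn_Re|exact: continuous_Cn_Im].
rewrite (_ : (fun _ => _) = fun z => Re (F z) * Im (G z) + Im (F z) * Re (G z)); last first.
  by apply/funext => z; rewrite cImM.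
apply: continuous_CnD; apply: continuous_CnM;
  solve [exact: continuous_Cn_Re|exact: continuous_Cn_Im].
Qed.

Lemma continuous_CnCD F G : continuous F -> continuous G -> continuous (fun z => F z + G z).
Proof.
move=> cF cG; apply: continuous_Cn_complex.
  rewrite (_ : (fun _ => _) = fun z => Re (F z) + Re (G z)); last by apply/funext => z; rewrite cReD.
  by apply: continuous_CnD; exact: continuous_Cn_Re.
rewrite (_ : (fun _ => _) = fun z => Im (F z) + Im (G z)); last by apply/funext => z; rewrite cImD.
by apply: continuous_CnD; exact: continuous_Cn_Im.
Qed.

Lemma continuous_CnC_cst (c : C) : continuous (fun _ : Cn R n => c).
Proof. by apply: continuous_Cn_complex; exact: continuous_Cn_cst. Qed.

Lemma continuous_CnC_sum (I : Type) (r : seq I) (F : I -> Cn R n -> C) :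
  (forall i, continuous (F i)) -> continuous (fun z => \sum_(i <- r) F i z).
Proof.
move=> cF; elim: r => [|i r IH].
  by rewrite (_ : (fun _ => _) = fun=> 0); [exact: continuous_CnC_cst|apply/funext => x; rewrite big_nil].
have -> : (fun z => \sum_(k <- i :: r) F k z) = (fun z => F i z + \sum_(k <- r) F k z).
  by apply/funext => x; rewrite big_cons.
exact: (continuous_CnCD (cF i) IH).
Qed.

Lemma continuous_Cn_cexp F : continuous F -> continuous (fun z => cexp (F z) : C).
Proof.
move=> cF; apply: continuous_Cn_complex; apply: continuous_CnM.
- apply: continuous_Cn_comp; [exact: continuous_expR|exact: continuous_Cn_Re].
- apply: continuous_Cn_comp; [exact: continuous_cos|exact: continuous_Cn_Im].
- apply: continuous_Cn_comp; [exact: continuous_expR|exact: continuous_Cn_Re].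
- apply: continuous_Cn_comp; [exact: continuous_sin|exact: continuous_Cn_Im].
Qed.

Lemma continuous_Cn_real f : continuous f -> continuous (fun z => (f z)%:C : C).
Proof. by move=> cf; apply: continuous_Cn_complex => //; exact: continuous_Cn_cst. Qed.

Lemma continuous_Cn_translate F a : continuous F -> continuous (fun z => F (a + z)).
Proof.
move=> cF z; apply/continuous_CnCP => e e0.
have /continuous_CnCP /(_ e e0) [d d0 H] := cF (a + z).
exists d => // w wz; apply: H => j; rewrite !mxE.
by rewrite opprD addrACA subrr add0r; exact: wz.
Qed.

Lemma continuous_Phi : continuous (fun z : Cn R n => Phi z).
Proof.
apply: continuous_CnM; first exact: continuous_Cn_cst.
apply: continuous_Cn_sum => j.
rewrite (_ : (fun _ => _) = fun z : Cn R n => Im (z 0 j) * Im (z 0 j)); last first.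
  by apply/funext => z; rewrite expr2.
by apply: continuous_CnM; exact: continuous_coordIm.
Qed.

End CnContinuity.

(** * The Bergman kernel *)

Section Kernel.
Context {R : realType} {n : nat}.
Local Notation C := (Cplx R).
Local Notation Re := complex.Re.
Local Notation Im := complex.Im.
Local Notation X := ((n + n).-tuple (measurableTypeR R)).
Local Notation mu := (@leb R (n + n)).
Variable N : nat.
Implicit Types (z w u : Cn R n) (v : Cn R n -> C).
Local Open Scope complex_scope.

(** The inverse of the integral of [exp (- (N / 2) |u|^2)], the Gaussian that remains when the
    kernel is applied to an element of the space. *)
Definition peak : R := (N%:R / (2 * pi)) ^+ n.

Definition gker u : R := peak * expR (- (N%:R / 4) * nsq u).

Definition bphase z w : R :=
  - (N%:R / 2) * \sum_(j < n) (Re (z 0 j) - Re (w 0 j)) * (Im (z 0 j) + Im (w 0 j)).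

(* This is [peak * exp (- N/4 (z - conj w)^2 - N Phi z - N Phi w)], with modulus
   and phase separated. *)
Definition bker z w : C := (gker (z - w))%:C * cexp (0 +i* bphase z w).

Definition bargmann v z : C := (expR (- (N%:R * Phi z)))%:C * v z.

Lemma peak_ge0 : 0 <= peak.
Proof. by rewrite exprn_ge0// divr_ge0// mulr_ge0// pi_ge0. Qed.

Lemma gker_ge0 u : 0 <= gker u.
Proof. by rewrite mulr_ge0 ?expR_ge0// peak_ge0. Qed.

Lemma gkerB z w : gker (z - w) = gker (w - z).
Proof. by rewrite /gker nsqB. Qed.

Lemma normc_bker z w : normc (bker z w) = gker (z - w).
Proof.
by rewrite Normc.normcM normc_real ger0_norm ?gker_ge0// normc_cexp /= expR0 mulr1.
Qed.

Lemma conj_bker z w : conjc (bker z w) = bker w z.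
Proof.
have cM (x y : R[i]) : conjc (x * y) = conjc x * conjc y.
  by apply: complex_eq; rewrite !complexE_simp; ring.
rewrite /bker cM conj_cexp gkerB /= oppr0; congr (_ * cexp _).
congr (_ +i* _); rewrite -mulrN; congr (_ * _).
by rewrite -sumrN; apply: eq_bigr => j _; ring.
Qed.

Lemma cmeas_bker d (T : measurableType d) (phi psi : T -> Cn R n) :
  (forall j, cmeas (fun t => phi t 0 j)) -> (forall j, cmeas (fun t => psi t 0 j)) ->
  cmeas (fun t => bker (phi t) (psi t)).
Proof.
move=> mphi mpsi; apply: cmeasM.
  apply: cmeas_real; apply: measurable_funM => //.
  apply: measurableT_comp => //; apply: measurable_funM => //.
  apply: measurable_nsq => j.
  rewrite (_ : (fun _ => _) = fun t => phi t 0 j - psi t 0 j); last by apply/funext => t; rewrite !mxE.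
  exact: cmeasB.
apply: cmeas_cexp; split => /=; first exact: measurable_cst.
apply: measurable_funM => //; apply: measurable_sum => j.
have [m1 m2] := mphi j; have [m3 m4] := mpsi j.
by apply: measurable_funM; [exact: measurable_funB|exact: measurable_funD].
Qed.

(** The part of the exponent that is holomorphic in [u = w - z], once the Gaussian of exponent
    [N / 2] is extracted. *)
Let q z u : C := (N%:R / 4)%:C * (\sum_(j < n) u 0 j * u 0 j) +
  (0 +i* N%:R) * \sum_(j < n) (Im (z 0 j))%:C * u 0 j.

(** Recentred at [z], the modulus of the kernel, its phase and the weight of the function combine
    into a radial Gaussian times a holomorphic function of [u], the shape required by
    [gaussian_mean]. *)
Lemma bker_bargmann v z u : bker z (u + z) * bargmann v (u + z) =
  (expR (- (N%:R / 2) * nsq u))%:C *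
  ((peak * expR (- (N%:R * Phi z)))%:C * (v (z + u) * cexp (q z u))).
Proof.
have Er (r : R) : (expR r)%:C = cexp r%:C :> C.
  by apply: complex_eq; rewrite /= ?cos0 ?sin0 ?mulr1 ?mulr0.
rewrite /bker /bargmann /gker (addrC z u) !rmorphM /= !Er.
set P : C := peak%:C; set v' : C := v _.
set e1 := cexp _; set e2 := cexp _; set e3 := cexp _; set e4 := cexp _; set e5 := cexp _; set e6 := cexp _.
suff E : e1 * e2 * e3 = e4 * e5 * e6.
  transitivity (P * v' * (e1 * e2 * e3)); first by ring.
  by rewrite E; ring.
rewrite /e1 /e2 /e3 /e4 /e5 /e6 -!cexpD; congr cexp.
have -> : nsq (z - (u + z)) = nsq u by rewrite opprD addrCA subrr addr0 nsqN.
have nE : nsq u = \sum_(j < n) (Re (u 0 j) ^+ 2 + Im (u 0 j) ^+ 2).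
  by apply: eq_bigr => j _; rewrite normc_sqr.
apply: complex_eq; rewrite /q !complexE_simp /= /bphase ?cRe_sum ?cIm_sum ?nE /Phi.
  rewrite !(mul0r, mulr0, subr0, addr0, sub0r, add0r).
  rewrite !mulr_sumr -!sumrN -!big_split /=; apply: eq_bigr => j _.
  by rewrite !mxE !complexE_simp /=; field.
rewrite !(mul0r, mulr0, subr0, addr0, sub0r, add0r).
rewrite !mulr_sumr -!big_split /=; apply: eq_bigr => j _.
by rewrite !mxE !complexE_simp /=; field.
Qed.

Hypothesis N0 : (0 < N)%N.

Lemma reproducing v z : holomorphic v ->
  cintegrable mu (fun t => bker z (cpoint t) * bargmann v (cpoint t)) ->
  Cint mu (fun t => bker z (cpoint t) * bargmann v (cpoint t)) = bargmann v z.
Proof.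
move=> hv iv; have [mv voo] := iv.
have NR : (0 : R) < N%:R by rewrite ltr0n.
rewrite -(@cint_translate R n z (fun w => bker z w * bargmann v w))//.
pose vt u := (peak * expR (- (N%:R * Phi z)))%:C * (v (z + u) * cexp (q z u)) : C.
transitivity (Cint mu (fun t => (expR (- (N%:R / 2) * nsq (cpoint t)))%:C * vt (cpoint t))).
  by apply: eq_Cint => t; exact: bker_bargmann.
rewrite gaussian_mean.
- have q0 : q z 0 = 0.
    by rewrite /q !big1 ?mulr0 ?addr0// => j _; rewrite mxE mulr0.
  rewrite /vt addr0 q0 cexp0 mulr1 /bargmann rmorphM /= mulrA mulrA -rmorphM /=.
  have E1 : pi / (N%:R / 2) * (N%:R / (2 * pi)) = 1 :> R.
    have pn0 : (pi : R) != 0 by rewrite gt_eqF// pi_gt0.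
    have Nn0 : (N%:R : R) != 0 by rewrite gt_eqF.
    by move: pi pn0 => p pn0; field; rewrite pn0 Nn0.
  by rewrite /peak -exprMn E1 expr1n mul1r.
- by rewrite divr_gt0.
- apply: continuous_CnCM.
    by apply: continuous_Cn_real; exact: continuous_Cn_cst.
  apply: continuous_CnCM.
    by apply: continuous_Cn_translate; exact: holomorphic_continuous.
  apply: continuous_Cn_cexp.
  apply: continuous_CnCD; apply: continuous_CnCM; try exact: continuous_CnC_cst.
    by apply: continuous_CnC_sum => j; apply: continuous_CnCM; exact: continuous_coord.
  by apply: continuous_CnC_sum => j; apply: continuous_CnCM; [exact: continuous_CnC_cst|exact: continuous_coord].
- move=> w l.
  have [c Hc] := differentiable_line (hv (z + (l : C) *: w)).
  pose A : R[i] := (N%:R / 4)%:C * (\sum_(j < n) w 0 j * w 0 j).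
  pose B : R[i] := (0 +i* N%:R) * \sum_(j < n) (Im (z 0 j))%:C * w 0 j.
  have qE (x : R[i]) : q z ((x : C) *: w) = x * x * A + x * B.
    rewrite /q /A /B; congr (_ + _); rewrite mulrCA; congr (_ * _).
      by rewrite mulr_sumr; apply: eq_bigr => j _; rewrite !mxE mulrACA.
    by rewrite mulr_sumr; apply: eq_bigr => j _; rewrite !mxE mulrCA.
  have dq : cderiv (fun x : R[i] => q z ((x : C) *: w) : R[i]) l (2 * l * A + B).
    apply: (@cderiv_quadratic _ _ _ _ (normc A)) => h _; rewrite !qE.
    rewrite (_ : _ - _ - _ = h * h * A); last by ring.
    by rewrite !Normc.normcM expr2 mulrC.
  have dc (k : R[i]) : cderiv (fun=> k) l 0.
    apply: (@cderiv_quadratic _ _ _ _ 0) => h _.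
    by rewrite subrr mulr0 subr0 Normc.normc0 mul0r.
  eexists; apply: cderivM; first exact: dc.
  apply: cderivM; first exact: Hc.
  exact: cderiv_comp dq (cderiv_cexp _).
- split.
    have [m1 m2] := mv.
    have mtr : measurable_fun setT (fun t : X => tadd (tpoint z) t) by exact: measurable_tadd.
    have : cmeas (fun t : X => bker z (cpoint t + z) * bargmann v (cpoint t + z)).
      split.
        have := measurableT_comp m1 mtr; rewrite (_ : _ \o _ = fun t : X => Re (bker z (cpoint t + z) * bargmann v (cpoint t + z)))//.
        by apply/funext => t /=; rewrite cpoint_tadd.
      have := measurableT_comp m2 mtr; rewrite (_ : _ \o _ = fun t : X => Im (bker z (cpoint t + z) * bargmann v (cpoint t + z)))//.
      by apply/funext => t /=; rewrite cpoint_tadd.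
    by rewrite (_ : (fun _ => _) = (fun t => (expR (- (N%:R / 2) * nsq (cpoint t)))%:C * vt (cpoint t)))//;
      apply/funext => t; exact: bker_bargmann.
  move: voo; rewrite -(@cleb_translate R n z (fun w => (normc (bker z w * bargmann v w))%:E)); last 2 first.
  - by apply/measurable_EFinP; exact: cmeas_normc.
  - by move=> w; rewrite lee_fin normc_ge0.
  apply: le_lt_trans; rewrite le_eqVlt; apply/orP; left; apply/eqP.
  by apply: eq_integral => t _; rewrite bker_bargmann.
Qed.

End Kernel.

(** * Gaussian averages and square-integrable functions *)

Section GaussianWeights.
Context {R : realType} {n : nat}.
Local Notation C := (Cplx R).
Local Notation X := ((n + n).-tuple (measurableTypeR R)).
Local Notation mu := (@leb R (n + n)).
Implicit Types (z w u : Cn R n).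

Lemma polynomial_le_expR (L : nat) (e : R) : 0 < e ->
  exists2 c : R, 0 < c & forall y, 0 <= y -> (1 + y) ^+ L <= c * expR (e * y).
Proof.
move=> e0; case: L => [|L].
  by exists 1 => // y y0; rewrite expr0 mul1r -expR0 ler_expR mulr_ge0// ltW.
pose a := e / L.+1%:R; have a0 : 0 < a by rewrite divr_gt0.
exists ((1 + a^-1) ^+ L.+1); first by rewrite exprn_gt0// addr_gt0// invr_gt0.
move=> y y0; apply: le_trans (_ : ((1 + a^-1) * expR (a * y)) ^+ L.+1 <= _); last first.
  rewrite exprMn -expRM_natl (_ : L.+1%:R * (a * y) = e * y)//.
  by rewrite /a; field.
have b0 : 0 <= a^-1 by rewrite invr_ge0 ltW.
have c0 : 0 <= 1 + a^-1 by lra.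
have ay0 : 0 <= a * y by rewrite mulr_ge0// ltW.
apply: lerXn2r; rewrite ?nnegrE ?mulr_ge0 ?expR_ge0//; first by lra.
apply: le_trans (_ : (1 + a^-1) * (1 + a * y) <= _).
  rewrite mulrDl mul1r mulrDr mulr1 mulrA mulVf ?gt_eqF// mul1r; lra.
by apply: ler_wpM2l => //; exact: expR_ge1Dx.
Qed.

(** One normalization and a variable width [c]; width 4 is the modulus of the kernel. Wider weights
    absorb the polynomial factors met later. *)
Definition gauss_weight (N : nat) (c : R) u : R :=
  @peak R n N * expR (- (N%:R / c) * nsq u).

Lemma gkerE N u : gker N u = gauss_weight N 4 u. Proof. by []. Qed.

Lemma gauss_weight_ge0 N c u : 0 <= gauss_weight N c u.
Proof. by rewrite mulr_ge0 ?expR_ge0// peak_ge0. Qed.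

Lemma gauss_weightB N c z w : gauss_weight N c (z - w) = gauss_weight N c (w - z).
Proof. by rewrite /gauss_weight nsqB. Qed.

Lemma measurable_gauss_weight N c d (T : measurableType d) (phi psi : T -> Cn R n) :
  (forall j, cmeas (fun t => phi t 0 j)) -> (forall j, cmeas (fun t => psi t 0 j)) ->
  measurable_fun setT (fun t => gauss_weight N c (phi t - psi t)).
Proof.
move=> mphi mpsi; apply: measurable_funM => //.
apply: measurableT_comp => //; apply: measurable_funM => //.
apply: measurable_nsq => j.
rewrite (_ : (fun _ => _) = fun t => phi t 0 j - psi t 0 j); last by apply/funext => t; rewrite !mxE.
exact: cmeasB.
Qed.

Lemma gauss_weight_le (L : nat) (c e : R) : 0 < c < e ->
  exists2 k : R, 0 < k & forall N, (0 < N)%N -> forall u,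
    (1 + N%:R * nsq u) ^+ L * gauss_weight N c u <= k * gauss_weight N e u.
Proof.
move=> /andP[c0 ce]; have e0 := lt_trans c0 ce.
have d0 : 0 < c^-1 - e^-1 by rewrite subr_gt0 ltf_pV2.
have [k k0 Hk] := polynomial_le_expR L d0.
exists k => // N N0 u; rewrite /gauss_weight mulrCA [X in _ <= X]mulrCA.
rewrite ler_wpM2l ?peak_ge0//.
have y0 : 0 <= N%:R * nsq u by rewrite mulr_ge0 ?nsq_ge0.
apply: le_trans (_ : k * expR ((c^-1 - e^-1) * (N%:R * nsq u)) * expR (- (N%:R / c) * nsq u) <= _).
  by rewrite ler_wpM2r ?expR_ge0// Hk.
by rewrite -mulrA -expRD le_eqVlt; apply/orP; left; apply/eqP; congr (_ * expR _); ring.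
Qed.

Lemma gauss_weight_mono N c e u : 0 < c <= e -> gauss_weight N c u <= gauss_weight N e u.
Proof.
move=> /andP[c0 ce]; rewrite ler_wpM2l ?peak_ge0// ler_expR !mulNr lerN2.
by rewrite ler_wpM2r ?nsq_ge0// ler_wpM2l// lef_pV2// posrE// (lt_le_trans c0).
Qed.

Lemma gauss_weight_int N c z : (0 < N)%N -> 0 < c ->
  (\int[mu]_t (gauss_weight N c (z - cpoint t))%:E = ((c / 2) ^+ n)%:E)%E.
Proof.
move=> N0 c0; have NR : (0 : R) < N%:R by rewrite ltr0n.
under eq_integral => t _ do rewrite gauss_weightB.
rewrite (@cleb_translate R n (- z) (fun w => (gauss_weight N c w)%:E)); last 2 first.
- apply/measurable_EFinP; apply: measurable_funM => //.
  apply: measurableT_comp => //; apply: measurable_funM => //.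
  by apply: measurable_nsq; exact: cmeas_coord.
- by move=> w; rewrite lee_fin gauss_weight_ge0.
rewrite nintZ; last 3 first.
- apply: measurableT_comp => //; apply: measurable_funM => //.
  by apply: measurable_nsq; exact: cmeas_coord.
- by move=> t; exact: expR_ge0.
- exact: peak_ge0.
rewrite cleb_gauss ?divr_gt0// -EFinM /peak -exprMn; congr ((_ ^+ _)%:E).
have pn0 : (pi : R) != 0 by rewrite gt_eqF// pi_gt0.
have Nn0 : (N%:R : R) != 0 by rewrite gt_eqF.
have cn0 : c != 0 by rewrite gt_eqF.
by move: pi pn0 => p pn0; field; rewrite ?pn0 ?Nn0 ?cn0.
Qed.

(** Integrates [h <= l / 2 + h^2 / (2 l)] against [g] for every [l > 0]; the same inequality
    provides the finiteness of the integral. *)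
Lemma weighted_cauchy_schwarz (g h : X -> R) (A B : R) : 0 < A ->
  measurable_fun setT g -> measurable_fun setT h ->
  (forall t, 0 <= g t) -> (forall t, 0 <= h t) ->
  (\int[mu]_t (g t)%:E = A%:E)%E -> (\int[mu]_t (g t * h t ^+ 2)%:E <= B%:E)%E ->
  exists2 I : R, (\int[mu]_t (g t * h t)%:E = I%:E)%E & 0 <= I /\ I ^+ 2 <= A * B.
Proof.
move=> A0 mg mh g0 h0 gA ghB.
have mgh : measurable_fun setT (fun t => g t * h t) by exact: measurable_funM.
have mgh2 : measurable_fun setT (fun t => g t * h t ^+ 2).
  by apply: measurable_funM => //; exact: measurable_funX.
have gh0 t : 0 <= g t * h t by rewrite mulr_ge0.
have gh20 t : 0 <= g t * h t ^+ 2 by rewrite mulr_ge0// sqr_ge0.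
have B0 : 0 <= B by rewrite -lee_fin; apply: le_trans ghB; exact: nint_ge0.
have key l : 0 < l -> (\int[mu]_t (g t * h t)%:E <= ((l / 2) * A + (l^-1 / 2) * B)%:E)%E.
  move=> l0; apply: le_trans (_ : (\int[mu]_t ((l / 2) * g t + (l^-1 / 2) * (g t * h t ^+ 2))%:E <= _)%E).
    apply: nint_le => //.
      by apply: measurable_funD; apply: measurable_funM.
    move=> t; have := sqr_ge0 (l - h t) => H.
    rewrite -subr_ge0 (_ : _ - _ = g t * (l^-1 / 2) * (l - h t) ^+ 2); last by field; rewrite gt_eqF.
    apply: mulr_ge0; last exact: sqr_ge0.
    by apply: mulr_ge0 => //; rewrite divr_ge0// invr_ge0 ltW.
  rewrite nintD; last 4 first.
  - exact: measurable_funM.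
  - exact: measurable_funM.
  - by move=> t; rewrite mulr_ge0// divr_ge0// ltW.
  - by move=> t; rewrite mulr_ge0// divr_ge0// invr_ge0 ltW.
  rewrite nintZ//; last by rewrite divr_ge0// ltW.
  rewrite nintZ//; last by rewrite divr_ge0// invr_ge0 ltW.
  rewrite gA EFinD; apply: leeD; first by rewrite EFinM.
  by rewrite [leRHS]EFinM; apply: lee_wpmul2l => //; rewrite lee_fin divr_ge0// invr_ge0 ltW.
have [I IE] : exists I : R, (\int[mu]_t (g t * h t)%:E = I%:E)%E.
  have := key 1 ltr01; set J := integral _ _ _ => HJ.
  exists (fine J); rewrite fineK// ge0_fin_numE; last exact: nint_ge0.
  by apply: le_lt_trans HJ _; rewrite ltry.
have I0 : 0 <= I by rewrite -lee_fin -IE; exact: nint_ge0.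
exists I => //; split=> //.
move: I0; rewrite le_eqVlt => /predU1P[<-|I0]; first by rewrite expr0n mulr_ge0// ltW.
(* For this [l] the first term equals [I / 2], so half of [I] is absorbed on the left. *)
have := key (I / A); rewrite divr_gt0// IE lee_fin => /(_ isT).
rewrite -(@ler_pM2l _ (2 * I))//; last by rewrite mulr_gt0.
rewrite (_ : 2 * I * (_ + _) = I ^+ 2 + A * B); first by rewrite expr2; lra.
by field; rewrite !gt_eqF.
Qed.

(** Tonelli, since the weight has the same integral in either variable. *)
Lemma schur N c (a : Cn R n -> R) : (0 < N)%N -> 0 < c ->
  measurable_fun setT (fun t : X => a (cpoint t)) -> (forall z, 0 <= a z) ->
  (\int[mu]_t \int[mu]_s (gauss_weight N c (cpoint t - cpoint s) * a (cpoint s))%:E =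
   ((c / 2) ^+ n)%:E * \int[mu]_t (a (cpoint t))%:E)%E.
Proof.
move=> N0 c0 ma a0.
pose f (t s : X) := (gauss_weight N c (cpoint t - cpoint s) * a (cpoint s))%:E.
have mG : measurable_fun setT (fun p : X * X => gauss_weight N c (cpoint p.1 - cpoint p.2)).
  apply: measurable_gauss_weight => j; have [m1 m2] := @cmeas_coord R n j.
    by split; [exact: (measurableT_comp m1 measurable_fst)|exact: (measurableT_comp m2 measurable_fst)].
  by split; [exact: (measurableT_comp m1 measurable_snd)|exact: (measurableT_comp m2 measurable_snd)].
rewrite (@fubini_tonelli _ _ _ _ _ mu mu (fun p => f p.1 p.2)); last 2 first.
- apply/measurable_EFinP; apply: measurable_funM => //.
  exact: (measurableT_comp ma measurable_snd).
- by move=> p; rewrite lee_fin mulr_ge0// gauss_weight_ge0.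
rewrite -ge0_integralZl_EFin//; last 3 first.
- by move=> t _; rewrite lee_fin.
- exact/measurable_EFinP.
- by rewrite exprn_ge0// divr_ge0// ltW.
apply: eq_integral => s _; rewrite /f /=.
under eq_integral => t _ do rewrite mulrC gauss_weightB.
rewrite nintZ//; last 2 first.
- by apply: measurable_gauss_weight => j; [exact: cmeas_cst|exact: cmeas_coord].
- by move=> t; exact: gauss_weight_ge0.
by rewrite gauss_weight_int// muleC.
Qed.

End GaussianWeights.

Section SquareIntegrable.
Context {R : realType} {n : nat}.
Local Notation C := (Cplx R).
Local Notation X := ((n + n).-tuple (measurableTypeR R)).
Local Notation mu := (@leb R (n + n)).
Implicit Types (z w : Cn R n) (u v : Cn R n -> C).
Local Open Scope complex_scope.

(** Unlike [L2], which allows a modification on a null set, this asks the function itself to be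
    Borel; the elements of [Hspace], being continuous, satisfy it. *)
Definition sqint u := cmeas (fun t : X => u (cpoint t)) /\
  (\int[mu]_t (normc (u (cpoint t)) ^+ 2)%:E < +oo)%E.

Definition energy u : R := Rintegral mu setT (fun t => normc (u (cpoint t)) ^+ 2).

Lemma measurable_sqnorm u : cmeas (fun t : X => u (cpoint t)) ->
  measurable_fun setT (fun t : X => normc (u (cpoint t)) ^+ 2).
Proof. by move=> mu_; apply: measurable_funX; exact: cmeas_normc. Qed.

Lemma energyE u : sqint u ->
  (\int[mu]_t (normc (u (cpoint t)) ^+ 2)%:E = (energy u)%:E)%E.
Proof.
move=> [mu_ uoo]; rewrite /energy /Rintegral fineK// ge0_fin_numE//.
by apply: nint_ge0 => t; exact: sqr_ge0.
Qed.

Lemma energy_ge0 u : 0 <= energy u.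
Proof. by apply: Rintegral_ge0 => t _; exact: sqr_ge0. Qed.

Lemma sqint_le u v (c : R) : cmeas (fun t : X => u (cpoint t)) -> 0 <= c ->
  (forall z, normc (u z) <= c * normc (v z)) -> sqint v -> sqint u.
Proof.
move=> mu_ c0 uv [mv voo]; split=> //.
apply: le_lt_trans (_ : (\int[mu]_t (c ^+ 2 * normc (v (cpoint t)) ^+ 2)%:E < +oo)%E).
  apply: nint_le => //.
  - exact: measurable_sqnorm.
  - by apply: measurable_funM => //; exact: measurable_sqnorm.
  - by move=> t; exact: sqr_ge0.
  - move=> t; rewrite -exprMn ler_pXn2r ?nnegrE ?mulr_ge0 ?normc_ge0//.
rewrite nintZ; last 3 first.
- exact: measurable_sqnorm.
- by move=> t; exact: sqr_ge0.
- exact: sqr_ge0.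
by apply: lte_mul_pinfty; rewrite ?lee_fin ?sqr_ge0.
Qed.

Lemma sqintD u v : sqint u -> sqint v -> sqint (fun z => u z + v z).
Proof.
move=> [mu_ uoo] [mv voo]; have muv := cmeasD mu_ mv; split=> //.
apply: le_lt_trans (_ : (\int[mu]_t (2 * normc (u (cpoint t)) ^+ 2 +
    2 * normc (v (cpoint t)) ^+ 2)%:E < +oo)%E).
  apply: nint_le => //.
  - exact: (measurable_sqnorm (u := fun z => u z + v z)).
  - by apply: measurable_funD; apply: measurable_funM => //; exact: measurable_sqnorm.
  - by move=> t; exact: sqr_ge0.
  move=> t; set a := u _; set b := v _.
  apply: le_trans (_ : (normc a + normc b) ^+ 2 <= _).
    by rewrite ler_pXn2r ?nnegrE ?addr_ge0 ?normc_ge0//; exact: le_normcD.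
  by rewrite sqrrD; have := sqr_ge0 (normc a - normc b); rewrite sqrrB; lra.
rewrite nintD; last 4 first.
- by apply: measurable_funM => //; exact: measurable_sqnorm.
- by apply: measurable_funM => //; exact: measurable_sqnorm.
- by move=> t; rewrite mulr_ge0// sqr_ge0.
- by move=> t; rewrite mulr_ge0// sqr_ge0.
rewrite !nintZ//; try exact: measurable_sqnorm; try (by move=> t; exact: sqr_ge0).
by apply: lte_add_pinfty; apply: lte_mul_pinfty => //; rewrite lee_fin.
Qed.

Lemma sqintZ (c : C) u : sqint u -> sqint (fun z => c * u z).
Proof.
move=> su; apply: (@sqint_le _ u (normc c)) => //.
- by apply: cmeasM; [exact: cmeas_cst|case: su].
- exact: normc_ge0.
- by move=> z; rewrite Normc.normcM.
Qed.

Lemma sqintB u v : sqint u -> sqint v -> sqint (fun z => u z - v z).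
Proof.
move=> su /(sqintZ (-1)) sv; have := sqintD su sv.
by under eq_fun => z do rewrite mulN1r.
Qed.

Lemma sqint_pair u v : sqint u -> sqint v ->
  (\int[mu]_t (normc (u (cpoint t)) * normc (v (cpoint t)))%:E <=
   (2^-1 * energy u + 2^-1 * energy v)%:E)%E.
Proof.
move=> su sv; have [mu_ uoo] := su; have [mv voo] := sv.
apply: le_trans (_ : (\int[mu]_t (2^-1 * normc (u (cpoint t)) ^+ 2 +
    2^-1 * normc (v (cpoint t)) ^+ 2)%:E <= _)%E).
  apply: nint_le => //.
  - by apply: measurable_funM; exact: cmeas_normc.
  - by apply: measurable_funD; apply: measurable_funM => //; exact: measurable_sqnorm.
  - by move=> t; rewrite mulr_ge0// normc_ge0.
  move=> t; set a := normc _; set b := normc _.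
  by have := sqr_ge0 (a - b); rewrite sqrrB; lra.
rewrite nintD; last 4 first.
- by apply: measurable_funM => //; exact: measurable_sqnorm.
- by apply: measurable_funM => //; exact: measurable_sqnorm.
- by move=> t; rewrite mulr_ge0// sqr_ge0.
- by move=> t; rewrite mulr_ge0// sqr_ge0.
rewrite !nintZ//; try exact: measurable_sqnorm; try (by move=> t; exact: sqr_ge0).
by rewrite !energyE// -!EFinM -EFinD.
Qed.

Lemma cintegrable_sqint u v : sqint u -> sqint v ->
  cintegrable mu (fun t => u (cpoint t) * conjc (v (cpoint t))).
Proof.
move=> su sv; split.
  by apply: cmeasM; [case: su|apply: cmeas_conj; case: sv].
under eq_integral => t _ do rewrite Normc.normcM normc_conj.
by apply: le_lt_trans (sqint_pair su sv) _; rewrite ltry.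
Qed.

Definition gavg (N : nat) (c : R) (a : Cn R n -> R) z : R :=
  Rintegral mu setT (fun t => gauss_weight N c (z - cpoint t) * a (cpoint t)).

Definition avg1 N c u z : R := gavg N c (fun w => normc (u w)) z.

Definition avg2 N c u z : R := gavg N c (fun w => normc (u w) ^+ 2) z.

Lemma measurable_gauss_weight1 N c z :
  measurable_fun setT (fun t : X => gauss_weight N c (z - cpoint t)).
Proof. by apply: measurable_gauss_weight => j; [exact: cmeas_cst|exact: cmeas_coord]. Qed.

Lemma gauss_weight_le_peak N c z : 0 < c -> gauss_weight N c z <= @peak R n N.
Proof.
move=> c0; rewrite ler_piMr ?peak_ge0// -expR0 ler_expR mulNr oppr_le0.
by rewrite mulr_ge0 ?nsq_ge0// divr_ge0// ltW.
Qed.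

Lemma gavg_ge0 N c (a : Cn R n -> R) z : (forall z, 0 <= a z) -> 0 <= gavg N c a z.
Proof. by move=> a0; apply: Rintegral_ge0 => t _; rewrite mulr_ge0// gauss_weight_ge0. Qed.

Lemma avg2E N c u z : 0 < c -> sqint u ->
  (\int[mu]_t (gauss_weight N c (z - cpoint t) * normc (u (cpoint t)) ^+ 2)%:E =
   (avg2 N c u z)%:E)%E.
Proof.
move=> c0 [mu_ uoo]; rewrite /avg2 /gavg /Rintegral fineK// ge0_fin_numE; last first.
  by apply: nint_ge0 => t; rewrite mulr_ge0 ?sqr_ge0 ?gauss_weight_ge0.
apply: le_lt_trans (_ : (\int[mu]_t (@peak R n N * normc (u (cpoint t)) ^+ 2)%:E < +oo)%E).
  apply: nint_le => //.
  - by apply: measurable_funM; [exact: measurable_gauss_weight1|exact: measurable_sqnorm].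
  - by apply: measurable_funM => //; exact: measurable_sqnorm.
  - by move=> t; rewrite mulr_ge0 ?sqr_ge0 ?gauss_weight_ge0.
  - by move=> t; rewrite ler_wpM2r ?sqr_ge0// gauss_weight_le_peak.
rewrite nintZ; last 3 first.
- exact: measurable_sqnorm.
- by move=> t; exact: sqr_ge0.
- exact: peak_ge0.
by apply: lte_mul_pinfty; rewrite ?lee_fin ?peak_ge0.
Qed.

Lemma avg1_cs N c u z : (0 < N)%N -> 0 < c -> sqint u ->
  (\int[mu]_t (gauss_weight N c (z - cpoint t) * normc (u (cpoint t)))%:E =
   (avg1 N c u z)%:E)%E /\
  avg1 N c u z ^+ 2 <= (c / 2) ^+ n * avg2 N c u z.
Proof.
move=> N0 c0 su; have [mu_ uoo] := su.
have := @weighted_cauchy_schwarz R n (fun t => gauss_weight N c (z - cpoint t))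
  (fun t => normc (u (cpoint t))) ((c / 2) ^+ n) (avg2 N c u z).
case.
- by rewrite exprn_gt0// divr_gt0.
- exact: measurable_gauss_weight1.
- exact: cmeas_normc.
- by move=> t; exact: gauss_weight_ge0.
- by move=> t; exact: normc_ge0.
- exact: gauss_weight_int.
- by rewrite avg2E.
move=> I IE [I0 Ile]; have gE : avg1 N c u z = I by rewrite /avg1 /gavg /Rintegral /= IE.
by rewrite gE.
Qed.

Lemma measurable_gavg N c (a : Cn R n -> R) : measurable_fun setT (fun t : X => a (cpoint t)) ->
  (forall z, 0 <= a z) -> measurable_fun setT (fun t : X => gavg N c a (cpoint t)).
Proof.
move=> ma a0; apply: (measurableT_comp (fine_measurable measurableT)).
pose f (p : X * X) := (gauss_weight N c (cpoint p.1 - cpoint p.2) * a (cpoint p.2))%:E.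
apply: (@measurable_fun_fubini_tonelli_F _ _ _ _ _ mu f).
- apply/measurable_EFinP; apply: measurable_funM; last exact: (measurableT_comp ma measurable_snd).
  apply: measurable_gauss_weight => j; have [m1 m2] := @cmeas_coord R n j.
    by split; [exact: (measurableT_comp m1 measurable_fst)|exact: (measurableT_comp m2 measurable_fst)].
  by split; [exact: (measurableT_comp m1 measurable_snd)|exact: (measurableT_comp m2 measurable_snd)].
- by move=> p; rewrite lee_fin mulr_ge0// gauss_weight_ge0.
Qed.

Lemma int_avg2 N c u : (0 < N)%N -> 0 < c -> sqint u ->
  (\int[mu]_t (avg2 N c u (cpoint t))%:E =
   ((c / 2) ^+ n * energy u)%:E)%E.
Proof.
move=> N0 c0 su; have [mu_ uoo] := su.
rewrite EFinM -energyE// -(@schur _ _ N c (fun w => normc (u w) ^+ 2))//.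
- by apply: eq_integral => t _; rewrite avg2E.
- exact: measurable_sqnorm.
- by move=> z; exact: sqr_ge0.
Qed.

(** Cauchy-Schwarz against the weight, then [schur]: averaging is bounded on L^2 with norm at most
    [(c / 2) ^+ n], uniformly in [N]. *)
Lemma sqint_avg1 N c u : (0 < N)%N -> 0 < c -> sqint u ->
  sqint (fun z => (avg1 N c u z)%:C) /\
  energy (fun z => (avg1 N c u z)%:C) <= (c / 2) ^+ n * ((c / 2) ^+ n * energy u).
Proof.
move=> N0 c0 su; have [mu_ uoo] := su.
have mg : measurable_fun setT (fun t : X => avg1 N c u (cpoint t)).
  by apply: measurable_gavg => [|z]; [exact: cmeas_normc|exact: normc_ge0].
have mc : cmeas (fun t : X => (avg1 N c u (cpoint t))%:C) by exact: cmeas_real.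
have cn : 0 <= (c / 2) ^+ n by rewrite exprn_ge0// divr_ge0// ltW.
have le : (\int[mu]_t (normc (avg1 N c u (cpoint t))%:C ^+ 2)%:E <=
    ((c / 2) ^+ n * ((c / 2) ^+ n * energy u))%:E)%E.
  rewrite [leRHS]EFinM -(int_avg2 N0 c0 su) -nintZ//; last 2 first.
  - by apply: measurable_gavg => [|z]; [exact: measurable_sqnorm|exact: sqr_ge0].
  - by move=> t; apply: gavg_ge0 => z; exact: sqr_ge0.
  apply: nint_le => //.
  - exact: (measurable_sqnorm (u := fun z => (avg1 N c u z)%:C)).
  - apply: measurable_funM => //.
    by apply: measurable_gavg => [|z]; [exact: measurable_sqnorm|exact: sqr_ge0].
  - by move=> t; exact: sqr_ge0.
  - by move=> t; rewrite normc_real real_normK ?num_real//; have [] := avg1_cs (cpoint t) N0 c0 su.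
have s : sqint (fun z => (avg1 N c u z)%:C).
  by split=> //; apply: le_lt_trans le _; rewrite ltry.
by split=> //; rewrite -lee_fin -energyE.
Qed.

(** The common pattern of all kernel estimates: once the integrand is dominated by a Gaussian weight
    times [|u|], integrability and a bound by [avg1] come together. *)
Lemma kernel_bound (F : X -> C) u (B : R) N c z : (0 < N)%N -> 0 < c -> 0 <= B ->
  cmeas F -> sqint u ->
  (forall t, normc (F t) <= B * (gauss_weight N c (z - cpoint t) * normc (u (cpoint t)))) ->
  cintegrable mu F /\ normc (Cint mu F) <= 2 * (B * avg1 N c u z).
Proof.
move=> N0 c0 B0 mF su FB; have [mu_ _] := su; have [gE _] := avg1_cs z N0 c0 su.
have mg : measurable_fun setT (fun t : X => gauss_weight N c (z - cpoint t) * normc (u (cpoint t))).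
  by apply: measurable_funM; [exact: measurable_gauss_weight1|exact: cmeas_normc].
have le : (\int[mu]_t (normc (F t))%:E <= (B * avg1 N c u z)%:E)%E.
  rewrite [leRHS]EFinM -gE -nintZ//; last by move=> t; rewrite mulr_ge0 ?gauss_weight_ge0 ?normc_ge0.
  apply: nint_le => //.
  - exact: cmeas_normc.
  - exact: measurable_funM.
  - by move=> t; exact: normc_ge0.
have iF : cintegrable mu F by split=> //; apply: le_lt_trans le _; rewrite ltry.
by split=> //; exact: Cint_bound.
Qed.

End SquareIntegrable.

(** * L^2 and the Bargmann space *)

Section L2Space.
Context {R : realType} {n : nat}.
Local Notation C := (Cplx R).
Local Notation X := ((n + n).-tuple (measurableTypeR R)).
Local Notation mu := (@leb R (n + n)).
Implicit Types (z w : Cn R n) (u v : Cn R n -> C).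
Local Open Scope complex_scope.

(** Taken from the definition by simple functions, without measurability: the dominating function
    will be [m * V], which is Borel only up to a null set. *)
Lemma ge0_integral_mono (f g : X -> \bar R) : (forall t, 0 <= f t)%E ->
  (forall t, f t <= g t)%E -> (\int[mu]_t f t <= \int[mu]_t g t)%E.
Proof.
move=> f0 fg; have g0 t : (0 <= g t)%E := le_trans (f0 t) (fg t).
rewrite !ge0_integralTE//; apply: ereal_sup_le => _ [h hf <-].
by exists h => // t; exact: le_trans (hf t) (fg t).
Qed.

Lemma Lpnorm2E u :
  Lpnorm 2%:E u = ((\int[mu]_t (normc (u (cpoint t)) ^+ 2)%:E) `^ 2^-1)%E.
Proof.
rewrite /Lpnorm unlock; congr (_ `^ _)%E; apply: eq_integral => t _.
by rewrite /= ger0_norm ?normc_ge0// powR_mulrn// normc_ge0.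
Qed.

Lemma Lpnorm2_energy u : sqint u -> Lpnorm 2%:E u = (Num.sqrt (energy u))%:E.
Proof.
move=> su; rewrite Lpnorm2E energyE// poweR_EFin powR12_sqrt//.
exact: energy_ge0.
Qed.

Lemma Lpnorm2_lty u : (Lpnorm 2%:E u < +oo)%E ->
  (\int[mu]_t (normc (u (cpoint t)) ^+ 2)%:E < +oo)%E.
Proof.
rewrite Lpnorm2E; set J := integral _ _ _.
have : (0 <= J)%E by apply: nint_ge0 => t; exact: sqr_ge0.
case: J => [r _ _|//|//]; first exact: ltry.
by rewrite poweRyr// ?ltxx// invr_eq0.
Qed.

Lemma sqint_L2 u : cmeas (fun t : X => u (cpoint t)) -> L2 u -> sqint u.
Proof. by move=> mu_ [_ /Lpnorm2_lty]. Qed.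

Lemma L2_sqint u : sqint u -> L2 u.
Proof.
move=> su; split; last by rewrite Lpnorm2_energy// ltry.
by exists u; [case: su|exact/nearW].
Qed.

Lemma L2_dominated u v (c : R) : cmeas (fun t : X => u (cpoint t)) ->
  (forall z, normc (u z) <= c * normc (v z)) -> L2 v -> sqint u.
Proof.
move=> mu_ uv [_ /Lpnorm2_lty voo]; split=> //.
have [c0|c0] := ltP 0 c; last first.
  rewrite (_ : (fun _ => _) = fun=> 0%E) ?integral0 ?ltry//.
  apply/funext => t; have := uv (cpoint t).
  have : c * normc (v (cpoint t)) <= 0 by rewrite mulr_le0_ge0// normc_ge0.
  by have := normc_ge0 (u (cpoint t)) => a b d; rewrite (_ : normc _ = 0) ?expr0n//; lra.
have c2 : 0 < c ^+ 2 by rewrite exprn_gt0.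
have le : (\int[mu]_t (c ^- 2 * normc (u (cpoint t)) ^+ 2)%:E <=
    \int[mu]_t (normc (v (cpoint t)) ^+ 2)%:E)%E.
  apply: ge0_integral_mono => t.
    by rewrite lee_fin mulr_ge0 ?sqr_ge0// invr_ge0 ltW.
  rewrite lee_fin mulrC ler_pdivrMr// mulrC -exprMn.
  by rewrite ler_pXn2r ?nnegrE ?mulr_ge0 ?normc_ge0// ltW.
move: le; rewrite nintZ; last 3 first.
- exact: measurable_sqnorm.
- by move=> t; exact: sqr_ge0.
- by rewrite invr_ge0 ltW.
move=> /le_lt_trans /(_ voo); set J := integral _ _ _.
have : (0 <= J)%E by apply: nint_ge0 => t; exact: sqr_ge0.
case: J => [r _ _|_|//]; first exact: ltry.
by rewrite gt0_muley// lte_fin invr_gt0.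
Qed.

Lemma Hspace_bargmann N u : Hspace N u -> exists2 v, holomorphic v & u = bargmann N v.
Proof. by move=> [_ [v hv ->]]; exists v. Qed.

Lemma continuous_bargmann N v : holomorphic v -> continuous (bargmann N v).
Proof.
move=> hv; apply: continuous_CnCM; last exact: holomorphic_continuous.
apply: continuous_Cn_real; apply: (continuous_Cn_comp (h := expR)); first exact: continuous_expR.
move=> z; apply: (@continuousN _ _ _ (fun z : Cn R n => N%:R * Phi z : R)).
by apply: continuous_CnM; [exact: continuous_Cn_cst|exact: continuous_Phi].
Qed.

Lemma Hspace_continuous N u : Hspace N u -> continuous u.
Proof. by move=> /Hspace_bargmann[v hv ->]; exact: continuous_bargmann. Qed.

Lemma Hspace_sqint N u : Hspace N u -> sqint u.
Proof.
move=> Hu; apply: sqint_L2; last by case: Hu.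
by apply: cmeas_continuous; exact: Hspace_continuous Hu.
Qed.

Lemma HspaceB N u v : Hspace N u -> Hspace N v -> Hspace N (fun z => u z - v z).
Proof.
move=> Hu Hv; split.
  by apply: L2_sqint; apply: sqintB; [exact: (Hspace_sqint Hu)|exact: (Hspace_sqint Hv)].
have [_ [a ha uE]] := Hu; have [_ [b hb vE]] := Hv.
exists (fun z => a z - b z).
  by move=> z; apply: differentiableB; [exact: ha|exact: hb].
by apply/funext => z; rewrite uE vE mulrBr.
Qed.

Lemma HspaceZ N (c : C) u : Hspace N u -> Hspace N (fun z => c * u z).
Proof.
move=> Hu; split.
  by apply: L2_sqint; apply: sqintZ; exact: Hspace_sqint Hu.
have [_ [a ha uE]] := Hu; exists (fun z => c * a z).
  move=> z; have : differentiable (c \*: a) z by apply: differentiableZ; exact: ha.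
  by [].
by apply/funext => z; rewrite uE mulrCA.
Qed.

Lemma innerE u v : inner u v = Cint mu (fun t => u (cpoint t) * conjc (v (cpoint t))).
Proof. by []. Qed.

Lemma normcM_conj (x : C) : x * conjc x = ((normc x) ^+ 2)%:C.
Proof. by apply: complex_eq; rewrite !complexE_simp normc_sqr /=; ring. Qed.

Lemma Cint_energy u : sqint u ->
  Cint mu (fun t => u (cpoint t) * conjc (u (cpoint t))) = (energy u)%:C.
Proof.
move=> su; apply: complex_eq; rewrite /energy /Cint /Rintegral /=.
  congr fine; by apply: eq_integral => t _; rewrite normcM_conj.
rewrite (_ : 0 = fine (0%:E)%E)//; congr fine; rewrite -[RHS](@integral0 _ _ _ mu setT).
by apply: eq_integral => t _; rewrite normcM_conj.
Qed.

End L2Space.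

(** * The integral operator with the Bergman kernel *)

Section Projection.
Context {R : realType} {n : nat}.
Local Notation C := (Cplx R).
Local Notation Re := complex.Re.
Local Notation Im := complex.Im.
Local Notation X := ((n + n).-tuple (measurableTypeR R)).
Local Notation mu := (@leb R (n + n)).
Variable N : nat.
Hypothesis N0 : (0 < N)%N.
Implicit Types (z w h : Cn R n) (u v : Cn R n -> C).
Local Open Scope complex_scope.

(** The explicit candidate for the orthogonal projection; [orth_projE] identifies the two. *)
Definition proj u z : C := Cint mu (fun t => bker N z (cpoint t) * u (cpoint t)).

Lemma cmeas_bker1 z : cmeas (fun t : X => bker N z (cpoint t)).
Proof. by apply: cmeas_bker => j; [exact: cmeas_cst|exact: cmeas_coord]. Qed.

Lemma bker_bound z u : sqint u ->
  cintegrable mu (fun t => bker N z (cpoint t) * u (cpoint t)) /\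
  normc (proj u z) <= 2 * avg1 N 4 u z.
Proof.
move=> su; have := @kernel_bound R n (fun t => bker N z (cpoint t) * u (cpoint t)) u 1 N 4 z.
rewrite !mul1r; apply => //.
- by apply: cmeasM; [exact: cmeas_bker1|case: su].
- by move=> t; rewrite mul1r Normc.normcM normc_bker gkerE.
Qed.

Lemma Hspace_reproducing u z : Hspace N u -> proj u z = u z.
Proof.
move=> Hu; have su := Hspace_sqint Hu; have [iu _] := bker_bound z su.
have [v hv uE] := Hspace_bargmann Hu; move: iu; rewrite /proj uE => iu.
exact: reproducing.
Qed.

Definition hs h : R := \sum_(j < n) normc (h 0 j).

Lemma hs_ge0 h : 0 <= hs h.
Proof. by apply: sumr_ge0 => j _; exact: normc_ge0. Qed.

Definition dbar_exponent z w h : C := (N%:R / 2)%:C * \sum_(j < n) conjc ((w - z) 0 j) * h 0 j.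

Definition moment u z j : C :=
  Cint mu (fun t => bker N z (cpoint t) * conjc ((cpoint t - z) 0 j) * u (cpoint t)).

(* [proj u (z + h)] is [twisted u z h] times a factor independent of [u]; the
   latter is holomorphic in [h], with derivative given by the moments. *)
Definition twisted u z h : C :=
  Cint mu (fun t => bker N z (cpoint t) * cexp (dbar_exponent z (cpoint t) h) * u (cpoint t)).

Lemma dbar_exponent_le z w h : normc (dbar_exponent z w h) <= N%:R / 2 * (hs h * Num.sqrt (nsq (z - w))).
Proof.
rewrite Normc.normcM normc_real ger0_norm ?divr_ge0// ler_wpM2l ?divr_ge0//.
have le_sum (I : Type) (r : seq I) (F : I -> C) :
    normc (\sum_(i <- r) F i) <= \sum_(i <- r) normc (F i).
  elim: r => [|i r IH]; first by rewrite !big_nil Normc.normc0.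
  by rewrite !big_cons; apply: le_trans (le_normcD _ _) _; rewrite lerD2l.
apply: le_trans (le_sum _ _ _) _; rewrite /hs mulr_suml; apply: ler_sum => j _.
rewrite Normc.normcM normc_conj mulrC ler_wpM2l ?normc_ge0// nsqB.
rewrite -(ger0_norm (normc_ge0 _)) -sqrtr_sqr ler_wsqrtr//; exact: normc_le_nsq.
Qed.

(** With [exp (N Phi)] restored, the kernel is the exponential of a quadratic polynomial in [z] and
    [conj w], up to a factor in [w] alone. Shifting [z] by [h] produces a mixed term
    [dbar_exponent], linear in [h], and terms free of [w]. *)
Lemma bker_shift z w h :
  (expR (N%:R * Phi (z + h)))%:C * bker N (z + h) w =
  (expR (N%:R * Phi z))%:C *
  cexp ((0 +i* (- N%:R)) * (\sum_(j < n) (Im (z 0 j))%:C * h 0 j) -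
        (N%:R / 4)%:C * \sum_(j < n) h 0 j * h 0 j) *
  (bker N z w * cexp (dbar_exponent z w h)) :> C.
Proof.
have Er (r : R) : (expR r)%:C = cexp r%:C :> C.
  by apply: complex_eq; rewrite /= ?cos0 ?sin0 ?mulr1 ?mulr0.
rewrite /bker /gker !rmorphM /= !Er.
set P : C := (@peak R n N)%:C.
set e1 := cexp _; set e2 := cexp _; set e3 := cexp _; set e4 := cexp _; set e5 := cexp _; set e6 := cexp _; set e7 := cexp _; set e8 := cexp _.
suff E : e1 * e2 * e3 = e4 * e5 * e6 * e7 * e8.
  transitivity (P * (e1 * e2 * e3)); first by ring.
  by rewrite E; ring.
rewrite /e1 /e2 /e3 /e4 /e5 /e6 /e7 /e8 -!cexpD; congr cexp.
have nE y : nsq y = \sum_(j < n) (Re (y 0 j) ^+ 2 + Im (y 0 j) ^+ 2) :> R.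
  by apply: eq_bigr => j _; rewrite normc_sqr.
apply: complex_eq; rewrite /dbar_exponent !complexE_simp /= /bphase ?cRe_sum ?cIm_sum ?nE /Phi.
  rewrite !(mul0r, mulr0, subr0, addr0, sub0r, add0r, oppr0).
  rewrite !mulr_sumr -?sumrN -?big_split -?sumrN -?big_split -?sumrN -?big_split /=; apply: eq_bigr => j _.
  by rewrite !mxE !complexE_simp /=; field.
rewrite !(mul0r, mulr0, subr0, addr0, sub0r, add0r, oppr0).
rewrite !mulr_sumr -?sumrN -?big_split -?sumrN -?big_split -?sumrN -?big_split /=; apply: eq_bigr => j _.
by rewrite !mxE !complexE_simp /=; field.
Qed.

Lemma cmeas_dbar_exponent z h : cmeas (fun t : X => dbar_exponent z (cpoint t) h).
Proof.
apply: cmeasM; first exact: cmeas_cst.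
apply: cmeas_sum => j.
apply: cmeasM; last exact: cmeas_cst.
apply: cmeas_conj.
have -> : (fun t : X => (cpoint t - z) 0 j) = (fun t => cpoint t 0 j - z 0 j).
  by apply/funext => t; rewrite !mxE.
by apply: cmeasB; [exact: cmeas_coord|exact: cmeas_cst].
Qed.

(** As [a / 2 <= a^2 / 16 + 1], a part [1/16] of the Gaussian exponent pays for the linear term, and
    [1/4 - 1/16 = 3/16] gives the width 16/3. The factor [expR N] is harmless because the expansion
    serves only to differentiate at fixed [N]. *)
Lemma exponent_absorb z w h : hs h <= 1 ->
  expR (normc (dbar_exponent z w h)) * gker N (z - w) <= expR N%:R * gauss_weight N (16 / 3) (z - w).
Proof.
move=> h1; rewrite gkerE /gauss_weight mulrCA [leRHS]mulrCA ler_wpM2l ?peak_ge0//.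
rewrite -!expRD ler_expR.
have := dbar_exponent_le z w h; set a := Num.sqrt _.
have a0 : 0 <= a by exact: sqrtr_ge0.
have a2 : a ^+ 2 = nsq (z - w) by rewrite sqr_sqrtr// nsq_ge0.
rewrite -a2 => H.
have : N%:R / 2 * (hs h * a) <= N%:R / 16 * (a ^+ 2 + 16).
  have E : 0 <= N%:R / 16 * (a - 4) ^+ 2 :> R by rewrite mulr_ge0 ?divr_ge0// sqr_ge0.
  have E2 : N%:R / 2 * (hs h * a) <= N%:R / 2 * a.
    by rewrite ler_wpM2l ?divr_ge0// ler_piMl.
  apply: le_trans E2 _.
  rewrite (_ : N%:R / 16 * _ = N%:R / 2 * a + N%:R / 16 * (a - 4) ^+ 2); last by field.
  by rewrite lerDl mulr_ge0 ?divr_ge0// sqr_ge0.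
move=> H2; have H3 := le_trans H H2.
rewrite (_ : (- (N%:R / (16 / 3)) * _)= N%:R / 16 * a ^+ 2 + - (N%:R / 4) * a ^+ 2); last by field.
rewrite addrA lerD2r; apply: le_trans H3 _; rewrite le_eqVlt; apply/orP; left; apply/eqP; by field.
Qed.

(** Taylor expansion of the exponential under the integral. Only the existence of [K] matters, and
    it depends on [N] and [z]. *)
Lemma twisted_expansion u z : sqint u ->
  exists2 K : R, 0 <= K & forall h, hs h <= 1 ->
  normc (twisted u z h - proj u z - (N%:R / 2)%:C * \sum_(j < n) h 0 j * moment u z j) <= K * hs h ^+ 2.
Proof.
move=> su; have [mu_ _] := su.
have NR : (0 : R) < N%:R by rewrite ltr0n.
have NE : (0 : R) < expR N%:R by exact: expR_gt0.
have [k k0 Hk] : exists2 k : R, 0 < k & forall N, (0 < N)%N -> forall u : Cn R n,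
    (1 + N%:R * nsq u) ^+ 1 * gauss_weight N (16 / 3) u <= k * gauss_weight N 8 u.
  by apply: gauss_weight_le; apply/andP; split; lra.
pose g z t := gauss_weight N 8 (z - cpoint t) : R.
have kb (F : X -> C) (B : R) : 0 <= B -> cmeas F ->
   (forall t, normc (F t) <= B * (g z t * normc (u (cpoint t)))) ->
   cintegrable mu F /\ normc (Cint mu F) <= 2 * (B * avg1 N 8 u z).
  by move=> B0 mF HF; apply: kernel_bound.
have mb := cmeas_bker1 z.
have mcoord j : cmeas (fun t : X => conjc ((cpoint t - z) 0 j)).
  apply: cmeas_conj; have -> : (fun t : X => (cpoint t - z) 0 j) = (fun t => cpoint t 0 j - z 0 j).
    by apply/funext => t; rewrite !mxE.
  by apply: cmeasB; [exact: cmeas_coord|exact: cmeas_cst].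
have [i0 _] := bker_bound z su.
have n1 (w : Cn R n) : 1 <= 1 + N%:R * nsq w by rewrite lerDl mulr_ge0 ?nsq_ge0.
have Hk1 (w : Cn R n) : gauss_weight N (16 / 3) w <= k * gauss_weight N 8 w.
  by apply: le_trans (Hk N N0 w); rewrite expr1 ler_peMl ?gauss_weight_ge0.
have ij j : cintegrable mu (fun t => bker N z (cpoint t) * conjc ((cpoint t - z) 0 j) * u (cpoint t)).
  apply: (kb _ k (ltW k0) _ _).1; first by apply: cmeasM => //; exact: cmeasM.
  move=> t; rewrite 2!Normc.normcM normc_bker normc_conj mulrA ler_wpM2r ?normc_ge0//.
  apply: le_trans (Hk N N0 (z - cpoint t)); rewrite expr1 mulrC gkerE.
  apply: ler_pM; rewrite ?normc_ge0 ?gauss_weight_ge0//; last first.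
    by apply: gauss_weight_mono; apply/andP; split; lra.
  have := normc_le_nsq (cpoint t - z) j; rewrite (nsqB z) => H.
  have H2 : nsq (cpoint t - z) <= N%:R * nsq (cpoint t - z) by rewrite ler_peMl ?nsq_ge0// ler1n.
  by have := sqr_ge0 (normc ((cpoint t - z) 0 j) - 2^-1); rewrite sqrrB; lra.
exists (2 * (N%:R * expR N%:R * k * avg1 N 8 u z)).
  by rewrite !mulr_ge0 ?expR_ge0 ?(ltW k0)//; apply: gavg_ge0 => w; exact: normc_ge0.
move=> h h1; set e := fun t => dbar_exponent z (cpoint t) h.
have me : cmeas e by exact: cmeas_dbar_exponent.
have it : cintegrable mu (fun t => bker N z (cpoint t) * cexp (e t) * u (cpoint t)).
  have B0 : 0 <= expR N%:R * k by rewrite mulr_ge0 ?expR_ge0// ltW.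
  apply: (kb _ _ B0 _ _).1.
    by apply: cmeasM => //; apply: cmeasM => //; exact: cmeas_cexp.
  move=> t; rewrite 2!Normc.normcM normc_bker normc_cexp mulrA ler_wpM2r ?normc_ge0//.
  apply: le_trans (_ : expR (normc (e t)) * gker N (z - cpoint t) <= _).
    rewrite mulrC ler_wpM2r ?gker_ge0// ler_expR; exact: le_trans (ler_norm _) (normr_Re _).
  apply: le_trans (exponent_absorb z (cpoint t) h1) _.
  by rewrite -mulrA ler_wpM2l ?expR_ge0.
have il : cintegrable mu (fun t => bker N z (cpoint t) * e t * u (cpoint t)) /\
    Cint mu (fun t => bker N z (cpoint t) * e t * u (cpoint t)) =
    (N%:R / 2)%:C * \sum_(j < n) h 0 j * moment u z j.
  have E t : bker N z (cpoint t) * e t * u (cpoint t) =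
      (N%:R / 2)%:C * \sum_(j < n) h 0 j * (bker N z (cpoint t) * conjc ((cpoint t - z) 0 j) * u (cpoint t)).
    rewrite /e /dbar_exponent mulrCA -mulrA mulr_sumr mulr_suml; congr (_ * _).
    by apply: eq_bigr => j _; ring.
  have is_ : cintegrable mu (fun t => \sum_(j < n) h 0 j * (bker N z (cpoint t) * conjc ((cpoint t - z) 0 j) * u (cpoint t))).
    by apply: cintegrable_sum => j; exact: cintegrableZ.
  have -> : (fun t => bker N z (cpoint t) * e t * u (cpoint t)) =
      (fun t => (N%:R / 2)%:C * \sum_(j < n) h 0 j * (bker N z (cpoint t) * conjc ((cpoint t - z) 0 j) * u (cpoint t))).
    by apply/funext => t; exact: E.
  split; first exact: cintegrableZ.
  rewrite CintZ// Cint_sum; last by move=> j; exact: cintegrableZ.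
  by congr (_ * _); apply: eq_bigr => j _; rewrite CintZ.
case: il => il <-.
rewrite /twisted /proj -CintB// -CintB//; last exact: cintegrableB.
have -> : 2 * (N%:R * expR N%:R * k * avg1 N 8 u z) * hs h ^+ 2 =
   2 * (N%:R * expR N%:R * k * hs h ^+ 2 * avg1 N 8 u z) by ring.
apply: (kb _ _ _ _ _).2.
- by rewrite !mulr_ge0 ?expR_ge0 ?(ltW k0) ?hs_ge0.
- apply: cmeasB; first apply: cmeasB.
  + by apply: cmeasM => //; apply: cmeasM => //; exact: cmeas_cexp.
  + exact: cmeasM.
  + by apply: cmeasM => //; exact: cmeasM.
move=> t.
have -> : bker N z (cpoint t) * cexp (e t) * u (cpoint t) - bker N z (cpoint t) * u (cpoint t) -
   bker N z (cpoint t) * e t * u (cpoint t) =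
   bker N z (cpoint t) * (cexp (e t) - 1 - e t) * u (cpoint t) by ring.
rewrite 2!Normc.normcM normc_bker mulrA ler_wpM2r ?normc_ge0//.
apply: le_trans (_ : gker N (z - cpoint t) * (4 * normc (e t) ^+ 2 * expR (normc (e t))) <= _).
  by rewrite ler_wpM2l ?gker_ge0// cexp_taylor.
have e2 : 4 * normc (e t) ^+ 2 <= N%:R * hs h ^+ 2 * (1 + N%:R * nsq (z - cpoint t)).
  have := dbar_exponent_le z (cpoint t) h; rewrite -/(e t) => H.
  apply: le_trans (_ : 4 * (N%:R / 2 * (hs h * Num.sqrt (nsq (z - cpoint t)))) ^+ 2 <= _).
    rewrite ler_wpM2l// ler_pXn2r ?nnegrE ?normc_ge0 ?mulr_ge0 ?divr_ge0 ?sqrtr_ge0 ?hs_ge0//.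
  rewrite !exprMn sqr_sqrtr ?nsq_ge0//.
  have : 0 <= N%:R * hs h ^+ 2 :> R by rewrite mulr_ge0// sqr_ge0.
  rewrite mulrDr mulr1 => H3.
  apply: le_trans (_ : N%:R * hs h ^+ 2 * (N%:R * nsq (z - cpoint t)) <= _); last by rewrite lerDr.
  by rewrite le_eqVlt; apply/orP; left; apply/eqP; field.
rewrite mulrCA; have ex := exponent_absorb z (cpoint t) h1; rewrite -/(e t) in ex.
apply: le_trans (_ : N%:R * hs h ^+ 2 * (1 + N%:R * nsq (z - cpoint t)) *
    (expR N%:R * gauss_weight N (16 / 3) (z - cpoint t)) <= _).
  apply: ler_pM => //.
  - by rewrite mulr_ge0// sqr_ge0.
  - by rewrite mulr_ge0 ?gker_ge0 ?expR_ge0.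
  - by rewrite mulrC.
rewrite (_ : N%:R * hs h ^+ 2 * (1 + N%:R * nsq (z - cpoint t)) * _ =
   N%:R * hs h ^+ 2 * expR N%:R * ((1 + N%:R * nsq (z - cpoint t)) ^+ 1 * gauss_weight N (16 / 3) (z - cpoint t))); last by rewrite expr1; ring.
apply: le_trans (_ : N%:R * hs h ^+ 2 * expR N%:R * (k * g z t) <= _).
  by rewrite ler_wpM2l ?Hk// !mulr_ge0 ?expR_ge0 ?hs_ge0.
by rewrite le_eqVlt; apply/orP; left; apply/eqP; ring.
Qed.

End Projection.

(** * The Bergman projection *)

Lemma is_derive_quadratic (R : realType) (f : R -> R) (x b K d : R) : 0 < d ->
  (forall t, `|t| <= d -> `|f (x + t) - f x - t * b| <= K * t ^+ 2) ->
  is_derive x 1 f b.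
Proof.
move=> d0 H.
have K0 : 0 <= K.
  have := H d; rewrite (gtr0_norm d0) => /(_ (lexx _)).
  by move=> /(le_trans (normr_ge0 _)); rewrite pmulr_lge0// exprn_gt0.
suff C : h^-1 *: (f (h *: 1 + x) - f x) @[h --> 0^'] --> b.
  have D : derivable f x 1 by apply/cvg_ex; exists b.
  by apply: DeriveDef => //; exact: cvg_lim.
apply/cvgrPdist_le => e e0.
near=> h.
have h0 : h != 0 by near: h; exact: nbhs_dnbhs_neq.
have h1 : `|h| <= d by near: h; exact: dnbhs0_le.
have h2 : `|h| <= e / (K + 1).
  near: h; apply: dnbhs0_le; rewrite divr_gt0//.
  by rewrite (lt_le_trans ltr01)// lerDr.
rewrite -normrN opprB /GRing.scale/= mulr1 (addrC h).
have -> : h^-1 * (f (x + h) - f x) - b = h^-1 * (f (x + h) - f x - h * b).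
  by field.
rewrite normrM normfV ler_pdivrMl ?normr_gt0//.
apply: le_trans (H h h1) _.
rewrite -real_normK ?num_real// expr2 mulrA (mulrC _ e) ler_wpM2r//.
apply: le_trans (_ : K * (e / (K + 1)) <= _); first by rewrite ler_wpM2l.
rewrite mulrCA ger_pMr// ler_pdivrMr ?mul1r ?lerDl//.
by rewrite (lt_le_trans ltr01)// lerDr.
Unshelve. all: by end_near.
Qed.

Section QuadraticExpansion.
Context {R : realType} {n : nat}.
Local Notation C := (Cplx R).
Implicit Types (z w h : Cn R n) (u v : Cn R n -> C).
Local Open Scope complex_scope.

Lemma normc_sum_le (I : Type) (r : seq I) (F : I -> C) :
  normc (\sum_(i <- r) F i) <= \sum_(i <- r) normc (F i).
Proof.
elim: r => [|i r IH]; first by rewrite !big_nil Normc.normc0.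
by rewrite !big_cons; apply: le_trans (le_normcD _ _) _; rewrite lerD2l.
Qed.

Lemma hs_linear_le (L : 'I_n -> C) h :
  normc (\sum_(j < n) h 0 j * L j) <= (\sum_(j < n) normc (L j)) * hs h.
Proof.
apply: le_trans (normc_sum_le _ _) _; rewrite mulr_suml; apply: ler_sum => j _.
rewrite Normc.normcM mulrC ler_wpM2l ?normc_ge0// /hs (bigD1 j)//= lerDl.
by apply: sumr_ge0 => i _; exact: normc_ge0.
Qed.

Lemma normc_coord_le h j : normc (h 0 j) <= complex.Re `|h|.
Proof.
rewrite leNgt; apply/negP => lt.
have : ball (0 : Cn R n) (normc (h 0 j))%:C h.
  by rewrite mx_norm_ball /ball_ /= sub0r normrN norm_Cn_real ltcR.
move=> [_ /(_ 0 j)]; rewrite /ball /= mxE sub0r normrN normr_normc.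
by rewrite ltxx.
Qed.

Definition lform (L : 'I_n -> C) h : C := \sum_(j < n) h 0 j * L j.

Lemma lform_is_linear L : linear (lform L : Cn R n -> C).
Proof.
move=> a x y; rewrite /lform /GRing.scale /= mulr_sumr -big_split /=.
by apply: eq_bigr => j _; rewrite !mxE mulrDl mulrA.
Qed.

HB.instance Definition _ L := GRing.isLinear.Build _ _ _ _ (lform L) (lform_is_linear L).

Lemma continuous_lform L : continuous (lform L).
Proof.
apply: continuous_CnC_sum => j.
by apply: continuous_CnCM; [exact: continuous_coord|exact: continuous_CnC_cst].
Qed.

Lemma differentiable_quadratic v z (L : 'I_n -> C) (K : R) :
  (forall h, hs h <= 1 ->
    normc (v (z + h) - v z - \sum_(j < n) h 0 j * L j) <= K * hs h ^+ 2) ->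
  differentiable v z.
Proof.
move=> H.
suff E : v \o shift z = cst (v z) + (lform L : Cn R n -> C) +o_ (0 : Cn R n) id.
  apply/diff_locallyP; rewrite (diff_unique (@continuous_lform L) E).
  by split => //; exact: continuous_lform.
apply/eqaddoP => eps e0.
have er : eps = (complex.Re eps)%:C by move: e0; case: (eps) => a b; rewrite ltcE /= => /andP[/eqP -> _].
move: e0; rewrite er ltcR; set e := complex.Re eps => e0.
pose M := (n%:R + 1) ^+ 2 * (`|K| + 1) : R.
have M0 : 0 < M by rewrite mulr_gt0 ?exprn_gt0 ?ltr_wpDl.
have n0 : 0 < n%:R + 1 :> R by rewrite ltr_wpDl.
apply/nbhs_CnP; exists (Num.min (n%:R + 1)^-1 (e / M)).
  by rewrite lt_min invr_gt0 n0 divr_gt0.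
move=> h hsmall /=.
have hj j : normc (h 0 j) <= Num.min (n%:R + 1)^-1 (e / M).
  by have := hsmall j; rewrite mxE subr0 => /ltW.
have hsle (b : R) : 0 <= b -> (forall j, normc (h 0 j) <= b) -> hs h <= (n%:R + 1) * b.
  move=> b0 hb; apply: le_trans (_ : \sum_(j < n) b <= _); first exact: ler_sum.
  by rewrite sumr_const card_ord -[leLHS]mulr_natl ler_wpM2r// lerDl.
have hs1 : hs h <= 1.
  apply: le_trans (hsle (n%:R + 1)^-1 _ _) _.
  - by rewrite invr_ge0 ltW.
  - by move=> j; apply: le_trans (hj j) _; rewrite ge_min lexx.
  - by rewrite divff// gt_eqF.
have -> : (v \o shift z - (cst (v z) + lform L)) h = v (z + h) - v z - \sum_(j < n) h 0 j * L j.
  transitivity (v (h + z) - (v z + lform L h)); first by [].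
  by rewrite opprD addrA (addrC h).
rewrite normr_normc norm_Cn_real -rmorphM /= lecR.
apply: le_trans (H h hs1) _.
have a1 : hs h <= (n%:R + 1) * complex.Re `|h|.
  by apply: hsle; [exact: Re_norm_Cn_ge0|exact: normc_coord_le].
have a2 : hs h <= (n%:R + 1) * (e / M).
  apply: hsle; first by rewrite divr_ge0// ltW.
  by move=> j; apply: le_trans (hj j) _; rewrite ge_min lexx orbT.
have Hn : 0 <= complex.Re `|h| by exact: Re_norm_Cn_ge0.
apply: le_trans (_ : (`|K| + 1) * (((n%:R + 1) * (e / M)) * ((n%:R + 1) * complex.Re `|h|)) <= _).
  apply: le_trans (_ : (`|K| + 1) * hs h ^+ 2 <= _).
    by rewrite ler_wpM2r ?sqr_ge0//; apply: le_trans (ler_norm _) _; rewrite lerDl.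
  rewrite ler_wpM2l ?addr_ge0// expr2; apply: ler_pM => //; exact: hs_ge0.
rewrite le_eqVlt; apply/orP; left; apply/eqP; rewrite /M.
by field; rewrite !gt_eqF// ltr_wpDl.
Qed.

End QuadraticExpansion.

Section BergmanProjection.
Context {R : realType} {n : nat}.
Local Notation C := (Cplx R).
Local Notation Re := complex.Re.
Local Notation Im := complex.Im.
Local Notation X := ((n + n).-tuple (measurableTypeR R)).
Local Notation mu := (@leb R (n + n)).
Variable N : nat.
Hypothesis N0 : (0 < N)%N.
Implicit Types (z w h : Cn R n) (u v : Cn R n -> C).
Local Open Scope complex_scope.

(** The exponent in [bker_shift] that does not involve [w]; it is holomorphic in [h]. *)
Definition hol_exponent z h : C :=
  (0 +i* (- N%:R)) * (\sum_(j < n) (Im (z 0 j))%:C * h 0 j) -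
  (N%:R / 4)%:C * \sum_(j < n) h 0 j * h 0 j.

Lemma proj_shift u z h : sqint u ->
  twisted N u z h =
  (expR (N%:R * Phi (z + h) - N%:R * Phi z))%:C * cexp (- hol_exponent z h) * proj N u (z + h).
Proof.
move=> su; have [iu _] := bker_bound N0 (z + h) su.
rewrite /proj -CintZ//; apply: eq_Cint => t.
have eu : cexp (- hol_exponent z h) * cexp (hol_exponent z h) = 1.
  by rewrite -cexpD addNr cexp0.
have := bker_shift N z (cpoint t) h; rewrite -/(hol_exponent z h).
set k := bker N (z + h) _; set k' := bker N z _ * _ => H.
have E : (expR (N%:R * Phi (z + h) - N%:R * Phi z))%:C * k = cexp (hol_exponent z h) * k'.
  rewrite expRD rmorphM /= mulrAC H expRN fmorphV /=.
  set x := (expR (N%:R * Phi z))%:C.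
  have x0 : x != 0 by rewrite eq_complex /= gt_eqF ?expR_gt0.
  by rewrite -(mulrA x) mulrAC divff// mul1r.
rewrite -[LHS]mul1r -eu.
transitivity (cexp (- hol_exponent z h) * (cexp (hol_exponent z h) * k') * u (cpoint t)).
  by rewrite /k'; ring.
by rewrite -E; ring.
Qed.

(** In modulus the factor relating [proj] to [twisted] collapses to a Gaussian in [h], which is flat
    to first order; hence the derivative of the squared modulus at [h = 0] sees only [twisted]. *)
Lemma normc_proj_shift u z h : sqint u ->
  normc (proj N u (z + h)) ^+ 2 =
  expR (- (N%:R / 2 * nsq h)) * normc (twisted N u z h) ^+ 2.
Proof.
move=> su; rewrite (proj_shift z h su) 2!Normc.normcM normc_cexp normc_real.
rewrite ger0_norm ?expR_ge0// -expRD exprMn mulrA -expRM_natl -expRD.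
rewrite [X in expR X](_ : _ = 0) ?expR0 ?mul1r//.
have nE y : nsq y = \sum_(j < n) (Re (y 0 j) ^+ 2 + Im (y 0 j) ^+ 2) :> R.
  by apply: eq_bigr => j _; rewrite normc_sqr.
rewrite nE /hol_exponent /Phi !complexE_simp /= ?cRe_sum ?cIm_sum.
rewrite !(mul0r, mulr0, subr0, addr0, sub0r, add0r, oppr0).
rewrite !mulr_sumr -?sumrN -?big_split -?sumrN -?big_split -?sumrN -?big_split /=.
rewrite mulr_sumr -big_split /=; apply: big1 => j _.
by rewrite !mxE !complexE_simp /=; field.
Qed.

Lemma cexp_hol_expansion z : exists2 K : R, 0 <= K & forall h, hs h <= 1 ->
  normc (cexp (hol_exponent z h) - 1 -
    \sum_(j < n) h 0 j * ((0 +i* (- N%:R)) * (Im (z 0 j))%:C)) <= K * hs h ^+ 2.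
Proof.
pose L j : C := (0 +i* (- N%:R)) * (Im (z 0 j))%:C.
pose l : R := \sum_(j < n) normc (L j).
have l0 : 0 <= l by apply: sumr_ge0 => j _; exact: normc_ge0.
pose b := l + N%:R / 4.
have b0 : 0 <= b by rewrite addr_ge0// divr_ge0.
exists (4 * b ^+ 2 * expR b + N%:R / 4).
  by rewrite addr_ge0 ?divr_ge0// mulr_ge0 ?expR_ge0// mulr_ge0// sqr_ge0.
move=> h h1; have h0 := hs_ge0 h.
have BE : hol_exponent z h = \sum_(j < n) h 0 j * L j - (N%:R / 4)%:C * \sum_(j < n) h 0 j * h 0 j.
  rewrite /hol_exponent; congr (_ - _); rewrite mulr_sumr; apply: eq_bigr => j _.
  by rewrite /L; ring.
have q : normc ((N%:R / 4)%:C * \sum_(j < n) h 0 j * h 0 j) <= N%:R / 4 * hs h ^+ 2.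
  rewrite Normc.normcM normc_real ger0_norm ?divr_ge0// ler_wpM2l ?divr_ge0// expr2.
  exact: hs_linear_le.
have q1 : N%:R / 4 * hs h ^+ 2 <= N%:R / 4 * hs h.
  by rewrite ler_wpM2l ?divr_ge0// expr2 ler_piMl.
have Bb : normc (hol_exponent z h) <= b * hs h.
  rewrite BE; apply: le_trans (le_normcD _ _) _; rewrite normcN mulrDl; apply: lerD.
    exact: hs_linear_le.
  exact: le_trans q q1.
rewrite -/(L _); have -> : cexp (hol_exponent z h) - 1 - \sum_(j < n) h 0 j * L j =
  (cexp (hol_exponent z h) - 1 - hol_exponent z h) - (N%:R / 4)%:C * \sum_(j < n) h 0 j * h 0 j.
  by rewrite {3}BE; ring.
apply: le_trans (le_normcD _ _) _; rewrite normcN mulrDl; apply: lerD => //.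
apply: le_trans (cexp_taylor _) _.
have Bb1 : normc (hol_exponent z h) <= b by apply: le_trans Bb _; rewrite ler_piMr.
apply: le_trans (_ : 4 * (b * hs h) ^+ 2 * expR b <= _); last by rewrite exprMn le_eqVlt; apply/orP; left; apply/eqP; ring.
have e0 := normc_ge0 (hol_exponent z h).
apply: ler_pM; rewrite ?expR_ge0 ?ler_expR ?mulr_ge0//.
by rewrite ler_wpM2l// ler_pXn2r// nnegrE mulr_ge0.
Qed.

(** With the weight removed, [proj N u (z + h)] is a constant times [cexp (hol_exponent z h) *
    twisted N u z h], a product of two factors with complex linear expansions in [h]. *)
Lemma proj_holomorphic u : sqint u ->
  holomorphic (fun z => (expR (N%:R * Phi z))%:C * proj N u z).
Proof.
move=> su z.
have [K K0 HK] := cexp_hol_expansion z.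
have [M M0 HM] := twisted_expansion N0 z su.
pose Lb j : C := (0 +i* (- N%:R)) * (Im (z 0 j))%:C.
pose La j : C := (N%:R / 2)%:C * moment N u z j.
pose A0 := proj N u z; pose c0 : C := (expR (N%:R * Phi z))%:C.
pose la : R := \sum_(j < n) normc (La j).
pose lb : R := \sum_(j < n) normc (Lb j).
have la0 : 0 <= la by apply: sumr_ge0 => j _; exact: normc_ge0.
have lb0 : 0 <= lb by apply: sumr_ge0 => j _; exact: normc_ge0.
apply: (@differentiable_quadratic R n _ z (fun j => c0 * (La j + A0 * Lb j))
  (normc c0 * (K * (normc A0 + (M + la)) + M + lb * (M + la)))) => h h1.
have h0 := hs_ge0 h.
have vE : (expR (N%:R * Phi (z + h)))%:C * proj N u (z + h) =
    c0 * (cexp (hol_exponent z h) * twisted N u z h).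
  rewrite (proj_shift z h su) expRD rmorphM /= expRN fmorphV /= -/c0.
  have eu : cexp (hol_exponent z h) * cexp (- hol_exponent z h) = 1.
    by rewrite -cexpD subrr cexp0.
  have cu : c0 * c0^-1 = 1 by rewrite divff// eq_complex /= gt_eqF ?expR_gt0.
  set P := proj _ _ _; set e1 := cexp _ in eu *; set e2 := cexp _ in eu *; set c1 := _%:C.
  transitivity ((c0 * c0^-1) * (e1 * e2) * (c1 * P)); last by ring.
  by rewrite eu cu !mul1r.
rewrite vE -/c0 -/A0.
set a := \sum_(j < n) h 0 j * La j; set b := \sum_(j < n) h 0 j * Lb j.
have -> : \sum_(j < n) h 0 j * (c0 * (La j + A0 * Lb j)) = c0 * (a + A0 * b).
  rewrite /a /b !mulr_sumr -big_split /= mulr_sumr; apply: eq_bigr => j _; ring.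
set e := cexp _; set A := twisted _ _ _ _.
have HA : normc (A - A0 - a) <= M * hs h ^+ 2.
  have := HM h h1; rewrite -/A -/A0; congr (normc (_ - _) <= _).
  by rewrite /a mulr_sumr; apply: eq_bigr => j _; rewrite /La; ring.
have HE : normc (e - 1 - b) <= K * hs h ^+ 2 by exact: HK.
have Ha : normc a <= la * hs h by exact: hs_linear_le.
have Hb : normc b <= lb * hs h by exact: hs_linear_le.
have HAA : normc (A - A0) <= (M + la) * hs h.
  rewrite -[A - A0](subrK a); apply: le_trans (le_normcD _ _) _.
  rewrite mulrDl lerD//; apply: le_trans HA _.
  by rewrite ler_wpM2l// expr2 ler_piMl.
have HAn : normc A <= normc A0 + (M + la).
  rewrite -[A](subrK A0) addrC; apply: le_trans (le_normcD _ _) _; rewrite lerD2l.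
  by apply: le_trans HAA _; rewrite ler_piMr// addr_ge0.
have -> : c0 * (e * A) - c0 * A0 - c0 * (a + A0 * b) =
   c0 * ((e - 1 - b) * A + (A - A0 - a) + b * (A - A0)) by ring.
rewrite Normc.normcM -mulrA ler_wpM2l ?normc_ge0// 2![in leRHS]mulrDl.
apply: le_trans (le_normcD _ _) _; apply: lerD; last first.
  rewrite Normc.normcM [leRHS](_ : _ = (lb * hs h) * ((M + la) * hs h)); last by ring.
  by apply: ler_pM; rewrite ?normc_ge0.
apply: le_trans (le_normcD _ _) _; apply: lerD => //.
rewrite Normc.normcM mulrAC.
by apply: ler_pM; rewrite ?normc_ge0.
Qed.

Lemma proj_Hspace u : sqint u -> Hspace N (proj N u).
Proof.
move=> su; have hol := proj_holomorphic su.
have E : proj N u = bargmann N (fun z => (expR (N%:R * Phi z))%:C * proj N u z).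
  by apply/funext => z; rewrite /bargmann mulrA -rmorphM /= -expRD addNr expR0 mul1r.
split; last by eexists; [exact: hol|exact: E].
have [sg _] := sqint_avg1 N0 (ltr0n _ 4) su.
apply: L2_sqint; apply: (@sqint_le R n _ (fun z => (avg1 N 4 u z)%:C) 2) => //.
  by rewrite E; apply: cmeas_continuous; exact: continuous_bargmann.
move=> z; rewrite normc_real ger0_norm; first by have [_] := bker_bound N0 z su.
by apply: gavg_ge0 => w; exact: normc_ge0.
Qed.

(** Fubini and the Hermitian symmetry of the kernel move the projection onto [v], which it fixes. *)
Lemma inner_proj u v : sqint u -> Hspace N v -> inner (proj N u) v = inner u v.
Proof.
move=> su Hv; have sv := Hspace_sqint Hv; have [mu_ _] := su; have [mv _] := sv.
pose F (t s : X) : C := bker N (cpoint t) (cpoint s) * u (cpoint s) * conjc (v (cpoint t)).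
have m1 (G : Cn R n -> C) : cmeas (fun t : X => G (cpoint t)) -> cmeas (fun p : X * X => G (cpoint p.1)).
  by move=> [a b]; split; [exact: (measurableT_comp a measurable_fst)|exact: (measurableT_comp b measurable_fst)].
have m2 (G : Cn R n -> C) : cmeas (fun t : X => G (cpoint t)) -> cmeas (fun p : X * X => G (cpoint p.2)).
  by move=> [a b]; split; [exact: (measurableT_comp a measurable_snd)|exact: (measurableT_comp b measurable_snd)].
have mF : cmeas (fun p : X * X => F p.1 p.2).
  apply: cmeasM; last by apply: cmeas_conj; exact: (m1 v).
  apply: cmeasM; last exact: (m2 u).
  apply: cmeas_bker => j.
    by apply: (m1 (fun z => z 0 j)); exact: cmeas_coord.
  by apply: (m2 (fun z => z 0 j)); exact: cmeas_coord.
have i1 t : cintegrable mu (F t).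
  have [iu _] := bker_bound N0 (cpoint t) su.
  have -> : F t = fun s => conjc (v (cpoint t)) * (bker N (cpoint t) (cpoint s) * u (cpoint s)).
    by apply/funext => s; rewrite /F mulrC.
  exact: cintegrableZ.
have i2' s : cintegrable mu (fun t => conjc (bker N (cpoint s) (cpoint t) * v (cpoint t))).
  by apply: cintegrable_conj; have [] := bker_bound N0 (cpoint s) sv.
have FE s t : F t s = u (cpoint s) * conjc (bker N (cpoint s) (cpoint t) * v (cpoint t)).
  rewrite /F -conj_bker; set k := bker _ _ _.
  by apply: complex_eq; rewrite !complexE_simp; ring.
have i2 s : cintegrable mu (F^~ s).
  have -> : F^~ s = fun t => u (cpoint s) * conjc (bker N (cpoint s) (cpoint t) * v (cpoint t)).
    by apply/funext => t; exact: FE.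
  exact: cintegrableZ.
have [sg _] := sqint_avg1 N0 (ltr0n _ 4) su.
have finF : (\int[mu]_t \int[mu]_s (normc (F t s))%:E < +oo)%E.
  apply: le_lt_trans (_ : (\int[mu]_t (normc (avg1 N 4 u (cpoint t))%:C * normc (v (cpoint t)))%:E < +oo)%E); last first.
    by apply: le_lt_trans (sqint_pair sg sv) _; rewrite ltry.
  rewrite le_eqVlt; apply/orP; left; apply/eqP; apply: eq_integral => t _.
  have [gE _] := avg1_cs (cpoint t) N0 (ltr0n _ 4) su.
  rewrite normc_real ger0_norm; last by apply: gavg_ge0 => w; exact: normc_ge0.
  rewrite mulrC EFinM -gE -nintZ; last 3 first.
  - by apply: measurable_funM; [exact: measurable_gauss_weight1|exact: cmeas_normc].
  - by move=> s; rewrite mulr_ge0 ?gauss_weight_ge0 ?normc_ge0.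
  - exact: normc_ge0.
  apply: eq_integral => s _; rewrite /F 2!Normc.normcM normc_bker normc_conj gkerE; congr _%:E.
  by rewrite mulrC.
rewrite !innerE; transitivity (Cint mu (fun t => Cint mu (F t))).
  apply: eq_Cint => t; rewrite /F CintZr//.
  by have [] := bker_bound N0 (cpoint t) su.
rewrite Cfubini//; apply: eq_Cint => s.
transitivity (Cint mu (fun t => u (cpoint s) * conjc (bker N (cpoint s) (cpoint t) * v (cpoint t)))).
  by apply: eq_Cint => t; exact: FE.
rewrite CintZ// Cint_conj; last by have [] := bker_bound N0 (cpoint s) sv.
by congr (_ * conjc _); exact: Hspace_reproducing.
Qed.

Lemma innerB u v (w : Cn R n -> C) : sqint u -> sqint v -> sqint w ->
  inner (fun z => u z - v z) w = inner u w - inner v w.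
Proof.
move=> su sv sw; rewrite !innerE -CintB; try exact: cintegrable_sqint.
by apply: eq_Cint => t; rewrite mulrBl.
Qed.

(** The reproducing formula controls the value at each point by the L^2 norm, so a null element
    vanishes everywhere and not only almost everywhere. *)
Lemma Hspace_eq0 u : Hspace N u -> inner u u = 0 -> u = fun=> 0.
Proof.
move=> Hu; have su := Hspace_sqint Hu; have [mu_ _] := su.
rewrite innerE Cint_energy// => /(congr1 (@Re R)) /= e0.
apply/funext => z; rewrite -(Hspace_reproducing N0 z Hu).
have [_ b1] := bker_bound N0 z su.
have [_ b2] := avg1_cs z N0 (ltr0n _ 4) su.
have e2 : avg2 N 4 u z <= @peak R n N * energy u.
  rewrite -lee_fin -avg2E// EFinM -energyE// -nintZ//; last 3 first.
  - exact: measurable_sqnorm.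
  - by move=> t; exact: sqr_ge0.
  - exact: peak_ge0.
  apply: nint_le => //.
  - by apply: measurable_funM; [exact: measurable_gauss_weight1|exact: measurable_sqnorm].
  - by apply: measurable_funM => //; exact: measurable_sqnorm.
  - by move=> t; rewrite mulr_ge0 ?sqr_ge0 ?gauss_weight_ge0.
  - by move=> t; rewrite ler_wpM2r ?sqr_ge0// gauss_weight_le_peak.
have a0 : avg1 N 4 u z ^+ 2 <= 0.
  apply: le_trans b2 _; rewrite mulr_ge0_le0 ?exprn_ge0 ?divr_ge0//.
  by move: e2; rewrite e0 mulr0.
have {}a0 : avg1 N 4 u z = 0.
  by apply/eqP; rewrite -sqrf_eq0 eq_le a0 sqr_ge0.
move: b1; rewrite a0 mulr0 => b1.
by apply/eqP; rewrite -normc_eq0 eq_le b1 normc_ge0.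
Qed.

(** [xget] returns some function with the defining property; its difference with [proj N u] lies in
    [Hspace] and is orthogonal to itself. *)
Lemma orth_projE u : sqint u -> orth_proj (Hspace N) u = proj N u.
Proof.
move=> su; have HP := proj_Hspace su; have sP := Hspace_sqint HP.
have Pin : [set w : Cn R n -> C | Hspace N w /\ forall h : Cn R n -> C, Hspace N h -> inner (fun z => u z - w z) h = 0] (proj N u).
  split=> // h Hh; have sh := Hspace_sqint Hh.
  by rewrite innerB// inner_proj// subrr.
rewrite /orth_proj; have [] := @xgetPex _ (fun=> 0) _ (ex_intro _ _ Pin).
set T := xget _ _ => HT oT; have sT := Hspace_sqint HT.
have HD := HspaceB HT HP; have sD := Hspace_sqint HD.
suff : (fun z => T z - proj N u z) = fun=> 0.
  by move=> E; apply/funext => z; have := congr1 (fun F : Cn R n -> C => F z) E => /= /eqP; rewrite subr_eq0 => /eqP.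
apply: Hspace_eq0 => //; rewrite innerB//.
have := oT _ HD; rewrite innerB// => /eqP; rewrite subr_eq0 => /eqP <-.
by rewrite inner_proj// subrr.
Qed.

(** Along the line [|u|^2] is an even Gaussian in [t] times [|twisted|^2], and the first-order term
    of [twisted] is [N / 2] times the combination of moments. This identity is exact, with no error
    in [N]. *)
Lemma is_derive_sqnorm u z h : Hspace N u ->
  is_derive (0 : R) 1 (fun t => normc (u (z + (t%:C : C) *: h)) ^+ 2)
    (N%:R * Re (conjc (u z) * \sum_(j < n) h 0 j * moment N u z j)).
Proof.
move=> Hu; have su := Hspace_sqint Hu.
pose S := \sum_(j < n) h 0 j * moment N u z j.
pose d := (1 + hs h)^-1; have d1 : 0 < 1 + hs h by rewrite ltr_wpDr// hs_ge0.
have d0 : 0 < d by rewrite invr_gt0.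
have hsZ (t : R) : hs ((t%:C : C) *: h) = `|t| * hs h.
  by rewrite /hs mulr_sumr; apply: eq_bigr => j _; rewrite mxE Normc.normcM normc_real.
have [K K0 HK] := twisted_expansion N0 z su.
pose A (t : R) := twisted N u z ((t%:C : C) *: h).
have A0 : A 0 = u z.
  rewrite -(Hspace_reproducing N0 z Hu); apply: eq_Cint => t.
  rewrite /dbar_exponent big1 ?mulr0 ?cexp0 ?mulr1// => j _.
  by rewrite [X in _ * X]mxE mul0r mulr0.
have HA t : `|t| <= d -> normc (A t - A 0 - t%:C * ((N%:R / 2)%:C * S)) <= (K * hs h ^+ 2) * t ^+ 2.
  move=> td; have : hs ((t%:C : C) *: h) <= 1.
    rewrite hsZ; apply: le_trans (_ : d * hs h <= _); first by rewrite ler_wpM2r ?hs_ge0.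
    by rewrite mulrC ler_pdivrMr// mul1r lerDr.
  move=> /HK; rewrite Hspace_reproducing// -A0 hsZ exprMn real_normK ?num_real//.
  rewrite -/(A t) mulrCA [leRHS]mulrC; congr (normc (_ - _) <= _).
  rewrite mulrCA; congr (_ * _); rewrite /S mulr_sumr; apply: eq_bigr => j _.
  by rewrite mxE mulrA.
pose B : C := (N%:R / 2)%:C * S; rewrite -/B in HA.
have dRe : is_derive (0 : R) 1 (fun t => Re (A t)) (Re B).
  apply: (@is_derive_quadratic _ _ _ _ (K * hs h ^+ 2) d) => // t /HA; rewrite add0r.
  apply: le_trans; apply: le_trans (normr_Re _).
  by move: (A t) (A 0) (B) => a b c; rewrite !cReD !cReN cReM /= mul0r subr0.
have dIm : is_derive (0 : R) 1 (fun t => Im (A t)) (Im B).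
  apply: (@is_derive_quadratic _ _ _ _ (K * hs h ^+ 2) d) => // t /HA; rewrite add0r.
  apply: le_trans; apply: le_trans (normr_Im _).
  by move: (A t) (A 0) (B) => a b c; rewrite !cImD !cImN cImM /= mul0r addr0.
have -> : (fun t : R => normc (u (z + (t%:C : C) *: h)) ^+ 2) =
   (fun t => expR (- (N%:R / 2 * nsq h) * (t * t)) * (Re (A t) * Re (A t) + Im (A t) * Im (A t))).
  apply/funext => t; rewrite -(Hspace_reproducing N0 _ Hu) normc_proj_shift// normc_sqr.
  by rewrite nsqZ normc_real real_normK ?num_real// !expr2; congr (expR _ * _); ring.
clear HA; move: A A0 dRe dIm => A A0 dRe dIm.
apply: is_derive_eq.
rewrite /GRing.scale /= A0 !(mulr0, mul0r, expR0, addr0, add0r, mul1r).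
by rewrite -/S /B !complexE_simp /=; field.
Qed.

End BergmanProjection.

(** * Taylor expansion of symbols *)

Section RealCoordinates.
Context {R : realType} {n : nat}.
Local Notation C := (Cplx R).
Local Notation D := ('I_n + 'I_n)%type.
Implicit Types (z w h : Cn R n) (k l : D).
Local Open Scope complex_scope.

Definition rcoord k z : R :=
  match k with inl j => complex.Re (z 0 j) | inr j => complex.Im (z 0 j) end.

Lemma rcoordD k z w : rcoord k (z + w) = rcoord k z + rcoord k w.
Proof. by case: k => j /=; rewrite mxE !complexE_simp. Qed.

Lemma rcoordN k z : rcoord k (- z) = - rcoord k z.
Proof. by case: k => j /=; rewrite mxE !complexE_simp. Qed.

Lemma rcoordB k z w : rcoord k (z - w) = rcoord k z - rcoord k w.
Proof. by rewrite rcoordD rcoordN. Qed.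

Lemma rcoordZ k (t : R) z : rcoord k ((t%:C : C) *: z) = t * rcoord k z.
Proof. by case: k => j /=; rewrite mxE !complexE_simp /=; ring. Qed.

Lemma rcoord_dir l k : rcoord l (coord_dir k : Cn R n) = (l == k)%:R.
Proof.
case: l => i; case: k => j; rewrite /= !mxE ?eqxx /=.
- by rewrite (_ : (inl i == inl j) = (i == j))//; case: (i == j).
- by case: (i == j); rewrite /= !(mulr0, mulr1, mul0r, subrr).
- by case: (i == j).
- by rewrite (_ : (inr i == inr j) = (i == j))//; case: (i == j); rewrite /= !(mulr0, mulr1, mul0r, addr0, add0r).
Qed.

Lemma rcoord_inj z w : (forall k, rcoord k z = rcoord k w) -> z = w.
Proof.
move=> H; apply/rowP => j; apply: complex_eq.
  exact: (H (inl j)).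
exact: (H (inr j)).
Qed.

Lemma nsq_rcoord z : nsq z = \sum_k rcoord k z ^+ 2.
Proof.
rewrite big_sumType /= -big_split /=; apply: eq_bigr => j _.
by rewrite normc_sqr.
Qed.

Lemma rcoord_le k z : `|rcoord k z| <= Num.sqrt (nsq z).
Proof.
rewrite -sqrtr_sqr ler_wsqrtr// nsq_rcoord (bigD1 k)//= lerDl.
by apply: sumr_ge0 => l _; exact: sqr_ge0.
Qed.

Lemma continuous_rcoord k : continuous (fun z => rcoord k z).
Proof. by case: k => j; [exact: continuous_coordRe|exact: continuous_coordIm]. Qed.

Definition tdist z w : R := \sum_k `|rcoord k w - rcoord k z|.

Lemma tdist_ge0 z w : 0 <= tdist z w.
Proof. exact: sumr_ge0. Qed.

Lemma tdist_le z w : tdist z w <= (n + n)%:R * Num.sqrt (nsq (w - z)).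
Proof.
apply: le_trans (_ : \sum_(k : D) Num.sqrt (nsq (w - z)) <= _).
  by apply: ler_sum => k _; rewrite -rcoordB; exact: rcoord_le.
by rewrite sumr_const card_sum card_ord mulr_natl.
Qed.

(** The box is centred at [z], with half-sides the coordinates of [w - z]; paths that change one
    coordinate at a time stay inside it. *)
Definition between z w p := forall k, `|rcoord k p - rcoord k z| <= `|rcoord k w - rcoord k z|.

Lemma between_tdist z w p : between z w p -> tdist z p <= tdist z w.
Proof. by move=> H; apply: ler_sum => k _; exact: H. Qed.

Lemma between_trans z w p q : between z w p -> between z p q -> between z w q.
Proof. by move=> H1 H2 k; exact: le_trans (H2 k) (H1 k). Qed.

Definition partials (G : Cn R n -> R) (G1 : D -> Cn R n -> R) :=
  forall k z, is_derive (0 : R) 1 (fun t : R => G (z + (t%:C : C) *: coord_dir k)) (G1 k z).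

Lemma is_derive_shift (g : R -> R) (t b : R) :
  is_derive (0 : R) 1 (fun s => g (t + s)) b -> is_derive t 1 g b.
Proof.
move=> H.
have -> : g = (fun s => g (t + s)) \o (fun s => s - t).
  by apply/funext => s /=; rewrite addrC subrK.
rewrite -[b]mulr1; apply: is_derive1_comp; first by rewrite subrr.
by apply: is_derive_eq; rewrite subr0.
Qed.

Lemma partials_line G G1 k z (t : R) : partials G G1 ->
  is_derive t 1 (fun t : R => G (z + (t%:C : C) *: coord_dir k)) (G1 k (z + (t%:C : C) *: coord_dir k)).
Proof.
move=> H; apply: is_derive_shift.
have E : (fun s : R => G (z + ((t + s)%:C : C) *: coord_dir k)) =
    (fun s : R => G (z + (t%:C : C) *: coord_dir k + (s%:C : C) *: coord_dir k)).
  by apply/funext => s; rewrite -addrA -scalerDl rmorphD.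
by rewrite E; exact: H.
Qed.

Lemma mvt_line (g g1 : R -> R) (M t : R) :
  (forall s : R, is_derive s 1 g (g1 s)) ->
  (forall s : R, `|s| <= `|t| -> `|g1 s| <= M) -> `|g t - g 0| <= M * `|t|.
Proof.
move=> dg HM; have [t0|t0] := leP 0 t.
  rewrite (ger0_norm t0) -{2}[t]subr0; apply: (@mvt_itv _ g g1 M 0 t) => // s /andP[s0 st].
  by apply: HM; rewrite !ger0_norm.
rewrite (ltr0_norm t0) distrC -[- t]add0r; apply: (@mvt_itv _ g g1 M t 0) => //; first exact: ltW.
move=> s /andP[ts s0]; apply: HM.
by rewrite ler0_norm// ltr0_norm// lerN2.
Qed.

(** The path from [z] to [w] moves one coordinate at a time, so partial derivatives suffice and no
    joint differentiability is involved. *)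
Lemma lipschitz_between G G1 (M : R) z w : partials G G1 ->
  (forall p, between z w p -> forall k, `|G1 k p| <= M) -> `|G w - G z| <= M * tdist z w.
Proof.
move=> dG HM.
pose t k := rcoord k w - rcoord k z.
pose pt (s : seq D) := z + \sum_(k <- s) ((t k)%:C : C) *: coord_dir k.
have ptE s k : uniq s -> rcoord k (pt s) = if k \in s then rcoord k w else rcoord k z.
  rewrite /pt; elim: s => [|l s IH] /=; first by rewrite big_nil addr0.
  move=> /andP[ls us]; rewrite big_cons addrCA rcoordD (IH us) rcoordZ rcoord_dir inE.
  have [->|kl] := eqVneq k l; last by rewrite mulr0 add0r.
  by rewrite (negbTE ls) mulr1 /t subrK.
have ptw : pt (index_enum (D : finType)) = w.
  by apply: rcoord_inj => k; rewrite ptE ?index_enum_uniq// mem_index_enum.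
suff key s : uniq s -> `|G (pt s) - G z| <= M * \sum_(k <- s) `|t k|.
  by have := key _ (index_enum_uniq (D : finType)); rewrite ptw.
elim: s => [|l s IH] /=.
  by rewrite /pt !big_nil addr0 subrr normr0 mulr0.
move=> /andP[ls us]; rewrite big_cons mulrDr.
have -> : G (pt (l :: s)) - G z = (G (pt (l :: s)) - G (pt s)) + (G (pt s) - G z) by ring.
apply: le_trans (ler_normD _ _) _; apply: lerD; last exact: IH.
have := @mvt_line (fun x : R => G (pt s + (x%:C : C) *: coord_dir l))
  (fun x => G1 l (pt s + (x%:C : C) *: coord_dir l)) M (t l).
rewrite scale0r addr0 [pt (l :: s)](_ : _ = pt s + ((t l)%:C : C) *: coord_dir l); last first.
  by rewrite /pt big_cons addrCA addrC.
apply; first by move=> x; exact: partials_line.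
move=> x xt; apply: HM => k; rewrite rcoordD rcoordZ rcoord_dir ptE//.
have [->|kl] := eqVneq k l; last first.
  by rewrite mulr0 addr0; case: ifP => // _; rewrite subrr normr0.
by rewrite (negbTE ls) mulr1 addrAC subrr add0r.
Qed.

(** [lipschitz_between] is applied to [G] minus its affine part, whose partial derivatives are small
    by [lipschitz_between] again. *)
Lemma taylor_between G G1 G2 (M : R) z w : partials G G1 ->
  (forall k, partials (G1 k) (G2 k)) -> 0 <= M ->
  (forall p, between z w p -> forall k l, `|G2 k l p| <= M) ->
  `|G w - G z - \sum_k rcoord k (w - z) * G1 k z| <= M * tdist z w ^+ 2.
Proof.
move=> dG dG1 M0 HM.
pose H p := G p - \sum_k rcoord k (p - z) * G1 k z.
have dH : partials H (fun k p => G1 k p - G1 k z).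
  move=> k p; rewrite /H.
  have -> : (fun t : R => G (p + (t%:C : C) *: coord_dir k) -
      \sum_l rcoord l (p + (t%:C : C) *: coord_dir k - z) * G1 l z) =
    (fun t : R => G (p + (t%:C : C) *: coord_dir k)) -
      (fun t : R => \sum_l rcoord l (p - z) * G1 l z + t * G1 k z).
    apply/funext => t /=; rewrite fctE; congr (_ - _).
    rewrite (bigD1 k)//= [in RHS](bigD1 k)//=.
    rewrite [in RHS]addrAC; congr (_ + _).
      by rewrite !rcoordB rcoordD rcoordZ rcoord_dir eqxx mulr1 addrAC mulrDl.
    apply: eq_bigr => l lk; rewrite !rcoordB rcoordD rcoordZ rcoord_dir (negbTE lk).
    by rewrite mulr0 addr0.
  apply: is_deriveB; first exact: dG.
  by apply: is_derive_eq; rewrite scaler0 !add0r mul1r /GRing.scale /= mulr1.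
have := @lipschitz_between H _ (M * tdist z w) z w dH.
have -> : H z = G z.
  by rewrite /H big1 ?subr0// => k _; rewrite subrr; case: k => j; rewrite /= mxE mul0r.
rewrite /H addrAC expr2 mulrA; apply.
move=> p zp k; apply: le_trans (_ : M * tdist z p <= _); last first.
  by rewrite ler_wpM2l// between_tdist.
apply: (lipschitz_between (dG1 k)) => q pq l.
by apply: HM; exact: between_trans pq.
Qed.

End RealCoordinates.

Section BoxCompactness.
Context {R : realType} {n : nat}.
Local Notation C := (Cplx R).
Local Notation D := ('I_n + 'I_n)%type.
Implicit Types (z w h : Cn R n) (k l : D) (G : Cn R n -> R).
Local Open Scope complex_scope.

Definition rbox (r : R) : set (Cn R n) := [set z | forall k, `|rcoord k z| <= r].

(** Compactness is taken from real row vectors of length [n + n], through the continuous map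
    [emb]. *)
Lemma bounded_on_rbox G (r : R) : continuous G ->
  exists2 M : R, 0 <= M & forall z, rbox r z -> `|G z| <= M.
Proof.
move=> cG.
pose emb (v : 'rV[R]_(n + n)) : Cn R n := \row_j ((v 0 (lshift n j)) +i* (v 0 (rshift n j))).
have ce : continuous (G \o emb).
  move=> v A /nbhs_ballP[e /= e0 HA].
  have /continuous_CnP /(_ e e0) [d d0 H] := cG (emb v).
  have d2 : 0 < d / 2 by rewrite divr_gt0.
  apply/nbhs_ballP; exists (d / 2) => //= v' [_ vv'] /=.
  apply: HA; rewrite /ball /= distrC; apply: H => j; rewrite !mxE.
  apply: le_lt_trans (normc_le _) _; rewrite !complexE_simp /= [d]splitr.
  have h1 := vv' 0 (lshift n j); have h2 := vv' 0 (rshift n j).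
  by move: h1 h2; rewrite /ball /= => h1 h2; apply: ltrD; rewrite distrC.
have cp := @rV_compact R (n + n) (fun=> `[- r, r]%classic) (fun=> @segment_compact _ _ _).
have cI := continuous_compact (@continuous_subspaceT _ _ _ _ ce) cp.
have [M [_ HM]] := compact_bounded cI.
exists (`|M| + 1); first by rewrite addr_ge0.
move=> z zr; apply: (HM (`|M| + 1)); first by rewrite (le_lt_trans (ler_norm _))// ltrDl.
exists (\row_(i < n + n) match fintype.split i with inl j => complex.Re (z 0 j) | inr j => complex.Im (z 0 j) end).
  move=> i /=; rewrite mxE in_itv /= -ler_norml.
  by case: (fintype.split i) => j; [exact: (zr (inl j))|exact: (zr (inr j))].
rewrite /=; congr G; apply/rowP => j; rewrite !mxE.
have -> : fintype.split (lshift n j) = inl j by exact: (unsplitK (inl j)).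
have -> : fintype.split (rshift n j) = inr j by exact: (unsplitK (inr j)).
by case: (z 0 j).
Qed.

Lemma bounded_on_rbox_fin (I : finType) (G : I -> Cn R n -> R) (r : R) :
  (forall i, continuous (G i)) ->
  exists2 M : R, 0 <= M & forall i z, rbox r z -> `|G i z| <= M.
Proof.
move=> cG; have /choice[M HM] : forall i, exists M : R, 0 <= M /\ forall z, rbox r z -> `|G i z| <= M.
  by move=> i; have [M M0 H] := bounded_on_rbox r (cG i); exists M.
exists (\sum_i M i); first by apply: sumr_ge0 => i _; case: (HM i).
move=> i z zr; apply: le_trans ((HM i).2 z zr) _.
by rewrite (bigD1 i)//= lerDl; apply: sumr_ge0 => j _; case: (HM j).
Qed.

(** Links the coordinate derivatives used throughout with [regular_value], which speaks of arbitrary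
    directions. *)
Lemma partials_direction G (G1 : D -> Cn R n -> R) (G2 : D -> D -> Cn R n -> R) z h : partials G G1 ->
  (forall k, partials (G1 k) (G2 k)) -> (forall k l, continuous (G2 k l)) ->
  is_derive (0 : R) 1 (fun t : R => G (z + (t%:C : C) *: h)) (\sum_k rcoord k h * G1 k z).
Proof.
move=> dG dG1 cG2.
have [M M0 HM] := bounded_on_rbox_fin (Num.sqrt (nsq z) + 1) (fun kl : D * D => cG2 kl.1 kl.2).
have Md p : tdist z p <= 1 -> forall k l, `|G2 k l p| <= M.
  move=> zp k l; apply: (HM (k, l)) => i; rewrite -[p](subrK z) addrC.
  rewrite rcoordD; apply: le_trans (ler_normD _ _) _; apply: lerD; first exact: rcoord_le.
  rewrite rcoordB; apply: le_trans zp; rewrite /tdist (bigD1 i)//= lerDl.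
  exact: sumr_ge0.
have d0 : (0 : R) < 1 by [].
set d := (1 : R) in d0 Md.
pose S := \sum_k `|rcoord k h|.
have S0 : 0 <= S by exact: sumr_ge0.
have tdE t : tdist z (z + (t%:C : C) *: h) = `|t| * S.
  rewrite /tdist /S mulr_sumr; apply: eq_bigr => k _.
  by rewrite rcoordD addrAC subrr add0r rcoordZ normrM.
apply: (@is_derive_quadratic _ _ _ _ (M * S ^+ 2) (d / (S + 1))).
  by rewrite divr_gt0// ltr_wpDl.
move=> t td; rewrite add0r scale0r addr0.
have zd : tdist z (z + (t%:C : C) *: h) <= d.
  rewrite tdE; apply: le_trans (_ : d / (S + 1) * S <= _); first by rewrite ler_wpM2r.
  by rewrite mulrAC ler_pdivrMr ?ltr_wpDl// ler_wpM2l ?lerDl// ltW.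
have := @taylor_between R n G G1 G2 M z (z + (t%:C : C) *: h) dG dG1 M0.
rewrite tdE exprMn real_normK ?num_real// [z + _ - z]addrAC subrr add0r.
have -> : \sum_k rcoord k ((t%:C : C) *: h) * G1 k z = t * \sum_k rcoord k h * G1 k z.
  by rewrite mulr_sumr; apply: eq_bigr => k _; rewrite rcoordZ mulrA.
rewrite [M * (_ * _)]mulrCA [M * S ^+ 2 * _]mulrC; apply => p zp k l.
by apply: Md; apply: le_trans (between_tdist zp) zd.
Qed.

Lemma nsq_rbox z (r : R) : 0 <= r -> nsq z <= r ^+ 2 -> rbox r z.
Proof.
move=> r0 zr k; apply: le_trans (rcoord_le k z) _.
by rewrite -(ger0_norm r0) -sqrtr_sqr ler_wsqrtr.
Qed.

Lemma rboxD (r s : R) z w : rbox r z -> rbox s w -> rbox (r + s) (z + w).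
Proof.
by move=> zr ws k; rewrite rcoordD; apply: le_trans (ler_normD _ _) _; apply: lerD.
Qed.

Lemma between_rbox (r s : R) z w p : 0 <= s -> rbox r z -> nsq (w - z) <= s ^+ 2 ->
  between z w p -> rbox (r + s) p.
Proof.
move=> s0 zr ws zp; rewrite -[p](subrK z) addrC; apply: rboxD => // k.
rewrite rcoordB; apply: le_trans (zp k) _; rewrite -rcoordB.
exact: nsq_rbox.
Qed.

End BoxCompactness.

(** * Constant sign at infinity *)

Section ConstantSign.
Context {R : realType} {n : nat}.
Local Notation C := (Cplx R).
Implicit Types (z w h : Cn R n) (G : Cn R n -> R).
Local Open Scope complex_scope.

Definition cdot z w : R := \sum_(j < n) complex.Re (z 0 j * conjc (w 0 j)).

Lemma nsq_segment z w (t : R) :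
  nsq (z + (t%:C : C) *: (w - z)) =
  (1 - t) ^+ 2 * nsq z + 2 * (t * (1 - t)) * cdot z w + t ^+ 2 * nsq w.
Proof.
rewrite /nsq /cdot !mulr_sumr -!big_split /=; apply: eq_bigr => j _.
rewrite !mxE; move: (z 0 j) (w 0 j) => [a b] [c d].
by rewrite !normc_sqr !complexE_simp /=; ring.
Qed.

Lemma cdotN z w : cdot z (- w) = - cdot z w.
Proof.
rewrite /cdot -sumrN; apply: eq_bigr => j _.
by rewrite mxE !complexE_simp; ring.
Qed.

Lemma cdot_rot w : cdot w ((0 +i* 1 : C) *: w) = 0.
Proof.
rewrite /cdot big1// => j _.
by rewrite mxE !complexE_simp /=; ring.
Qed.

(** As [(1 - t)^2 + t^2 >= 1/2], a segment whose endpoints have nonnegative scalar product loses at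
    most a factor 2 in squared norm. This is the origin of [2 * r] in the lemmas that follow. *)
Lemma segment_bound (r a b c t : R) : 0 <= t -> t <= 1 -> 0 <= r ->
  2 * r <= a -> 2 * r <= b -> 0 <= c ->
  r <= (1 - t) ^+ 2 * a + 2 * (t * (1 - t)) * c + t ^+ 2 * b.
Proof.
move=> t0 t1 r0 ra rb c0.
have h3 : 0 <= 2 * (t * (1 - t)) * c by rewrite !mulr_ge0// subr_ge0.
have h4 : (1 - t) ^+ 2 * (2 * r) <= (1 - t) ^+ 2 * a by rewrite ler_wpM2l// sqr_ge0.
have h5 : t ^+ 2 * (2 * r) <= t ^+ 2 * b by rewrite ler_wpM2l// sqr_ge0.
have h6 : 0 <= r * (1 - 2 * t) ^+ 2 by rewrite mulr_ge0// sqr_ge0.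
have h7 : r + r * (1 - 2 * t) ^+ 2 = (1 - t) ^+ 2 * (2 * r) + t ^+ 2 * (2 * r) by ring.
lra.
Qed.

Lemma same_sign (a b : R) : ~ (Num.min a b <= 0 <= Num.max a b) -> (0 < a) = (0 < b).
Proof.
move=> ab; apply/idP/idP => gp; rewrite ltNge; apply/negP => gn; apply: ab.
  by rewrite ge_min gn orbT le_max (ltW gp).
by rewrite ge_min gn le_max (ltW gp) orbT.
Qed.

Lemma continuous_segment G z w : continuous G ->
  continuous (fun t : R => G (z + (t%:C : C) *: (w - z))).
Proof.
move=> cG t; apply/cvgrPdist_lt => e e0.
have /continuous_CnP /(_ e e0) [d d0 H] := cG (z + (t%:C : C) *: (w - z)).
pose M := hs (w - z) + 1; have M0 : 0 < M by rewrite ltr_wpDl// hs_ge0.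
have dM : 0 < d / M by rewrite divr_gt0.
apply/nbhs_ballP; exists (d / M) => //= s; rewrite /ball /= => st.
rewrite distrC; apply: H => j.
have -> : (z + (s%:C : C) *: (w - z)) 0 j - (z + (t%:C : C) *: (w - z)) 0 j =
    (s - t)%:C * (w - z) 0 j.
  have E (x : R) : (z + (x%:C : C) *: (w - z)) 0 j = z 0 j + x%:C * (w - z) 0 j.
    by rewrite mxE [X in _ + X]mxE.
  apply: etrans (congr2 (fun a b : R[i] => a - b) (E s) (E t)) _.
  move: (z 0 j) ((w - z) 0 j) => a b; apply: complex_eq; rewrite !complexE_simp /=; ring.
rewrite Normc.normcM normc_real distrC.
apply: le_lt_trans (_ : `|t - s| * M < _); last by rewrite -ltr_pdivlMr.
rewrite ler_wpM2l// /M /hs (bigD1 j)//= -addrA lerDl addr_ge0// sumr_ge0// => i _.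
exact: normc_ge0.
Qed.

Lemma constant_sign_segment G (r : R) z w : continuous G ->
  (forall p, r <= nsq p -> 1 <= `|G p|) ->
  2 * r <= nsq z -> 2 * r <= nsq w -> 0 <= cdot z w -> 0 <= r -> (0 < G z) = (0 < G w).
Proof.
move=> cG HG rz rw zw r0.
pose g (t : R) := G (z + (t%:C : C) *: (w - z)).
have g0 : g 0 = G z by rewrite /g scale0r addr0.
have g1 : g 1 = G w by rewrite /g scale1r addrC subrK.
have far (t : R) : 0 <= t <= 1 -> 1 <= `|g t|.
  move=> /andP[t0 t1]; apply: HG; rewrite nsq_segment.
  exact: segment_bound.
have nz (t : R) : 0 <= t <= 1 -> g t <> 0.
  by move=> /far gt g0t; move: gt; rewrite g0t normr0 ler10.
have cg : {within `[0, 1], continuous g}.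
  by apply: continuous_subspaceT; exact: continuous_segment.
have nocross : ~ (Num.min (g 0) (g 1) <= 0 <= Num.max (g 0) (g 1)).
  by move=> /(IVT ler01 cg)[t]; rewrite in_itv /= => /nz.
rewrite -g0 -g1; exact: same_sign.
Qed.

(** If the scalar product of [z] and [w] is negative, [w] is replaced by [- w], itself reached from
    [w] by two quarter turns: [i p] is orthogonal to [p] for the real scalar product, so every
    segment used avoids the ball. *)
Lemma constant_sign G (r : R) z w : continuous G -> 0 <= r ->
  (forall p, r <= nsq p -> 1 <= `|G p|) ->
  2 * r <= nsq z -> 2 * r <= nsq w -> (0 < G z) = (0 < G w).
Proof.
move=> cG r0 HG rz rw.
have rot (p : Cn R n) : 2 * r <= nsq p -> 2 * r <= nsq ((0 +i* 1 : C) *: p).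
  by rewrite nsqZ normc_sqr /= expr0n expr1n add0r mul1r.
have opp p : 2 * r <= nsq p -> (0 < G p) = (0 < G (- p)).
  move=> rp; have rp' := rot p rp.
  have -> : (0 < G p) = (0 < G ((0 +i* 1 : C) *: p)).
    by apply: (constant_sign_segment cG HG rp rp' _ r0); rewrite cdot_rot.
  apply: (constant_sign_segment cG HG rp' _ _ r0); first by rewrite nsqN.
  have -> : - p = (0 +i* 1 : C) *: ((0 +i* 1 : C) *: p).
    apply/rowP => j; rewrite !mxE; move: (p 0 j) => a.
    by apply: complex_eq; rewrite !complexE_simp /=; ring.
  by rewrite cdot_rot.
have [zw|zw] := leP 0 (cdot z w); first exact: constant_sign_segment HG _ _ _ _.
rewrite (opp w rw); apply: (constant_sign_segment cG HG rz _ _ r0); rewrite ?nsqN//.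
by rewrite cdotN oppr_ge0 ltW.
Qed.

End ConstantSign.

(** * Expansion of the Toeplitz operator at a point *)

Section SymbolExpansion.
Context {R : realType} {n : nat}.
Local Notation C := (Cplx R).
Local Notation Re := complex.Re.
Local Notation Im := complex.Im.
Local Notation D := ('I_n + 'I_n)%type.
Local Notation X := ((n + n).-tuple (measurableTypeR R)).
Local Notation mu := (@leb R (n + n)).
Implicit Types (z w h : Cn R n) (u v : Cn R n -> C).
Local Open Scope complex_scope.

Variables (F : Cn R n -> R) (G1 : D -> Cn R n -> R) (G2 : D -> D -> Cn R n -> R).
Hypothesis dF : partials F G1.
Hypothesis dG1 : forall k, partials (G1 k) (G2 k).
Hypothesis cG1 : forall k, continuous (G1 k).
Hypothesis cG2 : forall k l, continuous (G2 k l).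
Variables (m : Cn R n -> R) (Cm cF : R) (L : nat).
Hypothesis m0 : forall z, 0 < m z.
Hypothesis Cm0 : 0 < Cm.
Hypothesis cF0 : 0 <= cF.
Hypothesis tempered : forall z w, m w <= Cm * (1 + nsq (w - z)) ^+ L * m z.
Hypothesis Fm : forall z, `|F z| <= cF * m z.

Lemma weight_bounded (r : R) : exists2 M : R, 0 < M & forall z, nsq z <= r ^+ 2 -> m z <= M.
Proof.
exists (Cm * (1 + r ^+ 2) ^+ L * m 0).
  by rewrite !mulr_gt0// exprn_gt0// ltr_wpDr// sqr_ge0.
move=> z zr; apply: le_trans (tempered 0 z) _; rewrite subr0.
rewrite ler_wpM2r ?(ltW (m0 _))// ler_wpM2l ?(ltW Cm0)//.
by apply: lerXn2r; rewrite ?nnegrE ?addr_ge0 ?nsq_ge0 ?sqr_ge0// lerD2l.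
Qed.

(** Taylor near [z] and polynomial growth away from it give the same form of error: [1 / N] times a
    polynomial in [N |w - z|^2], the quantity that the Gaussian controls. *)
Lemma taylor_growth (r : R) : 0 <= r -> exists2 c : R, 0 <= c &
  forall N (f : Cn R n -> R), (0 < N)%N -> (forall w, `|f w - F w| <= cF / N%:R * m w) ->
  forall z w, nsq z <= r ^+ 2 ->
  `|f w - F z - \sum_k rcoord k (w - z) * G1 k z| <=
  c / N%:R * (1 + N%:R * nsq (w - z)) ^+ L.+1.
Proof.
move=> r0; have [M M0 HM] := weight_bounded r.
have [B1 B10 HB1] := bounded_on_rbox_fin r cG1.
have [B2 B20 HB2] := @bounded_on_rbox_fin R n (D * D)%type (fun kl => G2 kl.1 kl.2) (r + 1) (fun kl => @cG2 kl.1 kl.2).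
pose d : R := (n + n)%:R.
have d0 : 0 <= d by [].
pose c1 := B2 * d ^+ 2 + (cF * Cm * M + cF * M + d * B1).
have c2 : 0 <= cF * Cm * M + cF * M + d * B1.
  by rewrite !addr_ge0 ?mulr_ge0 ?(ltW M0) ?(ltW Cm0).
have c10 : 0 <= c1 by rewrite addr_ge0// mulr_ge0// sqr_ge0.
exists (c1 + cF * Cm * M); first by rewrite addr_ge0// !mulr_ge0 ?(ltW M0) ?(ltW Cm0).
move=> N f N0 fF z w zr; set y := nsq (w - z).
have NR : (0 : R) < N%:R by rewrite ltr0n.
have y0 : 0 <= y by exact: nsq_ge0.
have mzM := HM z zr.
pose b := (1 + y) ^+ L; have b1 : 1 <= b by rewrite exprn_ege1// lerDl.
have b0 : 0 <= b by exact: le_trans ler01 b1.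
have mw : m w <= Cm * M * b.
  apply: le_trans (tempered z w) _; rewrite -/y -/b mulrAC ler_wpM2r//.
  by rewrite ler_wpM2l// ltW.
have H1 : `|f w - F w| <= cF * Cm * M * (b / N%:R).
  apply: le_trans (fF w) _.
  apply: le_trans (_ : cF / N%:R * (Cm * M * b) <= _); first by rewrite ler_wpM2l// divr_ge0.
  by rewrite le_eqVlt; apply/orP; left; apply/eqP; field; rewrite gt_eqF.
have H2 : `|F w - F z - \sum_k rcoord k (w - z) * G1 k z| <= c1 * (b * y).
  have zbox : rbox r z by exact: nsq_rbox.
  (* Within distance 1 the second derivatives are bounded on a box; beyond it every term is bounded
     by growth alone and [1 <= y] supplies the missing factor. *)
  have [y1|y1] := leP y 1.
    have := @taylor_between R n F G1 G2 B2 z w dF dG1 B20.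
    have HB p : between z w p -> forall k l, `|G2 k l p| <= B2.
      move=> zp k l; apply: (HB2 (k, l)); apply: (between_rbox ler01 zbox _ zp).
      by rewrite expr1n.
    move=> /(_ HB) /le_trans; apply.
    have td : tdist z w ^+ 2 <= d ^+ 2 * y.
      rewrite -(sqr_sqrtr y0) -exprMn; apply: lerXn2r; rewrite ?nnegrE ?tdist_ge0 ?mulr_ge0 ?sqrtr_ge0//.
      exact: tdist_le.
    apply: le_trans (_ : B2 * (d ^+ 2 * y) <= _); first by rewrite ler_wpM2l.
    rewrite mulrA; apply: ler_pM => //; first by rewrite mulr_ge0// sqr_ge0.
      by rewrite lerDl.
    by rewrite ler_peMl.
  have by1 : b <= b * y by rewrite ler_peMr// ltW.
  have lin : `|\sum_k rcoord k (w - z) * G1 k z| <= d * B1 * (b * y).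
    apply: le_trans (ler_norm_sum _ _ _) _.
    apply: le_trans (_ : \sum_(k : D) (y * B1) <= _).
      apply: ler_sum => k _; rewrite normrM; apply: ler_pM => //; last exact: HB1.
      apply: le_trans (rcoord_le k _) _; rewrite -/y -{2}(sqr_sqrtr y0) expr2 ler_peMl ?sqrtr_ge0//.
      by rewrite -sqrtr1 ler_wsqrtr// ltW.
    rewrite sumr_const card_sum card_ord -[leLHS]mulr_natl -/d (mulrC y) -[leRHS]mulrA.
    apply: ler_wpM2l => //; apply: ler_wpM2l => //.
    by rewrite ler_peMl// ltW// (lt_trans _ y1).
  rewrite -addrA; apply: le_trans (ler_normD _ _) _.
  apply: le_trans (_ : cF * Cm * M * (b * y) + (cF * M * (b * y) + d * B1 * (b * y)) <= _); last first.
    rewrite (_ : _ + _ = (cF * Cm * M + cF * M + d * B1) * (b * y)); last by ring.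
    by rewrite ler_wpM2r ?mulr_ge0// lerDr mulr_ge0// sqr_ge0.
  apply: lerD.
    apply: le_trans (Fm w) _; apply: le_trans (_ : cF * (Cm * M * b) <= _); first by rewrite ler_wpM2l.
    rewrite (_ : cF * (Cm * M * b) = cF * Cm * M * b); last by ring.
    by rewrite ler_wpM2l ?mulr_ge0// ltW.
  apply: le_trans (ler_normD _ _) _; rewrite !normrN; apply: lerD => //.
  apply: le_trans (Fm z) _; rewrite -mulrA ler_wpM2l//.
  apply: le_trans mzM _; rewrite ler_peMr ?(ltW M0)//; exact: le_trans b1 by1.
have -> : f w - F z - \sum_k rcoord k (w - z) * G1 k z =
  (f w - F w) + (F w - F z - \sum_k rcoord k (w - z) * G1 k z) by ring.
apply: le_trans (ler_normD _ _) _; apply: le_trans (lerD H1 H2) _.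
have bN : b <= (1 + N%:R * y) ^+ L.
  apply: lerXn2r; rewrite ?nnegrE ?addr_ge0 ?mulr_ge0// lerD2l.
  by rewrite ler_peMl// ler1n.
apply: le_trans (_ : (c1 + cF * Cm * M) * (b * (N%:R^-1 + y)) <= _).
  rewrite [leRHS](_ : _ = cF * Cm * M * (b / N%:R) + c1 * (b * y) +
    (c1 * (b / N%:R) + cF * Cm * M * (b * y))); last by ring.
  by rewrite lerDl addr_ge0// !mulr_ge0 ?invr_ge0// ltW.
have -> : (c1 + cF * Cm * M) / N%:R * (1 + N%:R * y) ^+ L.+1 =
   (c1 + cF * Cm * M) * ((1 + N%:R * y) ^+ L * (N%:R^-1 + y)).
  by rewrite exprSr; field; rewrite gt_eqF.
rewrite ler_wpM2l//; first by rewrite addr_ge0// !mulr_ge0// ltW.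
by rewrite ler_wpM2r// addr_ge0// invr_ge0.
Qed.

(** This is [dbar_j F], as [F] is real-valued. *)
Definition grad z j : C := (G1 (inl j) z / 2) +i* (G1 (inr j) z / 2).

Lemma grad_linear z h : (\sum_k rcoord k h * G1 k z)%:C =
  \sum_(j < n) (grad z j * conjc (h 0 j) + conjc (grad z j) * h 0 j) :> C.
Proof.
rewrite rmorph_sum /= big_sumType /= -big_split /=; apply: eq_bigr => j _.
by move: (h 0 j) => [a b]; apply: complex_eq; rewrite /grad !complexE_simp /=; field.
Qed.

(* Multiplication by [w 0 j - z 0 j] preserves holomorphy, so the reproducing
   formula evaluates the integral at [w = z]. *)
Lemma bker_coord_vanishes N u z j : (0 < N)%N -> Hspace N u ->
  cintegrable mu (fun t => bker N z (cpoint t) * (cpoint t - z) 0 j * u (cpoint t)) /\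
  Cint mu (fun t => bker N z (cpoint t) * (cpoint t - z) 0 j * u (cpoint t)) = 0.
Proof.
move=> N0 Hu; have su := Hspace_sqint Hu; have [mu_ _] := su.
have [v hv uE] := Hspace_bargmann Hu.
have [k k0 Hk] : exists2 k : R, 0 < k & forall N, (0 < N)%N -> forall u : Cn R n,
    (1 + N%:R * nsq u) ^+ 1 * gauss_weight N 4 u <= k * gauss_weight N 8 u.
  by apply: gauss_weight_le; apply/andP; split; lra.
have coordE : (fun t : X => (cpoint t - z) 0 j) = (fun t => cpoint t 0 j - z 0 j).
  by apply/funext => t; rewrite !mxE.
have iI : cintegrable mu (fun t => bker N z (cpoint t) * (cpoint t - z) 0 j * u (cpoint t)).
  apply: (@kernel_bound R n _ u k N 8 z N0 _ (ltW k0) _ su _).1 => //.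
    apply: cmeasM => //; apply: cmeasM; first exact: cmeas_bker1.
    by rewrite coordE; apply: cmeasB; [exact: cmeas_coord|exact: cmeas_cst].
  move=> t; rewrite 2!Normc.normcM normc_bker mulrA ler_wpM2r ?normc_ge0//.
  apply: le_trans (Hk N N0 (z - cpoint t)); rewrite expr1 mulrC gkerE.
  apply: ler_wpM2r; first exact: gauss_weight_ge0.
  have := normc_le_nsq (cpoint t - z) j; rewrite (nsqB z) => H.
  have H2 : nsq (cpoint t - z) <= N%:R * nsq (cpoint t - z) by rewrite ler_peMl ?nsq_ge0// ler1n.
  by have := sqr_ge0 (normc ((cpoint t - z) 0 j) - 2^-1); rewrite sqrrB; lra.
split=> //.
pose v' w : C := (w 0 j - z 0 j) * v w.
have hv' : holomorphic v'.
  move=> w; apply: differentiableM; last exact: hv.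
  apply: (@differentiable_quadratic R n _ w (fun i => (i == j)%:R) 0) => h _.
  have -> : \sum_(i < n) h 0 i * (i == j)%:R = h 0 j.
    by rewrite (bigD1 j)//= eqxx mulr1 big1 ?addr0// => i /negbTE ->; rewrite mulr0.
  rewrite mxE (_ : _ - _ - _ = 0) ?Normc.normc0 ?mul0r//.
  by move: (w 0 j) (h 0 j) (z 0 j) => a b c; ring.
have E : (fun t => bker N z (cpoint t) * (cpoint t - z) 0 j * u (cpoint t)) =
    (fun t : X => bker N z (cpoint t) * bargmann N v' (cpoint t)).
  apply/funext => t; rewrite uE /bargmann /v' -mulrA; congr (_ * _).
  by rewrite mulrCA; congr (_ * (_ * _)); rewrite !mxE.
by rewrite E reproducing// -?E// /bargmann /v' subrr mul0r mulr0.
Qed.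

(** Against the Gaussian one factor [w - z] is worth [N^(-1/2)], at the price of widening the weight
    from 4 to 8. *)
Lemma moment_bound : exists2 c : R, 0 <= c & forall N u z j, (0 < N)%N -> sqint u ->
  cintegrable mu (fun t => bker N z (cpoint t) * conjc ((cpoint t - z) 0 j) * u (cpoint t)) /\
  normc (moment N u z j) <= c / Num.sqrt N%:R * avg1 N 8 u z.
Proof.
have [k k0 Hk] : exists2 k : R, 0 < k & forall N, (0 < N)%N -> forall u : Cn R n,
    (1 + N%:R * nsq u) ^+ 1 * gauss_weight N 4 u <= k * gauss_weight N 8 u.
  by apply: gauss_weight_le; apply/andP; split; lra.
exists (2 * k); first by rewrite mulr_ge0// ltW.
move=> M u z j M0 su; have [mu_ _] := su.
have MR : 0 < Num.sqrt M%:R :> R by rewrite sqrtr_gt0 ltr0n.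
have B0 : 0 <= k / Num.sqrt M%:R by rewrite divr_ge0 ?ltW.
have coordE : (fun t : X => (cpoint t - z) 0 j) = (fun t => cpoint t 0 j - z 0 j).
  by apply/funext => t; rewrite !mxE.
have -> : 2 * k / Num.sqrt M%:R * avg1 M 8 u z = 2 * (k / Num.sqrt M%:R * avg1 M 8 u z) by rewrite !mulrA.
apply: (@kernel_bound R n _ u _ M 8 z M0 _ B0 _ su _) => //.
  apply: cmeasM => //; apply: cmeasM; first exact: cmeas_bker1.
  by apply: cmeas_conj; rewrite coordE; apply: cmeasB; [exact: cmeas_coord|exact: cmeas_cst].
move=> t; rewrite 2!Normc.normcM normc_bker normc_conj mulrA ler_wpM2r ?normc_ge0// gkerE.
rewrite [leRHS]mulrAC ler_pdivlMr//; apply: le_trans (Hk M M0 (z - cpoint t)); rewrite expr1.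
rewrite -mulrA mulrC; apply: ler_wpM2r; first exact: gauss_weight_ge0.
have := normc_le_nsq (cpoint t - z) j; rewrite (nsqB z) => H.
set a := normc _ in H *; set s := Num.sqrt _.
have s2 : s ^+ 2 = M%:R by rewrite sqr_sqrtr.
have H2 : (a * s) ^+ 2 <= M%:R * nsq (cpoint t - z).
  by rewrite exprMn s2 mulrC ler_wpM2l.
by have := sqr_ge0 (a * s - 2^-1); rewrite sqrrB; lra.
Qed.

(** The constant does not depend on [N], [f], [u], nor on [z] in the ball; the holomorphic half of
    the linear term integrates to 0, which leaves the moments against [conj (w - z)]. *)
Lemma decomposition (r : R) : 0 <= r -> exists2 c : R, 0 <= c &
  forall N (f : Cn R n -> R) u, (0 < N)%N -> (forall w, `|f w - F w| <= cF / N%:R * m w) ->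
  continuous f -> Hspace N u -> sqint (fun w => (f w)%:C * u w) ->
  forall z, nsq z <= r ^+ 2 ->
  normc (proj N (fun w => (f w)%:C * u w) z - (F z)%:C * u z -
         \sum_(j < n) grad z j * moment N u z j) <= c / N%:R * avg1 N 8 u z.
Proof.
move=> r0; have [c c0 Hc] := taylor_growth r0.
have [k k0 Hk] : exists2 k : R, 0 < k & forall N, (0 < N)%N -> forall u : Cn R n,
    (1 + N%:R * nsq u) ^+ L.+1 * gauss_weight N 4 u <= k * gauss_weight N 8 u.
  by apply: gauss_weight_le; apply/andP; split; lra.
have [c' c'0 Hm] := moment_bound.
exists (2 * (c * k)); first by rewrite !mulr_ge0// ltW.
move=> N f u N0 fF cf Hu sfu z zr; have su := Hspace_sqint Hu; have [mu_ _] := su.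
have NR : (0 : R) < N%:R by rewrite ltr0n.
have ringE (a1 a2 a3 a4 a5 a6 : C) : a1 * (a2 * a3 + a4 * a5) * a6 = a2 * (a1 * a3 * a6) + a4 * (a1 * a5 * a6) by ring.
pose lin (t : X) := \sum_k rcoord k (cpoint t - z) * G1 k z.
pose b (t : X) : C := bker N z (cpoint t).
have [i1 _] := bker_bound N0 z sfu.
have [i2 _] := bker_bound N0 z su.
have ilin : cintegrable mu (fun t => b t * (lin t)%:C * u (cpoint t)) /\
    Cint mu (fun t => b t * (lin t)%:C * u (cpoint t)) = \sum_(j < n) grad z j * moment N u z j.
  have E t : b t * (lin t)%:C * u (cpoint t) =
      \sum_(j < n) (grad z j * (b t * conjc ((cpoint t - z) 0 j) * u (cpoint t)) +
                    conjc (grad z j) * (b t * (cpoint t - z) 0 j * u (cpoint t))).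
    rewrite /lin grad_linear mulr_sumr mulr_suml; apply: eq_bigr => j _.
    exact: ringE.
  have ij j : cintegrable mu (fun t => grad z j * (b t * conjc ((cpoint t - z) 0 j) * u (cpoint t)) +
                    conjc (grad z j) * (b t * (cpoint t - z) 0 j * u (cpoint t))).
    apply: cintegrableD; apply: cintegrableZ.
      by have [] := Hm N u z j N0 su.
    by have [] := bker_coord_vanishes z j N0 Hu.
  have -> : (fun t => b t * (lin t)%:C * u (cpoint t)) = (fun t =>
      \sum_(j < n) (grad z j * (b t * conjc ((cpoint t - z) 0 j) * u (cpoint t)) +
                    conjc (grad z j) * (b t * (cpoint t - z) 0 j * u (cpoint t)))).
    by apply/funext => t; exact: E.
  split; first exact: cintegrable_sum.
  rewrite Cint_sum//; apply: eq_bigr => j _.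
  have [h1 _] := Hm N u z j N0 su; have [h2 h3] := bker_coord_vanishes z j N0 Hu.
  rewrite CintD; [|exact: cintegrableZ|exact: cintegrableZ].
  by rewrite CintZ// CintZ// h3 mulr0 addr0.
case: ilin => ilin <-.
rewrite -[in (F z)%:C * u z](Hspace_reproducing N0 z Hu) /proj -CintZ// -CintB//; last exact: cintegrableZ.
rewrite -CintB//; last by apply: cintegrableB => //; exact: cintegrableZ.
have -> : 2 * (c * k) / N%:R * avg1 N 8 u z = 2 * (c * k / N%:R * avg1 N 8 u z) by rewrite !mulrA.
have B0 : 0 <= c * k / N%:R by rewrite divr_ge0// mulr_ge0// ltW.
apply: (@kernel_bound R n _ u _ N 8 z N0 _ B0 _ su _).2 => //.
  apply: cmeasB; last by case: ilin.
  by apply: cmeasB; [case: i1|apply: cmeasM; [exact: cmeas_cst|case: i2]].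
move=> t; rewrite -/(b t).
have -> : b t * ((f (cpoint t))%:C * u (cpoint t)) - (F z)%:C * (b t * u (cpoint t)) -
   b t * (lin t)%:C * u (cpoint t) = b t * (f (cpoint t) - F z - lin t)%:C * u (cpoint t).
  rewrite !rmorphB /=; move: (b t) (u _) (_%:C) (_%:C) (_%:C) => a1 a2 a3 a4 a5.
  by ring.
rewrite 2!Normc.normcM /b normc_bker normc_real gkerE mulrA ler_wpM2r ?normc_ge0//.
have NN0 : N%:R != 0 :> R by rewrite gt_eqF.
apply: le_trans (_ : gauss_weight N 4 (z - cpoint t) * (c / N%:R * (1 + N%:R * nsq (cpoint t - z)) ^+ L.+1) <= _).
  by rewrite ler_wpM2l ?gauss_weight_ge0// Hc.
rewrite nsqB mulrC -[leLHS]mulrA [leRHS](_ : _ = c / N%:R * (k * gauss_weight N 8 (z - cpoint t))); last first.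
  by rewrite mulrA [c * k / _]mulrAC.
by rewrite ler_wpM2l ?divr_ge0// Hk.
Qed.

End SymbolExpansion.

(** * Localization on the energy level *)

Section RealIntegral.
Context {R : realType} {n : nat}.
Local Notation X := ((n + n).-tuple (measurableTypeR R)).
Local Notation mu := (@leb R (n + n)).
Implicit Types (a b : X -> R).

Lemma Rintegral_EFin a : mu.-integrable setT (EFin \o a) ->
  (\int[mu]_t (a t)%:E = (Rintegral mu setT a)%:E)%E.
Proof. by move=> ia; rewrite /Rintegral fineK//; exact: integrable_fin_num ia. Qed.

Lemma nint_Rintegral a (B : R) : measurable_fun setT a -> (forall t, 0 <= a t) ->
  (\int[mu]_t (a t)%:E <= B%:E)%E ->
  mu.-integrable setT (EFin \o a) /\ 0 <= Rintegral mu setT a <= B.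
Proof.
move=> ma a0 aB; have ia : mu.-integrable setT (EFin \o a).
  by apply: nint_integrable => //; apply: le_lt_trans aB _; rewrite ltry.
split=> //; have := aB; rewrite Rintegral_EFin// lee_fin => ->.
by rewrite andbT; apply: Rintegral_ge0 => t _.
Qed.

Lemma nint_le_Rintegral a b : measurable_fun setT a -> (forall t, 0 <= a t) ->
  (forall t, a t <= b t) -> mu.-integrable setT (EFin \o b) ->
  (\int[mu]_t (a t)%:E <= (Rintegral mu setT b)%:E)%E.
Proof.
move=> ma a0 ab ib; rewrite -Rintegral_EFin//; apply: nint_le => //.
by apply/measurable_EFinP; exact: measurable_int ib.
Qed.

Lemma integrableD_real a b : mu.-integrable setT (EFin \o a) -> mu.-integrable setT (EFin \o b) ->
  mu.-integrable setT (EFin \o (fun t => a t + b t)).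
Proof. by move=> ia ib; have := integrableD measurableT ia ib. Qed.

Lemma integrableZ_real (k : R) a : mu.-integrable setT (EFin \o a) ->
  mu.-integrable setT (EFin \o (fun t => k * a t)).
Proof. by move=> /(integrableZl measurableT k). Qed.

End RealIntegral.

Section Quasimode.
Context {R : realType} {n : nat}.
Local Notation C := (Cplx R).
Local Notation Re := complex.Re.
Local Notation Im := complex.Im.
Local Notation X := ((n + n).-tuple (measurableTypeR R)).
Local Notation mu := (@leb R (n + n)).
Implicit Types (z w h : Cn R n) (u v : Cn R n -> C).
Local Open Scope complex_scope.

(** The weight [l] balances factors of different orders in [N]. *)
Lemma sqint_pair_scaled u v (l A B : R) : 0 < l -> sqint u -> sqint v ->
  l * energy u <= A -> l^-1 * energy v <= B ->
  (\int[mu]_t (normc (u (cpoint t)) * normc (v (cpoint t)))%:E <= (2^-1 * (A + B))%:E)%E.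
Proof.
move=> l0 su sv uA vB; have [mu_ uoo] := su; have [mv voo] := sv.
apply: le_trans (_ : (\int[mu]_t ((2^-1 * l) * normc (u (cpoint t)) ^+ 2 +
    (2^-1 * l^-1) * normc (v (cpoint t)) ^+ 2)%:E <= _)%E).
  apply: nint_le => //.
  - by apply: measurable_funM; exact: cmeas_normc.
  - by apply: measurable_funD; apply: measurable_funM => //; exact: measurable_sqnorm.
  - by move=> t; rewrite mulr_ge0// normc_ge0.
  move=> t; set a := normc _; set b := normc _.
  rewrite -subr_ge0 (_ : _ - _ = (2^-1 * l^-1) * (l * a - b) ^+ 2); last by field; rewrite gt_eqF.
  by apply: mulr_ge0; [rewrite mulr_ge0// invr_ge0 ltW|exact: sqr_ge0].
have l1 : 0 <= 2^-1 * l by rewrite mulr_ge0// ltW.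
have l2 : 0 <= 2^-1 * l^-1 by rewrite mulr_ge0// invr_ge0 ltW.
rewrite nintD; last 4 first.
- by apply: measurable_funM => //; exact: measurable_sqnorm.
- by apply: measurable_funM => //; exact: measurable_sqnorm.
- by move=> t; rewrite mulr_ge0// sqr_ge0.
- by move=> t; rewrite mulr_ge0// sqr_ge0.
rewrite !nintZ//; try exact: measurable_sqnorm; try (by move=> t; exact: sqr_ge0).
by rewrite !energyE// -!EFinM -EFinD lee_fin mulrDr -!mulrA lerD// ler_wpM2l.
Qed.

Variables (N : nat) (f : Cn R n -> R) (u : Cn R n -> C) (e : C) (cr : R).
Hypothesis N0 : (0 < N)%N.
Hypothesis cf : continuous f.
Hypothesis Hu : Hspace N u.
Hypothesis sfu : sqint (fun z => (f z)%:C * u z).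
Hypothesis u1 : energy u = 1.
Hypothesis cr0 : 0 < cr.

Definition residual z : C := proj N (fun z => (f z)%:C * u z) z - e * u z.

Hypothesis hr : energy residual <= (cr / N%:R) ^+ 2.

Let su : sqint u := Hspace_sqint Hu.
Let NR : (0 : R) < N%:R. Proof. by rewrite ltr0n. Qed.

Lemma Hspace_residual : Hspace N residual.
Proof. by apply: HspaceB; [exact: proj_Hspace|exact: HspaceZ]. Qed.

Let sr : sqint residual := Hspace_sqint Hspace_residual.

Lemma residual_pair :
  (\int[mu]_t (normc (residual (cpoint t)) * normc (u (cpoint t)))%:E <= (cr / N%:R)%:E)%E.
Proof.
have h : cr / N%:R = 2^-1 * (cr / N%:R + cr / N%:R) by field; rewrite gt_eqF.
(* [N / cr] balances the residual, of energy at most [(cr / N)^2], against [u], of energy 1. *)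
rewrite h; apply: (@sqint_pair_scaled _ _ (N%:R / cr)) => //.
- by rewrite divr_gt0.
- apply: le_trans (ler_wpM2l _ hr) _; first by rewrite divr_ge0// ltW.
  by rewrite le_eqVlt; apply/orP; left; apply/eqP; field; rewrite !gt_eqF.
- by rewrite u1 mulr1 invf_div.
Qed.

Let w2 z : R := normc (u z) ^+ 2.

Lemma integrable_f_sqnorm : mu.-integrable setT (EFin \o (fun t => f (cpoint t) * w2 (cpoint t))).
Proof.
have [mu_ _] := su.
apply: (@integrable_le _ _ _ _ _ (fun t => normc ((f (cpoint t))%:C * u (cpoint t)) * normc (u (cpoint t)))).
- apply: measurable_funM; last exact: measurable_sqnorm.
  by apply: measurable_continuous_Cn cf _; exact: cmeas_coord.
- by apply: measurable_funM; [apply: cmeas_normc; case: sfu|exact: cmeas_normc].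
- move=> t; rewrite normrM Normc.normcM normc_real -mulrA -expr2.
  by rewrite (ger0_norm (sqr_ge0 _)).
- by apply: le_lt_trans (sqint_pair sfu su) _; rewrite ltry.
Qed.

Lemma integrable_sqnorm : mu.-integrable setT (EFin \o (fun t => w2 (cpoint t))).
Proof.
apply: nint_integrable; [exact: measurable_sqnorm (su.1)|by move=> t; exact: sqr_ge0|by case: su].
Qed.

(* [proj] is self-adjoint and fixes [u]. *)
Lemma residual_inner : normc (inner residual u) <= 2 * (cr / N%:R) /\
  inner residual u = (Rintegral mu setT (fun t => (f (cpoint t) - Re e) * w2 (cpoint t))) +i* (- Im e).
Proof.
have iru := cintegrable_sqint sr su.
split.
  apply: Cint_bound => //.
  under eq_integral => t _ do rewrite Normc.normcM normc_conj.
  exact: residual_pair.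
have sT : sqint (proj N (fun z => (f z)%:C * u z)) := Hspace_sqint (proj_Hspace N0 sfu).
rewrite (innerB sT (sqintZ e su) su) inner_proj// !innerE.
have -> : Cint mu (fun t => e * u (cpoint t) * conjc (u (cpoint t))) = e.
  transitivity (Cint mu (fun t => e * (u (cpoint t) * conjc (u (cpoint t))))).
    by apply: eq_Cint => t; rewrite mulrA.
  by rewrite CintZ ?Cint_energy ?u1 ?mulr1//; exact: cintegrable_sqint.
have -> : Cint mu (fun t => (f (cpoint t))%:C * u (cpoint t) * conjc (u (cpoint t))) =
    (Rintegral mu setT (fun t => f (cpoint t) * w2 (cpoint t)))%:C.
  have E t : (f (cpoint t))%:C * u (cpoint t) * conjc (u (cpoint t)) = (f (cpoint t) * w2 (cpoint t))%:C.
    by rewrite -mulrA normcM_conj -rmorphM.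
  apply: complex_eq; rewrite /Cint /=.
    by congr fine; apply: eq_integral => t _; rewrite E.
  rewrite /Rintegral (_ : 0 = fine (0%:E)%E)//; congr fine; rewrite -[RHS](@integral0 _ _ _ mu setT).
  by apply: eq_integral => t _; rewrite E.
have -> : Rintegral mu setT (fun t => (f (cpoint t) - Re e) * w2 (cpoint t)) =
   Rintegral mu setT (fun t => f (cpoint t) * w2 (cpoint t)) - Re e.
  have -> : (fun t : X => (f (cpoint t) - Re e) * w2 (cpoint t)) =
     (fun t => f (cpoint t) * w2 (cpoint t) - Re e * w2 (cpoint t)).
    by apply/funext => t; rewrite mulrBl.
  rewrite RintegralB//; last 2 first.
  - exact: integrable_f_sqnorm.
  - by apply: integrableZ_real; exact: integrable_sqnorm.
  rewrite RintegralZl//; last exact: integrable_sqnorm.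
  by rewrite -[Rintegral _ _ (fun t => w2 _)]/(energy u) u1 mulr1.
by apply: complex_eq; rewrite !complexE_simp /= ?sub0r.
Qed.

(** The Toeplitz operator of a real symbol is symmetric, so [e] is real up to the residual. *)
Lemma Im_energy_le : `|Im e| <= 2 * (cr / N%:R).
Proof.
have [H E] := residual_inner; apply: le_trans H; apply: le_trans (normr_Im _).
by rewrite E /= normrN.
Qed.

Lemma mean_energy_le :
  `|Rintegral mu setT (fun t => (f (cpoint t) - Re e) * w2 (cpoint t))| <= 2 * (cr / N%:R).
Proof.
have [H E] := residual_inner; apply: le_trans H; apply: le_trans (normr_Re _).
by rewrite E.
Qed.

Lemma avg_pair : (\int[mu]_t (normc (u (cpoint t)) * avg1 N 8 u (cpoint t))%:E <=
  (2^-1 * (1 + 4 ^+ n * 4 ^+ n))%:E)%E.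
Proof.
have [sg eg] := sqint_avg1 N0 (ltr0n _ 8) su.
have -> : (fun t : X => (normc (u (cpoint t)) * avg1 N 8 u (cpoint t))%:E) =
   (fun t => (normc (u (cpoint t)) * normc ((avg1 N 8 u (cpoint t))%:C))%:E).
  apply/funext => t; rewrite normc_real ger0_norm//.
  by apply: gavg_ge0 => w; exact: normc_ge0.
apply: (@sqint_pair_scaled u (fun z => (avg1 N 8 u z)%:C) 1) => //; first by rewrite u1 mulr1.
rewrite invr1 mul1r; move: eg; rewrite u1 mulr1.
by rewrite (_ : 8 / 2 = 4)//; field.
Qed.

(* Away from the near region [f - Re e] has a constant sign, so its integral
   controls the mass there by the mass of the near region. *)
Lemma localization (P : set (Cn R n)) (c1 c2 : R) (s : R) : 0 <= c1 -> 0 <= c2 -> `|s| = 1 ->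
  (forall z, ~ P z -> `|f z - Re e| = s * (f z - Re e)) ->
  (forall z, P z -> `|f z - Re e| * w2 z <= normc (residual z) * normc (u z) +
     c1 / Num.sqrt N%:R * (normc (u z) * avg1 N 8 u z) + c2 / N%:R * w2 z) ->
  (\int[mu]_t (`|f (cpoint t) - Re e| * w2 (cpoint t))%:E <=
   ((4 * cr + c1 * (1 + 4 ^+ n * 4 ^+ n) + 2 * c2) / Num.sqrt N%:R)%:E)%E.
Proof.
move=> c10 c20 s1 far near; have [mu_ _] := su; have [mr _] := sr.
have NS : 0 < Num.sqrt N%:R :> R by rewrite sqrtr_gt0.
have mf : measurable_fun setT (fun t : X => f (cpoint t)).
  by apply: measurable_continuous_Cn cf _; exact: cmeas_coord.
pose b1 (t : X) := normc (residual (cpoint t)) * normc (u (cpoint t)).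
pose b2 (t : X) := normc (u (cpoint t)) * avg1 N 8 u (cpoint t).
pose b3 (t : X) := w2 (cpoint t).
pose g (t : X) := (f (cpoint t) - Re e) * w2 (cpoint t).
have avg0 z : 0 <= avg1 N 8 u z by apply: gavg_ge0 => w; exact: normc_ge0.
have b10 t : 0 <= b1 t by rewrite mulr_ge0 ?normc_ge0.
have b20 t : 0 <= b2 t by rewrite mulr_ge0 ?normc_ge0.
have b30 t : 0 <= b3 t by exact: sqr_ge0.
have mb1 : measurable_fun setT b1 by apply: measurable_funM; exact: cmeas_normc.
have mb2 : measurable_fun setT b2.
  apply: measurable_funM; first exact: cmeas_normc.
  by apply: measurable_gavg => [|z]; [exact: cmeas_normc|exact: normc_ge0].
have mb3 : measurable_fun setT b3 by exact: measurable_sqnorm.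
have [i1 /andP[_ B1]] := nint_Rintegral mb1 b10 residual_pair.
have [i2 /andP[_ B2]] := nint_Rintegral mb2 b20 avg_pair.
have i3 := integrable_sqnorm.
have ig : mu.-integrable setT (EFin \o g).
  have -> : g = (fun t => f (cpoint t) * w2 (cpoint t) + (- Re e) * w2 (cpoint t)).
    by apply/funext => t; rewrite /g mulrDl.
  by apply: integrableD_real; [exact: integrable_f_sqnorm|exact: integrableZ_real].
pose k1 := c1 / Num.sqrt N%:R; pose k2 := c2 / N%:R.
have k10 : 0 <= k1 by rewrite divr_ge0// ltW.
have k20 : 0 <= k2 by rewrite divr_ge0.
(* Off [P] the term [s * g] is the integrand itself. On [P] it may be as low as minus the integrand,
   hence the near bound is counted twice. *)
pose b t := s * g t + 2 * (b1 t + (k1 * b2 t + k2 * b3 t)).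
have i23 : mu.-integrable setT (EFin \o (fun t => k1 * b2 t + k2 * b3 t)).
  by apply: integrableD_real; exact: integrableZ_real.
have i123 : mu.-integrable setT (EFin \o (fun t => b1 t + (k1 * b2 t + k2 * b3 t))).
  exact: integrableD_real.
have ib : mu.-integrable setT (EFin \o b).
  by apply: integrableD_real; exact: integrableZ_real.
apply: le_trans (@nint_le_Rintegral _ _ _ b _ _ _ ib) _.
- apply: measurable_funM => //; apply: measurableT_comp => //; exact: measurable_funB.
- by move=> t; rewrite mulr_ge0// sqr_ge0.
- move=> t; rewrite /b /g; have [Pt|nPt] := pselect (P (cpoint t)); last first.
    by rewrite (far _ nPt) mulrA lerDl mulr_ge0// !addr_ge0// mulr_ge0.
  have h1 : `|f (cpoint t) - Re e| * w2 (cpoint t) <= b1 t + (k1 * b2 t + k2 * b3 t).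
    by rewrite addrA; exact: near.
  have h2 : - (`|f (cpoint t) - Re e| * w2 (cpoint t)) <= s * ((f (cpoint t) - Re e) * w2 (cpoint t)).
    have : `|s * ((f (cpoint t) - Re e) * w2 (cpoint t))| <= `|f (cpoint t) - Re e| * w2 (cpoint t).
      by rewrite normrM s1 mul1r normrM (ger0_norm (sqr_ge0 _)).
    by rewrite ler_norml => /andP[].
  by move: h1 h2; set x := `|_| * _; set y := s * _; set v := b1 t + _; lra.
rewrite lee_fin /b RintegralD//; [|exact: integrableZ_real|exact: integrableZ_real].
rewrite !RintegralZl// RintegralD// RintegralD//; [|exact: integrableZ_real|exact: integrableZ_real].
rewrite !RintegralZl//.
have -> : Rintegral mu setT b3 = 1 by rewrite -u1.
have G : s * Rintegral mu setT g <= 2 * (cr / N%:R).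
  apply: le_trans mean_energy_le; apply: le_trans (ler_norm _) _.
  by rewrite normrM s1 mul1r.
have NN : N%:R^-1 <= (Num.sqrt N%:R)^-1 :> R.
  rewrite lef_pV2 ?posrE// -{2}(sqr_sqrtr (ltW NR)) expr2 ler_peMl ?(ltW NS)//.
  by rewrite -{1}sqrtr1 ler_wsqrtr// ler1n.
have crN : cr / N%:R <= cr / Num.sqrt N%:R by rewrite ler_wpM2l// ltW.
have c2N : k2 <= c2 / Num.sqrt N%:R by rewrite ler_wpM2l.
have K : k1 * Rintegral mu setT b2 <= c1 * (2^-1 * (1 + 4 ^+ n * 4 ^+ n)) / Num.sqrt N%:R.
  by rewrite /k1 mulrAC ler_wpM2r ?invr_ge0 ?(ltW NS)// ler_wpM2l.
have -> : (4 * cr + c1 * (1 + 4 ^+ n * 4 ^+ n) + 2 * c2) / Num.sqrt N%:R =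
  2 * (cr / Num.sqrt N%:R) + 2 * (cr / Num.sqrt N%:R + (c1 * (2^-1 * (1 + 4 ^+ n * 4 ^+ n)) / Num.sqrt N%:R + c2 / Num.sqrt N%:R)).
  by field; rewrite gt_eqF.
rewrite mulr1; apply: lerD.
  by apply: le_trans G _; rewrite ler_wpM2l.
rewrite ler_wpM2l//; apply: lerD; first exact: le_trans B1 crN.
exact: lerD.
Qed.

End Quasimode.

(** * Transport along the Hamiltonian flow *)

Section Concentration.
Context {R : realType} {n : nat}.
Local Notation C := (Cplx R).
Local Notation X := ((n + n).-tuple (measurableTypeR R)).
Local Notation mu := (@leb R (n + n)).
Implicit Types (z w h : Cn R n) (u v : Cn R n -> C).
Local Open Scope complex_scope.
Variables (N : nat) (u : Cn R n -> C).
Hypothesis N0 : (0 < N)%N.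

Lemma avg2_le_peak c z : 0 < c -> sqint u -> avg2 N c u z <= @peak R n N * energy u.
Proof.
move=> c0 su; have [mu_ _] := su.
rewrite -lee_fin -avg2E// EFinM -energyE// -nintZ//; last 3 first.
- exact: measurable_sqnorm.
- by move=> t; exact: sqr_ge0.
- exact: peak_ge0.
apply: nint_le => //.
- by apply: measurable_funM; [exact: measurable_gauss_weight1|exact: measurable_sqnorm].
- by apply: measurable_funM => //; exact: measurable_sqnorm.
- by move=> t; rewrite mulr_ge0 ?sqr_ge0 ?gauss_weight_ge0.
- by move=> t; rewrite ler_wpM2r ?sqr_ge0// gauss_weight_le_peak.
Qed.

(** This bound depends on [N]; it serves only to justify integrations. *)
Lemma avg1_bounded c : 0 < c -> sqint u -> exists2 B : R, 0 <= B & forall z, avg1 N c u z <= B.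
Proof.
move=> c0 su; pose B := (c / 2) ^+ n * (@peak R n N * energy u).
exists (1 + B).
  by rewrite addr_ge0// mulr_ge0 ?exprn_ge0 ?divr_ge0 ?(ltW c0)// mulr_ge0 ?peak_ge0 ?energy_ge0.
move=> z; have [_ H] := avg1_cs z N0 c0 su.
have : avg1 N c u z ^+ 2 <= B.
  apply: le_trans H _; rewrite ler_wpM2l ?exprn_ge0 ?divr_ge0 ?(ltW c0)//.
  exact: avg2_le_peak.
by have := sqr_ge0 (avg1 N c u z - 2^-1); rewrite sqrrB; lra.
Qed.

Lemma sqnorm_le_avg2 z : Hspace N u -> normc (u z) ^+ 2 <= 4 * 2 ^+ n * avg2 N 4 u z.
Proof.
move=> Hu; have su := Hspace_sqint Hu.
have [_ b] := bker_bound N0 z su; rewrite Hspace_reproducing// in b.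
have [_ c] := avg1_cs z N0 (ltr0n _ 4) su.
apply: le_trans (_ : (2 * avg1 N 4 u z) ^+ 2 <= _).
  apply: lerXn2r => //; rewrite nnegrE ?normc_ge0// mulr_ge0//.
  by apply: gavg_ge0 => w; exact: normc_ge0.
rewrite exprMn -mulrA (_ : 2 ^+ 2 = 4); last by ring.
by rewrite ler_wpM2l// (le_trans c)// (_ : 4 / 2 = 2)//; field.
Qed.

(** [|u z|^2] is controlled by the Gaussian average of [|u|^2] around [z]. Points with
    [nsq (w - z) <= s] are paid by [a]; elsewhere [exp (- x) <= 1 / x] bounds the Gaussian by
    [4 / (s N)], and [u] is normalized. *)
Lemma concentration (a : Cn R n -> R) (A s : R) z : Hspace N u -> energy u = 1 ->
  measurable_fun setT (fun t : X => a (cpoint t)) -> (forall w, 0 <= a w) ->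
  (\int[mu]_t (a (cpoint t))%:E <= A%:E)%E -> 0 < s ->
  (forall w, nsq (w - z) <= s -> expR (- (N%:R / 4) * nsq (w - z)) * normc (u w) ^+ 2 <= a w) ->
  normc (u z) ^+ 2 <= 4 * 2 ^+ n * (@peak R n N * (A + 4 / s / N%:R)).
Proof.
move=> Hu u1 ma a0 aA s0 H; have su := Hspace_sqint Hu; have [mu_ _] := su.
have NR : (0 : R) < N%:R by rewrite ltr0n.
apply: le_trans (sqnorm_le_avg2 z Hu) _.
rewrite ler_wpM2l ?mulr_ge0 ?exprn_ge0//.
rewrite -lee_fin -avg2E//.
pose k := 4 / s / N%:R; have k0 : 0 <= k by rewrite !divr_ge0// ltW.
apply: le_trans (_ : (\int[mu]_t (@peak R n N * (a (cpoint t) + k * normc (u (cpoint t)) ^+ 2))%:E <= _)%E).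
  apply: nint_le => //.
  - by apply: measurable_funM; [exact: measurable_gauss_weight1|exact: measurable_sqnorm].
  - apply: measurable_funM => //; apply: measurable_funD => //; apply: measurable_funM => //.
    exact: measurable_sqnorm.
  - by move=> t; rewrite mulr_ge0 ?sqr_ge0 ?gauss_weight_ge0.
  - move=> t; rewrite /gauss_weight nsqB -mulrA ler_wpM2l ?peak_ge0//.
    have [ws|ws] := leP (nsq (cpoint t - z)) s.
      by apply: le_trans (H _ ws) _; rewrite lerDl mulr_ge0// sqr_ge0.
    apply: le_trans (_ : k * normc (u (cpoint t)) ^+ 2 <= _); last by rewrite lerDr.
    rewrite ler_wpM2r ?sqr_ge0// mulNr expRN.
    have x0 : 0 < N%:R / 4 * s by rewrite mulr_gt0// divr_gt0.
    rewrite (_ : k = (N%:R / 4 * s)^-1); last by rewrite /k; field; rewrite !gt_eqF.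
    rewrite lef_pV2 ?posrE ?expR_gt0//.
    apply: le_trans (_ : N%:R / 4 * nsq (cpoint t - z) <= _).
      by rewrite ler_wpM2l ?divr_ge0// ltW.
    by apply: le_trans (expR_ge1Dx _); rewrite lerDr.
have m1 : measurable_fun setT (fun t : X => normc (u (cpoint t)) ^+ 2) by exact: measurable_sqnorm.
rewrite nintZ ?peak_ge0//; last 2 first.
- by apply: measurable_funD => //; exact: measurable_funM.
- by move=> t; rewrite addr_ge0 ?a0// mulr_ge0// sqr_ge0.
rewrite [leRHS]EFinM; apply: lee_wpmul2l; first by rewrite lee_fin peak_ge0.
rewrite nintD; last 4 first.
- by [].
- exact: measurable_funM.
- by move=> t; exact: a0.
- by move=> t; rewrite mulr_ge0// sqr_ge0.
rewrite [leRHS]EFinD; apply: leeD => //.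
rewrite nintZ//; last by move=> t; exact: sqr_ge0.
by rewrite energyE// u1 mule1.
Qed.

End Concentration.

Section IntegrationByParts.
Context {R : realType} {n : nat}.
Local Notation C := (Cplx R).
Local Notation X := ((n + n).-tuple (measurableTypeR R)).
Local Notation mu := (@leb R (n + n)).
Implicit Types (z w h : Cn R n).
Local Open Scope complex_scope.

(** These Gaussians are at least [B] where [nsq z <= r], hence integrable majorants of functions
    bounded by [B] and supported there. *)
Lemma gauss_integrable (B r : R) : 0 <= B ->
  mu.-integrable setT (EFin \o (fun t => B * expR (r - nsq (cpoint t)))).
Proof.
move=> B0; have mn : measurable_fun setT (fun t : X => nsq (cpoint t)).
  by apply: measurable_nsq; exact: cmeas_coord.
have -> : (fun t : X => B * expR (r - nsq (cpoint t))) =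
    (fun t => (B * expR r) * expR (- 1 * nsq (cpoint t))).
  by apply/funext => t; rewrite expRD mulN1r mulrA.
apply: integrableZ_real; apply: nint_integrable.
- by apply: measurableT_comp => //; apply: measurable_funM.
- by move=> t; exact: expR_ge0.
- by rewrite cleb_gauss// ltry.
Qed.

Lemma Rintegral_translate (f : Cn R n -> R) a : measurable_fun setT (fun t : X => f (cpoint t)) ->
  Rintegral mu setT (fun t => f (cpoint t + a)) = Rintegral mu setT (fun t => f (cpoint t)).
Proof.
move=> mf; have := @cint_translate R n a (fun z => (f z)%:C) (cmeas_real mf).
by move=> /(congr1 (@complex.Re R)).
Qed.

Lemma derive_line (f f' : Cn R n -> R) h z (t : R) :
  (forall z, is_derive (0 : R) 1 (fun t : R => f (z + (t%:C : C) *: h)) (f' z)) ->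
  is_derive t 1 (fun t : R => f (z + (t%:C : C) *: h)) (f' (z + (t%:C : C) *: h)).
Proof.
move=> H.
have E : (fun s : R => f (z + ((t + s)%:C : C) *: h)) =
    (fun s : R => f (z + (t%:C : C) *: h + (s%:C : C) *: h)).
  by apply/funext => s; rewrite -addrA -scalerDl rmorphD.
have K : is_derive (0:R) 1 (fun s : R => f (z + ((t + s)%:C : C) *: h)) (f' (z + (t%:C : C) *: h)).
  by rewrite E; exact: H.
exact: (is_derive_shift K).
Qed.

Lemma derivative_harmonic (g : R -> R) (b : R) : is_derive (0 : R) 1 g b ->
  (fun k => (harmonic k)^-1 * (g (harmonic k) - g 0)) @ \oo --> b.
Proof.
move=> [D1 D2]; have D3 : h^-1 *: ((g \o shift 0) (h *: (1 : R)) - g 0) @[h --> 0^'] --> b by rewrite -D2.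
have /cvgr_dnbhsP/(_ (@harmonic R)) := D3.
have -> : (fun k => (harmonic k : R)^-1 *: ((g \o shift 0) (harmonic k *: (1 : R)) - g 0)) =
    (fun k => (harmonic k)^-1 * (g (harmonic k) - g 0)).
  by apply/funext => k /=; rewrite addr0 /GRing.scale /= mulr1.
by apply; split=> [k|]; [rewrite gt_eqF// harmonic_gt0|exact: cvg_harmonic].
Qed.

(** Difference quotients have zero integral by translation invariance; bounded and supported in a
    common ball, they converge under a Gaussian majorant. *)
Lemma integral_derivative_eq0 (f f' : Cn R n -> R) h (r B : R) : continuous f ->
  (forall z, is_derive (0 : R) 1 (fun t : R => f (z + (t%:C : C) *: h)) (f' z)) ->
  0 <= r -> (forall z, r < nsq z -> f z = 0) -> (forall z, `|f' z| <= B) ->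
  mu.-integrable setT (EFin \o (fun t => f' (cpoint t))) /\
  Rintegral mu setT (fun t => f' (cpoint t)) = 0.
Proof.
move=> cf df r0 f0 fB.
have B0 : 0 <= B by apply: le_trans (fB 0).
have mf : measurable_fun setT (fun t : X => f (cpoint t)).
  by apply: measurable_continuous_Cn cf _; exact: cmeas_coord.
have lip z (t : R) : `|f (z + (t%:C : C) *: h) - f z| <= B * `|t|.
  have := @mvt_line R (fun t : R => f (z + (t%:C : C) *: h)) (fun t => f' (z + (t%:C : C) *: h)) B t.
  rewrite scale0r addr0; apply=> [s|//]; exact: derive_line.
have [M M0 HM] := bounded_on_rbox (Num.sqrt r) cf.
have fM z : `|f z| <= M * expR (r - nsq z).
  have [zr|zr] := leP (nsq z) r; last by rewrite f0// normr0 mulr_ge0// expR_ge0.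
  apply: le_trans (HM z _) _; first by apply: nsq_rbox; rewrite ?sqrtr_ge0// sqr_sqrtr.
  by rewrite ler_peMr// -expR0 ler_expR subr_ge0.
have i_f : mu.-integrable setT (EFin \o (fun t => f (cpoint t))).
  have ig := gauss_integrable r M0.
  apply: (@integrable_le _ _ _ _ _ (fun t => M * expR (r - nsq (cpoint t)))) => //.
    by apply/measurable_EFinP; exact: measurable_int ig.
  by rewrite (Rintegral_EFin ig) ltry.
pose d (k : nat) : R := k.+1%:R^-1.
have d0 k : 0 < d k by rewrite invr_gt0.
pose q (k : nat) z := k.+1%:R * (f (z + ((d k)%:C : C) *: h) - f z).
have mfT k : measurable_fun setT (fun t : X => f (cpoint t + ((d k)%:C : C) *: h)).
  apply: measurable_continuous_Cn cf _ => j.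
  have -> : (fun t : X => (cpoint t + ((d k)%:C : C) *: h) 0 j) =
     (fun t => cpoint t 0 j + (((d k)%:C : C) *: h) 0 j).
    by apply/funext => t; rewrite mxE.
  by apply: cmeasD; [exact: cmeas_coord|exact: cmeas_cst].
have mq k : measurable_fun setT (fun t : X => q k (cpoint t)).
  by apply: measurable_funM => //; apply: measurable_funB.
have qB k z : `|q k z| <= B.
  rewrite normrM ger0_norm// mulrC -ler_pdivlMr// -/(d k).
  by apply: le_trans (lip z (d k)) _; rewrite (gtr0_norm (d0 k)).
(* Translations by at most [h] keep all the quotients supported in this ball. *)
pose r' := 2 * r + 2 * nsq h.
have dk1 k : d k <= 1 by rewrite invf_le1// ler1n.
have q0 k z : r' < nsq z -> q k z = 0.
  move=> zr; have h0 := nsq_ge0 h.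
  have H := nsqD (z + ((d k)%:C : C) *: h) (- (((d k)%:C : C) *: h)).
  rewrite addrK nsqN nsqZ normc_real (gtr0_norm (d0 k)) in H.
  have H2 : d k ^+ 2 * nsq h <= nsq h.
    by rewrite ler_piMl// expr_le1// ltW.
  rewrite /q !f0 ?subrr ?mulr0//.
    by move: zr; rewrite /r'; lra.
  move: zr H H2; rewrite /r'; move: (nsq (z + _)) (d k ^+ 2 * nsq h) => x y; lra.
have qdom k z : `|q k z| <= B * expR (r' - nsq z).
  have [zr|zr] := leP (nsq z) r'; last by rewrite q0// normr0 mulr_ge0// expR_ge0.
  by apply: le_trans (qB k z) _; rewrite ler_peMr// -expR0 ler_expR subr_ge0.
have qlim z : (fun k => q k z) @ \oo --> f' z.
  have := derivative_harmonic (df z); rewrite scale0r addr0.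
  by under eq_fun => k do rewrite -[(harmonic k)^-1]/((k.+1%:R : R)^-1^-1) invrK.
have mf' : measurable_fun setT (fun t : X => f' (cpoint t)).
  by apply: (@measurable_fun_cvg _ _ _ _ (fun k t => q k (cpoint t))) => // t _; exact: qlim.
have ig := gauss_integrable r' B0.
have h1 k : measurable_fun setT (fun t : X => (q k (cpoint t))%:E) by exact/measurable_EFinP.
have h2 : measurable_fun setT (fun t : X => (f' (cpoint t))%:E) by exact/measurable_EFinP.
have h3 : {ae mu, forall t, setT t -> (fun k => (q k (cpoint t))%:E) @ \oo --> (f' (cpoint t))%:E}.
  by apply/nearW => t _; apply: cvg_EFin; [exact: nearW|exact: qlim].
have h5 : {ae mu, forall t k, setT t -> (`|(q k (cpoint t))%:E| <= (B * expR (r' - nsq (cpoint t)))%:E)%E}.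
  by apply/nearW => t k _; rewrite lee_fin.
have [if' _ cv] := @dominated_convergence _ _ R mu setT measurableT
  (fun k t => (q k (cpoint t))%:E) (fun t => (f' (cpoint t))%:E)
  (fun t => (B * expR (r' - nsq (cpoint t)))%:E) h1 h2 h3 ig h5.
split=> //.
have q_int k : (\int[mu]_t (q k (cpoint t))%:E = 0)%E.
  have iT : mu.-integrable setT (EFin \o (fun t => f (cpoint t + ((d k)%:C : C) *: h))).
    apply: (@integrable_le _ _ _ _ _ (fun t => B * expR (r' - nsq (cpoint t)) + M * expR (r - nsq (cpoint t)))) => //.
    - by apply: measurable_funD; apply/measurable_EFinP; apply: measurable_int (gauss_integrable _ _).
    - move=> t; have -> : f (cpoint t + ((d k)%:C : C) *: h) = d k * q k (cpoint t) + f (cpoint t).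
        by rewrite /q mulrA /d mulVf// mul1r subrK.
      apply: le_trans (ler_normD _ _) _; apply: lerD => //.
      by rewrite normrM (gtr0_norm (d0 k)); apply: le_trans (qdom k _); rewrite ler_piMl.
    - rewrite (Rintegral_EFin (integrableD_real (gauss_integrable r' B0) (gauss_integrable r M0))).
      exact: ltry.
  have iD : mu.-integrable setT (EFin \o (fun t => f (cpoint t + ((d k)%:C : C) *: h) - f (cpoint t))).
    have := integrableD_real iT (integrableZ_real (-1) i_f).
    by congr (_.-integrable _ _); apply/funext => t /=; rewrite mulN1r.
  rewrite (Rintegral_EFin (integrableZ_real k.+1%:R iD)) RintegralZl// RintegralB//.
  by rewrite (@Rintegral_translate f)// subrr mulr0.
have E0 : (fun k => \int[mu]_t (q k (cpoint t))%:E)%E = (fun=> 0%E).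
  by apply/funext => k; exact: q_int.
have cv' : (fun k => \int[mu]_(t in setT) (q k (cpoint t))%:E)%E @ \oo --> (\int[mu]_(t in setT) (f' (cpoint t))%:E)%E := cv.
rewrite E0 in cv'.
have := cvg_unique _ cv' (cvg_cst _) => H.
by rewrite /Rintegral H.
Qed.

End IntegrationByParts.

Section Transport.
Context {R : realType} {n : nat}.
Local Notation C := (Cplx R).
Local Notation Re := complex.Re.
Local Notation Im := complex.Im.
Local Notation D := ('I_n + 'I_n)%type.
Local Notation X := ((n + n).-tuple (measurableTypeR R)).
Local Notation mu := (@leb R (n + n)).
Implicit Types (z w h : Cn R n) (k l : D).
Local Open Scope complex_scope.

(** The square of the positive part, a cut-off profile of class C^1 whose derivative is explicit and
    vanishes wherever the profile does. *)
Definition sqpos (x : R) : R := Num.max 0 x ^+ 2.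

Lemma is_derive_sqpos (x : R) : is_derive x 1 sqpos (2 * Num.max 0 x).
Proof.
apply: (@is_derive_quadratic _ _ _ _ 1 1) => // t _; rewrite /sqpos mul1r.
have t2 : 0 <= t ^+ 2 := sqr_ge0 t.
rewrite ler_norml; have [x0|x0] := leP 0 x; have [xt|xt] := leP 0 (x + t).
- by rewrite (_ : _ - _ = t ^+ 2); [apply/andP; split; lra|ring].
- rewrite expr0n sub0r (_ : - x ^+ 2 - _ = t ^+ 2 - (x + t) ^+ 2); last by ring.
  have h : 0 <= (x + t) ^+ 2 := sqr_ge0 _.
  have h2 : (x + t) ^+ 2 <= t ^+ 2.
    have : 0 <= x * (- (x + t) - t) by rewrite mulr_ge0//; lra.
    rewrite (_ : x * _ = t ^+ 2 - (x + t) ^+ 2); [lra|ring].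
  by apply/andP; split; lra.
- rewrite expr0n subr0 !mulr0 subr0.
  have h : 0 <= (x + t) ^+ 2 := sqr_ge0 _.
  have h2 : (x + t) ^+ 2 <= t ^+ 2 by apply: lerXn2r; rewrite ?nnegrE; lra.
  by apply/andP; split; lra.
- by rewrite expr0n subrr !mulr0 subr0; apply/andP; split; lra.
Qed.

Lemma continuous_sqpos : continuous sqpos.
Proof.
move=> x; have [D1 _] := is_derive_sqpos x.
by apply: differentiable_continuous; apply/derivable1_diffP.
Qed.

Lemma is_derive_product4 (h A p w : R -> R) (dh dA dp dw : R) :
  is_derive (0 : R) 1 h dh -> is_derive (0 : R) 1 A dA ->
  is_derive (0 : R) 1 p dp -> is_derive (0 : R) 1 w dw ->
  is_derive (0 : R) 1 (fun t => h t * (A t * p t) * w t)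
    (dh * (A 0 * p 0) * w 0 + h 0 * (dA * p 0 + A 0 * dp) * w 0 + h 0 * (A 0 * p 0) * dw).
Proof.
move=> d1 d2 d3 d4; apply: is_derive_eq; rewrite /GRing.scale /=.
by move: (h 0) (A 0) (p 0) (w 0) => a b c d; ring.
Qed.

Variables (F : Cn R n -> R) (G1 : D -> Cn R n -> R) (G2 : D -> D -> Cn R n -> R).
Hypothesis dG1 : forall k, partials (G1 k) (G2 k).
Hypothesis cG1 : forall k, continuous (G1 k).

(** The components of the Hamiltonian field X of [F]: the derivative in [y_j], then minus the
    derivative in [x_j]. *)
Definition ham k z : R :=
  match k with inl j => G1 (inr j) z | inr j => - G1 (inl j) z end.

Definition ham1 k l z : R :=
  match k with inl j => G2 (inr j) l z | inr j => - G2 (inl j) l z end.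

Lemma partials_ham k : partials (ham k) (ham1 k).
Proof.
case: k => j l z; first exact: dG1.
have := dG1 (inl j) l z => H.
by apply: is_derive_eq.
Qed.

Lemma continuous_ham k : continuous (ham k).
Proof.
case: k => j z; first exact: cG1.
by apply: (@continuousN _ _ _ (G1 (inl j))); exact: cG1.
Qed.

Variables (N : nat) (f : Cn R n -> R) (u : Cn R n -> C) (e : C) (cr : R).
Hypothesis N0 : (0 < N)%N.
Hypothesis cf : continuous f.
Hypothesis Hu : Hspace N u.
Hypothesis sfu : sqint (fun z => (f z)%:C * u z).
Hypothesis u1 : energy u = 1.
Hypothesis cr0 : 0 < cr.
Hypothesis hr : energy (residual N f u e) <= (cr / N%:R) ^+ 2.

Let su : sqint u := Hspace_sqint Hu.
Let w2 z : R := normc (u z) ^+ 2.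

Definition dsqnorm k z : R :=
  N%:R * Re (conjc (u z) * \sum_(j < n) (coord_dir k : Cn R n) 0 j * moment N u z j).

Lemma sum_dirx z i : \sum_(j < n) (dirx i : Cn R n) 0 j * moment N u z j = moment N u z i.
Proof.
rewrite (bigD1 i)//= mxE !eqxx mul1r big1 ?addr0// => j ji.
by rewrite mxE (negbTE ji) andbF mul0r.
Qed.

Lemma sum_diry z i : \sum_(j < n) (diry i : Cn R n) 0 j * moment N u z j =
  (0 +i* 1) * moment N u z i.
Proof.
rewrite (bigD1 i)//= !mxE !eqxx mulr1 big1 ?addr0// => j ji.
by rewrite !mxE (negbTE ji) andbF mulr0 mul0r.
Qed.

(** Pairing with X rather than with the gradient of [F] selects the imaginary part, in which the
    real multiple of [|u|^2] from the expansion disappears. *)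
Lemma ham_dsqnorm z : \sum_k ham k z * dsqnorm k z =
  2 * N%:R * Im (conjc (u z) * \sum_(j < n) grad G1 z j * moment N u z j).
Proof.
rewrite big_sumType /= -big_split /= mulr_sumr cIm_sum mulr_sumr; apply: eq_bigr => j _.
rewrite /dsqnorm [coord_dir (inl j)]/= [coord_dir (inr j)]/= sum_dirx sum_diry /grad.
by move: (conjc (u z)) (moment N u z j) => [a b] [c d] /=; field.
Qed.

Lemma dsqnorm_bounded k : exists2 B : R, 0 <= B & forall z, w2 z <= B /\ `|dsqnorm k z| <= B.
Proof.
have [B4 B40 H4] := avg1_bounded N0 (ltr0n _ 4 : 0 < 4%:R :> R) su.
have [B8 B80 H8] := avg1_bounded N0 (ltr0n _ 8 : 0 < 8%:R :> R) su.
have [c c0 Hm] := @moment_bound R n.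
have ub z : normc (u z) <= 2 * B4.
  have [_ b] := bker_bound N0 z su; rewrite Hspace_reproducing// in b.
  by apply: le_trans b _; rewrite ler_wpM2l.
pose q := c / Num.sqrt N%:R * B8.
have q0 : 0 <= q by rewrite mulr_ge0// divr_ge0// sqrtr_ge0.
pose P := N%:R * ((2 * B4) * (n%:R * q * hs (coord_dir k : Cn R n))).
have P0 : 0 <= P by rewrite !mulr_ge0// hs_ge0.
exists ((2 * B4) ^+ 2 + P); first by rewrite addr_ge0// sqr_ge0.
move=> z; split.
  apply: le_trans (_ : (2 * B4) ^+ 2 <= _); last by rewrite lerDl.
  by apply: lerXn2r; rewrite ?nnegrE ?normc_ge0// mulr_ge0.
apply: le_trans (_ : P <= _); last by rewrite lerDr sqr_ge0.
rewrite /dsqnorm normrM ger0_norm// ler_wpM2l//.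
apply: le_trans (normr_Re _) _; rewrite Normc.normcM normc_conj.
apply: ler_pM; rewrite ?normc_ge0//.
apply: le_trans (hs_linear_le _ _) _; rewrite ler_wpM2r ?hs_ge0//.
apply: le_trans (_ : \sum_(j < n) q <= _).
  apply: ler_sum => j _; have [_ H] := Hm N u z j N0 su.
  by apply: le_trans H _; rewrite ler_wpM2l// divr_ge0// sqrtr_ge0.
by rewrite sumr_const card_ord mulr_natl.
Qed.

Variables (z0 : Cn R n) (rho B1 B2 dl cd : R).
Hypothesis rho0 : 0 < rho.
Hypothesis rho1 : rho <= 1.
Hypothesis B10 : 0 <= B1.
Hypothesis B20 : 0 <= B2.
Hypothesis cd0 : 0 <= cd.
Local Notation near z := (nsq (z - z0) <= rho ^+ 2).
Hypothesis HB1 : forall z, near z -> forall k, `|G1 k z| <= B1.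
Hypothesis HB2 : forall z, near z -> forall k l, `|G2 k l z| <= B2.
Hypothesis Hdl : forall z, near z -> dl <= \sum_k ham k z * ham k z0.
Hypothesis Hdec : forall z, near z ->
  normc (proj N (fun w => (f w)%:C * u w) z - (F z)%:C * u z -
    \sum_(j < n) grad G1 z j * moment N u z j) <= cd / N%:R * avg1 N 8 u z.

Let s : R := Num.sqrt N%:R.
Let a : R := pi / 2.
Let cut z : R := rho ^+ 2 - nsq (z - z0).
Let psi z : R := sqpos (cut z).
(** The linear form with gradient [X z0]; its derivative along X is the sum that [Hdl] bounds below
    by [dl]. *)
Let lin z : R := \sum_k ham k z0 * rcoord k (z - z0).
(* The derivative of [A] along the flow is about [s / (1 + (s * lin)^2)], which
   is of size [s] on a strip of width [1 / s] across the flow. *)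
Let A z : R := atan (s * lin z).

Let psi1 k z : R := - 4 * Num.max 0 (cut z) * rcoord k (z - z0).
Let A1 k z : R := s * ham k z0 / (1 + (s * lin z) ^+ 2).

(** The [k]-th component of the field [A psi |u|^2 X]; [dweighted k] is its [k]-th partial
    derivative, so that the sum over [k] is a divergence and has zero integral. *)
Definition weighted k z : R := ham k z * (A z * psi z) * w2 z.

Definition dweighted k z : R := ham1 k k z * (A z * psi z) * w2 z +
  ham k z * (A1 k z * psi z + A z * psi1 k z) * w2 z + ham k z * (A z * psi z) * dsqnorm k z.

Let derive_psi k z : is_derive (0 : R) 1 (fun t : R => psi (z + (t%:C : C) *: coord_dir k)) (psi1 k z).
Proof.
pose c (t : R) : R := cut z - 2 * rcoord k (z - z0) * t - t ^+ 2.
have E : (fun t : R => psi (z + (t%:C : C) *: coord_dir k)) = sqpos \o c.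
  apply/funext => t /=; congr sqpos; rewrite /c /cut addrAC !nsq_rcoord.
  have -> : \sum_l rcoord l (z - z0 + (t%:C : C) *: coord_dir k) ^+ 2 =
      \sum_l rcoord l (z - z0) ^+ 2 + (2 * rcoord k (z - z0) * t + t ^+ 2).
    rewrite (bigD1 k)//= [in RHS](bigD1 k)//= [in RHS]addrAC; congr (_ + _).
      by rewrite [rcoord k (_ + _ *: _)]rcoordD rcoordZ rcoord_dir eqxx mulr1; ring.
    by apply: eq_bigr => l lk; rewrite [rcoord l (_ + _ *: _)]rcoordD rcoordZ rcoord_dir (negbTE lk) mulr0 addr0.
  by ring.
have dc : is_derive (0 : R) 1 c (- 2 * rcoord k (z - z0)).
  rewrite /c; apply: is_derive_eq.
  by rewrite /GRing.scale /=; ring.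
have -> : psi1 k z = (2 * Num.max 0 (c 0)) * (- 2 * rcoord k (z - z0)).
  by rewrite /c mulr0 expr0n !subr0 /psi1; ring.
by rewrite E; apply: is_derive1_comp; exact: is_derive_sqpos.
Qed.

Let derive_A k z : is_derive (0 : R) 1 (fun t : R => A (z + (t%:C : C) *: coord_dir k)) (A1 k z).
Proof.
pose c (t : R) : R := s * (lin z + ham k z0 * t).
have E : (fun t : R => A (z + (t%:C : C) *: coord_dir k)) = atan \o c.
  apply/funext => t /=; congr (atan (s * _)); rewrite /lin addrAC.
  rewrite (bigD1 k)//= [in RHS](bigD1 k)//= [in RHS]addrAC; congr (_ + _).
    by rewrite [rcoord k (_ + _ *: _)]rcoordD rcoordZ rcoord_dir eqxx mulr1; ring.
  by apply: eq_bigr => l lk; rewrite [rcoord l (_ + _ *: _)]rcoordD rcoordZ rcoord_dir (negbTE lk) mulr0 addr0.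
have dc : is_derive (0 : R) 1 c (s * ham k z0).
  rewrite /c; apply: is_derive_eq.
  by rewrite /GRing.scale /=; ring.
have -> : A1 k z = (1 + (c 0) ^+ 2)^-1 * (s * ham k z0).
  by rewrite /c mulr0 addr0 /A1 mulrC.
by rewrite E; apply: is_derive1_comp; exact: is_derive1_atan.
Qed.

Lemma derive_weighted k z :
  is_derive (0 : R) 1 (fun t : R => weighted k (z + (t%:C : C) *: coord_dir k)) (dweighted k z).
Proof.
have := is_derive_product4 (partials_ham k k z) (derive_A k z) (derive_psi k z)
  (is_derive_sqnorm N0 z (coord_dir k) Hu).
by rewrite scale0r addr0.
Qed.

Lemma continuous_weighted k : continuous (weighted k).
Proof.
have clin : continuous lin.
  apply: continuous_Cn_sum => l; apply: continuous_CnM; first exact: continuous_Cn_cst.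
  have -> : (fun z => rcoord l (z - z0)) = (fun z => rcoord l z - rcoord l z0).
    by apply/funext => z; rewrite rcoordB.
  by apply: continuous_CnB; [exact: continuous_rcoord|exact: continuous_Cn_cst].
have ccut : continuous cut.
  apply: continuous_CnB; first exact: continuous_Cn_cst.
  have -> : (fun z => nsq (z - z0)) = (fun z => \sum_l (rcoord l z - rcoord l z0) * (rcoord l z - rcoord l z0)).
    by apply/funext => z; rewrite nsq_rcoord; apply: eq_bigr => l _; rewrite rcoordB expr2.
  apply: continuous_Cn_sum => l; apply: continuous_CnM;
    by apply: continuous_CnB; [exact: continuous_rcoord|exact: continuous_Cn_cst].
apply: continuous_CnM; last first.
  have cu := Hspace_continuous Hu.
  rewrite (_ : w2 = fun z => Re (u z) * Re (u z) + Im (u z) * Im (u z)); last first.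
    by apply/funext => z; rewrite /w2 normc_sqr !expr2.
  by apply: continuous_CnD; apply: continuous_CnM;
    solve [exact: continuous_Cn_Re|exact: continuous_Cn_Im].
apply: continuous_CnM; first exact: continuous_ham.
apply: continuous_CnM.
  apply: (continuous_Cn_comp (h := atan)); first exact: continuous_atan.
  by apply: continuous_CnM => //; exact: continuous_Cn_cst.
by apply: (continuous_Cn_comp (h := sqpos)) => //; exact: continuous_sqpos.
Qed.

Let a0 : 0 <= a. Proof. by rewrite divr_ge0// pi_ge0. Qed.
Let s0 : 0 < s. Proof. by rewrite sqrtr_gt0 ltr0n. Qed.

Let A_le z : `|A z| <= a.
Proof. by rewrite ler_norml (ltW (atan_gtNpi2 _)) (ltW (atan_ltpi2 _)). Qed.

Let far_cut z : ~~ (near z) -> Num.max 0 (cut z) = 0.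
Proof. by rewrite -ltNge => zr; apply/max_idPl; rewrite subr_le0 ltW. Qed.

Let far_psi z : ~~ (near z) -> psi z = 0.
Proof. by move=> zr; rewrite /psi /sqpos far_cut// expr0n. Qed.

Let far_dweighted k z : ~~ (near z) -> dweighted k z = 0.
Proof. by move=> zr; rewrite /dweighted /psi1 far_psi// far_cut// !(mulr0, mul0r, addr0). Qed.

Let cut01 z : 0 <= Num.max 0 (cut z) <= 1.
Proof.
rewrite le_max lexx /= ge_max ler01 /= /cut lerBlDr.
apply: le_trans (_ : 1 <= _); last by rewrite lerDl nsq_ge0.
by rewrite expr_le1// ltW.
Qed.

Let psi01 z : 0 <= psi z <= 1.
Proof. by have /andP[c0 c1] := cut01 z; rewrite /psi /sqpos sqr_ge0 /= expr_le1. Qed.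

Let psi1_le k z : near z -> `|psi1 k z| <= 4.
Proof.
move=> zr; have /andP[c0 c1] := cut01 z.
rewrite /psi1 !normrM normrN (ger0_norm c0) (ger0_norm (ler0n _ _)) -mulrA ger_pMr//.
apply: mulr_ile1 => //; apply: le_trans (rcoord_le _ _) _; rewrite -sqrtr1 ler_wsqrtr//.
by apply: le_trans zr _; rewrite expr_le1// ltW.
Qed.

Let near0 : near z0.
Proof.
have -> : nsq (z0 - z0) = 0.
  by rewrite subrr /nsq big1// => j _; rewrite mxE Normc.normc0 expr0n.
exact: sqr_ge0.
Qed.

Let ham_le k z : near z -> `|ham k z| <= B1.
Proof. by move=> zr; case: k => j /=; rewrite ?normrN; exact: HB1. Qed.

Let ham1_le k l z : near z -> `|ham1 k l z| <= B2.
Proof. by move=> zr; case: k => j /=; rewrite ?normrN; exact: HB2. Qed.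

Let w20 z : 0 <= w2 z. Proof. exact: sqr_ge0. Qed.

Let Apsi_le z : `|A z * psi z| <= a.
Proof.
have /andP[p0 p1] := psi01 z.
by rewrite normrM (ger0_norm p0) -[leRHS]mulr1; apply: ler_pM.
Qed.

Let A1_le k z : `|A1 k z| <= s * B1.
Proof.
have d1 : 1 <= 1 + (s * lin z) ^+ 2 by rewrite lerDl sqr_ge0.
have d0 := lt_le_trans ltr01 d1.
rewrite /A1 normrM normfV (gtr0_norm d0) ler_pdivrMr// normrM (gtr0_norm s0).
apply: le_trans (_ : s * B1 <= _); first by rewrite ler_wpM2l ?(ltW s0)// ham_le.
by rewrite ler_peMr// mulr_ge0// ltW.
Qed.

Lemma integral_dweighted k :
  mu.-integrable setT (EFin \o (fun t => dweighted k (cpoint t))) /\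
  Rintegral mu setT (fun t => dweighted k (cpoint t)) = 0.
Proof.
have [B B0 HB] := dsqnorm_bounded k.
apply: (@integral_derivative_eq0 R n (weighted k) (dweighted k) (coord_dir k)
  (2 * rho ^+ 2 + 2 * nsq z0) (B2 * a * B + B1 * (s * B1 + a * 4) * B + B1 * a * B)).
- exact: continuous_weighted.
- exact: derive_weighted.
- by rewrite addr_ge0// mulr_ge0 ?sqr_ge0 ?nsq_ge0.
- move=> z zr; rewrite /weighted far_psi ?mulr0 ?mul0r// -ltNge.
  have := nsqD (z - z0) z0; rewrite subrK => H.
  by move: zr H; move: (nsq z) (nsq (z - z0)) (nsq z0) => x y v; lra.
- move=> z; have [zr|zr] := boolP (near z); last first.
    rewrite far_dweighted// normr0; apply: addr_ge0; last by apply: mulr_ge0 => //; exact: mulr_ge0.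
    apply: addr_ge0; apply: mulr_ge0 => //; apply: mulr_ge0 => //.
    by apply: addr_ge0; apply: mulr_ge0 => //; exact: ltW.
  have [Bw BP] := HB z; have /andP[p0 p1] := psi01 z.
  apply: le_trans (ler_normD _ _) _; apply: lerD; last first.
    by rewrite 2!normrM; apply: ler_pM => //; apply: ler_pM => //; exact: ham_le.
  apply: le_trans (ler_normD _ _) _; apply: lerD.
    rewrite 2!normrM (ger0_norm (w20 z)); apply: ler_pM => //; apply: ler_pM => //; exact: ham1_le.
  rewrite 2!normrM (ger0_norm (w20 z)); apply: ler_pM => //; apply: ler_pM => //; first exact: ham_le.
  apply: le_trans (ler_normD _ _) _; apply: lerD.
    rewrite normrM (ger0_norm p0) -[leRHS]mulr1; apply: ler_pM => //; exact: A1_le.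
  by rewrite normrM; apply: ler_pM => //; exact: psi1_le.
Qed.

(** The term of the divergence where the derivative falls on [atan], without the factor that [dl]
    bounds below. *)
Definition transport_weight z : R := s * psi z / (1 + (s * lin z) ^+ 2) * w2 z.

(** When the divergence is expanded, the derivative of [A] gives the main term; the derivatives of X
    and [psi] cost a multiple of [|u|^2]; the derivative of [|u|^2] is [N] times an imaginary part
    made of the residual, the expansion error and [Im e]. *)
Lemma transport_pointwise z : dl * transport_weight z <= \sum_k dweighted k z +
  ((n + n)%:R * (a * B2 + 4 * a * B1) * w2 z +
   2 * a * (N%:R * (normc (residual N f u e z) * normc (u z)) +
            (cd * (normc (u z) * avg1 N 8 u z) + N%:R * `|Im e| * w2 z))).
Proof.
have avg0 : 0 <= avg1 N 8 u z by apply: gavg_ge0 => w; exact: normc_ge0.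
have [zr|zr] := boolP (near z); last first.
  rewrite /transport_weight far_psi// !(mulr0, mul0r) big1 => [|k _]; last exact: far_dweighted.
  have m4 : 0 <= 4 * a by exact: mulr_ge0.
  have nu := normc_ge0 (u z); have nr := normc_ge0 (residual N f u e z).
  rewrite add0r; apply: addr_ge0.
    by apply: mulr_ge0 => //; apply: mulr_ge0 => //; apply: addr_ge0; exact: mulr_ge0.
  apply: mulr_ge0; first exact: mulr_ge0.
  apply: addr_ge0; first by apply: mulr_ge0 => //; exact: mulr_ge0.
  by apply: addr_ge0; apply: mulr_ge0 => //; exact: mulr_ge0.
have /andP[p0 p1] := psi01 z.
pose T := s * psi z / (1 + (s * lin z) ^+ 2) * w2 z.
have d1 : 0 < 1 + (s * lin z) ^+ 2 by rewrite ltr_pwDl// sqr_ge0.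
have T0 : 0 <= T.
  apply: mulr_ge0 => //; apply: divr_ge0; last exact: ltW.
  by apply: mulr_ge0 => //; exact: ltW.
have E : \sum_k dweighted k z = T * (\sum_k ham k z * ham k z0) +
    \sum_k (ham1 k k z * (A z * psi z) * w2 z + ham k z * (A z * psi1 k z) * w2 z) +
    A z * psi z * \sum_k ham k z * dsqnorm k z.
  rewrite !mulr_sumr -!big_split /=; apply: eq_bigr => k _.
  by rewrite /dweighted /A1 /T; field; rewrite gt_eqF.
rewrite E -/T.
have S2 : `|\sum_k (ham1 k k z * (A z * psi z) * w2 z + ham k z * (A z * psi1 k z) * w2 z)| <=
    (n + n)%:R * (a * B2 + 4 * a * B1) * w2 z.
  apply: le_trans (ler_norm_sum _ _ _) _.
  apply: le_trans (_ : \sum_(k : D) ((a * B2 + 4 * a * B1) * w2 z) <= _); last first.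
    by rewrite sumr_const card_sum card_ord -[leLHS]mulr_natl mulrA.
  apply: ler_sum => k _; apply: le_trans (ler_normD _ _) _; rewrite mulrDl; apply: lerD.
    rewrite 2!normrM (ger0_norm (w20 z)) ler_wpM2r// mulrC; apply: ler_pM => //; exact: ham1_le.
  rewrite 2!normrM (ger0_norm (w20 z)) ler_wpM2r// mulrC; apply: ler_pM => //; last exact: ham_le.
  by rewrite normrM mulrC; apply: ler_pM => //; exact: psi1_le.
have S3 : `|A z * psi z * \sum_k ham k z * dsqnorm k z| <=
  2 * a * (N%:R * (normc (residual N f u e z) * normc (u z)) +
            (cd * (normc (u z) * avg1 N 8 u z) + N%:R * `|Im e| * w2 z)).
  rewrite ham_dsqnorm normrM.
  set G := \sum_(j < n) _; set err := proj N (fun w => (f w)%:C * u w) z - (F z)%:C * u z - G.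
  (* [conj u] times the expansion at [z]. As [F] is real, only [Im e] survives from the last
     term. *)
  have GE : conjc (u z) * G = conjc (u z) * (residual N f u e z - err) + (e - (F z)%:C) * (u z * conjc (u z)).
    have ringE (x1 x2 x3 x4 x5 x6 : C) :
        x3 * x5 = x3 * ((x1 - x6 * x2) - (x1 - x4 * x2 - x5)) + (x6 - x4) * (x2 * x3) by ring.
    exact: ringE.
  have -> : Im (conjc (u z) * G) = Im (conjc (u z) * (residual N f u e z - err)) + Im e * w2 z.
    have imE (c : C) (x y : R) : Im ((c - x%:C) * y%:C) = Im c * y.
      by case: c => c d /=; ring.
    by rewrite GE normcM_conj cImD imE.
  rewrite -[2 * a * _]mulrA [leRHS]mulrCA.
  have NR : (0 : R) < N%:R by rewrite ltr0n.
  apply: ler_pM => //.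
  rewrite -mulrA normrM (ger0_norm (ler0n _ 2)) ler_wpM2l// normrM (gtr0_norm NR).
  apply: le_trans (_ : N%:R * (normc (u z) * (normc (residual N f u e z) + cd / N%:R * avg1 N 8 u z) + `|Im e| * w2 z) <= _).
    rewrite ler_wpM2l ?(ltW NR)//; apply: le_trans (ler_normD _ _) _; apply: lerD; last first.
      by rewrite normrM (ger0_norm (w20 z)).
    apply: le_trans (normr_Im _) _; rewrite Normc.normcM normc_conj ler_wpM2l ?normc_ge0//.
    by apply: le_trans (le_normcD _ _) _; rewrite normcN lerD2l; exact: Hdec.
  by rewrite le_eqVlt; apply/orP; left; apply/eqP; field; rewrite gt_eqF.
have S1 : dl * T <= T * (\sum_k ham k z * ham k z0) by rewrite mulrC ler_wpM2l// Hdl.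
move: S2 S3; rewrite !ler_norml => /andP[S2 _] /andP[S3 _].
have ineq (p x1 x2 x3 y2 y3 : R) : p <= x1 -> - y2 <= x2 -> - y3 <= x3 ->
  p <= x1 + x2 + x3 + (y2 + y3) by lra.
exact: ineq.
Qed.

Lemma continuous_transport_weight : continuous transport_weight.
Proof.
have crc l : continuous (fun z => rcoord l (z - z0)).
  have -> : (fun z => rcoord l (z - z0)) = (fun z => rcoord l z - rcoord l z0).
    by apply/funext => z; rewrite rcoordB.
  by apply: continuous_CnB; [exact: continuous_rcoord|exact: continuous_Cn_cst].
have clin : continuous lin.
  by apply: continuous_Cn_sum => l; apply: continuous_CnM => //; exact: continuous_Cn_cst.
have ccut : continuous cut.
  apply: continuous_CnB; first exact: continuous_Cn_cst.
  have -> : (fun z => nsq (z - z0)) = (fun z => \sum_l rcoord l (z - z0) * rcoord l (z - z0)).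
    by apply/funext => z; rewrite nsq_rcoord; apply: eq_bigr => l _; rewrite expr2.
  by apply: continuous_Cn_sum => l; apply: continuous_CnM.
apply: continuous_CnM; last first.
  have cu := Hspace_continuous Hu.
  rewrite (_ : w2 = fun z => Re (u z) * Re (u z) + Im (u z) * Im (u z)); last first.
    by apply/funext => z; rewrite /w2 normc_sqr !expr2.
  by apply: continuous_CnD; apply: continuous_CnM;
    solve [exact: continuous_Cn_Re|exact: continuous_Cn_Im].
apply: continuous_CnM.
  apply: continuous_CnM; first exact: continuous_Cn_cst.
  by apply: (continuous_Cn_comp (h := sqpos)) => //; exact: continuous_sqpos.
apply: (continuous_Cn_comp (h := fun x => (1 + x ^+ 2)^-1) (f := fun z => s * lin z)).
  move=> x; apply: cvgV; first by rewrite gt_eqF// ltr_pwDl// sqr_ge0.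
  by apply: cvgD; [exact: cvg_cst|exact: exprn_continuous].
by apply: continuous_CnM => //; exact: continuous_Cn_cst.
Qed.

(** In [3 * cr] one [cr] comes from the residual and two from [Im e]; the factor of [cd] is the
    bound of [avg_pair]. *)
Let K : R := (n + n)%:R * (a * B2 + 4 * a * B1) +
  2 * a * (3 * cr + cd * (2^-1 * (1 + 4 ^+ n * 4 ^+ n))).

Lemma transport_weight_ge0 z : 0 <= transport_weight z.
Proof.
have /andP[p0 _] := psi01 z; apply: mulr_ge0 => //; apply: divr_ge0.
  by apply: mulr_ge0 => //; exact: ltW.
by rewrite addr_ge0// sqr_ge0.
Qed.

Lemma integral_transport_weight : 0 < dl ->
  (\int[mu]_t (transport_weight (cpoint t))%:E <= (K / dl)%:E)%E.
Proof.
move=> dl0.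
have NR : (0 : R) < N%:R by rewrite ltr0n.
have mT : measurable_fun setT (fun t : X => transport_weight (cpoint t)).
  by apply: measurable_continuous_Cn continuous_transport_weight _; exact: cmeas_coord.
have [mu_ _] := su; have Hr := Hspace_residual e N0 Hu sfu.
have sr := Hspace_sqint Hr; have [mr _] := sr.
have avg0 z : 0 <= avg1 N 8 u z by apply: gavg_ge0 => w; exact: normc_ge0.
pose b1 (t : X) := normc (residual N f u e (cpoint t)) * normc (u (cpoint t)).
pose b2 (t : X) := normc (u (cpoint t)) * avg1 N 8 u (cpoint t).
pose b3 (t : X) := w2 (cpoint t).
have mb1 : measurable_fun setT b1 by apply: measurable_funM; exact: cmeas_normc.
have mb2 : measurable_fun setT b2.
  apply: measurable_funM; first exact: cmeas_normc.
  by apply: measurable_gavg => [|z]; [exact: cmeas_normc|exact: normc_ge0].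
have [i1 /andP[_ I1]] := nint_Rintegral mb1 (fun t => mulr_ge0 (normc_ge0 _) (normc_ge0 _))
  (residual_pair N0 Hu sfu u1 cr0 hr).
have [i2 /andP[_ I2]] := nint_Rintegral mb2 (fun t => mulr_ge0 (normc_ge0 _) (avg0 _))
  (avg_pair N0 Hu u1).
have i3 : mu.-integrable setT (EFin \o b3) := integrable_sqnorm Hu.
pose d (t : X) := \sum_k dweighted k (cpoint t).
have idR : mu.-integrable setT (EFin \o d) /\ Rintegral mu setT d = 0.
  rewrite /d; elim: (index_enum _) => [|k r [IH IH0]].
    have -> : (fun t : X => \sum_(k <- [::]) dweighted k (cpoint t)) = fun=> 0.
      by apply/funext => t; rewrite big_nil.
    by split; [exact: integrable0|rewrite /Rintegral integral0].
  have [ik ik0] := integral_dweighted k.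
  have -> : (fun t : X => \sum_(l <- k :: r) dweighted l (cpoint t)) =
    (fun t => dweighted k (cpoint t) + \sum_(l <- r) dweighted l (cpoint t)).
    by apply/funext => t; rewrite big_cons.
  by split; [exact: integrableD_real|rewrite RintegralD// ik0 IH0 addr0].
case: idR => id_ id0.
pose c1 := (n + n)%:R * (a * B2 + 4 * a * B1).
pose bd (t : X) := c1 * b3 t + 2 * a * (N%:R * b1 t + (cd * b2 t + N%:R * `|Im e| * b3 t)).
have i23 : mu.-integrable setT (EFin \o (fun t => cd * b2 t + N%:R * `|Im e| * b3 t)).
  by apply: integrableD_real; exact: integrableZ_real.
have i123 : mu.-integrable setT (EFin \o (fun t => N%:R * b1 t + (cd * b2 t + N%:R * `|Im e| * b3 t))).
  by apply: integrableD_real => //; exact: integrableZ_real.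
have ibd : mu.-integrable setT (EFin \o bd).
  by apply: integrableD_real; exact: integrableZ_real.
have Rbd : Rintegral mu setT bd <= K.
  rewrite /bd RintegralD//; [|exact: integrableZ_real|exact: integrableZ_real].
  rewrite !RintegralZl// RintegralD//; last exact: integrableZ_real.
  rewrite RintegralZl// RintegralD//; [|exact: integrableZ_real|exact: integrableZ_real].
  rewrite !RintegralZl//.
  have -> : Rintegral mu setT b3 = 1 by rewrite -u1.
  rewrite mulr1 lerD2l; apply: ler_wpM2l; first exact: mulr_ge0.
  have h1 : N%:R * Rintegral mu setT b1 <= cr.
    by rewrite mulrC -ler_pdivlMr.
  have h2 : cd * Rintegral mu setT b2 <= cd * (2^-1 * (1 + 4 ^+ n * 4 ^+ n)) by rewrite ler_wpM2l.
  have h3 : N%:R * `|Im e| <= 2 * cr.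
    have := Im_energy_le N0 cf Hu sfu u1 cr0 hr; rewrite mulrA ler_pdivlMr// mulrC.
    exact.
  have -> : 3 * cr + cd * (2^-1 * (1 + 4 ^+ n * 4 ^+ n)) =
    cr + (cd * (2^-1 * (1 + 4 ^+ n * 4 ^+ n)) + 2 * cr) by ring.
  by rewrite mulr1; apply: lerD => //; exact: lerD.
have key : (\int[mu]_t (dl * transport_weight (cpoint t))%:E <= K%:E)%E.
  apply: le_trans (@nint_le_Rintegral R n _ (fun t => d t + bd t) _ _ _ _) _.
  - exact: measurable_funM.
  - by move=> t; rewrite mulr_ge0 ?transport_weight_ge0// ltW.
  - by move=> t; exact: transport_pointwise.
  - exact: integrableD_real.
  - by rewrite lee_fin RintegralD// id0 add0r.
move: key; rewrite nintZ//; last 2 first.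
- by move=> t; exact: transport_weight_ge0.
- exact: ltW.
rewrite -lee_pdivlMl// => /le_trans; apply.
by rewrite -EFinM mulrC.
Qed.

(** With [y = nsq (z - z0)], one has [1 + (s lin)^2 <= (1 + b) (1 + N y) <= 4 (1 + b) exp (N y /
    4)]: the Gaussian is dominated by the slower decay of the derivative of [atan]. Dividing by its
    height [s] gains the factor [N^(-1/2)]. *)
Lemma transport_lower z : nsq (z - z0) <= rho ^+ 2 / 2 ->
  expR (- (N%:R / 4) * nsq (z - z0)) * w2 z <=
  (1 + ((n + n)%:R * B1) ^+ 2) * 4 / (rho ^+ 2 / 2) ^+ 2 / s * transport_weight z.
Proof.
move=> zr; set y := nsq (z - z0) in zr *; set b := _ ^+ 2.
have NR : (0 : R) < N%:R by rewrite ltr0n.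
have y0 : 0 <= y by exact: nsq_ge0.
have b0 : 0 <= b by exact: sqr_ge0.
have r0 : 0 < rho ^+ 2 / 2 by rewrite divr_gt0// exprn_gt0.
have r2 : 0 < (rho ^+ 2 / 2) ^+ 2 by rewrite exprn_gt0.
have psi_ge : (rho ^+ 2 / 2) ^+ 2 <= psi z.
  rewrite /psi /sqpos; apply: lerXn2r; rewrite ?nnegrE ?le_max ?lexx ?(ltW r0)//.
  by rewrite /cut -/y; apply/orP; right; lra.
have lin_le : (s * lin z) ^+ 2 <= N%:R * (b * y).
  rewrite exprMn sqr_sqrtr ?ler0n// ler_wpM2l// -real_normK ?num_real//.
  rewrite -(sqr_sqrtr y0) -exprMn; apply: lerXn2r; rewrite ?nnegrE ?mulr_ge0 ?sqrtr_ge0//.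
  apply: le_trans (ler_norm_sum _ _ _) _.
  apply: le_trans (_ : \sum_(k : D) B1 * Num.sqrt y <= _); last first.
    by rewrite sumr_const card_sum card_ord -mulrA mulr_natl.
  apply: ler_sum => k _; rewrite normrM; apply: ler_pM => //; first exact: ham_le.
  exact: rcoord_le.
have den : 1 + (s * lin z) ^+ 2 <= (1 + b) * (4 * expR (N%:R / 4 * y)).
  apply: le_trans (_ : (1 + b) * (1 + N%:R * y) <= _).
    have : 0 <= N%:R * y by rewrite mulr_ge0.
    by move: lin_le; rewrite mulrCA mulrDl mul1r mulrDr mulr1; move: (_ ^+ 2) (N%:R * y) (b * _) => x1 x2 x3; lra.
  rewrite ler_wpM2l ?addr_ge0//.
  have := expR_ge1Dx (N%:R / 4 * y); have : 0 <= N%:R * y by rewrite mulr_ge0.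
  by rewrite (_ : N%:R / 4 * y = N%:R * y / 4); [lra|field].
rewrite /transport_weight mulrA; apply: ler_wpM2r => //.
have d1 : 0 < 1 + (s * lin z) ^+ 2 by rewrite ltr_pwDl// sqr_ge0.
have -> : (1 + b) * 4 / (rho ^+ 2 / 2) ^+ 2 / s * (s * psi z / (1 + (s * lin z) ^+ 2)) =
   (1 + b) * 4 * (psi z / (rho ^+ 2 / 2) ^+ 2) / (1 + (s * lin z) ^+ 2).
  move: (rho ^+ 2 / 2) r0 (1 + _ ^+ 2) d1 => q q0 p p0; field.
  by rewrite !gt_eqF.
rewrite ler_pdivlMr// mulNr expRN mulrC ler_pdivrMr ?expR_gt0//.
apply: le_trans den _; rewrite mulrA -[leRHS]mulrA.
rewrite ler_wpM2l ?mulr_ge0 ?addr_ge0// ler_peMl ?expR_ge0//.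
by rewrite ler_pdivlMr// mul1r.
Qed.

Lemma transport_sup : 0 < dl -> normc (u z0) ^+ 2 <=
  4 * 2 ^+ n * (@peak R n N * ((1 + ((n + n)%:R * B1) ^+ 2) * 4 / (rho ^+ 2 / 2) ^+ 2 / s * (K / dl) +
    4 / (rho ^+ 2 / 2) / N%:R)).
Proof.
move=> dl0; set kap := (1 + _) * _ / _ / s.
have kap0 : 0 <= kap.
  by rewrite !divr_ge0 ?(ltW s0)// ?sqr_ge0// mulr_ge0// addr_ge0// sqr_ge0.
have mT : measurable_fun setT (fun t : X => transport_weight (cpoint t)).
  by apply: measurable_continuous_Cn continuous_transport_weight _; exact: cmeas_coord.
apply: (@concentration R n N u N0 (fun z => kap * transport_weight z)) => //.
- exact: measurable_funM.
- by move=> z; rewrite mulr_ge0// transport_weight_ge0.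
- rewrite nintZ//; last by move=> t; exact: transport_weight_ge0.
  by rewrite [leRHS]EFinM; apply: lee_wpmul2l; [rewrite lee_fin|exact: integral_transport_weight].
- by rewrite divr_gt0// exprn_gt0.
- exact: transport_lower.
Qed.

End Transport.

(** * Pointwise bound and interpolation *)

Section SupBound.
Context {R : realType} {n : nat}.
Local Notation C := (Cplx R).
Local Notation Re := complex.Re.
Local Notation Im := complex.Im.
Local Notation D := ('I_n + 'I_n)%type.
Local Notation X := ((n + n).-tuple (measurableTypeR R)).
Local Notation mu := (@leb R (n + n)).
Implicit Types (z w h : Cn R n) (k l : D).
Local Open Scope complex_scope.

Lemma between_nsq z w p : between z w p -> nsq (p - z) <= nsq (w - z).
Proof.
move=> H; rewrite !nsq_rcoord; apply: ler_sum => k _; rewrite !rcoordB.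
by rewrite -(real_normK (num_real (rcoord k p - _))) -(real_normK (num_real (rcoord k w - _)))
  lerXn2r ?nnegrE.
Qed.

Lemma lipschitz_ball (G : Cn R n -> R) (G1 : D -> Cn R n -> R) (B rho : R) z w :
  partials G G1 -> 0 <= B -> 0 <= rho ->
  (forall p, nsq (p - z) <= rho ^+ 2 -> forall k, `|G1 k p| <= B) ->
  nsq (w - z) <= rho ^+ 2 -> `|G w - G z| <= B * ((n + n)%:R * rho).
Proof.
move=> dG B0 r0 HB wz; apply: le_trans (lipschitz_between dG (M := B) _) _.
  by move=> p zp k; apply: HB; exact: le_trans (between_nsq zp) wz.
rewrite ler_wpM2l//; apply: le_trans (tdist_le _ _) _; rewrite ler_wpM2l//.
by rewrite -(ger0_norm r0) -sqrtr_sqr ler_wsqrtr.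
Qed.

Lemma eventually_small (x eta : R) : 0 < eta ->
  exists N1 : nat, forall N, (N1 <= N)%N -> x / N%:R <= eta.
Proof.
move=> e0; pose N1 := (Num.trunc (`|x| / eta)).+1.
exists N1 => N NN; have NR : (0 : R) < N%:R by rewrite ltr0n (leq_trans _ NN).
rewrite ler_pdivrMr// -ler_pdivrMl// mulrC; apply: le_trans (_ : `|x| / eta <= _).
  by rewrite ler_wpM2r ?invr_ge0 ?(ltW e0)// ler_norm.
by apply: le_trans (ltW (truncnS_gt _)) _; rewrite ler_nat.
Qed.

(** Passes from the l^1 norm to the l^2 norm by a weighted inequality on each term; [d] is the
    dimension plus one, hence positive even for [n = 0]. *)
Lemma gradient_lower (G : D -> R) (kap : R) : 0 < kap -> kap / 2 <= \sum_k `|G k| ->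
  kap ^+ 2 / (4 * ((n + n)%:R + 1)) <= \sum_k G k ^+ 2.
Proof.
move=> k0 H; set d : R := (n + n)%:R + 1.
have d0 : 0 < d by rewrite ltr_wpDl.
pose a := kap / (4 * d); have a0 : 0 < a by rewrite divr_gt0// mulr_gt0.
have S : \sum_k `|G k| <= kap / 4 + d / kap * \sum_k G k ^+ 2.
  apply: le_trans (_ : \sum_(k : D) (a + d / kap * G k ^+ 2) <= _).
    apply: ler_sum => k _; rewrite -real_normK ?num_real//; set x := `|_|.
    rewrite -subr_ge0 (_ : _ - _ = d / kap * (x - 2 * a) ^+ 2); last first.
      by rewrite /a; field; rewrite !gt_eqF.
    by rewrite mulr_ge0 ?sqr_ge0// divr_ge0// ltW.
  rewrite big_split /= -[X in _ + X <= _]mulr_sumr lerD2r sumr_const card_sum card_ord.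
  rewrite [leRHS](_ : _ = d * a); last by rewrite /a; field; rewrite gt_eqF.
  by rewrite -[leLHS]mulr_natl ler_wpM2r ?(ltW a0)// lerDl.
have {S}H : kap / 4 <= d / kap * \sum_k G k ^+ 2 by lra.
rewrite (_ : kap ^+ 2 / (4 * d) = (kap / 4) / (d / kap)); last by field; rewrite !gt_eqF.
by rewrite ler_pdivrMr ?divr_gt0// [leRHS]mulrC.
Qed.

Variables (F : Cn R n -> R) (G1 : D -> Cn R n -> R) (G2 : D -> D -> Cn R n -> R).
Hypothesis cF_ : continuous F.
Hypothesis dF : partials F G1.
Hypothesis dG1 : forall k, partials (G1 k) (G2 k).
Hypothesis cG1 : forall k, continuous (G1 k).
Hypothesis cG2 : forall k l, continuous (G2 k l).
Variables (m : Cn R n -> R) (Cm cF : R) (L : nat).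
Hypothesis m0 : forall z, 0 < m z.
Hypothesis Cm0 : 0 < Cm.
Hypothesis cF0 : 0 <= cF.
Hypothesis tempered : forall z w, m w <= Cm * (1 + nsq (w - z)) ^+ L * m z.
Hypothesis Fm : forall z, `|F z| <= cF * m z.
Variables (f : nat -> Cn R n -> R) (V : nat -> Cn R n -> C) (EN : nat -> C) (E : C).
Hypothesis fF : forall N, (0 < N)%N -> forall w, `|f N w - F w| <= cF / N%:R * m w.
Hypothesis cf : forall N, (0 < N)%N -> continuous (f N).
Hypothesis HV : forall N, (0 < N)%N -> Hspace N (V N).
Hypothesis sfV : forall N, (0 < N)%N -> sqint (fun z => (f N z)%:C * V N z).
Hypothesis V1 : forall N, (0 < N)%N -> energy (V N) = 1.
Variables (q cr : R) (N2 : nat).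
Hypothesis q0 : 0 <= q.
Hypothesis cr0 : 0 < cr.
Hypothesis far : forall N, (0 < N)%N -> forall z, q <= nsq z -> `|Re E| + 2 <= `|f N z|.
Hypothesis hr : forall N, (N2 <= N)%N -> (0 < N)%N ->
  energy (residual N (f N) (V N) (EN N)) <= (cr / N%:R) ^+ 2.
Hypothesis hE : forall eta : R, 0 < eta -> exists N3 : nat,
  forall N, (N3 <= N)%N -> normc (EN N - E) <= eta.
Hypothesis regular : forall z, (F z)%:C = E -> exists k, G1 k z != 0.

(** [E] is the limit of numbers whose imaginary parts are O(1/N). This makes [F z = Re E] the
    equation to which regularity applies. *)
Lemma Im_eigenvalue : Im E = 0.
Proof.
apply/eqP; rewrite -normr_eq0 eq_le normr_ge0 andbT; apply/ler_addgt0Pl => eta eta0.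
have e2 : 0 < eta / 2 by rewrite divr_gt0.
have [N3 H3] := hE e2.
have [N4 H4] := eventually_small (2 * cr) e2.
pose N := (N2 + N3 + N4).+1.
have N0 : (0 < N)%N by [].
have H1 : `|Im (EN N)| <= eta / 2.
  apply: le_trans (Im_energy_le N0 (cf N0) (HV N0) (sfV N0) (V1 N0) cr0 (hr _ N0)) _.
    by rewrite /N -addnA -addnS leq_addr.
  by rewrite mulrA; apply: H4; rewrite leqW// leq_addl.
have H2 : `|Im (EN N - E)| <= eta / 2.
  apply: le_trans (normr_Im _) _; apply: H3.
  by rewrite /N -addnS addnAC leq_addl.
rewrite addr0; have -> : Im E = Im (EN N) - Im (EN N - E) by rewrite cImD cImN; ring.
by apply: le_trans (ler_normB _ _) _; rewrite [leRHS]splitr lerD.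
Qed.

(** From [nsq w <= 2 nsq (w - z) + 2 nsq z]: the ball of this radius contains every [w] within
    distance 1 of a [z] with [nsq z <= 2 * q + 2]. *)
Let near_radius : R := Num.sqrt (2 * (2 * q + 2) + 2).

Let near_radius2 : near_radius ^+ 2 = 2 * (2 * q + 2) + 2.
Proof. by rewrite sqr_sqrtr// addr_ge0// mulr_ge0// addr_ge0// mulr_ge0. Qed.

(** [localization] with the near region [nsq z <= 2 * q]: outside it the growth of the symbol and
    [constant_sign] give [f N - Re (EN N)] a fixed sign. *)
Lemma mass_localization : exists c N1, 0 <= c /\ forall N, (N1 <= N)%N -> (0 < N)%N ->
  (\int[mu]_t (`|f N (cpoint t) - Re (EN N)| * normc (V N (cpoint t)) ^+ 2)%:E <=
   (c / Num.sqrt N%:R)%:E)%E.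
Proof.
have r0 : 0 <= near_radius by exact: sqrtr_ge0.
have [cd cd0 Hd] := decomposition dF dG1 cG1 cG2 m0 Cm0 cF0 tempered Fm r0.
have [M M0 HM] := weight_bounded m0 Cm0 tempered near_radius.
have [B1 B10 HB1] := bounded_on_rbox_fin near_radius cG1.
have [cq cq0 Hq] := @moment_bound R n.
have [N3 H3] := hE ltr01.
pose c1 := n%:R * (2 * B1) * cq + cd; pose c2 := cF * M.
have c10 : 0 <= c1 by rewrite addr_ge0// !mulr_ge0.
have c20 : 0 <= c2 by rewrite mulr_ge0// ltW.
exists (4 * cr + c1 * (1 + 4 ^+ n * 4 ^+ n) + 2 * c2), (N2 + N3)%N; split.
  by rewrite !addr_ge0 ?mulr_ge0 ?addr_ge0 ?mulr_ge0 ?exprn_ge0// ltW.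
move=> N NN N0; have NR : (0 : R) < N%:R by rewrite ltr0n.
have NS : 0 < Num.sqrt N%:R :> R by rewrite sqrtr_gt0.
have hN := hr (leq_trans (leq_addr _ _) NN) N0.
have ReEN : `|Re (EN N)| <= `|Re E| + 1.
  have -> : Re (EN N) = Re E + Re (EN N - E) by rewrite cReD cReN; ring.
  apply: le_trans (ler_normD _ _) _; rewrite lerD2l; apply: le_trans (normr_Re _) _.
  by apply: H3; exact: leq_trans (leq_addl _ _) NN.
pose G z := f N z - Re (EN N).
have cG : continuous G by apply: continuous_CnB; [exact: cf|exact: continuous_Cn_cst].
have HG z : q <= nsq z -> 1 <= `|G z|.
  move=> /(far N0) fz; have := lerB_dist (f N z) (Re (EN N)); rewrite /G; lra.
(* [s] is the sign at infinity. It may depend on [N], the final constant does not. *)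
have [s s1 Hs] : exists2 s : R, `|s| = 1 & forall z, ~ (nsq z <= 2 * q) -> `|G z| = s * G z.
  have [[z0 [z0r z0G]]|no] := pselect (exists z0, 2 * q <= nsq z0 /\ 0 < G z0).
    exists 1; first by rewrite normr1.
    move=> z /negP; rewrite -ltNge mul1r => zr; rewrite gtr0_norm//.
    by rewrite (constant_sign cG q0 HG (ltW zr) z0r).
  exists (-1); first by rewrite normrN1.
  move=> z /negP; rewrite -ltNge mulN1r => zr; rewrite ler0_norm// leNgt; apply/negP => Gz.
  by apply: no; exists z; rewrite (ltW zr).
apply: (@localization R n N (f N) (V N) (EN N) cr N0 (cf N0) (HV N0) (sfV N0) (V1 N0) cr0 hN
  [set z | nsq z <= 2 * q] c1 c2 s) => // z /= zr.
have zr' : nsq z <= near_radius ^+ 2.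
  by rewrite near_radius2; apply: le_trans zr _; move: q0; lra.
have su := Hspace_sqint (HV N0).
have := Hd N (f N) (V N) N0 (fF N0) (cf N0) (HV N0) (sfV N0) z zr'.
set S := \sum_(j < n) _; set err := (_ - S) => Herr.
have avg0 : 0 <= avg1 N 8 (V N) z by apply: gavg_ge0 => w; exact: normc_ge0.
have zbox : rbox near_radius z by exact: nsq_rbox.
have HS : normc S <= n%:R * (2 * B1) * cq / Num.sqrt N%:R * avg1 N 8 (V N) z.
  apply: le_trans (normc_sum_le _ _) _.
  apply: le_trans (_ : \sum_(j < n) (2 * B1) * (cq / Num.sqrt N%:R * avg1 N 8 (V N) z) <= _); last first.
    by rewrite sumr_const card_ord -[leLHS]mulr_natl !mulrA.
  apply: ler_sum => j _; rewrite Normc.normcM; apply: ler_pM; rewrite ?normc_ge0//; last first.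
    by have [_] := Hq N (V N) z j N0 su.
  apply: le_trans (normc_le _) _; rewrite /grad /= !normrM.
  have b1 := HB1 (inl j) z zbox; have b2 := HB1 (inr j) z zbox.
  have h2 : `|2^-1| <= 1 :> R by rewrite ger0_norm// invf_le1// ler1n.
  rewrite mulr2n mulrDl !mul1r; apply: lerD.
    by rewrite -[leRHS]mulr1; apply: ler_pM.
  by rewrite -[leRHS]mulr1; apply: ler_pM.
have resE : ((F z)%:C - EN N) * V N z = residual N (f N) (V N) (EN N) z - S - err.
  have ringE (x1 x2 x3 x4 x5 : C) : (x3 - x4) * x2 = (x1 - x4 * x2) - x5 - (x1 - x3 * x2 - x5) by ring.
  exact: ringE.
have H1 : `|F z - Re (EN N)| * normc (V N z) <= normc (residual N (f N) (V N) (EN N) z) +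
    (n%:R * (2 * B1) * cq / Num.sqrt N%:R * avg1 N 8 (V N) z + cd / N%:R * avg1 N 8 (V N) z).
  apply: le_trans (_ : normc (((F z)%:C - EN N) * V N z) <= _).
    rewrite Normc.normcM ler_wpM2r ?normc_ge0//.
    by apply: le_trans (normr_Re _); rewrite cReD cReN.
  rewrite resE; apply: le_trans (le_normcD _ _) _; rewrite normcN addrA; apply: lerD => //.
  by apply: le_trans (le_normcD _ _) _; rewrite normcN lerD2l.
have NN1 : N%:R^-1 <= (Num.sqrt N%:R)^-1 :> R.
  rewrite lef_pV2 ?posrE// -{2}(sqr_sqrtr (ltW NR)) expr2 ler_peMl ?(ltW NS)//.
  by rewrite -{1}sqrtr1 ler_wsqrtr// ler1n.
have H2 : `|f N z - F z| <= c2 / N%:R.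
  apply: le_trans (fF N0 z) _; rewrite /c2 mulrAC ler_wpM2r ?invr_ge0//.
  by rewrite ler_wpM2l// HM.
have H3' : cd / N%:R * avg1 N 8 (V N) z <= cd / Num.sqrt N%:R * avg1 N 8 (V N) z.
  by rewrite ler_wpM2r// ler_wpM2l.
have nu := normc_ge0 (V N z).
have -> : normc (residual N (f N) (V N) (EN N) z) * normc (V N z) +
  c1 / Num.sqrt N%:R * (normc (V N z) * avg1 N 8 (V N) z) + c2 / N%:R * normc (V N z) ^+ 2 =
  (normc (residual N (f N) (V N) (EN N) z) + (n%:R * (2 * B1) * cq / Num.sqrt N%:R * avg1 N 8 (V N) z +
    cd / Num.sqrt N%:R * avg1 N 8 (V N) z)) * normc (V N z) + c2 / N%:R * normc (V N z) ^+ 2.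
  by rewrite /c1; ring.
have -> : f N z - Re (EN N) = (F z - Re (EN N)) + (f N z - F z) by ring.
apply: le_trans (_ : (`|F z - Re (EN N)| + `|f N z - F z|) * normc (V N z) ^+ 2 <= _).
  by rewrite ler_wpM2r ?sqr_ge0// ler_normD.
rewrite mulrDl; apply: lerD; last by rewrite ler_wpM2r ?sqr_ge0.
rewrite [leLHS](_ : _ = `|F z - Re (EN N)| * normc (V N z) * normc (V N z)); last by ring.
rewrite ler_wpM2r//; apply: le_trans H1 _; rewrite lerD2l.
by rewrite lerD2l.
Qed.

(** By regularity the two terms have no common zero, so the inverse of their sum is continuous and
    bounded on a compact box. *)
Lemma dichotomy : exists2 kap : R, 0 < kap & forall z, nsq z <= 2 * q + 2 ->
  kap <= `|F z - Re E| + \sum_k `|G1 k z|.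
Proof.
pose h z := `|F z - Re E| + \sum_k `|G1 k z|.
have cabs (g : Cn R n -> R) : continuous g -> continuous (fun z : Cn R n => `|g z| : R).
  by move=> cg; apply: (continuous_Cn_comp (h := fun x : R => `|x|)) => // x; exact: norm_continuous.
have ch : continuous h.
  apply: continuous_CnD.
    by apply: (cabs (fun z => F z - Re E)); apply: continuous_CnB => //; exact: continuous_Cn_cst.
  by apply: continuous_Cn_sum => k; apply: cabs; exact: cG1.
have h0 z : 0 < h z.
  have S0 : 0 <= \sum_k `|G1 k z| by exact: sumr_ge0.
  rewrite lt_neqAle addr_ge0// andbT eq_sym; apply/negP => /eqP hz.
  have : `|F z - Re E| == 0 by rewrite eq_le normr_ge0 andbT -hz /h lerDl.
  rewrite normr_eq0 subr_eq0 => /eqP Fz.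
  have [k] : exists k, G1 k z != 0.
    apply: regular; rewrite Fz; apply: complex_eq => //=; exact/esym/Im_eigenvalue.
  rewrite -normr_gt0 => Gk; have : 0 < \sum_k `|G1 k z|.
    by rewrite (bigD1 k)//= ltr_pwDl// sumr_ge0.
  by have := hz; rewrite /h Fz subrr normr0 add0r => ->; rewrite ltxx.
have chV : continuous (fun z => (h z)^-1).
  by move=> z; apply: (@cvgV _ _ (nbhs z) _ h); [rewrite gt_eqF|exact: ch].
have r0 : 0 <= 2 * q + 2 by move: q0; lra.
have [M M0 HM] := bounded_on_rbox (Num.sqrt (2 * q + 2)) chV.
exists (M + 1)^-1; first by rewrite invr_gt0 ltr_wpDl.
move=> z zr; rewrite -/(h z) -[leRHS]invrK lef_pV2 ?posrE ?invr_gt0 ?h0 ?ltr_wpDl//.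
apply: le_trans (ler_norm _) _; apply: le_trans (HM z _) _; last by rewrite lerDl.
by apply: nsq_rbox; rewrite ?sqrtr_ge0// sqr_sqrtr.
Qed.

Lemma sqrt_peak_le (x N : R) : 0 <= x -> 1 <= N -> x / N <= x / Num.sqrt N.
Proof.
move=> x0 N1; have N0 := lt_le_trans ltr01 N1; have s0 : 0 < Num.sqrt N by rewrite sqrtr_gt0.
rewrite ler_wpM2l// lef_pV2 ?posrE// -{2}(sqr_sqrtr (ltW N0)) expr2 ler_peMl ?(ltW s0)//.
by rewrite -{1}sqrtr1 ler_wsqrtr.
Qed.

(** Each point falls into one of three cases: far out, or with [|F z - Re E|] at least [kap / 2],
    where [mass_localization] suffices; or with a gradient bounded below, where transport applies on
    a ball of radius [rho] independent of [z] and [N]. *)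
Lemma sup_bound : exists c N1, 0 <= c /\ forall N, (N1 <= N)%N -> (0 < N)%N ->
  forall z, normc (V N z) ^+ 2 <= c * (@peak R n N / Num.sqrt N%:R).
Proof.
have [c [N1 [c0 Hmass]]] := mass_localization.
have [kap kap0 Hkap] := dichotomy.
have r0 : 0 <= near_radius by exact: sqrtr_ge0.
have [cd cd0 Hd] := decomposition dF dG1 cG1 cG2 m0 Cm0 cF0 tempered Fm r0.
have [M M0 HM] := weight_bounded m0 Cm0 tempered near_radius.
have [B1 B10 HB1] := bounded_on_rbox_fin near_radius cG1.
have [B2 B20 HB2] := @bounded_on_rbox_fin R n (D * D)%type (fun kl => G2 kl.1 kl.2) near_radius (fun kl => @cG2 kl.1 kl.2).
pose d : R := (n + n)%:R.
have d0 : 0 <= d by [].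
(* Half the lower bound of [gradient_lower]; the other half absorbs the variation of the Hamiltonian
   field on the ball of radius [rho]. *)
pose dl := kap ^+ 2 / (4 * (d + 1)) / 2.
have dl0 : 0 < dl by rewrite !divr_gt0 ?exprn_gt0// mulr_gt0// ltr_wpDl.
(* [T] dominates the Lipschitz constants of [F] and of the scalar product in [Hdl], so that [rho]
   keeps their variations below [kap / 8] and [dl]. *)
pose T := 1 + B1 * d + B1 * (B2 * d) * d.
have T1 : 0 < T by rewrite /T -addrA ltr_pwDl// addr_ge0// !mulr_ge0.
pose rho := Num.min 1 (Num.min (kap / 8 / T) (dl / T)).
have rho0 : 0 < rho.
  by rewrite !lt_min ltr01 /=; apply/andP; split; apply: divr_gt0 => //; exact: divr_gt0.
have rho1 : rho <= 1 by rewrite ge_min lexx.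
have rhoB1 : B1 * (d * rho) <= kap / 8.
  apply: le_trans (_ : T * rho <= _).
    rewrite mulrA ler_wpM2r ?(ltW rho0)// /T addrAC lerDr addr_ge0// !mulr_ge0//.
  by rewrite mulrC -ler_pdivlMr// !ge_min lexx orbT.
have rhoB2 : B1 * (B2 * (d * rho)) * d <= dl.
  apply: le_trans (_ : T * rho <= _).
    rewrite (_ : B1 * (B2 * (d * rho)) * d = B1 * (B2 * d) * d * rho); last by ring.
    by rewrite ler_wpM2r ?(ltW rho0)// /T lerDr addr_ge0// mulr_ge0.
  by rewrite mulrC -ler_pdivlMr// !ge_min lexx !orbT.
have rho2 : rho ^+ 2 <= 1 by rewrite expr_le1// ltW.
have rho20 : 0 < rho ^+ 2 by rewrite exprn_gt0.
have inbox z w : nsq z <= 2 * q + 2 -> nsq (w - z) <= 1 -> nsq w <= near_radius ^+ 2.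
  move=> zq wz; rewrite near_radius2; have := nsqD (w - z) z; rewrite subrK.
  by move: zq wz; move: (nsq z) (nsq w) (nsq (w - z)) => x y v; lra.
have k16 : 0 < kap / 16 by rewrite divr_gt0.
(* [kap / 16] is spent where [F] is away from the energy, 1 at distant points. *)
have eta0 : 0 < Num.min (kap / 16) 1 by rewrite lt_min k16 ltr01.
have [N3 H3] := hE eta0.
have [N4 H4] := eventually_small (cF * M) k16.
pose a : R := pi / 2.
have a0 : 0 <= a by rewrite divr_ge0// pi_ge0.
pose Kt := (n + n)%:R * (a * B2 + 4 * a * B1) +
  2 * a * (3 * cr + cd * (2^-1 * (1 + 4 ^+ n * 4 ^+ n))).
have Kt0 : 0 <= Kt.
  have Z1 : 0 <= a * B2 + 4 * a * B1.
    by apply: addr_ge0; [exact: mulr_ge0|apply: mulr_ge0 => //; exact: mulr_ge0].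
  have Z2 : 0 <= 2^-1 * (1 + 4 ^+ n * 4 ^+ n) :> R by rewrite mulr_ge0// addr_ge0// mulr_ge0 ?exprn_ge0.
  have Z3 : 0 <= 3 * cr + cd * (2^-1 * (1 + 4 ^+ n * 4 ^+ n)).
    by apply: addr_ge0; apply: mulr_ge0 => //; exact: ltW.
  by apply: addr_ge0; apply: mulr_ge0 => //; exact: mulr_ge0.
pose kap2 := (1 + (d * B1) ^+ 2) * 4 / (rho ^+ 2 / 2) ^+ 2.
have kap20 : 0 <= kap2 by rewrite divr_ge0 ?sqr_ge0// mulr_ge0// addr_ge0// sqr_ge0.
pose C1 := c + 4.
pose C2 := 4 / kap * c + 4 / rho ^+ 2.
pose C3 := kap2 * (Kt / dl) + 4 / (rho ^+ 2 / 2).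
have C10 : 0 <= C1 by rewrite addr_ge0.
have rho2' := ltW rho20; have kap' := ltW kap0; have dl' := ltW dl0.
have q1 : 0 <= 4 / rho ^+ 2 by apply: divr_ge0.
have q2 : 0 <= 4 / (rho ^+ 2 / 2) by apply: divr_ge0 => //; apply: divr_ge0.
have q3 : 0 <= 4 / kap * c by apply: mulr_ge0 => //; apply: divr_ge0.
have q4 : 0 <= kap2 * (Kt / dl) by apply: mulr_ge0 => //; apply: divr_ge0.
have C20 : 0 <= C2 by apply: addr_ge0.
have C30 : 0 <= C3 by apply: addr_ge0.
exists (4 * 2 ^+ n * (C1 + C2 + C3)), (N1 + N2 + N3 + N4)%N; split.
  by rewrite mulr_ge0 ?mulr_ge0 ?exprn_ge0// !addr_ge0.
move=> N NN N0.
have NN1 : (N1 <= N)%N by apply: leq_trans NN; rewrite -!addnA leq_addr.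
have NN2 : (N2 <= N)%N by apply: leq_trans NN; rewrite -addnA addnAC leq_addl.
have NN3 : (N3 <= N)%N by apply: leq_trans NN; rewrite addnAC leq_addl.
have NN4 : (N4 <= N)%N by apply: leq_trans NN; rewrite leq_addl.
have NR : (0 : R) < N%:R by rewrite ltr0n.
have N1R : 1 <= N%:R :> R by rewrite ler1n.
have NS : 0 < Num.sqrt N%:R :> R by rewrite sqrtr_gt0.
have hN := hr NN2 N0; have mass := Hmass N NN1 N0.
have HVN := HV N0; have su := Hspace_sqint HVN.
have [mu_ _] := su.
have P0 : 0 <= @peak R n N by exact: peak_ge0.
have ReEN_min : `|Re (EN N) - Re E| <= Num.min (kap / 16) 1.
  by apply: le_trans (H3 N NN3); apply: le_trans (normr_Re _); rewrite cReD cReN.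
have ReEN : `|Re (EN N) - Re E| <= kap / 16 by apply: le_trans ReEN_min _; rewrite ge_min lexx.
have ReEN1 : `|Re (EN N) - Re E| <= 1 by apply: le_trans ReEN_min _; rewrite ge_min lexx orbT.
have mf : measurable_fun setT (fun t : X => f N (cpoint t)).
  by apply: measurable_continuous_Cn (cf N0) _; exact: cmeas_coord.
pose g w := `|f N w - Re (EN N)| * normc (V N w) ^+ 2.
have mg : measurable_fun setT (fun t : X => g (cpoint t)).
  apply: measurable_funM; last exact: measurable_sqnorm.
  by apply: measurableT_comp => //; exact: measurable_funB.
have g0 w : 0 <= g w by rewrite mulr_ge0// sqr_ge0.
have finish (A s Ck : R) z : 0 <= Ck -> Ck <= C1 + C2 + C3 ->
    A + 4 / s / N%:R <= Ck / Num.sqrt N%:R ->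
    normc (V N z) ^+ 2 <= 4 * 2 ^+ n * (@peak R n N * (A + 4 / s / N%:R)) ->
    normc (V N z) ^+ 2 <= 4 * 2 ^+ n * (C1 + C2 + C3) * (@peak R n N / Num.sqrt N%:R).
  move=> Ck0 CkC AC /le_trans; apply; rewrite -[leRHS]mulrA ler_wpM2l ?mulr_ge0 ?exprn_ge0//.
  rewrite [leRHS]mulrCA ler_wpM2l//; apply: le_trans AC _.
  by rewrite ler_wpM2r ?invr_ge0// ltW.
have gauss_le1 z w : expR (- (N%:R / 4) * nsq (w - z)) <= 1.
  by rewrite -[leRHS]expR0 ler_expR mulNr oppr_le0 mulr_ge0 ?nsq_ge0// divr_ge0.
(* Where the symbol stays [k] away from the energy, [k^-1 * g] dominates [|V N|^2] and has mass
   O(N^(-1/2)). *)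
have elliptic (k s : R) z : 0 < k -> 0 < s ->
    (forall w, nsq (w - z) <= s -> k <= `|f N w - Re (EN N)|) ->
    normc (V N z) ^+ 2 <= 4 * 2 ^+ n * (@peak R n N * (k^-1 * (c / Num.sqrt N%:R) + 4 / s / N%:R)).
  move=> k0 s0 H; apply: (@concentration R n N (V N) N0 (fun w => k^-1 * g w)) => //.
  - by rewrite V1.
  - exact: measurable_funM.
  - by move=> w; rewrite mulr_ge0// invr_ge0 ltW.
  - rewrite nintZ//; last by rewrite invr_ge0 ltW.
    by rewrite [leRHS]EFinM; apply: lee_wpmul2l; rewrite // lee_fin invr_ge0 ltW.
  - move=> w wz; rewrite /g [leRHS]mulrA; apply: ler_wpM2r; first exact: sqr_ge0.
    apply: le_trans (gauss_le1 z w) _; rewrite mulrC ler_pdivlMr// mul1r; exact: H.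
move=> z.
(* The bound [2 * q + 2] keeps the unit ball around [z] inside [q <= nsq w], where the symbol is at
   distance at least 1 from [Re (EN N)]. *)
have [zfar|znear] := leP (2 * q + 2) (nsq z).
  apply: (finish (1^-1 * (c / Num.sqrt N%:R)) 1 C1) => //.
  - by rewrite -addrA lerDl addr_ge0.
  - rewrite invr1 mul1r mulr1 /C1 [leRHS]mulrDl lerD2l; exact: sqrt_peak_le.
  apply: elliptic => // w wz.
  have qw : q <= nsq w.
    have := nsqD (z - w) w; rewrite subrK nsqB => H.
    by move: H wz zfar; move: (nsq z) (nsq w) (nsq (w - z)) => x y v; lra.
  have := far N0 qw; have := lerB_dist (f N w) (Re (EN N)).
  have : `|Re (EN N)| <= `|Re E| + 1.
    rewrite -[Re (EN N)](subrK (Re E)) addrC; apply: le_trans (ler_normD _ _) _.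
    by rewrite lerD2l.
  by move: `|Re (EN N)| `|Re E| `|f N w| `|_ - _| => x1 x2 x3 x4; lra.
have zq := ltW znear.
have inbox' w : nsq (w - z) <= rho ^+ 2 -> nsq w <= near_radius ^+ 2.
  by move=> wz; apply: (inbox z w zq); exact: le_trans wz rho2.
have inrbox w : nsq (w - z) <= rho ^+ 2 -> rbox near_radius w.
  by move=> wz; apply: nsq_rbox => //; exact: inbox'.
have zz : nsq (z - z) <= rho ^+ 2.
  have -> : nsq (z - z) = 0.
    by rewrite subrr /nsq big1// => j _; rewrite mxE Normc.normc0 expr0n.
  exact: sqr_ge0.
(* From [kap / 2] the variation of [F] takes [kap / 8], and [f N - F] and [EN N - E] take [kap / 16]
   each: [kap / 4] remains. *)
have [Fz|Fz] := leP (kap / 2) `|F z - Re E|.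
  have k4 : 0 < kap / 4 by rewrite divr_gt0.
  apply: (finish ((kap / 4)^-1 * (c / Num.sqrt N%:R)) (rho ^+ 2) C2) => //.
  - by rewrite addrAC lerDr addr_ge0.
  - rewrite /C2 [leRHS]mulrDl invf_div mulrA lerD2l; exact: sqrt_peak_le.
  apply: elliptic => // w wz.
  have h1 : `|F w - F z| <= kap / 8.
    apply: le_trans rhoB1; apply: (@lipschitz_ball F G1 B1 rho) => //; first exact: ltW.
    by move=> p pz k; apply: HB1; exact: inrbox.
  have h2 : `|f N w - F w| <= kap / 16.
    apply: le_trans (fF N0 w) _; apply: le_trans (H4 N NN4); rewrite mulrAC.
    by rewrite ler_wpM2r ?invr_ge0// ler_wpM2l// HM// inbox'.
  have h3 : F z - Re E = (f N w - Re (EN N)) - (f N w - F w) - (F w - F z) + (Re (EN N) - Re E) by ring.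
  have : kap / 2 <= `|f N w - Re (EN N)| + `|f N w - F w| + `|F w - F z| + `|Re (EN N) - Re E|.
    apply: le_trans Fz _; rewrite h3; apply: le_trans (ler_normD _ _) _; apply: lerD => //.
    apply: le_trans (ler_normB _ _) _; apply: lerD => //.
    exact: ler_normB.
  move: h1 h2 ReEN; move: `|f N w - Re _| `|f N w - F w| `|F w - F z| `|_ - _| => x1 x2 x3 x4; lra.
(* By [dichotomy] the gradient carries the other half of [kap], and transport is centred at [z]. *)
have Gz : kap / 2 <= \sum_k `|G1 k z|.
  have := Hkap z zq; move: Fz; move: `|_ - _| (\sum_k _) => x1 x2; lra.
have S2 : 2 * dl <= \sum_k ham G1 k z ^+ 2.
  have -> : \sum_k ham G1 k z ^+ 2 = \sum_k G1 k z ^+ 2.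
    rewrite !big_sumType /= addrC; congr (_ + _).
    by apply: eq_bigr => j _; rewrite sqrrN.
  have := @gradient_lower (fun k => G1 k z) kap kap0 Gz; apply: le_trans.
  by rewrite /dl mulrCA divff ?mulr1.
have Hdl w : nsq (w - z) <= rho ^+ 2 -> dl <= \sum_k ham G1 k w * ham G1 k z.
  move=> wz.
  have -> : \sum_k ham G1 k w * ham G1 k z = \sum_k ham G1 k z ^+ 2 +
      \sum_k (ham G1 k w - ham G1 k z) * ham G1 k z.
    by rewrite -big_split /=; apply: eq_bigr => k _; ring.
  have : `|\sum_k (ham G1 k w - ham G1 k z) * ham G1 k z| <= dl.
    apply: le_trans rhoB2; apply: le_trans (ler_norm_sum _ _ _) _.
    apply: le_trans (_ : \sum_(k : D) B1 * (B2 * (d * rho)) <= _); last first.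
      by rewrite sumr_const card_sum card_ord -[leLHS]mulr_natl mulrC.
    apply: ler_sum => k _; rewrite normrM mulrC; apply: ler_pM => //.
      case: k => j /=; rewrite ?normrN; apply: HB1; exact: inrbox.
    apply: (@lipschitz_ball (ham G1 k) (ham1 G2 k) B2 rho) => //.
    - exact: partials_ham.
    - exact: ltW.
    - move=> p pz l; case: k => j /=; rewrite ?normrN; [apply: (HB2 (inr j, l))|apply: (HB2 (inl j, l))];
        exact: inrbox.
  by rewrite ler_norml => /andP[H _]; move: S2 H; move: (\sum_k _) (\sum_k _) => x y; lra.
apply: (finish (kap2 / Num.sqrt N%:R * (Kt / dl)) (rho ^+ 2 / 2) C3) => //.
- by rewrite lerDr addr_ge0.
- rewrite /C3 [leRHS]mulrDl mulrAC lerD2l; exact: sqrt_peak_le.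
apply: (@transport_sup R n F G1 G2 dG1 cG1 N (f N) (V N) (EN N) cr N0 (cf N0) HVN (sfV N0) (V1 N0) cr0 hN
  z rho B1 B2 dl cd rho0 rho1 B10 B20 cd0 _ _ Hdl _ dl0).
- by move=> w wz k; apply: HB1; exact: inrbox.
- by move=> w wz k l; apply: (HB2 (k, l)); exact: inrbox.
- by move=> w wz; apply: (Hd N (f N) (V N)) => //; [exact: fF|exact: cf|exact: sfV|exact: inbox'].
Qed.

End SupBound.

Section Interpolation.
Context {R : realType} {n : nat}.
Local Notation C := (Cplx R).
Local Notation X := ((n + n).-tuple (measurableTypeR R)).
Local Notation mu := (@leb R (n + n)).
Implicit Types (u : Cn R n -> C).
Local Open Scope complex_scope.

(** [B] bounds [|u|^2], so [|u|^r] is at most [B^((r - 2) / 2) |u|^2]. For [p = +oo] the term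
    [fine (p^-1)] is 0 and the bound is the essential supremum. *)
Lemma Lpnorm_interpolation u (B : R) (p : \bar R) : sqint u -> energy u = 1 -> 0 <= B ->
  (forall z, normc (u z) <= B `^ 2^-1) -> (2%:E <= p)%E ->
  (Lpnorm p u <= (B `^ (2^-1 - fine (p^-1)%E))%:E)%E.
Proof.
move=> su u1 B0 uB; case: p => [r|_|//].
- rewrite lee_fin => r2; have r0 : 0 < r by exact: lt_le_trans r2.
  have [mu_ _] := su.
  have le : (\int[mu]_t (normc (u (cpoint t)) `^ r)%:E <= ((B `^ 2^-1) `^ (r - 2))%:E)%E.
    apply: le_trans (_ : (\int[mu]_t ((B `^ 2^-1) `^ (r - 2) * normc (u (cpoint t)) ^+ 2)%:E <= _)%E).
      apply: nint_le.
      + exact: (measurableT_comp (measurable_powR r) (cmeas_normc mu_)).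
      + by apply: measurable_funM => //; exact: measurable_sqnorm.
      + by move=> t; exact: powR_ge0.
      + move=> t; have nu := normc_ge0 (u (cpoint t)).
        have -> : normc (u (cpoint t)) `^ r = normc (u (cpoint t)) `^ (r - 2) * normc (u (cpoint t)) ^+ 2.
          by rewrite -{1}(subrK 2 r) [LHS]powRD ?powR_mulrn// subrK gt_eqF.
        rewrite ler_wpM2r ?sqr_ge0// ge0_ler_powR ?nnegrE ?subr_ge0 ?powR_ge0//.
    rewrite nintZ ?powR_ge0//; last 2 first.
    + exact: measurable_sqnorm.
    + by move=> t; exact: sqr_ge0.
    by rewrite energyE// u1 mule1.
  rewrite /Lpnorm unlock inver gt_eqF//=.
  have -> : B `^ (2^-1 - r^-1) = ((B `^ 2^-1) `^ (r - 2)) `^ r^-1.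
    by rewrite -!powRrM; congr (_ `^ _); field; rewrite gt_eqF.
  rewrite -poweR_EFin; apply: gt0_ler_poweR.
  + by rewrite invr_ge0 ltW.
  + by rewrite in_itv /= leey andbT; apply: integral_ge0 => t _; rewrite lee_fin powR_ge0.
  + by rewrite in_itv /= leey andbT lee_fin powR_ge0.
  apply: le_trans le; rewrite le_eqVlt; apply/orP; left; apply/eqP.
  by apply: eq_integral => t _; rewrite /= ger0_norm// normc_ge0.
rewrite /Lpnorm unlock invey /= subr0; case: ifPn => // _; last by rewrite lee_fin powR_ge0.
apply/ess_supP; apply/nearW => t /=.
by rewrite lee_fin ger0_norm ?normc_ge0.
Qed.

End Interpolation.

(** * Symbol classes and the conclusion *)

Section SymbolClasses.
Context {R : realType} {n : nat}.
Local Notation C := (Cplx R).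
Local Notation Re := complex.Re.
Local Notation Im := complex.Im.
Local Notation D := ('I_n + 'I_n)%type.
Implicit Types (z w : Cn R n) (k l : D) (u v : Cn R n -> C).
Local Open Scope complex_scope.

Lemma enormE z : enorm z = Num.sqrt (nsq z). Proof. by []. Qed.

Lemma multi0 (d : 'I_n -> (Cn R n -> C) -> Cn R n -> C) u : multi d (fun=> 0%N) u = u.
Proof. by rewrite /multi; elim: (enum 'I_n). Qed.

Lemma smooth_partials u : smooth u ->
  [/\ continuous u,
      partials (fun z => Re (u z)) (fun k z => Re (rderive u (coord_dir k) z)),
      forall k, partials (fun z => Re (rderive u (coord_dir k) z))
        (fun l z => Re (rderive (rderive u (coord_dir k)) (coord_dir l) z)) &
      (forall k, continuous (fun z => Re (rderive u (coord_dir k) z) : R)) /\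
      (forall k l, continuous (fun z => Re (rderive (rderive u (coord_dir k)) (coord_dir l) z) : R))].
Proof.
move=> su; have [c0 d0] := su [::].
have part v : (forall k z, rderivable v (coord_dir k) z) ->
    partials (fun z => Re (v z)) (fun k z => Re (rderive v (coord_dir k) z)).
  by move=> dv k z; have [dz _] := dv k z; split; [exact: dz|rewrite /rderive /= derive1E].
split; [exact: c0|exact: part d0| | ].
- by move=> k; apply: part; have [_] := su [:: k].
- split.
    by move=> k; apply: continuous_Cn_Re; have [] := su [:: k].
  by move=> k l; apply: continuous_Cn_Re; have [] := su [:: l; k].
Qed.

Lemma order_function_tempered (m : Cn R n -> R) : order_function m ->
  (forall z, 0 < m z) /\ exists Cm (L : nat), 0 < Cm /\
  forall z w, m w <= Cm * (1 + nsq (w - z)) ^+ L * m z.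
Proof.
move=> [m0 [Cm [L [Cm0 H]]]]; split=> //.
(* The exponent of an order function is any real number; a natural number above its absolute value
   serves since the bracket is at least 1. *)
pose K := (Num.trunc `|L|).+1; exists Cm, K; split=> // z w.
apply: le_trans (H w z) _; rewrite ler_wpM2r ?(ltW (m0 z))// ler_wpM2l ?(ltW Cm0)//.
have s0 : 0 <= nsq (w - z) by exact: nsq_ge0.
have a1 : 1 <= 1 + nsq (w - z) by rewrite lerDl.
have a0 := le_trans ler01 a1.
have -> : japanese_bracket (w - z) = Num.sqrt (1 + nsq (w - z)).
  by rewrite /japanese_bracket enormE sqr_sqrtr.
have b1 : 1 <= Num.sqrt (1 + nsq (w - z)) by rewrite -{1}sqrtr1 ler_wsqrtr.
have LK : L <= K%:R by apply: le_trans (ler_norm _) _; exact: ltW (truncnS_gt _).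
apply: le_trans (ler_powR b1 LK) _; rewrite powR_mulrn ?sqrtr_ge0//.
apply: lerXn2r; rewrite ?nnegrE ?sqrtr_ge0//.
by rewrite -{2}(sqr_sqrtr a0) expr2 ler_peMl// sqrtr_ge0.
Qed.

End SymbolClasses.

Theorem theorem4p10 (R : realType) (n : nat)
    (m : Cn R n -> R)
    (f : nat -> Cn R n -> Cplx R) (fj : nat -> Cn R n -> Cplx R)
    (V : nat -> Cn R n -> Cplx R) (EN : nat -> Cplx R) (E : Cplx R)
    (hm : order_function m)
    (hf : symbol_family m f)
    (hfj : expansion m f fj)
    (freal : forall N, (0 < N)%N -> forall z, f N z \is Num.real)
    (finf : diverges f)
    (hV : forall N, (0 < N)%N -> Toeplitz_dom N m (V N))
    (V1 : forall N, (0 < N)%N -> Lpnorm 2%:E (V N) = 1%E)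
    (hTV : rapidly_small_L2 (fun N z => Toeplitz N (f N) (V N) z - EN N * V N z))
    (hEN : EN @ \oo --> E)
    (hE : regular_value (fj 0%N) E)
    (p : \bar R) (hp : (2%:E <= p)%E) :
  exists c : R, \forall N \near \oo,
    (Lpnorm p (V N) <=
     (c * N%:R `^ ((n%:R - 2^-1) * (2^-1 - fine (p^-1)%E)))%:E)%E.
Proof.
have [m0 [Cm [L [Cm0 tempered]]]] := order_function_tempered hm.
have [hf1 hf2] := hf; have [hj1 hj2] := hfj.
(* Without derivatives, the expansion of order 0 bounds [f N] by [m], and that of order 1 bounds
   [f N - f0] by [m / N]. *)
have [c0 H0] := hj2 0%N (fun=> 0%N) (fun=> 0%N).
have [c1 H1] := hj2 1%N (fun=> 0%N) (fun=> 0%N).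
pose f0 := fj 0%N.
have fm N z : (0 < N)%N -> normc (f N z) <= c0 * m z.
  by move=> /H0 /(_ z); rewrite !multi0 big_ord0 subr0 expr0 invr1 mulr1.
have ff0 N z : (0 < N)%N -> normc (f N z - f0 z) <= c1 / N%:R * m z.
  by move=> /H1 /(_ z); rewrite !multi0 big_ord1 expr0 invr1 mul1r expr1.
pose g N z : R := complex.Re (f N z).
have fE N z : (0 < N)%N -> f N z = (g N z)%:C%C.
  by move=> N0; rewrite RRe_real//; exact: freal.
have [cf0 d1 d2 [c1' c2']] := smooth_partials (hj1 0%N).1.
pose F z : R := complex.Re (f0 z).
pose G1 k z : R := complex.Re (rderive f0 (coord_dir k) z).
pose G2 k l z : R := complex.Re (rderive (rderive f0 (coord_dir k)) (coord_dir l) z).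
(* [f N] is real, so the imaginary part of [f0] is at most [|f N - f0|], which tends to 0. *)
have f0E z : f0 z = (F z)%:C%C.
  apply: complex_eq => //=; apply/eqP; rewrite -normr_eq0 eq_le normr_ge0 andbT.
  apply/ler_addgt0Pl => eta eta0; rewrite addr0.
  have [N4 H4] := eventually_small (c1 * m z) eta0.
  apply: le_trans (H4 N4.+1 (leqnSn _)); rewrite mulrAC.
  apply: le_trans (ff0 N4.+1 z isT); apply: le_trans (normr_Im _).
  by rewrite cImD cImN fE//= sub0r normrN.
pose cF := `|c0| + `|c1|.
have cF0 : 0 <= cF by rewrite addr_ge0.
have gF N : (0 < N)%N -> forall w, `|g N w - F w| <= cF / N%:R * m w.
  move=> N0 w; apply: le_trans (_ : c1 / N%:R * m w <= _).
    by apply: le_trans (ff0 N w N0); apply: le_trans (normr_Re _); rewrite cReD cReN.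
  rewrite ler_wpM2r ?(ltW (m0 _))// ler_wpM2r ?invr_ge0//.
  by apply: le_trans (ler_norm _) _; rewrite lerDr.
have Fm z : `|F z| <= cF * m z.
  have -> : F z = g 1%N z - (g 1%N z - F z) by ring.
  apply: le_trans (ler_normB _ _) _; rewrite mulrDl; apply: lerD.
    apply: le_trans (normr_Re _) _; apply: le_trans (fm 1%N z isT) _.
    by rewrite ler_wpM2r ?ler_norm// ltW.
  have := ff0 1%N z isT; rewrite divr1 => H.
  apply: le_trans (_ : c1 * m z <= _); last by rewrite ler_wpM2r ?ler_norm// ltW.
  by apply: le_trans H; apply: le_trans (normr_Re _); rewrite cReD cReN.
have cg N : (0 < N)%N -> continuous (g N).
  by move=> N0; apply: continuous_Cn_Re; have [] := hf1 N N0 [::].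
have HV N : (0 < N)%N -> Hspace N (V N) by move=> /hV[].
have sgV N : (0 < N)%N -> sqint (fun z => (g N z)%:C%C * V N z).
  move=> N0; have [HVN mV] := hV N N0.
  apply: (@L2_dominated R n _ _ c0 _ _ mV).
    apply: (@cmeas_continuous R n (fun z => (g N z)%:C%C * V N z)); apply: continuous_CnCM; last exact: Hspace_continuous HVN.
    by apply: continuous_Cn_real; exact: cg.
  move=> z; rewrite 2!Normc.normcM -fE// normc_real gtr0_norm// mulrA.
  by rewrite ler_wpM2r ?normc_ge0// fm.
have eV N : (0 < N)%N -> energy (V N) = 1.
  move=> N0; have := V1 N N0; rewrite Lpnorm2_energy; last exact: Hspace_sqint (HV N N0).
  move=> [] /(congr1 (fun x => x ^+ 2)); rewrite sqr_sqrtr ?energy_ge0// => ->.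
  by rewrite expr1n.
have resE N : (0 < N)%N -> (fun z => Toeplitz N (f N) (V N) z - EN N * V N z) =
    residual N (g N) (V N) (EN N).
  move=> N0; apply/funext => z; rewrite /residual /Toeplitz; congr (_ - _).
  have -> : (fun w => f N w * V N w) = (fun w => (g N w)%:C%C * V N w).
    by apply/funext => w; rewrite fE.
  by rewrite orth_projE//; exact: sgV.
(* Exponent 1 gives a residual of size [1 / N], the order of the expansion error. *)
have [c [N2 _ Hc]] := hTV 1%N.
have hr N : (N2 <= N)%N -> (0 < N)%N ->
    energy (residual N (g N) (V N) (EN N)) <= ((`|c| + 1) / N%:R) ^+ 2.
  move=> NN N0; have := Hc N NN; rewrite resE// Lpnorm2_energy; last first.
    by apply: Hspace_sqint; apply: Hspace_residual => //; [exact: HV|exact: sgV].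
  rewrite lee_fin expr1 => H.
  rewrite -(sqr_sqrtr (energy_ge0 _)); apply: lerXn2r; rewrite ?nnegrE ?sqrtr_ge0//.
  apply: le_trans H _; rewrite ler_wpM2r ?invr_ge0//.
  by apply: le_trans (ler_norm _) _; rewrite lerDl.
have hE' (eta : R) : 0 < eta -> exists N3 : nat, forall N, (N3 <= N)%N -> normc (EN N - E) <= eta.
  move=> eta0; have /hEN[N3 _ H3] : nbhs E [set y | normc (y - E) < eta].
    by apply/nbhs_CP; exists eta.
  by exists N3 => N NN; apply: ltW; exact: H3.
(* The margin 2 leaves 1 once [EN N] is within 1 of [E]. *)
have [r Hr] := finf (`|complex.Re E| + 2).
have far N : (0 < N)%N -> forall z, `|r| ^+ 2 <= nsq z -> `|complex.Re E| + 2 <= `|g N z|.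
  move=> N0 z rz; have := Hr N N0 z; rewrite fE// normc_real; apply.
  rewrite enormE; apply: le_trans (ler_norm r) _.
  by rewrite -(normr_id r) -sqrtr_sqr ler_wsqrtr.
have regular z : (F z)%:C%C = E -> exists k, G1 k z != 0.
  (* If all partial derivatives of [F] vanished at [z], so would the real part of every directional
     derivative; the imaginary part is 0 because [f0] is real. *)
  rewrite -f0E => /hE[w]; apply: contra_neqP => /forallNP noG.
  have G0 k : G1 k z = 0 by apply/eqP; have := noG k => /negP; rewrite negbK.
  rewrite /rderive; apply: complex_eq => /=.
    have [_ D2] := @partials_direction R n F G1 G2 z w d1 d2 c2'.
    by rewrite derive1E D2 big1// => k _; rewrite G0 mulr0.
  have -> : (fun t : R => complex.Im (fj 0%N (z + (t%:C)%C *: w))) = cst 0.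
    by apply/funext => t; rewrite -/f0 f0E.
  by rewrite derive1_cst.
have cr0 : 0 < `|c| + 1 by rewrite ltr_wpDl.
have [C0 [N1 [C00 Hsup]]] := @sup_bound R n F G1 G2 (continuous_Cn_Re cf0) d1 d2 c1' c2' m Cm cF L m0 Cm0 cF0 tempered Fm
  g V EN E gF cg HV sgV eV (`|r| ^+ 2) (`|c| + 1) N2 (sqr_ge0 _) cr0 far hr hE' regular.
(* The factor [(2 pi)^n] comes from [peak]: [peak / sqrt N] is [N^(n - 1/2) / (2 pi)^n]. *)
pose C1 := C0 / (2 * pi) ^+ n.
have C10 : 0 <= C1 by rewrite divr_ge0// exprn_ge0// mulr_ge0// pi_ge0.
set th := 2^-1 - _; exists (C1 `^ th).
exists N1.+1 => // N /= NN; have N0 : (0 < N)%N by exact: leq_ltn_trans NN.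
have NR : (0 : R) < N%:R by rewrite ltr0n.
pose B := C1 * N%:R `^ (n%:R - 2^-1).
have B0 : 0 <= B by rewrite mulr_ge0// powR_ge0.
have -> : C1 `^ th * N%:R `^ ((n%:R - 2^-1) * th) = B `^ th.
  by rewrite [RHS]powRM ?powR_ge0// powRrM.
apply: Lpnorm_interpolation => //.
- exact: Hspace_sqint (HV N N0).
- exact: eV.
move=> z; rewrite powR12_sqrt// -(ger0_norm (normc_ge0 (V N z))) -sqrtr_sqr ler_wsqrtr//.
apply: le_trans (Hsup N (ltnW NN) N0 z) _.
rewrite le_eqVlt; apply/orP; left; apply/eqP.
rewrite /B powRD; last by apply/implyP => _; rewrite gt_eqF.
rewrite powR_mulrn ?(ltW NR)// powRN powR12_sqrt ?(ltW NR)// /C1 /peak expr_div_n.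
by rewrite !mulrA; congr (_ / _); rewrite -!mulrA; congr (_ * _); rewrite mulrC.
Qed.
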